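(* Let $k\in(0,1)$. For each of the following functions $f$ and all $y\in\mathbb{R}$, the Fourier transform $\mathcal{F}[f](y)=\int_{\mathbb{R}+i\epsilon}f(x)e^{2\pi i xy}\,dx$ is given by the indicated expression: (19) $f(x)=\dfrac{\mathrm{cn}(2K'x,k)}{\cosh(\pi x)}$, $\ \mathcal{F}[f](y)=\dfrac1k\,\dfrac{1}{\sinh(\pi y)}\left\{k^2\displaystyle\int_0^{2Ky}\mathrm{nd}(u,k')^2\,du+2(E-K)y\right\}$; (20) $f(x)=\dfrac{\mathrm{dn}(2K'x,k)}{\cosh(\pi x)}$, $\ \mathcal{F}[f](y)=\dfrac{1}{\sinh(\pi y)}\left\{\displaystyle\int_0^{2Ky}\mathrm{dn}(u,k')^2\,du+2(E-K)y\right\}$; (21) $f(x)=\dfrac{\mathrm{sn}(2K'x,k)}{\cosh(\pi x)}$, $\ \mathcal{F}[f](y)=\dfrac ik\,\dfrac{1}{\cosh(\pi y)}\left\{k^2\displaystyle\int_0^{2Ky}\mathrm{nd}(u,k')^2\,du+2(E-K)y\right\}$; (22) $f(x)=\dfrac{\mathrm{cs}(2K'x,k)}{\sinh(\pi x)}$, $\ \mathcal{F}[f](y)=\dfrac{2}{1-e^{2\pi y}}\left\{\displaystyle\int_0^{2Ky}\mathrm{dn}(u,k')^2\,du+2(E-K)y\right\}$; (23) $f(x)=\dfrac{\mathrm{ds}(2K'x,k)}{\sinh(\pi x)}$, $\ \mathcal{F}[f](y)=\dfrac{2}{1-e^{2\pi y}}\left\{k^2\displaystyle\int_0^{2Ky}\mathrm{nd}(u,k')^2\,du+2(E-K)y\right\}$;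 (24) $f(x)=\dfrac{\mathrm{ns}(2K'x,k)}{\sinh(\pi x)}$, $\ \mathcal{F}[f](y)=\dfrac{2}{1+e^{2\pi y}}\left\{k^2\displaystyle\int_0^{2Ky}\mathrm{nd}(u,k')^2\,du+2(E-K)y\right\}$.
   Context: $k\in(0,1)$ is the modulus, $k'=\sqrt{1-k^2}$, $K=K(k)=\int_0^{\pi/2}(1-k^2\sin^2\theta)^{-1/2}d\theta$ and $E=E(k)=\int_0^{\pi/2}(1-k^2\sin^2\theta)^{1/2}d\theta$ are the complete elliptic integrals of the first and second kind, and $K'=K(k')$. $\mathrm{sn},\mathrm{cn},\mathrm{dn}$ are the Jacobi elliptic functions, as functions of (argument, modulus), and $\mathrm{nd}=1/\mathrm{dn}$, $\mathrm{cs}=\mathrm{cn}/\mathrm{sn}$, $\mathrm{ds}=\mathrm{dn}/\mathrm{sn}$, $\mathrm{ns}=1/\mathrm{sn}$. The Fourier transform is $\mathcal{F}[f](y)=\int_{\mathbb{R}+i\epsilon}f(x)e^{2\pi i xy}\,dx$, $y\in\mathbb{R}$, where $\epsilon$ is a small positive number (any $\epsilon\in(0,1/2)$); the functions $f$ considered are analytic in the strip $0<\mathrm{Im}(x)<1/2$ and the integral does not depend on $\epsilon$ in this range. At $y=0$, right-hand sides of the form $0/0$ are understood as limits $y\to0$. *)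

(* Defs.v *)
From Stdlib Require Import Reals Lra Psatz Ranalysis5.
From Coquelicot Require Import Coquelicot.
Open Scope R_scope.

Definition ellF (phi k : R) : R :=
  RInt (fun t => / sqrt (1 - k ^ 2 * sin t ^ 2)) 0 phi.

Definition ellK (k : R) : R :=
  RInt (fun t => / sqrt (1 - k ^ 2 * sin t ^ 2)) 0 (PI / 2).

Definition ellE (k : R) : R :=
  RInt (fun t => sqrt (1 - k ^ 2 * sin t ^ 2)) 0 (PI / 2).

Definition comod (k : R) : R := sqrt (1 - k ^ 2).

(** The amplitude is the inverse function of [fun phi => ellF phi k]; see [ellF_am]. *)
Definition am (u k : R) : R := iota (fun phi => ellF phi k = u).

Definition snR (u k : R) : R := sin (am u k).
Definition cnR (u k : R) : R := cos (am u k).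
Definition dnR (u k : R) : R := sqrt (1 - k ^ 2 * snR u k ^ 2).
Definition ndR (u k : R) : R := / dnR u k.

(** These are the analytic continuations of [snR], [cnR], [dnR].  The values at
    [x + i y] come from the addition theorem together with Jacobi's imaginary
    transformation
      sn(iy,k) = i sn(y,k')/cn(y,k'),  cn(iy,k) = 1/cn(y,k'),
      dn(iy,k) = dn(y,k')/cn(y,k'),
    after clearing the factor cn(y,k').  The common denominator [jac_den] vanishes
    exactly at the poles.  [sn_RtoC], [cn_RtoC], [dn_RtoC] and [is_derive_sn],
    [is_derive_cn], [is_derive_dn] below establish that the functions so defined
    extend the real ones and are complex differentiable, with the usual
    derivatives, away from the poles.  On the strip |Im z| < K(k') there are none. *)

Definition jac_den (z : C) (k : R) : R :=
  cnR (Im z) (comod k) ^ 2 + k ^ 2 * snR (Re z) k ^ 2 * snR (Im z) (comod k) ^ 2.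

Definition sn (z : C) (k : R) : C :=
  let k' := comod k in let x := Re z in let y := Im z in
  (snR x k * dnR y k' / jac_den z k,
   cnR x k * dnR x k * snR y k' * cnR y k' / jac_den z k).

Definition cn (z : C) (k : R) : C :=
  let k' := comod k in let x := Re z in let y := Im z in
  (cnR x k * cnR y k' / jac_den z k,
   - (snR x k * dnR x k * snR y k' * dnR y k') / jac_den z k).

Definition dn (z : C) (k : R) : C :=
  let k' := comod k in let x := Re z in let y := Im z in
  (dnR x k * cnR y k' * dnR y k' / jac_den z k,
   - (k ^ 2 * snR x k * cnR x k * snR y k') / jac_den z k).

Definition cs (z : C) (k : R) : C := (cn z k / sn z k)%C.
Definition ds (z : C) (k : R) : C := (dn z k / sn z k)%C.
Definition ns (z : C) (k : R) : C := (1 / sn z k)%C.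

Definition Cexp (z : C) : C := (exp (Re z) * cos (Im z), exp (Re z) * sin (Im z)).
Definition Ccosh (z : C) : C := ((Cexp z + Cexp (- z)) / 2)%C.
Definition Csinh (z : C) : C := ((Cexp z - Cexp (- z)) / 2)%C.

Definition fourier_integrand (f : C -> C) (eps y t : R) : C :=
  let x : C := (t, eps) in (f x * Cexp (2 * PI * Ci * x * y))%C.

(** [is_fourier f y l]: on every line [R + i eps] with [0 < eps < 1/2] the integral
    converges absolutely, and its value is [l]. *)
Definition is_fourier (f : C -> C) (y : R) (l : C) : Prop :=
  forall eps : R, 0 < eps < 1 / 2 ->
    ex_RInt_gen (fun t => Cmod (fourier_integrand f eps y t))
      (Rbar_locally m_infty) (Rbar_locally p_infty) /\
    is_RInt_gen (fourier_integrand f eps y)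
      (Rbar_locally m_infty) (Rbar_locally p_infty) l.

(** [l] is the value of [g] at [y], the value at [0] being understood as the limit
    of [g] at [0] (Rocq's total division would otherwise give 0/0 = 0). *)
Definition value_or_limit (g : R -> R) (y l : R) : Prop :=
  (y <> 0 -> l = g y) /\ (y = 0 -> is_lim g 0 l).

Lemma ellF_radicand_pos (k t : R) : 0 < k < 1 -> 0 < 1 - k ^ 2 * sin t ^ 2.
Proof.
intros hk.
assert (h := sin2_cos2 t); unfold Rsqr in h.
assert (sin t ^ 2 <= 1) by nra.
assert (0 < k ^ 2 < 1) by nra.
assert (0 <= sin t ^ 2) by nra.
nra.
Qed.

Lemma is_derive_ellF (k phi : R) : 0 < k < 1 ->
  is_derive (fun p => ellF p k) phi (/ sqrt (1 - k ^ 2 * sin phi ^ 2)).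
Proof.
intros hk.
assert (hc : forall t, continuous (fun t => / sqrt (1 - k ^ 2 * sin t ^ 2)) t).
{ intros t. apply (ex_derive_continuous (fun t => / sqrt (1 - k ^ 2 * sin t ^ 2))).
  assert (h := ellF_radicand_pos k t hk).
  auto_derive. replace (1 + - (k * (k * 1) * (sin t * (sin t * 1))))
    with (1 - k ^ 2 * sin t ^ 2) by ring.
  assert (h' := sqrt_lt_R0 _ h). repeat split; lra. }
apply (is_derive_RInt (fun t => / sqrt (1 - k ^ 2 * sin t ^ 2)) (fun p => ellF p k) 0 phi).
- exists (mkposreal 1 Rlt_0_1). intros p _.
  apply (RInt_correct (V := R_CompleteNormedModule)).
  apply (ex_RInt_continuous (V := R_CompleteNormedModule)). intros; apply hc.
- apply hc.
Qed.

Lemma ellF_growth (k a b : R) : 0 < k < 1 -> a <= b ->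
  b - a <= ellF b k - ellF a k.
Proof.
intros hk hab.
destruct (MVT_gen (fun p => ellF p k) a b
  (fun p => / sqrt (1 - k ^ 2 * sin p ^ 2))) as [c [_ hc]].
- intros p _. apply is_derive_ellF, hk.
- intros p _. apply continuity_pt_filterlim, (ex_derive_continuous (fun p => ellF p k)).
  eexists; apply is_derive_ellF, hk.
- rewrite hc.
  assert (h := ellF_radicand_pos k c hk).
  assert (h1 : sqrt (1 - k ^ 2 * sin c ^ 2) <= 1).
  { apply Rle_trans with (sqrt 1); [apply sqrt_le_1_alt | rewrite sqrt_1; lra].
    assert (0 <= k ^ 2 * sin c ^ 2) by (rewrite <- Rpow_mult_distr; apply pow2_ge_0).
    lra. }
  assert (h2 := sqrt_lt_R0 _ h).
  assert (1 <= / sqrt (1 - k ^ 2 * sin c ^ 2)).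
  { rewrite <- Rinv_1 at 1. apply Rinv_le_contravar; lra. }
  nra.
Qed.

Lemma ellF_am (u k : R) : 0 < k < 1 -> ellF (am u k) k = u.
Proof.
intros hk. unfold am.
apply (iota_correct (V := R_CompleteNormedModule) (fun phi => ellF phi k = u)).
assert (h0 : ellF 0 k = 0) by (unfold ellF; apply (RInt_point (V := R_CompleteNormedModule))).
assert (hc : continuity (fun p => ellF p k)).
{ intros p. apply continuity_pt_filterlim, (ex_derive_continuous (fun p => ellF p k)).
  eexists; apply is_derive_ellF, hk. }
assert (hex : exists p, ellF p k = u).
{ destruct (IVT_gen (fun p => ellF p k) (- Rabs u) (Rabs u) u hc) as [p [_ hp]].
  - assert (ha := Rabs_pos u).
    assert (h1 := ellF_growth k 0 (Rabs u) hk ha).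
    assert (h2 : 0 - (- Rabs u) <= ellF 0 k - ellF (- Rabs u) k)
      by (apply ellF_growth; lra).
    assert (h3 := Rle_abs u). assert (h4 := Rle_abs (- u)). rewrite Rabs_Ropp in h4.
    rewrite Rmin_left, Rmax_right by lra. lra.
  - exists p; exact hp. }
destruct hex as [p hp]. exists p. split; [exact hp|].
intros q hq.
destruct (Rle_or_lt p q) as [h|h].
- assert (h1 := ellF_growth k p q hk h). lra.
- assert (h1 := ellF_growth k q p hk (Rlt_le _ _ h)). lra.
Qed.

Lemma am_ellF (phi k : R) : 0 < k < 1 -> am (ellF phi k) k = phi.
Proof.
intros hk. assert (h := ellF_am (ellF phi k) k hk).
destruct (Rle_or_lt phi (am (ellF phi k) k)) as [h'|h'].
- assert (h1 := ellF_growth k _ _ hk h'). lra.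
- assert (h1 := ellF_growth k _ _ hk (Rlt_le _ _ h')). lra.
Qed.

Lemma am_lipschitz (u v k : R) : 0 < k < 1 -> Rabs (am v k - am u k) <= Rabs (v - u).
Proof.
intros hk.
assert (hu := ellF_am u k hk). assert (hv := ellF_am v k hk).
destruct (Rle_or_lt (am u k) (am v k)) as [h|h].
- assert (h1 := ellF_growth k _ _ hk h). rewrite !Rabs_pos_eq; lra.
- assert (h1 := ellF_growth k _ _ hk (Rlt_le _ _ h)).
  rewrite (Rabs_left (am v k - am u k)), (Rabs_left (v - u)); lra.
Qed.

Lemma am_continuous (u k : R) : 0 < k < 1 -> continuity_pt (fun v => am v k) u.
Proof.
intros hk eps heps. exists eps. split; [exact heps|].
intros v [_ hv]. simpl in *. unfold R_dist in *.
eapply Rle_lt_trans; [apply am_lipschitz, hk | exact hv].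
Qed.

Lemma dnR_pos (u k : R) : 0 < k < 1 -> 0 < dnR u k.
Proof. intros hk. apply sqrt_lt_R0, ellF_radicand_pos, hk. Qed.

Lemma is_derive_am (u k : R) : 0 < k < 1 -> is_derive (fun v => am v k) u (dnR u k).
Proof.
intros hk.
assert (hd : forall p, derivable_pt (fun p => ellF p k) p).
{ intros p. eexists. apply is_derive_Reals, is_derive_ellF, hk. }
assert (hval : forall p (pr : derivable_pt (fun p => ellF p k) p),
  derive_pt (fun p => ellF p k) p pr = / sqrt (1 - k ^ 2 * sin p ^ 2)).
{ intros p pr. apply derive_pt_eq_0, is_derive_Reals, is_derive_ellF, hk. }
assert (hmon : forall x y, x <= y -> am x k <= am y k).
{ intros x y hxy. destruct (Rle_or_lt (am x k) (am y k)) as [h|h]; [exact h|].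
  assert (h1 := ellF_growth k _ _ hk (Rlt_le _ _ h)).
  rewrite !ellF_am in h1 by exact hk. lra. }
assert (hin : am (u - 1) k <= am u k <= am (u + 1) k) by (split; apply hmon; lra).
apply is_derive_Reals.
set (Prf := fun a (_ : am (u - 1) k <= a <= am (u + 1) k) => hd a).
assert (hne : derive_pt (fun p => ellF p k) (am u k) (Prf (am u k) hin) <> 0).
{ rewrite hval. apply Rinv_neq_0_compat.
  assert (h := sqrt_lt_R0 _ (ellF_radicand_pos k (am u k) hk)). lra. }
assert (H := Ranalysis5.derivable_pt_lim_recip_interv (fun p => ellF p k) (fun v => am v k)
  (u - 1) (u + 1) u Prf (am_continuous u k hk) ltac:(lra) ltac:(lra) hin
  (fun x _ => ellF_am x k hk) hne).
rewrite hval in H.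
replace (dnR u k) with (1 / / sqrt (1 - k ^ 2 * sin (am u k) ^ 2)); [exact H|].
unfold dnR, snR. field.
assert (h := sqrt_lt_R0 _ (ellF_radicand_pos k (am u k) hk)). lra.
Qed.

Lemma snR_cnR (u k : R) : snR u k ^ 2 + cnR u k ^ 2 = 1.
Proof. unfold snR, cnR. assert (h := sin2_cos2 (am u k)). unfold Rsqr in h. lra. Qed.

Lemma snR_dnR (u k : R) : 0 < k < 1 -> k ^ 2 * snR u k ^ 2 + dnR u k ^ 2 = 1.
Proof.
intros hk. unfold dnR. rewrite pow2_sqrt; [ring|].
apply Rlt_le, ellF_radicand_pos, hk.
Qed.

Lemma is_derive_snR (u k : R) : 0 < k < 1 ->
  is_derive (fun v => snR v k) u (cnR u k * dnR u k).
Proof.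
intros hk. unfold snR.
replace (cnR u k * dnR u k) with (scal (dnR u k) (cos (am u k)))
  by (unfold cnR, scal; simpl; unfold mult; simpl; ring).
apply (is_derive_comp sin (fun v => am v k)).
- apply is_derive_sin.
- apply is_derive_am, hk.
Qed.

Lemma is_derive_cnR (u k : R) : 0 < k < 1 ->
  is_derive (fun v => cnR v k) u (- (snR u k * dnR u k)).
Proof.
intros hk. unfold cnR.
replace (- (snR u k * dnR u k)) with (scal (dnR u k) (- sin (am u k)))
  by (unfold snR, scal; simpl; unfold mult; simpl; ring).
apply (is_derive_comp cos (fun v => am v k)).
- apply is_derive_cos.
- apply is_derive_am, hk.
Qed.

Lemma is_derive_dnR (u k : R) : 0 < k < 1 ->
  is_derive (fun v => dnR v k) u (- (k ^ 2 * snR u k * cnR u k)).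
Proof.
intros hk.
assert (hs := is_derive_snR u k hk). assert (hp := dnR_pos u k hk).
unfold dnR at 1. auto_derive.
- repeat split; [eexists; exact hs|].
  assert (h := ellF_radicand_pos k (am u k) hk). unfold snR in *. lra.
- replace (1 + - (k * (k * 1) * (snR u k * (snR u k * 1))))
    with (1 - k ^ 2 * snR u k ^ 2) by ring.
  fold (dnR u k).
  match goal with |- context [Derive ?f ?t] => rewrite (is_derive_unique f t _ hs) end. field. lra.
Qed.

Lemma comod_range (k : R) : 0 < k < 1 -> 0 < comod k < 1.
Proof.
intros hk. unfold comod. split.
- apply sqrt_lt_R0. nra.
- apply Rlt_le_trans with (sqrt 1); [apply sqrt_lt_1_alt; nra | rewrite sqrt_1; lra].
Qed.

Lemma comod_sqr (k : R) : 0 < k < 1 -> comod k ^ 2 = 1 - k ^ 2.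
Proof. intros hk. unfold comod. rewrite pow2_sqrt; [ring|nra]. Qed.

Lemma am_0 (k : R) : 0 < k < 1 -> am 0 k = 0.
Proof.
intros hk.
assert (h : ellF 0 k = 0) by (unfold ellF; apply (RInt_point (V := R_CompleteNormedModule))).
rewrite <- h at 1. apply am_ellF, hk.
Qed.

Lemma jacR_0 (k : R) : 0 < k < 1 -> snR 0 k = 0 /\ cnR 0 k = 1 /\ dnR 0 k = 1.
Proof.
intros hk. unfold dnR, snR, cnR. rewrite am_0 by exact hk.
rewrite sin_0, cos_0. repeat split.
replace (1 - k ^ 2 * 0 ^ 2) with 1 by ring. apply sqrt_1.
Qed.

Lemma jac_den_RtoC (u k : R) : 0 < k < 1 -> jac_den (RtoC u) k = 1.
Proof.
intros hk. destruct (jacR_0 _ (comod_range k hk)) as [h1 [h2 h3]].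
unfold jac_den; simpl Re; simpl Im. rewrite h1, h2. ring.
Qed.

Lemma sn_RtoC (u k : R) : 0 < k < 1 -> sn (RtoC u) k = RtoC (snR u k).
Proof.
intros hk. destruct (jacR_0 _ (comod_range k hk)) as [h1 [h2 h3]].
unfold sn. rewrite jac_den_RtoC by exact hk. simpl Re; simpl Im.
rewrite h1, h2, h3. unfold RtoC. f_equal; field.
Qed.

Lemma cn_RtoC (u k : R) : 0 < k < 1 -> cn (RtoC u) k = RtoC (cnR u k).
Proof.
intros hk. destruct (jacR_0 _ (comod_range k hk)) as [h1 [h2 h3]].
unfold cn. rewrite jac_den_RtoC by exact hk. simpl Re; simpl Im.
rewrite h1, h2, h3. unfold RtoC. f_equal; field.
Qed.

Lemma dn_RtoC (u k : R) : 0 < k < 1 -> dn (RtoC u) k = RtoC (dnR u k).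
Proof.
intros hk. destruct (jacR_0 _ (comod_range k hk)) as [h1 [h2 h3]].
unfold dn. rewrite jac_den_RtoC by exact hk. simpl Re; simpl Im.
rewrite h1, h2, h3. unfold RtoC. f_equal; field.
Qed.

Lemma differentiable_pt_lim_fst (g : R -> R) (x y l : R) :
  is_derive g x l -> differentiable_pt_lim (fun a _ => g a) x y l 0.
Proof. intros h. apply differentiable_pt_lim_proj1_0, is_derive_Reals, h. Qed.

Lemma differentiable_pt_lim_snd (g : R -> R) (x y l : R) :
  is_derive g y l -> differentiable_pt_lim (fun _ b => g b) x y 0 l.
Proof.
intros h eps.
destruct (differentiable_pt_lim_fst g y x l h eps) as [d hd].
exists d. intros u v hu hv. specialize (hd v u hv hu).
rewrite Rmax_comm. replace (0 * (u - x) + l * (v - y))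
  with (l * (v - y) + 0 * (u - x)) by ring. exact hd.
Qed.

Lemma differentiable_pt_lim_mult (f g : R -> R -> R) (x y a b c d : R) :
  differentiable_pt_lim f x y a b -> differentiable_pt_lim g x y c d ->
  differentiable_pt_lim (fun u v => f u v * g u v) x y
    (g x y * a + f x y * c) (g x y * b + f x y * d).
Proof.
intros hf hg.
apply (differentiable_pt_lim_comp (fun s t => s * t)); [|exact hf|exact hg].
intros eps. exists eps. intros u v hu hv.
replace (u * v - f x y * g x y - (g x y * (u - f x y) + f x y * (v - g x y)))
  with ((u - f x y) * (v - g x y)) by ring.
rewrite Rabs_mult. apply Rmult_le_compat; try apply Rabs_pos; [lra|apply Rmax_r].
Qed.

Lemma differentiable_pt_lim_plus (f g : R -> R -> R) (x y a b c d : R) :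
  differentiable_pt_lim f x y a b -> differentiable_pt_lim g x y c d ->
  differentiable_pt_lim (fun u v => f u v + g u v) x y (a + c) (b + d).
Proof.
intros hf hg.
assert (H : differentiable_pt_lim (fun u v => f u v + g u v) x y
  (1 * a + 1 * c) (1 * b + 1 * d)).
{ apply (differentiable_pt_lim_comp (fun s t => s + t)); [|exact hf|exact hg].
  intros eps. exists eps. intros u v hu hv.
  replace (u + v - (f x y + g x y) - (1 * (u - f x y) + 1 * (v - g x y)))
    with 0 by ring.
  rewrite Rabs_R0. apply Rmult_le_pos; [apply Rlt_le, cond_pos|].
  eapply Rle_trans; [apply Rabs_pos|apply Rmax_l]. }
now rewrite !Rmult_1_l in H.
Qed.

Lemma differentiable_pt_lim_comp1 (h : R -> R) (f : R -> R -> R) (x y a b l : R) :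
  is_derive h (f x y) l -> differentiable_pt_lim f x y a b ->
  differentiable_pt_lim (fun u v => h (f u v)) x y (l * a) (l * b).
Proof.
intros hh hf.
assert (H := differentiable_pt_lim_comp (fun s _ => h s) f f x y _ _ _ _ _ _
  (differentiable_pt_lim_fst h (f x y) (f x y) l hh) hf hf).
now rewrite !Rmult_0_l, !Rplus_0_r in H.
Qed.

Lemma is_derive_CR (f : C -> C) (z : C) (a b : R) :
  differentiable_pt_lim (fun x y => Re (f (x, y))) (Re z) (Im z) a (- b) ->
  differentiable_pt_lim (fun x y => Im (f (x, y))) (Re z) (Im z) b a ->
  is_derive (K := C_AbsRing) (V := C_NormedModule) f z (a, b).
Proof.
intros hu hv. split; [apply is_linear_scal_l|].
intros z' hz' eps.
replace z' with z
  by exact (is_filter_lim_locally_unique (K := C_AbsRing) (V := AbsRing_NormedModule C_AbsRing) _ _ hz').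
assert (heps : 0 < eps / 2) by (assert (h := cond_pos eps); lra).
destruct (hu (mkposreal _ heps)) as [d1 h1].
destruct (hv (mkposreal _ heps)) as [d2 h2].
exists (mkposreal _ (Rmin_stable_in_posreal d1 d2)).
intros w hw.
change (Cmod (w - z)%C < Rmin d1 d2) in hw.
change (Cmod (f w - f z - (w - z) * (a, b))%C <= eps * Cmod (w - z)%C).
specialize (h1 (Re w) (Im w)). specialize (h2 (Re w) (Im w)).
assert (hm := Rmax_Cmod (w - z)%C).
change (fst (w - z)%C) with (Re w - Re z) in hm.
change (snd (w - z)%C) with (Im w - Im z) in hm.
assert (hw1 := Rmax_l (Rabs (Re w - Re z)) (Rabs (Im w - Im z))).
assert (hw2 := Rmax_r (Rabs (Re w - Re z)) (Rabs (Im w - Im z))).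
assert (hm1 := Rmin_l d1 d2). assert (hm2 := Rmin_r d1 d2).
specialize (h1 ltac:(lra) ltac:(lra)). specialize (h2 ltac:(lra) ltac:(lra)).
cbv beta in h1, h2. simpl pos in h1, h2.
replace (Re w, Im w) with w in h1, h2 by now destruct w.
replace (Re z, Im z) with z in h1, h2 by now destruct z.
set (m := Rmax _ _) in *.
set (q := (f w - f z - (w - z) * (a, b))%C).
assert (hq1 : Rabs (fst q) <= eps / 2 * m).
{ replace (fst q) with
    (Re (f w) - Re (f z) - (a * (Re w - Re z) + - b * (Im w - Im z))); [exact h1|].
  unfold q, Re, Im; destruct w, z; simpl; ring. }
assert (hq2 : Rabs (snd q) <= eps / 2 * m).
{ replace (snd q) with
    (Im (f w) - Im (f z) - (b * (Re w - Re z) + a * (Im w - Im z))); [exact h2|].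
  unfold q, Re, Im; destruct w, z; simpl; ring. }
eapply Rle_trans; [apply Cmod_2Rmax|].
assert (hM : Rmax (Rabs (fst q)) (Rabs (snd q)) <= eps / 2 * m) by now apply Rmax_lub.
assert (hs : sqrt 2 <= 2).
{ assert (h := Rsqr_sqrt 2 ltac:(lra)). assert (h' := sqrt_pos 2). unfold Rsqr in h. nra. }
assert (h0 : 0 <= Rmax (Rabs (fst q)) (Rabs (snd q)))
  by (eapply Rle_trans; [apply Rabs_pos|apply Rmax_l]).
assert (h := cond_pos eps).
apply Rle_trans with (2 * (eps / 2 * m)).
- apply Rmult_le_compat; [apply sqrt_pos|exact h0|exact hs|exact hM].
- nra.
Qed.

Lemma differentiable_pt_lim_eq (f : R -> R -> R) (x y a b a' b' : R) :
  differentiable_pt_lim f x y a b -> a = a' -> b = b' ->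
  differentiable_pt_lim f x y a' b'.
Proof. now intros h <- <-. Qed.

Lemma jac_diff_prod (f g : R -> R) (x y a b : R) :
  is_derive f x a -> is_derive g y b ->
  differentiable_pt_lim (fun u v => f u * g v) x y (g y * a) (f x * b).
Proof.
intros hf hg. eapply differentiable_pt_lim_eq.
- apply (differentiable_pt_lim_mult (fun u _ => f u) (fun _ v => g v)).
  + apply differentiable_pt_lim_fst, hf.
  + apply differentiable_pt_lim_snd, hg.
- cbv beta; ring.
- cbv beta; ring.
Qed.

Lemma jac_diff_den (k x y : R) : 0 < k < 1 ->
  let k' := comod k in
  differentiable_pt_lim (fun x y => jac_den (x, y) k) x y
    (2 * k ^ 2 * snR x k * cnR x k * dnR x k * snR y k' ^ 2)
    (2 * (k ^ 2 * snR x k ^ 2 - 1) * snR y k' * cnR y k' * dnR y k').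
Proof.
intros hk k'. assert (hk' := comod_range k hk). fold k' in hk'.
assert (h1 : is_derive (fun _ : R => 1) x 0)
  by apply (is_derive_const (K := R_AbsRing) (V := R_NormedModule)).
assert (h2 : is_derive (fun v => cnR v k' ^ 2) y (- (2 * snR y k' * cnR y k' * dnR y k'))).
{ assert (h := is_derive_cnR y k' hk'). auto_derive; [eexists; exact h|].
  match goal with |- context [Derive ?f ?t] => rewrite (is_derive_unique f t _ h) end. ring. }
assert (h3 : is_derive (fun u => k ^ 2 * snR u k ^ 2) x
  (2 * k ^ 2 * snR x k * cnR x k * dnR x k)).
{ assert (h := is_derive_snR x k hk). auto_derive; [eexists; exact h|].
  match goal with |- context [Derive ?f ?t] => rewrite (is_derive_unique f t _ h) end. ring. }
assert (h4 : is_derive (fun v => snR v k' ^ 2) y (2 * snR y k' * cnR y k' * dnR y k')).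
{ assert (h := is_derive_snR y k' hk'). auto_derive; [eexists; exact h|].
  match goal with |- context [Derive ?f ?t] => rewrite (is_derive_unique f t _ h) end. ring. }
apply (differentiable_pt_lim_ext
  (fun u v => 1 * cnR v k' ^ 2 + (k ^ 2 * snR u k ^ 2) * snR v k' ^ 2)).
- exists (mkposreal 1 Rlt_0_1). intros u v _ _.
  unfold jac_den, Re, Im; simpl fst; simpl snd; fold k'. ring.
- eapply differentiable_pt_lim_eq.
  + apply differentiable_pt_lim_plus.
    * apply (jac_diff_prod (fun _ => 1) _ _ _ _ _ h1 h2).
    * apply (jac_diff_prod _ _ _ _ _ _ h3 h4).
  + cbv beta; ring.
  + cbv beta; ring.
Qed.

Lemma jac_diff_quot (k x y a b : R) (p q : R -> R) (w : R -> R -> R) :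
  0 < k < 1 -> jac_den (x, y) k <> 0 ->
  is_derive p x a -> is_derive q y b ->
  (forall u v, w u v = p u * q v / jac_den (u, v) k) ->
  let k' := comod k in let D := jac_den (x, y) k in
  differentiable_pt_lim w x y
    ((a * q y * D
      - p x * q y * (2 * k ^ 2 * snR x k * cnR x k * dnR x k * snR y k' ^ 2)) / D ^ 2)
    ((p x * b * D
      - p x * q y * (2 * (k ^ 2 * snR x k ^ 2 - 1) * snR y k' * cnR y k' * dnR y k'))
      / D ^ 2).
Proof.
intros hk hD hp hq hw k' D.
apply (differentiable_pt_lim_ext (fun u v => (p u * q v) * / jac_den (u, v) k)).
- exists (mkposreal 1 Rlt_0_1). intros u v _ _. symmetry. apply hw.
- eapply differentiable_pt_lim_eq.
  + apply differentiable_pt_lim_mult; [apply (jac_diff_prod _ _ _ _ _ _ hp hq)|].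
    eapply (differentiable_pt_lim_comp1 Rinv (fun u v => jac_den (u, v) k)
      x y _ _ (- / D ^ 2)); [|apply jac_diff_den, hk].
    fold D. replace (- / D ^ 2) with (- 1 / D ^ 2) by (field; exact hD).
    apply (is_derive_inv (fun t => t)); [|exact hD].
    apply (is_derive_id (K := R_AbsRing)).
  + cbv beta; fold k' D. field. exact hD.
  + cbv beta; fold k' D. field. exact hD.
Qed.

Lemma is_derive_Rmult (f g : R -> R) (x a b c : R) :
  is_derive f x a -> is_derive g x b -> c = a * g x + f x * b ->
  is_derive (fun t => f t * g t) x c.
Proof.
intros hf hg ->. apply (is_derive_mult f g x a b hf hg). intros; apply Rmult_comm.
Qed.

Lemma is_derive_Rscal (m : R) (f : R -> R) (x a c : R) :
  is_derive f x a -> c = m * a -> is_derive (fun t => m * f t) x c.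
Proof. intros hf ->. apply (is_derive_scal f x m a hf). Qed.

Ltac jac_derive hk hk' :=
  lazymatch goal with
  | |- is_derive (fun t => snR t (comod _)) _ _ => apply is_derive_snR, hk'
  | |- is_derive (fun t => cnR t (comod _)) _ _ => apply is_derive_cnR, hk'
  | |- is_derive (fun t => dnR t (comod _)) _ _ => apply is_derive_dnR, hk'
  | |- is_derive (fun t => snR t _) _ _ => apply is_derive_snR, hk
  | |- is_derive (fun t => cnR t _) _ _ => apply is_derive_cnR, hk
  | |- is_derive (fun t => dnR t _) _ _ => apply is_derive_dnR, hk
  | |- is_derive (fun t => - _ * _) _ _ =>
      eapply is_derive_Rscal; [jac_derive hk hk' | reflexivity]
  | |- is_derive (fun t => @?f t * @?g t) _ _ =>
      eapply (is_derive_Rmult f g); [jac_derive hk hk' | jac_derive hk hk' | reflexivity]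
  end.

Ltac jac_close k x y :=
  lazymatch goal with hk : 0 < k < 1, hk' : 0 < comod k < 1, hD : jac_den (x, y) k <> 0 |- _ =>
    let e1 := fresh in let e2 := fresh in let e3 := fresh in let e4 := fresh in
    let e5 := fresh in let e6 := fresh in
    cbv beta; unfold sn, cn, dn; simpl;
    assert (e6 := comod_sqr k hk);
    assert (e1 : cnR x k ^ 2 = 1 - snR x k ^ 2) by (pose proof (snR_cnR x k); lra);
    assert (e2 : dnR x k ^ 2 = 1 - k ^ 2 * snR x k ^ 2)
      by (pose proof (snR_dnR x k hk); lra);
    assert (e3 : cnR y (comod k) ^ 2 = 1 - snR y (comod k) ^ 2)
      by (pose proof (snR_cnR y (comod k)); lra);
    assert (e4 : dnR y (comod k) ^ 2 = 1 - (1 - k ^ 2) * snR y (comod k) ^ 2)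
      by (pose proof (snR_dnR y (comod k) hk'); rewrite <- e6; lra);
    assert (e5 : jac_den (x, y) k =
      1 - snR y (comod k) ^ 2 + k ^ 2 * snR x k ^ 2 * snR y (comod k) ^ 2)
      by (unfold jac_den; simpl Re; simpl Im; rewrite e3; reflexivity);
    clear hk hk';
    generalize dependent (jac_den (x, y) k);
    generalize dependent (snR x k); generalize dependent (cnR x k);
    generalize dependent (dnR x k); generalize dependent (snR y (comod k));
    generalize dependent (cnR y (comod k)); generalize dependent (dnR y (comod k));
    generalize dependent (comod k); clear x y;
    intros k' e6 d1 c1 s1 e3 e4 d c s e1 e2 D hD e5;
    field_simplify_eq; [ring [e1 e2 e3 e4 e5 e6] | exact hD]
  end.

Ltac jac_diff P Q :=
  lazymatch goal with hk : 0 < ?k < 1, hk' : 0 < comod ?k < 1,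
                  hD : jac_den (?x, ?y) ?k <> 0 |- _ =>
    eapply differentiable_pt_lim_eq;
    [ eapply (jac_diff_quot k x y) with (p := P) (q := Q);
      [exact hk | exact hD | jac_derive hk hk' | jac_derive hk hk' |
       intros u v; unfold sn, cn, dn, Re, Im, Rdiv; simpl;
       generalize (snR u k) (cnR u k) (dnR u k) (snR v (comod k)) (cnR v (comod k))
         (dnR v (comod k)) (/ jac_den (u, v) k); intros; ring]
    | jac_close k x y | jac_close k x y ]
  end.

Lemma is_derive_sn (z : C) (k : R) : 0 < k < 1 -> jac_den z k <> 0 ->
  is_derive (K := C_AbsRing) (V := C_NormedModule) (fun w => sn w k) z
    (cn z k * dn z k)%C.
Proof.
intros hk hD. assert (hk' := comod_range k hk). destruct z as [x y].
rewrite (surjective_pairing (cn (x, y) k * dn (x, y) k)%C).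
apply is_derive_CR; simpl (Re (x, y)); simpl (Im (x, y)).
- jac_diff (fun u => snR u k) (fun v => dnR v (comod k)).
- jac_diff (fun u => cnR u k * dnR u k) (fun v => snR v (comod k) * cnR v (comod k)).
Qed.

Lemma is_derive_cn (z : C) (k : R) : 0 < k < 1 -> jac_den z k <> 0 ->
  is_derive (K := C_AbsRing) (V := C_NormedModule) (fun w => cn w k) z
    (- (sn z k * dn z k))%C.
Proof.
intros hk hD. assert (hk' := comod_range k hk). destruct z as [x y].
rewrite (surjective_pairing (- (sn (x, y) k * dn (x, y) k))%C).
apply is_derive_CR; simpl (Re (x, y)); simpl (Im (x, y)).
- jac_diff (fun u => cnR u k) (fun v => cnR v (comod k)).
- jac_diff (fun u => - (1) * (snR u k * dnR u k))
    (fun v => snR v (comod k) * dnR v (comod k)).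
Qed.

Lemma is_derive_dn (z : C) (k : R) : 0 < k < 1 -> jac_den z k <> 0 ->
  is_derive (K := C_AbsRing) (V := C_NormedModule) (fun w => dn w k) z
    (- (k ^ 2 * (sn z k * cn z k)))%C.
Proof.
intros hk hD. assert (hk' := comod_range k hk). destruct z as [x y].
rewrite (surjective_pairing (- (k ^ 2 * (sn (x, y) k * cn (x, y) k)))%C).
apply is_derive_CR; simpl (Re (x, y)); simpl (Im (x, y)).
- jac_diff (fun u => dnR u k) (fun v => cnR v (comod k) * dnR v (comod k)).
- jac_diff (fun u => (- k ^ 2) * (snR u k * cnR u k)) (fun v => snR v (comod k)).
Qed.

(* Main.v *)
Require Import Defs.
From Stdlib Require Import Reals Lra Psatz FunctionalExtensionality.
From Coquelicot Require Import Coquelicot.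
Open Scope R_scope.

(** Put [b = K' / K].  On the real line [dn (2 K' x, k)], [cn (2 K' x, k)] and
    [sn (2 K' x, k)] are sums of exponentials [exp (2 pi i n b x)], with [n] integral for
    [dn] and half-integral for [cn] and [sn], and with coefficients proportional to
    [1 / cosh (pi n b)], resp. [1 / sinh (pi n b)].  As [1 / cosh (pi x)] is its own Fourier
    transform, the transform of [dn (2 K' x) / cosh (pi x)] is
      [pi / (2 K) sum_n 1 / (cosh (pi n b) cosh (pi (y + n b)))
        = pi / (2 K sinh (pi y)) sum_n (tanh (pi (y + n b)) - tanh (pi n b))],
    and the other two are similar.  The derivative of the last sum is the periodization of
    [1 / cosh^2].  It agrees with [dn (2 K y, k')^2] up to affine normalization because the
    Fourier coefficients of order [n <> 0] coincide, and Parseval's identity for [dn] fixes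
    the constant to be the one with [E - K].  The functions [cs], [ds], [ns] over [sinh] are
    the previous three integrands on the line lowered by [i / 2].

    The coefficients come from moving the line of integration up to the poles: there the
    relevant component of [dn], [cn] or [sn] is a positive kernel that concentrates at the
    poles, and its mass is known from the coefficient of order [0] of [dn]. *)

(** * Continuous functions, integrals and bilateral sums *)

(** The poles lie at height [K'] (height 1/2 after scaling by [2 * K']), on the boundary of the
    strip where Cauchy's theorem applies. Residues are replaced by inequalities: on each line of
    height s < 1/2 the deviation from the expected value is bounded by a quantity that vanishes at s
    = 1/2, namely sin (2 pi s) for sech and cn (2 K' s, k') for the Jacobi functions, and continuity
    in s gives the identity on the boundary. The mass of the limiting kernel needs no expansion at
    the pole: for dn it is the integral of am' over a period, for tanh the variation of an
    arctangent. All coefficients decay geometrically, so convergence is immediate; Fejer's theorem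
    only identifies the limits, and shows that a function whose coefficients of order n <> 0 vanish
    is constant. The nd formulas come from the dn one by a half period shift, which turns integral
    indices into half-integral ones. Multiplication by sinh (pi y) loses the value at y = 0, so this
    value is compared separately with a derivative at 0. *)

Definition cont (f : R -> R) : Prop := forall x, continuous f x.

Lemma cont_derive (f df : R -> R) : (forall x, is_derive f x (df x)) -> cont f.
Proof. intros h x. apply (ex_derive_continuous f). eexists. apply h. Qed.

Lemma cont_continuity_pt (f : R -> R) (x : R) : cont f -> continuity_pt f x.
Proof. intros h. apply continuity_pt_filterlim, h. Qed.

Lemma cont_const (c : R) : cont (fun _ => c).
Proof. intros x. apply continuous_const. Qed.

Lemma cont_id : cont (fun x => x).
Proof. intros x. apply continuous_id. Qed.

Lemma cont_plus (f g : R -> R) : cont f -> cont g -> cont (fun x => f x + g x).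
Proof. intros hf hg x. apply (continuous_plus f g x (hf x) (hg x)). Qed.

Lemma cont_opp (f : R -> R) : cont f -> cont (fun x => - f x).
Proof. intros hf x. apply (continuous_opp f x (hf x)). Qed.

Lemma cont_minus (f g : R -> R) : cont f -> cont g -> cont (fun x => f x - g x).
Proof. intros hf hg x. apply (continuous_minus f g x (hf x) (hg x)). Qed.

Lemma cont_mult (f g : R -> R) : cont f -> cont g -> cont (fun x => f x * g x).
Proof. intros hf hg x. apply (continuous_mult f g x (hf x) (hg x)). Qed.

Lemma cont_comp (f g : R -> R) : cont f -> cont g -> cont (fun x => f (g x)).
Proof. intros hf hg x. apply (continuous_comp g f x (hg x) (hf (g x))). Qed.

Lemma cont_inv (f : R -> R) : cont f -> (forall x, f x <> 0) -> cont (fun x => / f x).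
Proof.
intros hf h0 x. apply (continuous_comp f Rinv x (hf x)).
apply (filterlim_Rbar_inv (f x)). intros h; inversion h; now apply (h0 x).
Qed.

Lemma cont_div (f g : R -> R) : cont f -> cont g -> (forall x, g x <> 0) ->
  cont (fun x => f x / g x).
Proof. intros hf hg h0. apply cont_mult; [exact hf|now apply cont_inv]. Qed.

Lemma cont_pow (f : R -> R) (n : nat) : cont f -> cont (fun x => f x ^ n).
Proof.
intros hf. induction n as [|n IH]; simpl; [apply cont_const|now apply cont_mult].
Qed.

Lemma cont_abs (f : R -> R) : cont f -> cont (fun x => Rabs (f x)).
Proof. intros hf. apply (cont_comp Rabs f); [intros x; apply continuous_Rabs|exact hf]. Qed.

Lemma cont_sin : cont sin.
Proof. apply (cont_derive sin cos), is_derive_sin. Qed.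

Lemma cont_cos : cont cos.
Proof. apply (cont_derive cos (fun x => - sin x)), is_derive_cos. Qed.

Lemma cont_exp : cont exp.
Proof. apply (cont_derive exp exp), is_derive_exp. Qed.

(** * Hyperbolic functions *)

Lemma is_derive_cosh (x : R) : is_derive cosh x (sinh x).
Proof. unfold cosh, sinh. auto_derive; [easy|]. field. Qed.

Lemma is_derive_sinh (x : R) : is_derive sinh x (cosh x).
Proof. unfold cosh, sinh. auto_derive; [easy|]. field. Qed.

Lemma cont_cosh : cont cosh.
Proof. apply (cont_derive cosh sinh), is_derive_cosh. Qed.

Lemma cont_sinh : cont sinh.
Proof. apply (cont_derive sinh cosh), is_derive_sinh. Qed.

Lemma cosh_pos (x : R) : 0 < cosh x.
Proof. unfold cosh. assert (h := exp_pos x). assert (h' := exp_pos (- x)). lra. Qed.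

Lemma cosh_sinh_sqr (x : R) : cosh x ^ 2 = 1 + sinh x ^ 2.
Proof.
unfold cosh, sinh.
assert (h : exp x * exp (- x) = 1) by (rewrite <- exp_plus, Rplus_opp_r; apply exp_0).
field_simplify. nra.
Qed.

Lemma cosh_ge_1 (x : R) : 1 <= cosh x.
Proof. assert (h := cosh_sinh_sqr x). assert (h' := cosh_pos x). nra. Qed.

Lemma cosh_neg (x : R) : cosh (- x) = cosh x.
Proof. unfold cosh. rewrite Ropp_involutive. field. Qed.

Lemma sinh_neg (x : R) : sinh (- x) = - sinh x.
Proof. unfold sinh. rewrite Ropp_involutive. field. Qed.

Lemma cosh_plus (x y : R) : cosh (x + y) = cosh x * cosh y + sinh x * sinh y.
Proof. unfold cosh, sinh. rewrite Ropp_plus_distr, !exp_plus. field. Qed.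

Lemma sinh_plus (x y : R) : sinh (x + y) = sinh x * cosh y + cosh x * sinh y.
Proof. unfold cosh, sinh. rewrite Ropp_plus_distr, !exp_plus. field. Qed.

(** Structural continuity. The constant case comes early so that closed subterms are not taken
    apart; the nonvanishing of denominators is left to the caller. *)
Ltac ct := repeat
  match goal with
  | h : cont ?f |- cont ?f => exact h
  | |- cont (fun _ => ?c) => apply (cont_const c)
  | |- cont (fun x => x) => apply cont_id
  | |- cont (fun x => @?f x + @?g x) => apply (cont_plus f g)
  | |- cont (fun x => @?f x - @?g x) => apply (cont_minus f g)
  | |- cont (fun x => - @?f x) => apply (cont_opp f)
  | |- cont (fun x => @?f x * @?g x) => apply (cont_mult f g)
  | |- cont (fun x => @?f x / @?g x) => apply (cont_div f g)
  | |- cont (fun x => / @?f x) => apply (cont_inv f)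
  | |- cont (fun x => @?f x ^ ?n) => apply (cont_pow f n)
  | |- cont (fun x => Rabs (@?f x)) => apply (cont_abs f)
  | |- cont (fun x => sin (@?f x)) => apply (cont_comp sin f); [apply cont_sin|]
  | |- cont (fun x => cos (@?f x)) => apply (cont_comp cos f); [apply cont_cos|]
  | |- cont (fun x => exp (@?f x)) => apply (cont_comp exp f); [apply cont_exp|]
  | |- cont (fun x => cosh (@?f x)) => apply (cont_comp cosh f); [apply cont_cosh|]
  | |- cont (fun x => sinh (@?f x)) => apply (cont_comp sinh f); [apply cont_sinh|]
  | h : cont ?f |- cont (fun x => ?f (@?g x)) => apply (cont_comp f g); [exact h|]
  end.

(** * Riemann integrals of continuous functions *)

Lemma ex_RInt_cont (f : R -> R) (a b : R) : cont f -> ex_RInt f a b.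
Proof. intros h. apply (ex_RInt_continuous (V := R_CompleteNormedModule)). intros; apply h. Qed.

Lemma is_RInt_cont (f : R -> R) (a b : R) : cont f -> is_RInt f a b (RInt f a b).
Proof. intros h. apply (RInt_correct (V := R_CompleteNormedModule)), ex_RInt_cont, h. Qed.

Lemma RInt_plusR (f g : R -> R) (a b : R) : cont f -> cont g ->
  RInt (fun x => f x + g x) a b = RInt f a b + RInt g a b.
Proof.
intros hf hg. apply (RInt_plus (V := R_CompleteNormedModule) f g);
  now apply ex_RInt_cont.
Qed.

Lemma RInt_minusR (f g : R -> R) (a b : R) : cont f -> cont g ->
  RInt (fun x => f x - g x) a b = RInt f a b - RInt g a b.
Proof.
intros hf hg. apply (RInt_minus (V := R_CompleteNormedModule) f g);
  now apply ex_RInt_cont.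
Qed.

Lemma RInt_scalR (c : R) (f : R -> R) (a b : R) : cont f ->
  RInt (fun x => c * f x) a b = c * RInt f a b.
Proof.
intros hf. apply (RInt_scal (V := R_CompleteNormedModule) f); now apply ex_RInt_cont.
Qed.

Lemma RInt_oppR (f : R -> R) (a b : R) : cont f ->
  RInt (fun x => - f x) a b = - RInt f a b.
Proof.
intros hf. apply (RInt_opp (V := R_CompleteNormedModule) f); now apply ex_RInt_cont.
Qed.

Lemma RInt_constR (c a b : R) : RInt (fun _ => c) a b = (b - a) * c.
Proof. rewrite RInt_const. reflexivity. Qed.

Lemma RInt_ChaslesR (f : R -> R) (a b c : R) : cont f ->
  RInt f a b + RInt f b c = RInt f a c.
Proof.
intros h. apply (RInt_Chasles (V := R_CompleteNormedModule) f); now apply ex_RInt_cont.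
Qed.


Lemma RInt_FTC (F f : R -> R) (a b : R) : (forall x, is_derive F x (f x)) -> cont f ->
  RInt f a b = F b - F a.
Proof.
intros hF hf. apply (is_RInt_unique (V := R_CompleteNormedModule)).
apply (is_RInt_derive (V := R_CompleteNormedModule) F f a b); intros; [apply hF|apply hf].
Qed.

Lemma RInt_lin (f : R -> R) (u v a b : R) : cont f ->
  u * RInt (fun x => f (u * x + v)) a b = RInt f (u * a + v) (u * b + v).
Proof.
intros hf.
rewrite <- (RInt_comp_lin (V := R_CompleteNormedModule) f u v a b (ex_RInt_cont _ _ _ hf)).
symmetry. apply (RInt_scal (V := R_CompleteNormedModule) (fun x => f (u * x + v))).
apply ex_RInt_cont. ct.
Qed.

Lemma RInt_extR (f g : R -> R) (a b : R) : (forall x, f x = g x) -> RInt f a b = RInt g a b.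
Proof. intros h. apply (RInt_ext (V := R_CompleteNormedModule)). intros; apply h. Qed.

Lemma RInt_swap_bounds (f : R -> R) (a b : R) : cont f -> RInt f b a = - RInt f a b.
Proof.
intros hf. assert (h := RInt_ChaslesR f a b a hf).
rewrite (RInt_point (V := R_CompleteNormedModule)) in h. unfold zero in h; simpl in h. lra.
Qed.

Lemma RInt_reflect (f : R -> R) (a b : R) : cont f ->
  RInt (fun x => f (- x)) a b = RInt f (- b) (- a).
Proof.
intros hf. assert (h := RInt_lin f (-1) 0 a b hf).
rewrite (RInt_extR _ (fun x => f (- x))) in h by (intros x; f_equal; ring).
replace (-1 * a + 0) with (- a) in h by ring. replace (-1 * b + 0) with (- b) in h by ring.
rewrite (RInt_swap_bounds f (- b) (- a)) in h by exact hf. lra.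
Qed.

Lemma RInt_shift (f : R -> R) (v a b : R) : cont f ->
  RInt (fun x => f (x + v)) a b = RInt f (a + v) (b + v).
Proof.
intros hf. assert (h := RInt_lin f 1 v a b hf).
rewrite (RInt_extR _ (fun x => f (x + v))) in h by (intros x; f_equal; ring).
rewrite !Rmult_1_l in h. exact h.
Qed.

Lemma RInt_bound (f g : R -> R) (a b : R) : a <= b -> cont f -> cont g ->
  (forall x, a <= x <= b -> Rabs (f x) <= g x) -> Rabs (RInt f a b) <= RInt g a b.
Proof.
intros hab hf hg h.
eapply Rle_trans; [apply abs_RInt_le; [exact hab|now apply ex_RInt_cont]|].
apply RInt_le; [exact hab| | |]; try (apply ex_RInt_cont; ct).
intros x hx. apply h. lra.
Qed.

Lemma RInt_bound_const (f : R -> R) (C a b : R) : a <= b -> cont f ->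
  (forall x, a <= x <= b -> Rabs (f x) <= C) -> Rabs (RInt f a b) <= (b - a) * C.
Proof.
intros hab hf h. rewrite <- (RInt_constR C a b).
apply RInt_bound; [exact hab|exact hf|apply cont_const|exact h].
Qed.

Lemma RInt_odd (f : R -> R) (a : R) : cont f -> (forall x, f (- x) = - f x) ->
  RInt f (- a) a = 0.
Proof.
intros hf h. assert (e := RInt_reflect f (- a) a hf).
rewrite Ropp_involutive in e.
rewrite (RInt_extR _ (fun x => - f x)) in e by apply h.
rewrite RInt_oppR in e by exact hf. lra.
Qed.

Lemma RInt_period (f : R -> R) (p x : R) : cont f -> (forall t, f (t + p) = f t) ->
  RInt f (x - p / 2) (x + p / 2) = RInt f (- (p / 2)) (p / 2).
Proof.
intros hf h.
assert (h1 := RInt_ChaslesR f (- (p / 2)) (x - p / 2) (x + p / 2) hf).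
assert (h2 := RInt_ChaslesR f (- (p / 2)) (p / 2) (x + p / 2) hf).
assert (h3 := RInt_shift f p (- (p / 2)) (x - p / 2) hf).
rewrite (RInt_extR _ f) in h3 by exact h.
replace (- (p / 2) + p) with (p / 2) in h3 by field.
replace (x - p / 2 + p) with (x + p / 2) in h3 by field. lra.
Qed.

(** Bilateral partial sums over the indices [n + s] with [- N - 1 <= n <= N]. *)
Definition bs (h : R -> R) (s : R) (N : nat) : R :=
  sum_f_R0 (fun j => h (INR j + s) + h (s - 1 - INR j)) N.

Lemma bs_ext (h g : R -> R) (s : R) (N : nat) :
  (forall j, h (INR j + s) = g (INR j + s)) ->
  (forall j, h (s - 1 - INR j) = g (s - 1 - INR j)) -> bs h s N = bs g s N.
Proof. intros e1 e2. apply sum_eq. intros i _. now rewrite e1, e2. Qed.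

Lemma bs_plus (h g : R -> R) (s : R) (N : nat) :
  bs (fun n => h n + g n) s N = bs h s N + bs g s N.
Proof. unfold bs. rewrite <- sum_plus. apply sum_eq. intros; ring. Qed.

Lemma bs_minus (h g : R -> R) (s : R) (N : nat) :
  bs (fun n => h n - g n) s N = bs h s N - bs g s N.
Proof. unfold bs. rewrite <- minus_sum. apply sum_eq. intros; ring. Qed.

Lemma bs_scal (c : R) (h : R -> R) (s : R) (N : nat) :
  bs (fun n => c * h n) s N = c * bs h s N.
Proof. unfold bs. rewrite scal_sum. apply sum_eq. intros; ring. Qed.

Lemma bs_step (h : R -> R) (s : R) (N : nat) :
  bs (fun n => h (n + 1)) s N - bs h s N = h (INR N + 1 + s) - h (s - 1 - INR N).
Proof.
induction N as [|N IH]; unfold bs in *.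
- simpl. replace (0 + s + 1) with (0 + 1 + s) by ring.
  replace (s - 1 - 0 + 1) with (0 + s) by ring. ring.
- rewrite !tech5. rewrite S_INR in *.
  replace (INR N + 1 + s + 1) with (INR N + 1 + 1 + s) by ring.
  replace (s - 1 - (INR N + 1) + 1) with (s - 1 - INR N) by ring. lra.
Qed.

Lemma bs_tail (h : R -> R) (s B r : R) (M N : nat) : 0 < r < 1 ->
  (forall j, Rabs (h (INR j + s)) + Rabs (h (s - 1 - INR j)) <= B * r ^ j) ->
  (N <= M)%nat -> Rabs (bs h s M - bs h s N) <= B / (1 - r) * r ^ N.
Proof.
intros hr hb hNM.
assert (hB : 0 <= B).
{ specialize (hb 0%nat). rewrite pow_O in hb.
  assert (h1 := Rabs_pos (h (INR 0 + s))). assert (h2 := Rabs_pos (h (s - 1 - INR 0))). lra. }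
(* The sharper bound with [r ^ N - r ^ M] is the one that induction on [M] can carry: a further term
   costs at most [B * r ^ M], exactly the increment of the right-hand side. *)
assert (H : Rabs (bs h s M - bs h s N) <= B / (1 - r) * (r ^ N - r ^ M)).
{ induction hNM as [|M hNM IH].
  - rewrite !Rminus_diag, Rabs_R0. lra.
  - replace (bs h s (S M)) with (bs h s M + (h (INR (S M) + s) + h (s - 1 - INR (S M))))
      by reflexivity.
    replace (bs h s M + (h (INR (S M) + s) + h (s - 1 - INR (S M))) - bs h s N)
      with ((bs h s M - bs h s N) + (h (INR (S M) + s) + h (s - 1 - INR (S M)))) by ring.
    eapply Rle_trans; [apply Rabs_triang|].
    assert (h1 := Rabs_triang (h (INR (S M) + s)) (h (s - 1 - INR (S M)))).
    specialize (hb (S M)).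
    replace (B / (1 - r) * (r ^ N - r ^ S M)) with
      (B / (1 - r) * (r ^ N - r ^ M) + B * r ^ M) by (simpl; field; lra).
    assert (B * r ^ S M <= B * r ^ M).
    { apply Rmult_le_compat_l; [exact hB|]. simpl. assert (0 < r ^ M) by (apply pow_lt; lra). nra. }
    lra. }
eapply Rle_trans; [exact H|]. apply Rmult_le_compat_l.
- apply Rdiv_le_0_compat; lra.
- assert (0 < r ^ M) by (apply pow_lt; lra). lra.
Qed.

Lemma geom_small (C r eps : R) : 0 < r < 1 -> 0 < eps ->
  exists N0, forall N, (N0 <= N)%nat -> C * r ^ N < eps.
Proof.
intros hr he.
assert (hC : 0 < Rabs C + 1) by (assert (h := Rabs_pos C); lra).
destruct (pow_lt_1_zero r ltac:(rewrite Rabs_pos_eq; lra) (eps / (Rabs C + 1))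
  ltac:(apply Rdiv_lt_0_compat; lra)) as [N0 h].
exists N0. intros N hN. specialize (h N hN).
assert (hp : 0 < r ^ N) by (apply pow_lt; lra).
rewrite Rabs_pos_eq in h by lra.
apply (Rmult_lt_compat_l (Rabs C + 1)) in h; [|exact hC].
replace ((Rabs C + 1) * (eps / (Rabs C + 1))) with eps in h by (field; lra).
assert (h1 := Rle_abs C). nra.
Qed.

Lemma is_lim_seq_geom (C r l : R) (u : nat -> R) : 0 < r < 1 ->
  (forall N, Rabs (u N - l) <= C * r ^ N) -> is_lim_seq u l.
Proof.
intros hr h. apply is_lim_seq_spec. intros eps.
destruct (geom_small C r eps hr (cond_pos eps)) as [N0 hN].
exists N0. intros N hn. eapply Rle_lt_trans; [apply h|now apply hN].
Qed.

Lemma bs_cauchy (h : R -> R) (s B r : R) : 0 < r < 1 ->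
  (forall j, Rabs (h (INR j + s)) + Rabs (h (s - 1 - INR j)) <= B * r ^ j) ->
  ex_finite_lim_seq (bs h s).
Proof.
intros hr hb. apply ex_lim_seq_cauchy_corr. intros eps.
destruct (geom_small (B / (1 - r)) r eps hr (cond_pos eps)) as [N0 hN].
exists N0. intros n m hn hm.
destruct (Nat.le_ge_cases n m) as [hnm|hnm].
- rewrite Rabs_minus_sym. eapply Rle_lt_trans; [apply (bs_tail h s B r m n hr hb hnm)|].
  now apply hN.
- eapply Rle_lt_trans; [apply (bs_tail h s B r n m hr hb hnm)|]. now apply hN.
Qed.

Lemma bs_tail_lim (h : R -> R) (s B r l : R) (N : nat) : 0 < r < 1 ->
  (forall j, Rabs (h (INR j + s)) + Rabs (h (s - 1 - INR j)) <= B * r ^ j) ->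
  is_lim_seq (bs h s) l -> Rabs (bs h s N - l) <= B / (1 - r) * r ^ N.
Proof.
intros hr hb hl. rewrite Rabs_minus_sym.
assert (h1 : is_lim_seq (fun M => Rabs (bs h s (M + N) - bs h s N)) (Rabs (l - bs h s N))).
{ apply (is_lim_seq_abs _ (Finite (l - bs h s N))).
  apply is_lim_seq_minus'; [now apply is_lim_seq_incr_n|apply is_lim_seq_const]. }
apply (is_lim_seq_le _ _ _ _ (fun M => bs_tail h s B r (M + N) N hr hb (Nat.le_add_l N M))
  h1 (is_lim_seq_const _)).
Qed.

(** Carries estimates from the lines of height s < 1/2 to s = 1/2: both sides of the estimate are
    continuous there although the kernels behind them become singular. *)
Lemma le_at_endpoint (f g : R -> R) (a b : R) : a < b -> cont f -> cont g ->
  (forall x, a < x < b -> Rabs (f x) <= g x) -> Rabs (f b) <= g b.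
Proof.
intros hab hf hg h.
(* The exponent [S n] keeps the sequence strictly inside; with [n] it would start at [a]. *)
assert (hx : is_lim_seq (fun n => b - (b - a) * (/ 2) ^ (S n)) b).
{ replace (Finite b) with (Finite (b - (b - a) * 0)) by (f_equal; ring).
  apply is_lim_seq_minus'; [apply is_lim_seq_const|].
  change (Finite ((b - a) * 0)) with (Rbar_mult (b - a) 0). apply is_lim_seq_scal_l.
  apply (is_lim_seq_incr_1 (fun n => (/ 2) ^ n)). apply (is_lim_seq_geom 1 (/ 2)); [lra|].
  intros N. rewrite Rminus_0_r, Rabs_pos_eq; [lra|apply pow_le; lra]. }
assert (h1 := is_lim_seq_continuous (fun x => Rabs (f x)) _ b
  (cont_continuity_pt _ _ (cont_abs f hf)) hx).
assert (h2 := is_lim_seq_continuous g _ b (cont_continuity_pt _ _ hg) hx).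
refine (is_lim_seq_le _ _ _ _ _ h1 h2).
intros n. apply h.
assert (0 < (/ 2) ^ n) by (apply pow_lt; lra).
assert ((/ 2) ^ n <= 1). { rewrite <- (pow1 n). apply pow_incr; lra. }
simpl. split; nra.
Qed.

Lemma cont_uniform_limit (u : nat -> R -> R) (f : R -> R) :
  (forall N, cont (u N)) ->
  (forall Y eps, 0 < eps -> exists N, forall x, Rabs x <= Y -> Rabs (u N x - f x) < eps) ->
  cont f.
Proof.
intros hu hl x. apply continuity_pt_filterlim. intros eps he.
destruct (hl (Rabs x + 1) (eps / 3) ltac:(lra)) as [N hN].
destruct (cont_continuity_pt (u N) x (hu N) (eps / 3) ltac:(lra)) as [d [hd h]].
exists (Rmin d 1). split; [apply Rmin_glb_lt; lra|].
intros z [hz1 hz2]. simpl in *. unfold R_dist in *.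
assert (hm1 := Rmin_l d 1). assert (hm2 := Rmin_r d 1).
assert (h1 := h z (conj hz1 (Rlt_le_trans _ _ _ hz2 hm1))).
assert (hzx : Rabs z <= Rabs x + 1).
{ replace z with (x + (z - x)) by ring. eapply Rle_trans; [apply Rabs_triang|]. lra. }
assert (h2 := hN z hzx). assert (h3 := hN x ltac:(lra)).
apply Rabs_lt_between in h1, h2, h3. apply Rabs_lt_between. lra.
Qed.

Lemma RInt_uniform_limit (u : nat -> R -> R) (f : R -> R) (a b : R) (e : nat -> R) :
  a <= b -> cont f -> (forall N, cont (u N)) ->
  (forall N x, a <= x <= b -> Rabs (u N x - f x) <= e N) -> is_lim_seq e 0 ->
  is_lim_seq (fun N => RInt (u N) a b) (RInt f a b).
Proof.
intros hab hf hu he h0.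
assert (h1 : is_lim_seq (fun N => RInt (u N) a b - RInt f a b) 0).
{ apply is_lim_seq_abs_0.
  apply (is_lim_seq_le_le (fun _ => 0) _ (fun N => (b - a) * e N)).
  - intros N. split; [apply Rabs_pos|].
    rewrite <- RInt_minusR by auto. apply RInt_bound_const; [exact hab| |apply he].
    apply cont_minus; auto.
  - apply is_lim_seq_const.
  - replace (Finite 0) with (Rbar_mult (b - a) 0) by (simpl; f_equal; ring).
    now apply is_lim_seq_scal_l. }
apply (is_lim_seq_ext (fun N => (RInt (u N) a b - RInt f a b) + RInt f a b));
  [intros; ring|].
replace (Finite (RInt f a b)) with (Finite (0 + RInt f a b)) by (f_equal; ring).
apply is_lim_seq_plus'; [exact h1|apply is_lim_seq_const].
Qed.

Lemma RInt_bs (h : R -> R -> R) (s a b : R) (N : nat) : (forall n, cont (h n)) ->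
  RInt (fun x => bs (fun n => h n x) s N) a b = bs (fun n => RInt (h n) a b) s N.
Proof.
intros hc. induction N as [|N IH].
- unfold bs. simpl. apply RInt_plusR; apply hc.
- unfold bs in *. simpl sum_f_R0 at 2.
  rewrite (RInt_extR _ (fun x => sum_f_R0 (fun j => h (INR j + s) x + h (s - 1 - INR j) x) N
     + (h (INR (S N) + s) x + h (s - 1 - INR (S N)) x))) by reflexivity.
  rewrite RInt_plusR, RInt_plusR, IH; auto.
  + clear IH. induction N as [|N IH]; simpl; [apply cont_plus; apply hc|].
    apply cont_plus; [exact IH|apply cont_plus; apply hc].
  + apply cont_plus; apply hc.
Qed.

Lemma cont_bs (h : R -> R -> R) (s : R) (N : nat) : (forall n, cont (h n)) ->
  cont (fun x => bs (fun n => h n x) s N).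
Proof.
intros hc. unfold bs. induction N as [|N IH]; simpl; [apply cont_plus; apply hc|].
apply cont_plus; [exact IH|apply cont_plus; apply hc].
Qed.

Lemma is_lim_seq_cesaro (u : nat -> R) (l : R) : is_lim_seq u l ->
  is_lim_seq (fun n => sum_f_R0 u n / INR (S n)) l.
Proof.
intros h. apply is_lim_seq_Reals in h. apply Cesaro_1 in h. apply is_lim_seq_Reals in h.
apply is_lim_seq_incr_1 in h. exact h.
Qed.

Lemma is_lim_seq_inj (u : nat -> R) (l l' : R) : is_lim_seq u l -> is_lim_seq u l' -> l = l'.
Proof. intros h h'. apply is_lim_seq_unique in h, h'. rewrite h in h'. now inversion h'. Qed.

(** * Pointwise convergence of Fourier series *)

Lemma sin_ge_xcosx (x : R) : 0 <= x <= PI / 2 -> x * cos x <= sin x.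
Proof.
intros hx. destruct (MVT_gen sin 0 x cos) as [c [hc h]].
- intros; apply is_derive_sin.
- intros; apply cont_continuity_pt, cont_sin.
- rewrite Rmin_left, Rmax_right in hc by lra. rewrite sin_0 in h.
  assert (cos x <= cos c). { apply cos_decr_1; assert (hp := PI_RGT_0); lra. }
  nra.
Qed.

(** Jordan's inequality, with the constant [1/2] that the double angle formula gives. *)
Lemma sin_ge_half (x : R) : 0 <= x <= PI / 2 -> x / 2 <= sin x.
Proof.
intros hx. 
assert (h := sin_ge_xcosx (x / 2) ltac:(lra)).
replace x with (2 * (x / 2)) at 2 by field. rewrite sin_2a.
assert (hc : cos (PI / 4) <= cos (x / 2)) by (apply cos_decr_1; lra).
rewrite cos_PI4 in hc.
assert (h2 : 0 < sqrt 2) by (apply sqrt_lt_R0; lra).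
assert (h3 : sqrt 2 * sqrt 2 = 2) by (apply sqrt_sqrt; lra).
assert (h4 : 1 / sqrt 2 * (1 / sqrt 2) = 1 / 2).
{ replace (1 / sqrt 2 * (1 / sqrt 2)) with (1 / (sqrt 2 * sqrt 2)) by (field; lra).
  rewrite h3. reflexivity. }
assert (h5 : 0 < 1 / sqrt 2) by (apply Rdiv_lt_0_compat; lra).
set (c := cos (x / 2)) in *. set (w := 1 / sqrt 2) in *.
assert (1 / 2 <= c * c) by nra.
nra.
Qed.

Lemma sin_sqr_ge (x : R) : Rabs x <= PI / 2 -> x ^ 2 <= 4 * sin x ^ 2.
Proof.
intros hx. destruct (Rle_or_lt 0 x) as [h|h].
- rewrite Rabs_pos_eq in hx by lra. assert (h1 := sin_ge_half x (conj h hx)). nra.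
- rewrite Rabs_left in hx by lra.
  assert (h1 := sin_ge_half (- x) ltac:(lra)). rewrite sin_neg in h1. nra.
Qed.

Lemma Rabs_sin_le (x : R) : Rabs (sin x) <= Rabs x.
Proof.
destruct (MVT_gen sin 0 x cos) as [c [_ h]].
- intros; apply is_derive_sin.
- intros; apply cont_continuity_pt, cont_sin.
- rewrite sin_0, !Rminus_0_r in h. rewrite h, Rabs_mult.
  assert (Rabs (cos c) <= 1) by (apply Rabs_le, COS_bound).
  assert (0 <= Rabs x) by apply Rabs_pos. nra.
Qed.

Lemma sin_sqr_le (x : R) : sin x ^ 2 <= x ^ 2.
Proof.
rewrite <- (pow2_abs (sin x)), <- (pow2_abs x). apply pow_incr.
split; [apply Rabs_pos|apply Rabs_sin_le].
Qed.

Lemma one_minus_cos (x : R) : 1 - cos x = 2 * sin (x / 2) ^ 2.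
Proof. replace x with (2 * (x / 2)) at 1 by field. rewrite cos_2a_sin. ring. Qed.

Lemma one_minus_cos_bound (x : R) : Rabs (1 - cos x) <= x ^ 2 / 2.
Proof.
rewrite one_minus_cos. assert (h := sin_sqr_le (x / 2)).
rewrite Rabs_pos_eq by (assert (h' := pow2_ge_0 (sin (x / 2))); lra). lra.
Qed.

Lemma sin_PI_INR (n : nat) : sin (PI * INR n) = 0.
Proof.
apply sin_eq_0_1. exists (Z.of_nat n). rewrite <- INR_IZR_INZ. ring.
Qed.

Lemma RInt_cos_period (p z : R) : 0 < p -> z <> 0 -> sin (PI * z) = 0 ->
  RInt (fun t => cos (2 * PI * z * t / p)) (- (p / 2)) (p / 2) = 0 :> R.
Proof.
intros hp hz h. assert (hpi := PI_RGT_0).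
rewrite (RInt_FTC (fun t => p / (2 * PI * z) * sin (2 * PI * z * t / p))).
- replace (2 * PI * z * (p / 2) / p) with (PI * z) by (field; lra).
  replace (2 * PI * z * (- (p / 2)) / p) with (- (PI * z)) by (field; lra).
  rewrite sin_neg, h. ring.
- intros t. auto_derive; [easy|]. unfold Rdiv. field. repeat split; lra.
- unfold Rdiv. ct.
Qed.

Lemma RInt_cos_zero (p : R) :
  RInt (fun t => cos (2 * PI * 0 * t / p)) (- (p / 2)) (p / 2) = p :> R.
Proof.
rewrite (RInt_extR _ (fun _ => 1)).
- rewrite RInt_constR. field.
- intros t. replace (2 * PI * 0 * t / p) with 0 by (unfold Rdiv; ring). apply cos_0.
Qed.

Lemma cos_mult_sum (x y : R) : cos x * cos y = / 2 * (cos (x + y) + cos (x - y)).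
Proof. rewrite cos_plus, cos_minus. field. Qed.

Lemma cont_cos_lin (c p : R) : cont (fun t => cos (c * t / p)).
Proof. unfold Rdiv. ct. Qed.

Lemma sum_f_R0_first (u : nat -> R) (N : nat) : (forall j, (0 < j)%nat -> u j = 0) ->
  sum_f_R0 u N = u 0%nat.
Proof.
intros h. induction N as [|N IH]; [reflexivity|].
rewrite tech5, IH, (h (S N)) by apply Nat.lt_0_succ. ring.
Qed.

Section Fejer.

Variables (p s : R).
Hypothesis hp : 0 < p.
Hypothesis hs : s = 0 \/ s = / 2.

(** The indices are symmetric about [s - / 2], not about 0, whence the factor [cos ((s - / 2) * x)];
    it is 1 for half-integral indices. *)
Lemma dirichlet_kernel (x : R) (N : nat) :
  sin (x / 2) * bs (fun n => cos (n * x)) s N = cos ((s - / 2) * x) * sin ((INR N + 1) * x).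
Proof.
induction N as [|N IH].
- unfold bs. simpl. set (A := (s - / 2) * x).
  replace ((0 + s) * x) with (A + x / 2) by (unfold A; field).
  replace ((s - 1 - 0) * x) with (A - x / 2) by (unfold A; field).
  replace ((0 + 1) * x) with (2 * (x / 2)) by field.
  rewrite cos_plus, cos_minus, sin_2a. ring.
- unfold bs in *. rewrite tech5, Rmult_plus_distr_l, IH. rewrite S_INR.
  set (A := (s - / 2) * x). set (B := (INR N + 1 + / 2) * x).
  replace ((INR N + 1 + s) * x) with (A + B) by (unfold A, B; field).
  replace ((s - 1 - (INR N + 1)) * x) with (A - B) by (unfold A, B; field).
  replace ((INR N + 1) * x) with (B - x / 2) by (unfold B; field).
  replace ((INR N + 1 + 1) * x) with (B + x / 2) by (unfold B; field).
  rewrite cos_plus, cos_minus, sin_plus, sin_minus. ring.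
Qed.

(** A sum of sines in arithmetic progression, which a second factor [sin (x / 2)] telescopes. The
    product on the right can change sign, but only its modulus matters in [fejer_bound]. *)
Lemma fejer_kernel (x : R) (M : nat) :
  sin (x / 2) ^ 2 * sum_f_R0 (fun N => bs (fun n => cos (n * x)) s N) M =
  cos ((s - / 2) * x) * sin ((INR M + 1) * x / 2) * sin ((INR M + 2) * x / 2).
Proof.
assert (h : forall N, sin (x / 2) ^ 2 * bs (fun n => cos (n * x)) s N =
  cos ((s - / 2) * x) * (sin (x / 2) * sin ((INR N + 1) * x))).
{ intros N. replace (sin (x / 2) ^ 2 * bs (fun n => cos (n * x)) s N) with
    (sin (x / 2) * (sin (x / 2) * bs (fun n => cos (n * x)) s N)) by ring.
  rewrite dirichlet_kernel. ring. }
induction M as [|M IH].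
- simpl sum_f_R0. rewrite h. simpl INR.
  replace ((0 + 2) * x / 2) with ((0 + 1) * x) by field.
  replace ((0 + 1) * x / 2) with (x / 2) by field. ring.
- rewrite tech5, Rmult_plus_distr_l, IH, h, S_INR.
  set (u := (INR M + 2) * x / 2).
  replace ((INR M + 1) * x / 2) with (u - x / 2) by (unfold u; field).
  replace ((INR M + 1 + 1) * x / 2) with u by (unfold u; field).
  replace ((INR M + 1 + 2) * x / 2) with (u + x / 2) by (unfold u; field).
  replace ((INR M + 1 + 1) * x) with (2 * u) by (unfold u; field).
  rewrite sin_plus, sin_minus, sin_2a. ring.
Qed.

Lemma fejer_bound (x : R) (M : nat) :
  sin (x / 2) ^ 2 * Rabs (sum_f_R0 (fun N => bs (fun n => cos (n * x)) s N) M) <= 1.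
Proof.
rewrite <- (Rabs_pos_eq (sin (x / 2) ^ 2)) by apply pow2_ge_0.
rewrite <- Rabs_mult, fejer_kernel, !Rabs_mult.
assert (h : forall z, 0 <= Rabs (sin z) <= 1)
  by (intros z; split; [apply Rabs_pos|apply Rabs_le, SIN_bound]).
assert (h1 : 0 <= Rabs (cos ((s - / 2) * x)) <= 1)
  by (split; [apply Rabs_pos|apply Rabs_le, COS_bound]).
assert (h2 := h ((INR M + 1) * x / 2)). assert (h3 := h ((INR M + 2) * x / 2)).
set (A := Rabs (cos _)) in *. set (B := Rabs (sin _)) in *. set (D := Rabs (sin _)) in *.
assert (0 <= A * B <= 1) by nra. nra.
Qed.

(** The function [cos (2 pi s t / p)] has all its Fourier weight on the indices
    [n = s] and [n = - s], which lie in every partial sum. *)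
Lemma bs_coeff_cos (N : nat) :
  bs (fun n => RInt (fun t => cos (2 * PI * s * t / p) * cos (2 * PI * n * t / p))
    (- (p / 2)) (p / 2)) s N = p.
Proof.
assert (e : forall n, RInt (fun t => cos (2 * PI * s * t / p) * cos (2 * PI * n * t / p))
    (- (p / 2)) (p / 2) =
  / 2 * (RInt (fun t => cos (2 * PI * (s + n) * t / p)) (- (p / 2)) (p / 2) +
    RInt (fun t => cos (2 * PI * (s - n) * t / p)) (- (p / 2)) (p / 2))).
{ intros n. rewrite <- RInt_plusR by apply cont_cos_lin.
  rewrite <- RInt_scalR by (apply cont_plus; apply cont_cos_lin).
  apply RInt_extR. intros t. rewrite cos_mult_sum. do 2 f_equal; f_equal; unfold Rdiv; ring. }
assert (z : forall m : nat, (0 < m)%nat -> forall x, x = INR m \/ x = - INR m ->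
  RInt (fun t => cos (2 * PI * x * t / p)) (- (p / 2)) (p / 2) = 0).
{ intros m hm x hx. assert (h := lt_0_INR m hm). assert (h' := sin_PI_INR m).
  apply RInt_cos_period; [exact hp| |].
  - destruct hx; lra.
  - destruct hx as [-> | ->]; [exact h'|]. rewrite <- Ropp_mult_distr_r, sin_neg, h'. ring. }
unfold bs. rewrite sum_f_R0_first.
- rewrite !e. simpl INR. destruct hs as [-> | ->].
  + rewrite (z 1%nat Nat.lt_0_1 (0 + (0 - 1 - 0))) by (simpl; lra).
    rewrite (z 1%nat Nat.lt_0_1 (0 - (0 - 1 - 0))) by (simpl; lra).
    replace (0 - (0 + 0)) with 0 by ring. replace (0 + (0 + 0)) with 0 by ring.
    rewrite !RInt_cos_zero. field.
  + rewrite (z 1%nat Nat.lt_0_1 (/ 2 + (0 + / 2))) by (simpl; lra).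
    rewrite (z 1%nat Nat.lt_0_1 (/ 2 - (/ 2 - 1 - 0))) by (simpl; lra).
    replace (/ 2 - (0 + / 2)) with 0 by ring. replace (/ 2 + (/ 2 - 1 - 0)) with 0 by field.
    rewrite !RInt_cos_zero. field.
- intros j hj. rewrite !e.
  destruct hs as [-> | ->].
  + rewrite (z j hj (0 + (INR j + 0))), (z j hj (0 - (INR j + 0))) by lra.
    rewrite (z (S j) (Nat.lt_0_succ j) (0 + (0 - 1 - INR j))) by (rewrite S_INR; lra).
    rewrite (z (S j) (Nat.lt_0_succ j) (0 - (0 - 1 - INR j))) by (rewrite S_INR; lra). ring.
  + rewrite (z (S j) (Nat.lt_0_succ j) (/ 2 + (INR j + / 2))) by (rewrite S_INR; lra).
    rewrite (z j hj (/ 2 - (INR j + / 2))) by lra.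
    rewrite (z j hj (/ 2 + (/ 2 - 1 - INR j))) by lra.
    rewrite (z (S j) (Nat.lt_0_succ j) (/ 2 - (/ 2 - 1 - INR j))) by (rewrite S_INR; lra). ring.
Qed.

(** Fejer's theorem at a point where the second difference is quadratic: the
    averaged kernel is at most [1 / ((M + 1) sin^2)], so no positivity is needed. *)
Theorem fourier_pointwise (G : R -> R) (c l : R) : cont G ->
  (forall t, Rabs t <= p / 2 -> Rabs (G t - G 0) <= c * t ^ 2) ->
  is_lim_seq (bs (fun n => / p * RInt (fun t => G t * cos (2 * PI * n * t / p))
    (- (p / 2)) (p / 2)) s) l -> l = G 0.
Proof.
intros hG hc hl. assert (hpi := PI_RGT_0).
(* A constant is not a combination of half-integral frequencies. The function
   [cos (2 * PI * s * t / p)] is, it equals 1 at 0, and by [bs_coeff_cos] every partial sum gives it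
   the total weight [p]. Subtracting it makes [H] vanish to second order at 0. *)
set (H := fun t => G t - G 0 * cos (2 * PI * s * t / p)).
assert (hH : cont H) by (unfold H; apply cont_minus; [exact hG|];
  apply (cont_mult (fun _ => G 0)); [apply cont_const|apply cont_cos_lin]).
set (D := fun N t => bs (fun n => cos (2 * PI * n * t / p)) s N).
assert (hD : forall N, cont (D N)).
{ intros N. apply (cont_bs (fun n t => cos (2 * PI * n * t / p))). intros; apply cont_cos_lin. }
assert (hDe : forall N t, D N t = bs (fun n => cos (n * (2 * PI * t / p))) s N).
{ intros. apply bs_ext; intros; f_equal; unfold Rdiv; ring. }
assert (e1 : forall N, bs (fun n => / p * RInt (fun t => G t * cos (2 * PI * n * t / p))
    (- (p / 2)) (p / 2)) s N - G 0 = / p * RInt (fun t => H t * D N t) (- (p / 2)) (p / 2)).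
{ intros N. rewrite bs_scal.
  assert (e : forall x q, q = p -> / p * x - G 0 = / p * (x - G 0 * q))
    by (intros x q ->; field; lra).
  rewrite (e _ _ (bs_coeff_cos N)), <- bs_scal, <- bs_minus. f_equal.
  rewrite (RInt_extR _ (fun t => bs (fun n => H t * cos (2 * PI * n * t / p)) s N))
    by (intros t; unfold D; now rewrite bs_scal).
  rewrite (RInt_bs (fun n t => H t * cos (2 * PI * n * t / p))).
  2: { intros n. apply cont_mult; [exact hH|apply cont_cos_lin]. }
  apply bs_ext; intros j; unfold H;
  (rewrite <- RInt_scalR by (apply cont_mult; apply cont_cos_lin));
  (rewrite <- RInt_minusR; [apply RInt_extR; intros; ring| |]);
  repeat first [apply cont_cos_lin | exact hG | apply cont_const | apply cont_mult]. }
assert (e2 : forall M, sum_f_R0 (bs (fun n => / p *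
    RInt (fun t => G t * cos (2 * PI * n * t / p)) (- (p / 2)) (p / 2)) s) M / INR (S M) - G 0
  = / p * / INR (S M) * RInt (fun t => H t * sum_f_R0 (fun N => D N t) M) (- (p / 2)) (p / 2)).
{ intros M. assert (hM : 0 < INR (S M)) by apply lt_0_INR, Nat.lt_0_succ.
  set (u := bs _ s) in *.
  assert (e3 : sum_f_R0 u M - INR (S M) * G 0 =
    / p * RInt (fun t => H t * sum_f_R0 (fun N => D N t) M) (- (p / 2)) (p / 2)).
  { clear hM. induction M as [|M IH].
    - simpl. rewrite <- e1. ring.
    - rewrite tech5, S_INR.
      rewrite (RInt_extR _ (fun t => H t * sum_f_R0 (fun N => D N t) M + H t * D (S M) t))
        by (intros t; simpl; ring).
      rewrite RInt_plusR, Rmult_plus_distr_l, <- IH, <- e1; [ring| |].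
      + apply cont_mult; [exact hH|]. clear IH. induction M as [|M IH]; simpl; [apply hD|].
        now apply cont_plus.
      + now apply cont_mult. }
  replace (sum_f_R0 u M / INR (S M) - G 0) with
    (/ INR (S M) * (sum_f_R0 u M - INR (S M) * G 0)) by (field; lra).
  rewrite e3. ring. }
(* [Rmax c 0] keeps [B] nonnegative whatever the sign of [c]. *)
set (B := Rmax c 0 + Rabs (G 0) * (2 * PI * s / p) ^ 2).
assert (hHb : forall t, Rabs t <= p / 2 -> Rabs (H t) <= B * t ^ 2).
{ intros t ht. unfold H.
  replace (G t - G 0 * cos (2 * PI * s * t / p)) with
    ((G t - G 0) + G 0 * (1 - cos (2 * PI * s * t / p))) by ring.
  eapply Rle_trans; [apply Rabs_triang|]. rewrite Rabs_mult.
  assert (h1 := hc t ht). assert (h2 := one_minus_cos_bound (2 * PI * s * t / p)).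
  assert (h3 := Rabs_pos (G 0)). assert (h4 := Rmax_l c 0). assert (h5 := pow2_ge_0 t).
  assert (h6 := pow2_ge_0 (2 * PI * s / p)).
  replace ((2 * PI * s * t / p) ^ 2 / 2) with ((2 * PI * s / p) ^ 2 * t ^ 2 / 2) in h2
    by (field; lra).
  unfold B. set (q := (2 * PI * s / p) ^ 2) in *.
  assert (c * t ^ 2 <= Rmax c 0 * t ^ 2) by (apply Rmult_le_compat_r; lra).
  assert (Rabs (G 0) * Rabs (1 - cos (2 * PI * s * t / p)) <= Rabs (G 0) * (q * t ^ 2)).
  { apply Rmult_le_compat_l; [exact h3|]. assert (0 <= q * t ^ 2) by now apply Rmult_le_pos. lra. }
  lra. }
assert (hB : 0 <= B).
{ unfold B. assert (h4 := Rmax_r c 0). assert (h3 := Rabs_pos (G 0)).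
  assert (h6 := pow2_ge_0 (2 * PI * s / p)).
  assert (0 <= Rabs (G 0) * (2 * PI * s / p) ^ 2) by now apply Rmult_le_pos. lra. }
(* [t ^ 2] is at most [4 * p ^ 2 / PI ^ 2] times [sin (PI * t / p) ^ 2], and [fejer_bound] absorbs
   the latter. The integrand is thus bounded uniformly in [M], and division by [INR (S M)] sends the
   averaged integral to 0. *)
assert (hk : forall M t, Rabs t <= p / 2 ->
  Rabs (H t * sum_f_R0 (fun N => D N t) M) <= B * (4 * p ^ 2 / PI ^ 2)).
{ intros M t ht. rewrite Rabs_mult.
  rewrite (sum_eq _ (fun N => bs (fun n => cos (n * (2 * PI * t / p))) s N))
    by (intros; apply hDe).
  assert (h1 := fejer_bound (2 * PI * t / p) M).
  assert (h2 := hHb t ht).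
  replace (2 * PI * t / p / 2) with (PI * t / p) in h1 by (field; lra).
  assert (h3 := sin_sqr_ge (PI * t / p)).
  set (A := Rabs (sum_f_R0 _ M)) in *. set (q := sin (PI * t / p) ^ 2) in *.
  assert (hA : 0 <= A) by apply Rabs_pos.
  assert (h4 : t ^ 2 <= 4 * p ^ 2 / PI ^ 2 * q).
  { assert (h5 : Rabs (PI * t / p) <= PI / 2).
    { unfold Rdiv. rewrite !Rabs_mult, (Rabs_pos_eq PI), (Rabs_pos_eq (/ p));
        [|apply Rlt_le, Rinv_0_lt_compat; lra|lra].
      apply Rle_trans with (PI * (p / 2) * / p).
      - apply Rmult_le_compat_r; [apply Rlt_le, Rinv_0_lt_compat; lra|].
        apply Rmult_le_compat_l; lra.
      - right. field. lra. }
    specialize (h3 h5).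
    replace (t ^ 2) with (p ^ 2 / PI ^ 2 * (PI * t / p) ^ 2) by (field; lra).
    replace (4 * p ^ 2 / PI ^ 2 * q) with (p ^ 2 / PI ^ 2 * (4 * q)) by (field; lra).
    apply Rmult_le_compat_l; [|exact h3].
    apply Rlt_le, Rdiv_lt_0_compat; apply pow_lt; lra. }
  assert (h6 : 0 < 4 * p ^ 2 / PI ^ 2).
  { apply Rdiv_lt_0_compat; [|apply pow_lt; lra].
    assert (0 < p ^ 2) by (apply pow_lt; lra). lra. }
  set (w := 4 * p ^ 2 / PI ^ 2) in *.
  apply Rle_trans with (B * t ^ 2 * A); [now apply Rmult_le_compat_r|].
  apply Rle_trans with (B * (w * q) * A).
  - apply Rmult_le_compat_r; [exact hA|]. now apply Rmult_le_compat_l.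
  - replace (B * (w * q) * A) with (B * w * (q * A)) by ring.
    rewrite <- (Rmult_1_r (B * w)) at 2. apply Rmult_le_compat_l; [|exact h1].
    apply Rmult_le_pos; lra. }
assert (hz : is_lim_seq (fun M => sum_f_R0 (bs (fun n => / p *
    RInt (fun t => G t * cos (2 * PI * n * t / p)) (- (p / 2)) (p / 2)) s) M / INR (S M) - G 0) 0).
{ apply is_lim_seq_abs_0.
  apply (is_lim_seq_le_le (fun _ => 0) _ (fun M => B * (4 * p ^ 2 / PI ^ 2) * / INR (S M))).
  - intros M. split; [apply Rabs_pos|]. rewrite e2, Rabs_mult.
    assert (hM : 0 < / INR (S M)) by apply Rinv_0_lt_compat, lt_0_INR, Nat.lt_0_succ.
    assert (hip : 0 < / p) by now apply Rinv_0_lt_compat.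
    rewrite Rabs_pos_eq by (apply Rmult_le_pos; lra).
    assert (h1 : Rabs (RInt (fun t => H t * sum_f_R0 (fun N => D N t) M) (- (p / 2)) (p / 2))
      <= (p / 2 - - (p / 2)) * (B * (4 * p ^ 2 / PI ^ 2))).
    { apply RInt_bound_const; [lra| |].
      - apply cont_mult; [exact hH|]. induction M as [|M IH]; simpl; [apply hD|].
        apply cont_plus; [apply IH|apply hD]. apply Rinv_0_lt_compat, lt_0_INR, Nat.lt_0_succ.
      - intros t ht. apply hk, Rabs_le. lra. }
    replace (p / 2 - - (p / 2)) with p in h1 by field.
    apply Rle_trans with (/ p * / INR (S M) * (p * (B * (4 * p ^ 2 / PI ^ 2)))).
    + apply Rmult_le_compat_l; [apply Rmult_le_pos; lra|exact h1].
    + right. field. repeat split; try lra. apply not_0_INR; discriminate.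
  - apply is_lim_seq_const.
  - replace (Finite 0) with (Rbar_mult (B * (4 * p ^ 2 / PI ^ 2)) 0) by (simpl; f_equal; ring).
    apply is_lim_seq_scal_l.
    apply (is_lim_seq_incr_1 (fun n => / INR n)).
    replace (Finite 0) with (Rbar_inv p_infty) by reflexivity.
    apply is_lim_seq_inv; [apply is_lim_seq_INR|discriminate]. }
(* Averaging keeps the limit [l], so the averages have both limits. *)
assert (hz' := is_lim_seq_minus' _ _ _ _ (is_lim_seq_cesaro _ _ hl) (is_lim_seq_const (G 0))).
apply is_lim_seq_unique in hz, hz'. rewrite hz in hz'. inversion hz'. lra.
Qed.

End Fejer.

(** * Cauchy's theorem on rectangles *)

(** [hol S U V]: on the strip [|s| < S] the function [U x s + i V x s] of [x + i s] is
    complex differentiable with a continuous derivative [A + i B]. *)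
Definition hol (S : R) (U V : R -> R -> R) : Prop := exists A B : R -> R -> R,
  forall x s, Rabs s < S ->
  is_derive (fun x => U x s) x (A x s) /\ is_derive (fun x => V x s) x (B x s) /\
  is_derive (fun s => U x s) s (- B x s) /\ is_derive (fun s => V x s) s (A x s) /\
  continuity_2d_pt U x s /\ continuity_2d_pt V x s /\
  continuity_2d_pt A x s /\ continuity_2d_pt B x s.

Lemma continuity_2d_pt_swap (f : R -> R -> R) (x y : R) :
  continuity_2d_pt f x y -> continuity_2d_pt (fun b a => f a b) y x.
Proof.
intros h eps. destruct (h eps) as [d hd]. exists d. intros u v hu hv. now apply hd.
Qed.

Lemma continuity_2d_pt_continuous_1 (f : R -> R -> R) (x y : R) :
  continuity_2d_pt f x y -> continuous (fun u => f u y) x.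
Proof.
intros h. apply continuity_pt_filterlim. intros eps he.
destruct (h (mkposreal eps he)) as [d hd]. exists d. split; [apply cond_pos|].
intros u [_ hu]. apply hd; [exact hu|]. rewrite Rminus_diag, Rabs_R0. apply cond_pos.
Qed.

Lemma continuity_2d_pt_continuous_2 (f : R -> R -> R) (x y : R) :
  continuity_2d_pt f x y -> continuous (fun v => f x v) y.
Proof. intros h. apply (continuity_2d_pt_continuous_1 (fun b a => f a b)), continuity_2d_pt_swap, h. Qed.

Lemma strip_open (S s : R) : Rabs s < S -> locally s (fun t => Rabs t < S).
Proof.
intros h. assert (hd : 0 < S - Rabs s) by lra.
exists (mkposreal _ hd). intros t ht. change (Rabs (t - s) < S - Rabs s) in ht.
replace t with (s + (t - s)) by ring. eapply Rle_lt_trans; [apply Rabs_triang|]. lra.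
Qed.

Lemma strip_between (S s t : R) : Rabs s < S -> Rmin 0 s <= t <= Rmax 0 s -> Rabs t < S.
Proof.
intros hs ht. eapply Rle_lt_trans; [|exact hs].
unfold Rmin, Rmax in ht. destruct (Rle_dec 0 s).
- rewrite !Rabs_pos_eq; lra.
- rewrite !Rabs_left1; lra.
Qed.

(** Since [D] is both the x-derivative of [Z] and the t-derivative of [W], differentiating the
    horizontal integral of [W] in t leaves a boundary term of [Z]. The pairs ([U], [- V]) and ([V],
    [U]) yield the real and imaginary parts of Cauchy's theorem. *)
Lemma rectangle (S p q s : R) (W Z D : R -> R -> R) : p <= q -> Rabs s < S ->
  (forall x t, Rabs t < S -> is_derive (fun x => Z x t) x (D x t) /\
    is_derive (fun t => W x t) t (D x t) /\ continuity_2d_pt D x t /\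
    continuity_2d_pt W x t /\ continuity_2d_pt Z x t) ->
  RInt (fun x => W x s) p q - RInt (fun x => W x 0) p q = RInt (fun t => Z q t - Z p t) 0 s.
Proof.
intros hpq hs h. symmetry.
apply (is_RInt_unique (V := R_CompleteNormedModule)).
apply (is_RInt_derive (V := R_CompleteNormedModule) (fun t => RInt (fun x => W x t) p q)).
- intros t ht. assert (hts := strip_between S s t hs ht).
  assert (e : RInt (fun x => Derive (fun u => W x u) t) p q = Z q t - Z p t).
  { rewrite (RInt_extR _ (fun x => D x t)) by (intros x; apply is_derive_unique, (h x t hts)).
    apply (is_RInt_unique (V := R_CompleteNormedModule)).
    apply (is_RInt_derive (V := R_CompleteNormedModule) (fun x => Z x t)).
    - intros x _. apply (h x t hts).
    - intros x _. apply continuity_2d_pt_continuous_1, (h x t hts). }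
  rewrite <- e.
  apply (is_derive_RInt_param (fun t x => W x t)).
  + apply (filter_imp (fun t => Rabs t < S)); [|now apply strip_open].
    intros u hu x _. eexists. apply (h x u hu).
  + intros x _. apply (continuity_2d_pt_ext_loc (fun u v => D v u)).
    * destruct (strip_open S t hts) as [d hd]. exists d. intros u v hu _.
      symmetry. apply is_derive_unique, (h v u). apply hd, hu.
    * apply continuity_2d_pt_swap, (h x t hts).
  + apply (filter_imp (fun t => Rabs t < S)); [|now apply strip_open].
    intros u hu. apply (ex_RInt_continuous (V := R_CompleteNormedModule)).
    intros x _. apply (continuity_2d_pt_continuous_1 W), (h x u hu).
- intros t ht. assert (hts := strip_between S s t hs ht).
  apply (continuous_minus (fun t => Z q t) (fun t => Z p t));
    apply continuity_2d_pt_continuous_2, (h _ t hts).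
Qed.

Lemma hol_rectangle (S p q s : R) (U V : R -> R -> R) : hol S U V -> p <= q -> Rabs s < S ->
  RInt (fun x => U x s) p q - RInt (fun x => U x 0) p q = RInt (fun t => V p t - V q t) 0 s /\
  RInt (fun x => V x s) p q - RInt (fun x => V x 0) p q = RInt (fun t => U q t - U p t) 0 s.
Proof.
intros [A [B h]] hpq hs. split.
- rewrite (RInt_extR (fun t => V p t - V q t) (fun t => - V q t - - V p t)) by (intros; ring).
  apply (rectangle S p q s U (fun x t => - V x t) (fun x t => - B x t) hpq hs).
  intros x t ht. destruct (h x t ht) as (h1 & h2 & h3 & h4 & h5 & h6 & h7 & h8).
  repeat match goal with |- _ /\ _ => split end;
    [|exact h3|now apply continuity_2d_pt_opp|exact h5|now apply continuity_2d_pt_opp].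
  apply (is_derive_opp (fun x => V x t) x _ h2).
- apply (rectangle S p q s V U A hpq hs).
  intros x t ht. destruct (h x t ht) as (h1 & h2 & h3 & h4 & h5 & h6 & h7 & h8).
  repeat match goal with |- _ /\ _ => split end; assumption.
Qed.

Lemma hol_periodic (S p q s : R) (U V : R -> R -> R) : hol S U V -> p <= q -> Rabs s < S ->
  (forall t, Rabs t < S -> U q t = U p t) -> (forall t, Rabs t < S -> V q t = V p t) ->
  RInt (fun x => U x s) p q = RInt (fun x => U x 0) p q /\
  RInt (fun x => V x s) p q = RInt (fun x => V x 0) p q.
Proof.
intros h hpq hs hU hV.
destruct (hol_rectangle S p q s U V h hpq hs) as [h1 h2].
assert (z : forall F : R -> R, (forall t, Rabs t < S -> F t = 0) -> RInt F 0 s = 0 :> R).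
{ intros F hF. rewrite (RInt_ext (V := R_CompleteNormedModule) F (fun _ => 0)).
  - rewrite RInt_constR. ring.
  - intros t ht. apply hF. apply (strip_between S s t hs). lra. }
rewrite z in h1 by (intros t ht; rewrite hV by exact ht; ring).
rewrite z in h2 by (intros t ht; rewrite hU by exact ht; ring).
split; lra.
Qed.

Lemma hol_mult (S : R) (U1 V1 U2 V2 : R -> R -> R) : hol S U1 V1 -> hol S U2 V2 ->
  hol S (fun x s => U1 x s * U2 x s - V1 x s * V2 x s)
    (fun x s => U1 x s * V2 x s + V1 x s * U2 x s).
Proof.
intros [A1 [B1 h1]] [A2 [B2 h2]].
exists (fun x s => (A1 x s * U2 x s - B1 x s * V2 x s) + (U1 x s * A2 x s - V1 x s * B2 x s)),
  (fun x s => (A1 x s * V2 x s + B1 x s * U2 x s) + (U1 x s * B2 x s + V1 x s * A2 x s)).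
intros x s hs.
destruct (h1 x s hs) as (a1 & a2 & a3 & a4 & a5 & a6 & a7 & a8).
destruct (h2 x s hs) as (b1 & b2 & b3 & b4 & b5 & b6 & b7 & b8).
assert (hm : forall (f1 g1 f2 g2 : R -> R) (t d1 e1 d2 e2 l : R),
  is_derive f1 t d1 -> is_derive g1 t e1 -> is_derive f2 t d2 -> is_derive g2 t e2 ->
  l = (d1 * g1 t + f1 t * e1) - (d2 * g2 t + f2 t * e2) ->
  is_derive (fun t => f1 t * g1 t - f2 t * g2 t) t l).
{ intros f1 g1 f2 g2 t d1 e1 d2 e2 l i1 j1 i2 j2 ->.
  apply (is_derive_minus (fun t => f1 t * g1 t) (fun t => f2 t * g2 t));
    eapply is_derive_Rmult; eauto. }
assert (hp : forall (f1 g1 f2 g2 : R -> R) (t d1 e1 d2 e2 l : R),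
  is_derive f1 t d1 -> is_derive g1 t e1 -> is_derive f2 t d2 -> is_derive g2 t e2 ->
  l = (d1 * g1 t + f1 t * e1) + (d2 * g2 t + f2 t * e2) ->
  is_derive (fun t => f1 t * g1 t + f2 t * g2 t) t l).
{ intros f1 g1 f2 g2 t d1 e1 d2 e2 l i1 j1 i2 j2 ->.
  apply (is_derive_plus (fun t => f1 t * g1 t) (fun t => f2 t * g2 t));
    eapply is_derive_Rmult; eauto. }
repeat match goal with |- _ /\ _ => split end.
- eapply hm; [exact a1|exact b1|exact a2|exact b2|]. ring.
- eapply hp; [exact a1|exact b2|exact a2|exact b1|]. ring.
- eapply hm; [exact a3|exact b3|exact a4|exact b4|]. ring.
- eapply hp; [exact a3|exact b4|exact a4|exact b3|]. ring.
- apply continuity_2d_pt_minus; now apply continuity_2d_pt_mult.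
- apply continuity_2d_pt_plus; now apply continuity_2d_pt_mult.
- apply continuity_2d_pt_plus; apply continuity_2d_pt_minus; now apply continuity_2d_pt_mult.
- apply continuity_2d_pt_plus; apply continuity_2d_pt_plus; now apply continuity_2d_pt_mult.
Qed.

Lemma hol_inv (S : R) (U V : R -> R -> R) : hol S U V ->
  (forall x s, Rabs s < S -> U x s ^ 2 + V x s ^ 2 <> 0) ->
  hol S (fun x s => U x s / (U x s ^ 2 + V x s ^ 2)) (fun x s => - V x s / (U x s ^ 2 + V x s ^ 2)).
Proof.
intros [A [B h]] h0.
set (n := fun x s => U x s ^ 2 + V x s ^ 2).
(* [- (A + i B) / (U + i V)^2] *)
exists (fun x s => - (A x s * (U x s ^ 2 - V x s ^ 2) + 2 * B x s * U x s * V x s) * / (n x s * n x s)),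
  (fun x s => - (B x s * (U x s ^ 2 - V x s ^ 2) - 2 * A x s * U x s * V x s) * / (n x s * n x s)).
intros x s hs.
destruct (h x s hs) as (a1 & a2 & a3 & a4 & a5 & a6 & a7 & a8).
assert (hn := h0 x s hs).
assert (hq : forall (f u v : R -> R) (t df du dv l : R),
  is_derive f t df -> is_derive u t du -> is_derive v t dv -> u t ^ 2 + v t ^ 2 <> 0 ->
  l = (df * (u t ^ 2 + v t ^ 2) - f t * (2 * u t * du + 2 * v t * dv)) / (u t ^ 2 + v t ^ 2) ^ 2 ->
  is_derive (fun t => f t / (u t ^ 2 + v t ^ 2)) t l).
{ intros f u v t df du dv l hf hu hv hne ->.
  assert (hd : is_derive (fun t => u t ^ 2 + v t ^ 2) t (2 * u t * du + 2 * v t * dv)).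
  { auto_derive; [split; [eexists; exact hu|split; [eexists; exact hv|easy]]|].
    change (Derive (fun x => u x) t) with (Derive u t).
    change (Derive (fun x => v x) t) with (Derive v t).
    rewrite (is_derive_unique u t _ hu), (is_derive_unique v t _ hv). ring. }
  assert (hr := is_derive_div f (fun t => u t ^ 2 + v t ^ 2) t _ _ hf hd hne).
  exact hr. }
assert (hV : forall t l, is_derive (fun x => V x s) t l -> is_derive (fun x => - V x s) t (- l))
  by (intros; now apply (is_derive_opp (fun x => V x s))).
assert (hV' : forall t l, is_derive (fun s => V x s) t l -> is_derive (fun s => - V x s) t (- l))
  by (intros; now apply (is_derive_opp (fun s => V x s))).
assert (cn : continuity_2d_pt n x s).
{ unfold n. apply continuity_2d_pt_plus.
  - apply (continuity_2d_pt_ext (fun x s => U x s * U x s)); [intros; simpl; ring|].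
    now apply continuity_2d_pt_mult.
  - apply (continuity_2d_pt_ext (fun x s => V x s * V x s)); [intros; simpl; ring|].
    now apply continuity_2d_pt_mult. }
assert (cs2 : continuity_2d_pt (fun x s => U x s ^ 2 - V x s ^ 2) x s).
{ apply continuity_2d_pt_minus.
  - apply (continuity_2d_pt_ext (fun x s => U x s * U x s)); [intros; simpl; ring|].
    now apply continuity_2d_pt_mult.
  - apply (continuity_2d_pt_ext (fun x s => V x s * V x s)); [intros; simpl; ring|].
    now apply continuity_2d_pt_mult. }
assert (ci : continuity_2d_pt (fun x s => / n x s) x s)
  by (apply continuity_2d_pt_inv; assumption).
assert (cii : continuity_2d_pt (fun x s => / (n x s * n x s)) x s).
{ apply continuity_2d_pt_inv; [now apply continuity_2d_pt_mult|].
  now apply Rmult_integral_contrapositive. }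
repeat match goal with |- _ /\ _ => split end.
- eapply (hq (fun x => U x s) (fun x => U x s) (fun x => V x s));
    [exact a1|exact a1|exact a2|exact hn|]. unfold n. field. exact hn.
- eapply (hq (fun x => - V x s) (fun x => U x s) (fun x => V x s));
    [apply hV; exact a2|exact a1|exact a2|exact hn|]. unfold n. field. exact hn.
- eapply (hq (fun s => U x s) (fun s => U x s) (fun s => V x s));
    [exact a3|exact a3|exact a4|exact hn|]. unfold n. field. exact hn.
- eapply (hq (fun s => - V x s) (fun s => U x s) (fun s => V x s));
    [apply hV'; exact a4|exact a3|exact a4|exact hn|]. unfold n. field. exact hn.
- now apply continuity_2d_pt_mult.
- apply continuity_2d_pt_mult; [now apply continuity_2d_pt_opp|exact ci].
- apply continuity_2d_pt_mult; [|exact cii]. apply continuity_2d_pt_opp, continuity_2d_pt_plus.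
  + now apply continuity_2d_pt_mult.
  + apply continuity_2d_pt_mult; [|exact a6]. apply continuity_2d_pt_mult; [|exact a5].
    apply continuity_2d_pt_mult; [apply continuity_2d_pt_const|exact a8].
- apply continuity_2d_pt_mult; [|exact cii]. apply continuity_2d_pt_opp, continuity_2d_pt_minus.
  + now apply continuity_2d_pt_mult.
  + apply continuity_2d_pt_mult; [|exact a6]. apply continuity_2d_pt_mult; [|exact a5].
    apply continuity_2d_pt_mult; [apply continuity_2d_pt_const|exact a7].
Qed.

Lemma continuity_2d_pt_prod (f g : R -> R) (x y : R) : cont f -> cont g ->
  continuity_2d_pt (fun u v => f u * g v) x y.
Proof.
intros hf hg. apply continuity_2d_pt_mult.
- apply (continuity_1d_2d_pt_comp f (fun u _ => u)); [now apply cont_continuity_pt|].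
  apply continuity_2d_pt_id1.
- apply (continuity_1d_2d_pt_comp g (fun _ v => v)); [now apply cont_continuity_pt|].
  apply continuity_2d_pt_id2.
Qed.

Lemma hol_cosh (S : R) : hol S (fun x s => cosh (PI * x) * cos (PI * s))
  (fun x s => sinh (PI * x) * sin (PI * s)).
Proof.
exists (fun x s => (PI * sinh (PI * x)) * cos (PI * s)),
  (fun x s => (PI * cosh (PI * x)) * sin (PI * s)).
intros x s _.
assert (hc : forall t, is_derive (fun t => cosh (PI * t)) t (PI * sinh (PI * t))).
{ intros t. evar_last; [apply (is_derive_comp cosh (fun t => PI * t));
    [apply is_derive_cosh|auto_derive; [easy|reflexivity]]|].
  unfold scal; simpl; unfold mult; simpl. ring. }
assert (hs : forall t, is_derive (fun t => sinh (PI * t)) t (PI * cosh (PI * t))).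
{ intros t. evar_last; [apply (is_derive_comp sinh (fun t => PI * t));
    [apply is_derive_sinh|auto_derive; [easy|reflexivity]]|].
  unfold scal; simpl; unfold mult; simpl. ring. }
assert (hm : forall (f : R -> R) c t l m, is_derive f t l -> m = l * c ->
  is_derive (fun t => f t * c) t m).
{ intros f c t l m hf ->. evar_last; [apply (is_derive_scal_l f t l c hf)|]. reflexivity. }
assert (hm' : forall (f : R -> R) c t l m, is_derive f t l -> m = c * l ->
  is_derive (fun t => c * f t) t m).
{ intros f c t l m hf ->. apply (is_derive_scal f t c l hf). }
repeat match goal with |- _ /\ _ => split end.
- eapply (hm (fun x => cosh (PI * x))); [apply hc|ring].
- eapply (hm (fun x => sinh (PI * x))); [apply hs|ring].
- eapply (hm' (fun s => cos (PI * s))); [auto_derive; [easy|reflexivity]|ring].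
- eapply (hm' (fun s => sin (PI * s))); [auto_derive; [easy|reflexivity]|ring].
- apply (continuity_2d_pt_prod (fun x => cosh (PI * x)) (fun s => cos (PI * s))); ct.
- apply (continuity_2d_pt_prod (fun x => sinh (PI * x)) (fun s => sin (PI * s))); ct.
- apply (continuity_2d_pt_prod (fun x => PI * sinh (PI * x)) (fun s => cos (PI * s))); ct.
- apply (continuity_2d_pt_prod (fun x => PI * cosh (PI * x)) (fun s => sin (PI * s))); ct.
Qed.

Lemma hol_exp (S l : R) : hol S (fun x s => cos (2 * PI * l * x) * exp (- (2 * PI * l * s)))
  (fun x s => sin (2 * PI * l * x) * exp (- (2 * PI * l * s))).
Proof.
set (w := 2 * PI * l).
exists (fun x s => (- (w * sin (w * x))) * exp (- (w * s))),
  (fun x s => (w * cos (w * x)) * exp (- (w * s))).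
intros x s _.
repeat match goal with |- _ /\ _ => split end.
- auto_derive; [easy|ring].
- auto_derive; [easy|ring].
- auto_derive; [easy|ring].
- auto_derive; [easy|ring].
- apply (continuity_2d_pt_prod (fun x => cos (w * x)) (fun s => exp (- (w * s)))); ct.
- apply (continuity_2d_pt_prod (fun x => sin (w * x)) (fun s => exp (- (w * s)))); ct.
- apply (continuity_2d_pt_prod (fun x => - (w * sin (w * x))) (fun s => exp (- (w * s)))); ct.
- apply (continuity_2d_pt_prod (fun x => w * cos (w * x)) (fun s => exp (- (w * s)))); ct.
Qed.

(** * From complex derivatives to pairs of real functions *)

Lemma differentiable_C (f : C -> C) (z l : C) :
  is_derive (K := C_AbsRing) (V := C_NormedModule) f z l ->
  differentiable_pt_lim (fun x y => Re (f (x, y))) (Re z) (Im z) (Re l) (- Im l) /\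
  differentiable_pt_lim (fun x y => Im (f (x, y))) (Re z) (Im z) (Im l) (Re l).
Proof.
intros [_ H].
specialize (H z (fun P hP => hP)).
(* [Cmod] is at most twice the max norm of the coordinates; this accounts for [eps / 2] and
   [d / 2]. *)
assert (K : forall eps : posreal, exists d : posreal, forall u v,
  Rabs (u - Re z) < d -> Rabs (v - Im z) < d ->
  Cmod (f (u, v) - f z - ((u, v) - z) * l)%C <= eps * Rmax (Rabs (u - Re z)) (Rabs (v - Im z))).
{ intros eps. assert (he : 0 < eps / 2) by (assert (h := cond_pos eps); lra).
  destruct (H (mkposreal _ he)) as [d hd].
  assert (hd2 : 0 < d / 2) by (assert (h := cond_pos d); lra).
  exists (mkposreal _ hd2). intros u v hu hv. simpl in hu, hv.
  assert (hs : sqrt 2 <= 2).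
  { assert (h := Rsqr_sqrt 2 ltac:(lra)). unfold Rsqr in h. nra. }
  assert (hm : Cmod ((u, v) - z)%C <= 2 * Rmax (Rabs (u - Re z)) (Rabs (v - Im z))).
  { eapply Rle_trans; [apply Cmod_2Rmax|].
    change (fst ((u, v) - z)%C) with (u - Re z). change (snd ((u, v) - z)%C) with (v - Im z).
    apply Rmult_le_compat_r; [|exact hs]. eapply Rle_trans; [apply Rabs_pos|apply Rmax_l]. }
  assert (hb : Rmax (Rabs (u - Re z)) (Rabs (v - Im z)) < d / 2) by now apply Rmax_lub_lt.
  assert (hq : Cmod (f (u, v) - f z - ((u, v) - z) * l)%C <= eps / 2 * Cmod ((u, v) - z)%C).
  { apply (hd (u, v)). change (Cmod ((u, v) - z)%C < d). lra. }
  eapply Rle_trans; [exact hq|].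
  apply Rle_trans with (eps / 2 * (2 * Rmax (Rabs (u - Re z)) (Rabs (v - Im z)))).
  - apply Rmult_le_compat_l; [lra|exact hm].
  - right. field. }
split; intros eps; destruct (K eps) as [d hd]; exists d; intros u v hu hv;
  (eapply Rle_trans; [|apply (hd u v hu hv)]).
- eapply Rle_trans; [|apply Rmax_Cmod]. eapply Rle_trans; [|apply Rmax_l]. right. f_equal.
  destruct z as [x y], l as [a b]. unfold Re, Im. simpl. ring.
- eapply Rle_trans; [|apply Rmax_Cmod]. eapply Rle_trans; [|apply Rmax_r]. right. f_equal.
  destruct z as [x y], l as [a b]. unfold Re, Im. simpl. ring.
Qed.

Lemma differentiable_pt_lim_partial (f : R -> R -> R) (x y a b : R) :
  differentiable_pt_lim f x y a b ->
  is_derive (fun u => f u y) x a /\ is_derive (fun v => f x v) y b /\ continuity_2d_pt f x y.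
Proof.
intros h. split; [|split].
- apply is_derive_Reals. replace a with (a * 1 + b * 0) by ring.
  apply (derivable_pt_lim_comp_2d f (fun u => u) (fun _ => y) x a b 1 0 h).
  + apply derivable_pt_lim_id.
  + apply derivable_pt_lim_const.
- apply is_derive_Reals. replace b with (a * 0 + b * 1) by ring.
  apply (derivable_pt_lim_comp_2d f (fun _ => x) (fun v => v) y a b 0 1 h).
  + apply derivable_pt_lim_const.
  + apply derivable_pt_lim_id.
- apply differentiable_continuity_pt. now exists a, b.
Qed.

Lemma continuity_2d_pt_scale (f : R -> R -> R) (c x y : R) :
  continuity_2d_pt f (c * x) (c * y) -> continuity_2d_pt (fun u v => f (c * u) (c * v)) x y.
Proof.
intros h eps. destruct (h eps) as [d hd].
assert (hp : 0 < d / (Rabs c + 1)).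
{ apply Rdiv_lt_0_compat; [apply cond_pos|]. assert (h1 := Rabs_pos c). lra. }
exists (mkposreal _ hp). intros u v hu hv. simpl in hu, hv.
assert (k : forall t, Rabs t < d / (Rabs c + 1) -> Rabs (c * t) < d).
{ intros t ht. assert (h1 := Rabs_pos c). assert (h2 := Rabs_pos t). rewrite Rabs_mult.
  apply (Rmult_lt_compat_l (Rabs c + 1)) in ht; [|lra].
  replace ((Rabs c + 1) * (d / (Rabs c + 1))) with (pos d) in ht by (field; lra). nra. }
apply hd; rewrite <- Rmult_minus_distr_l; now apply k.
Qed.

(** The factor [c] will be [2 * K'], which brings the poles of the Jacobi functions to height 1/2,
    where those of sech (pi z) are. *)
Lemma hol_of_C (S c : R) (f f' : C -> C) :
  (forall z, Rabs (Im z) < c * S ->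
    is_derive (K := C_AbsRing) (V := C_NormedModule) f z (f' z) /\
    continuity_2d_pt (fun x y => Re (f' (x, y))) (Re z) (Im z) /\
    continuity_2d_pt (fun x y => Im (f' (x, y))) (Re z) (Im z)) -> 0 < c ->
  hol S (fun x s => Re (f (c * x, c * s))) (fun x s => Im (f (c * x, c * s))).
Proof.
intros h hc.
exists (fun x s => c * Re (f' (c * x, c * s))), (fun x s => c * Im (f' (c * x, c * s))).
intros x s hs.
destruct (h (c * x, c * s)) as (h1 & h2 & h3).
{ simpl. rewrite Rabs_mult, (Rabs_pos_eq c) by lra. now apply Rmult_lt_compat_l. }
simpl in h2, h3.
destruct (differentiable_C f _ _ h1) as [d1 d2]. simpl (Re (_, _)) in d1, d2.
simpl (Im (_, _)) in d1, d2.
apply differentiable_pt_lim_partial in d1, d2.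
destruct d1 as (d1 & d3 & d5), d2 as (d2 & d4 & d6).
assert (k : forall (g : R -> R) t l m, is_derive g (c * t) l -> m = c * l ->
  is_derive (fun t => g (c * t)) t m).
{ intros g t l m hg ->. evar_last.
  - apply (is_derive_comp g (fun t => c * t) t _ c hg). auto_derive; [easy|ring].
  - reflexivity. }
repeat match goal with |- _ /\ _ => split end.
- eapply (k (fun u => Re (f (u, c * s)))); [exact d1|reflexivity].
- eapply (k (fun u => Im (f (u, c * s)))); [exact d2|reflexivity].
- eapply (k (fun u => Re (f (c * x, u)))); [exact d3|ring].
- eapply (k (fun u => Im (f (c * x, u)))); [exact d4|reflexivity].
- now apply (continuity_2d_pt_scale (fun u v => Re (f (u, v)))).
- now apply (continuity_2d_pt_scale (fun u v => Im (f (u, v)))).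
- apply continuity_2d_pt_mult; [apply continuity_2d_pt_const|].
  now apply (continuity_2d_pt_scale (fun u v => Re (f' (u, v)))).
- apply continuity_2d_pt_mult; [apply continuity_2d_pt_const|].
  now apply (continuity_2d_pt_scale (fun u v => Im (f' (u, v)))).
Qed.

(** The derivatives of sn, cn and dn are, up to constants, products of two of these functions, so
    differentiability of the factors provides the continuous derivative that [hol_of_C] asks for. *)
Lemma continuity_2d_pt_Cmult (f g : C -> C) (z f' g' : C) :
  is_derive (K := C_AbsRing) (V := C_NormedModule) f z f' ->
  is_derive (K := C_AbsRing) (V := C_NormedModule) g z g' ->
  continuity_2d_pt (fun x y => Re (f (x, y) * g (x, y))%C) (Re z) (Im z) /\
  continuity_2d_pt (fun x y => Im (f (x, y) * g (x, y))%C) (Re z) (Im z).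
Proof.
intros hf hg. apply differentiable_C in hf, hg. destruct hf as [h1 h2], hg as [h3 h4].
apply differentiable_pt_lim_partial in h1, h2, h3, h4.
split.
- apply (continuity_2d_pt_ext (fun x y => Re (f (x, y)) * Re (g (x, y)) - Im (f (x, y)) * Im (g (x, y)))).
  + intros u v. unfold Re, Im. reflexivity.
  + apply continuity_2d_pt_minus; apply continuity_2d_pt_mult; tauto.
- apply (continuity_2d_pt_ext (fun x y => Re (f (x, y)) * Im (g (x, y)) + Im (f (x, y)) * Re (g (x, y)))).
  + intros u v. unfold Re, Im. reflexivity.
  + apply continuity_2d_pt_plus; apply continuity_2d_pt_mult; tauto.
Qed.

(** * Integrals over the line *)

Definition line (f : R -> R) : R := RInt_gen f (Rbar_locally m_infty) (Rbar_locally p_infty).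

(** The majorant is a multiple of sech (pi x) because this function has an elementary primitive and
    total mass 1: a pointwise bound passes to [line f] with the same constant. *)
Definition dom (f : R -> R) : Prop :=
  cont f /\ exists C, forall x, Rabs (f x) <= C / cosh (PI * x).

Lemma sech_pos (x : R) : 0 < / cosh x.
Proof. apply Rinv_0_lt_compat, cosh_pos. Qed.

Lemma cont_sech : cont (fun x => / cosh (PI * x)).
Proof. ct. intros x. apply Rgt_not_eq, cosh_pos. Qed.

(** The primitive is a rescaled Gudermannian function, with values in (-1/2, 1/2). *)
Lemma is_derive_gd (x : R) :
  is_derive (fun x => / PI * atan (sinh (PI * x))) x (/ cosh (PI * x)).
Proof.
assert (hpi := PI_RGT_0). assert (hc := cosh_pos (PI * x)).
assert (hs := cosh_sinh_sqr (PI * x)).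
evar_last.
- apply (is_derive_scal (fun x => atan (sinh (PI * x)))).
  apply (is_derive_comp atan (fun x => sinh (PI * x))).
  + apply is_derive_atan.
  + apply (is_derive_comp sinh (fun x => PI * x)); [apply is_derive_sinh|].
    auto_derive; [easy|reflexivity].
- unfold scal; simpl; unfold mult; simpl.
  replace (1 + Rsqr (sinh (PI * x))) with (cosh (PI * x) ^ 2) by (rewrite hs; unfold Rsqr; ring).
  field. split; lra.
Qed.

Lemma RInt_sech (a b : R) : RInt (fun x => / cosh (PI * x)) a b =
  / PI * atan (sinh (PI * b)) - / PI * atan (sinh (PI * a)) :> R.
Proof. apply (RInt_FTC _ _ a b is_derive_gd cont_sech). Qed.

Lemma gd_bound (x : R) : Rabs (/ PI * atan (sinh (PI * x))) < / 2.
Proof.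
assert (h := atan_bound (sinh (PI * x))).
rewrite Rabs_mult, Rabs_pos_eq by (apply Rlt_le, Rinv_0_lt_compat; lra).
apply (Rmult_lt_reg_l PI); [lra|].
replace (PI * (/ PI * Rabs (atan (sinh (PI * x))))) with (Rabs (atan (sinh (PI * x))))
  by (field; lra).
apply Rabs_def1; lra.
Qed.

Lemma sinh_ge (x : R) : 0 <= x -> x <= sinh x.
Proof.
intros hx. destruct (MVT_gen sinh 0 x cosh) as [c [_ h]].
- intros; apply is_derive_sinh.
- intros; apply cont_continuity_pt, cont_sinh.
- replace (sinh 0) with 0 in h by (unfold sinh; rewrite Ropp_0; field).
  assert (hc := cosh_ge_1 c). rewrite !Rminus_0_r in h. rewrite h. nra.
Qed.

Lemma sinh_sqr_ge (x : R) : x ^ 2 <= sinh x ^ 2.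
Proof.
destruct (Rle_or_lt 0 x) as [h|h].
- assert (h1 := sinh_ge x h). nra.
- assert (h1 := sinh_ge (- x) ltac:(lra)). rewrite sinh_neg in h1. nra.
Qed.

Lemma gd_tail (eps : R) : 0 < eps -> exists M, 0 < M /\ forall x, M < x ->
  / 2 - eps < / PI * atan (sinh (PI * x)) /\ / PI * atan (sinh (PI * - x)) < - / 2 + eps.
Proof.
intros he. assert (hpi2 := PI2_1).
(* The cap 1/4 keeps [PI / 2 - PI * d] in the range where [atan_tan] applies. *)
set (d := Rmin eps (/ 4)).
assert (hd : 0 < d <= / 4).
{ unfold d. split; [apply Rmin_glb_lt; lra|apply Rmin_r]. }
assert (hde : d <= eps) by apply Rmin_l.
set (M := Rmax (tan (PI / 2 - PI * d)) 1).
exists M. assert (hM := Rmax_r (tan (PI / 2 - PI * d)) 1). fold M in hM.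
split; [lra|]. intros x hx.
assert (h1 : / 2 - eps < / PI * atan (sinh (PI * x))).
{ assert (ht : tan (PI / 2 - PI * d) < sinh (PI * x)).
  { assert (h := Rmax_l (tan (PI / 2 - PI * d)) 1). fold M in h.
    assert (h' := sinh_ge (PI * x) ltac:(nra)). nra. }
  apply atan_increasing in ht. rewrite atan_tan in ht by nra.
  apply (Rmult_lt_compat_l (/ PI)) in ht; [|apply Rinv_0_lt_compat; lra].
  replace (/ PI * (PI / 2 - PI * d)) with (/ 2 - d) in ht by (field; lra). lra. }
split; [exact h1|].
rewrite <- Ropp_mult_distr_r, sinh_neg, atan_opp. lra.
Qed.

Lemma RInt_dom (f : R -> R) (C a b : R) : cont f ->
  (forall x, Rabs (f x) <= C / cosh (PI * x)) -> a <= b ->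
  Rabs (RInt f a b) <= C * (/ PI * atan (sinh (PI * b)) - / PI * atan (sinh (PI * a))).
Proof.
intros hf h hab. rewrite <- RInt_sech.
change (Rabs (RInt f a b) <= C * RInt (fun x => / cosh (PI * x)) a b).
rewrite <- RInt_scalR by apply cont_sech.
apply RInt_bound; [exact hab|exact hf| |intros; apply h].
apply (cont_mult (fun _ => C)); [apply cont_const|apply cont_sech].
Qed.

Lemma dom_nonneg (f : R -> R) (C : R) :
  (forall x, Rabs (f x) <= C / cosh (PI * x)) -> 0 <= C.
Proof.
intros h. specialize (h 0). assert (h1 := Rabs_pos (f 0)).
assert (h2 := sech_pos (PI * 0)). unfold Rdiv in h. nra.
Qed.

(** Cauchy's criterion: moving an end point beyond [M] changes the integral by at most [C] times a
    small variation of the Gudermannian. *)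
Lemma line_exists (f : R -> R) : dom f -> exists l, filterlim
  (fun ab => RInt f (fst ab) (snd ab))
  (filter_prod (Rbar_locally m_infty) (Rbar_locally p_infty)) (locally (T := R_UniformSpace) l).
Proof.
intros [hf [C h]].
apply (filterlim_locally_cauchy (U := R_CompleteNormedModule)).
intros eps. assert (hC := dom_nonneg f C h).
(* Each of the two ends will contribute at most [C * (2 * e)]; [C + 1] guards against [C = 0]. *)
destruct (gd_tail (eps / (4 * (C + 1)))) as [M [hM hg]].
{ apply Rdiv_lt_0_compat; [apply cond_pos|lra]. }
set (w := fun x => / PI * atan (sinh (PI * x))) in *.
exists (fun ab => fst ab < - M /\ M < snd ab). split.
{ exists (fun a => a < - M) (fun b => M < b).
  - exists (- M). now intros.
  - exists M. now intros.
  - intros a b ha hb. now split. }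
assert (hI : forall a b : R, Rabs (RInt f a b) <= C * Rabs (w b - w a)).
{ intros a b. destruct (Rle_or_lt a b) as [hab|hab].
  - eapply Rle_trans; [apply (RInt_dom f C a b hf h hab)|].
    apply Rmult_le_compat_l; [exact hC|]. apply Rle_abs.
  - rewrite RInt_swap_bounds by exact hf. rewrite Rabs_Ropp, Rabs_minus_sym.
    eapply Rle_trans; [apply (RInt_dom f C b a hf h ltac:(lra))|].
    apply Rmult_le_compat_l; [exact hC|]. apply Rle_abs. }
set (e := eps / (4 * (C + 1))) in *.
assert (he : C * (4 * e) < eps).
{ unfold e. assert (hp := cond_pos eps).
  replace (C * (4 * (eps / (4 * (C + 1))))) with (eps * (C / (C + 1))) by (field; lra).
  assert (hc1 : C / (C + 1) < 1).
  { apply (Rmult_lt_reg_r (C + 1)); [lra|]. replace (C / (C + 1) * (C + 1)) with C by (field; lra). lra. }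
  nra. }
assert (hw : forall x, M < x -> / 2 - e < w x < / 2).
{ intros x hx. split; [apply (hg x hx)|]. assert (hb := gd_bound x).
  apply Rabs_def2 in hb. unfold w. lra. }
assert (hw' : forall x, x < - M -> - / 2 < w x < - / 2 + e).
{ intros x hx. assert (hb := gd_bound x). apply Rabs_def2 in hb.
  destruct (hg (- x) ltac:(lra)) as [_ h2]. rewrite Ropp_involutive in h2. unfold w in *. lra. }
intros [a b] [a' b'] [ha hb] [ha' hb']. simpl in *.
change (Rabs (RInt f a' b' - RInt f a b) < eps).
assert (e1 := RInt_ChaslesR f a' a b' hf). assert (e2 := RInt_ChaslesR f a b b' hf).
replace (RInt f a' b' - RInt f a b) with (RInt f a' a + RInt f b b') by lra.
eapply Rle_lt_trans; [apply Rabs_triang|].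
assert (i1 := hI a' a). assert (i2 := hI b b').
assert (j1 := hw b hb). assert (j2 := hw b' hb'). assert (j3 := hw' a ha). assert (j4 := hw' a' ha').
assert (k1 : Rabs (w a - w a') <= 2 * e) by (apply Rabs_le; lra).
assert (k2 : Rabs (w b' - w b) <= 2 * e) by (apply Rabs_le; lra).
assert (C * Rabs (w a - w a') <= C * (2 * e)) by now apply Rmult_le_compat_l.
assert (C * Rabs (w b' - w b) <= C * (2 * e)) by now apply Rmult_le_compat_l.
lra.
Qed.

Lemma is_RInt_gen_of_lim (f : R -> R) (l : R) : cont f -> filterlim
  (fun ab => RInt f (fst ab) (snd ab))
  (filter_prod (Rbar_locally m_infty) (Rbar_locally p_infty)) (locally (T := R_UniformSpace) l) ->
  is_RInt_gen f (Rbar_locally m_infty) (Rbar_locally p_infty) l.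
Proof.
intros hf h P hP. specialize (h P hP).
unfold filtermapi. unfold filtermap in h.
destruct h as [Q1 Q2 h1 h2 h3]. exists Q1 Q2; [exact h1|exact h2|].
intros a b ha hb. eexists; split; [|apply (h3 a b ha hb)]. now apply is_RInt_cont.
Qed.

Lemma line_filterlim (f : R -> R) : dom f -> filterlim
  (fun ab => RInt f (fst ab) (snd ab))
  (filter_prod (Rbar_locally m_infty) (Rbar_locally p_infty))
  (locally (T := R_UniformSpace) (line f)).
Proof.
intros h. destruct (line_exists f h) as [l hl].
assert (e := is_RInt_gen_of_lim f l (proj1 h) hl).
unfold line. rewrite (is_RInt_gen_unique (V := R_CompleteNormedModule) f l e). exact hl.
Qed.

Lemma line_correct (f : R -> R) : dom f ->
  is_RInt_gen f (Rbar_locally m_infty) (Rbar_locally p_infty) (line f).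
Proof. intros h. apply is_RInt_gen_of_lim; [apply h|now apply line_filterlim]. Qed.

Lemma line_lim (f : R -> R) (a b : nat -> R) : dom f ->
  is_lim_seq a m_infty -> is_lim_seq b p_infty ->
  is_lim_seq (fun n => RInt f (a n) (b n)) (line f).
Proof.
intros h ha hb.
apply (filterlim_comp _ _ _ (fun n => (a n, b n)) (fun ab => RInt f (fst ab) (snd ab)) _
  (filter_prod (Rbar_locally m_infty) (Rbar_locally p_infty))).
- apply filterlim_pair; assumption.
- now apply line_filterlim.
Qed.

Lemma is_lim_seq_opp_INR : is_lim_seq (fun n => - INR n) m_infty.
Proof. apply (is_lim_seq_opp _ p_infty), is_lim_seq_INR. Qed.

(** Domination guarantees the existence of the integral, so its value can be computed along
    symmetric intervals. *)
Lemma line_unique (f : R -> R) (l : R) : dom f ->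
  is_lim_seq (fun n => RInt f (- INR n) (INR n)) l -> line f = l.
Proof.
intros h hl.
assert (h1 := line_lim f _ _ h is_lim_seq_opp_INR is_lim_seq_INR).
apply is_lim_seq_unique in h1, hl. rewrite h1 in hl. now inversion hl.
Qed.

Lemma line_ext (f g : R -> R) : (forall x, f x = g x) -> line f = line g.
Proof.
intros h. f_equal. now apply functional_extensionality.
Qed.

Lemma dom_ext (f g : R -> R) : (forall x, f x = g x) -> dom f -> dom g.
Proof.
intros h [hf [C hC]]. split.
- intros x. apply (continuous_ext f g x h), hf.
- exists C. intros x. now rewrite <- h.
Qed.

Lemma dom_mult (f g : R -> R) (B : R) : dom f -> cont g -> (forall x, Rabs (g x) <= B) ->
  dom (fun x => f x * g x).
Proof.
intros [hf [C hC]] hg hB. split; [now apply cont_mult|].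
exists (C * B). intros x. rewrite Rabs_mult.
apply Rle_trans with (C / cosh (PI * x) * B); [|right; unfold Rdiv; ring].
apply Rmult_le_compat; try apply Rabs_pos; auto.
Qed.

Lemma dom_plus (f g : R -> R) : dom f -> dom g -> dom (fun x => f x + g x).
Proof.
intros [hf [C hC]] [hg [D hD]]. split; [now apply cont_plus|].
exists (C + D). intros x. eapply Rle_trans; [apply Rabs_triang|].
unfold Rdiv in *. rewrite Rmult_plus_distr_r. apply Rplus_le_compat; auto.
Qed.

Lemma dom_scal (c : R) (f : R -> R) : dom f -> dom (fun x => c * f x).
Proof.
intros h. apply (dom_ext (fun x => f x * c)); [intros; ring|].
apply (dom_mult f (fun _ => c) (Rabs c) h (cont_const c)). intros; lra.
Qed.

Lemma dom_sech : dom (fun x => / cosh (PI * x)).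
Proof.
split; [apply cont_sech|]. exists 1. intros x.
rewrite Rabs_pos_eq by apply Rlt_le, sech_pos. unfold Rdiv. lra.
Qed.

Lemma line_plus (f g : R -> R) : dom f -> dom g ->
  line (fun x => f x + g x) = line f + line g.
Proof.
intros hf hg. apply line_unique; [now apply dom_plus|].
apply (is_lim_seq_ext (fun n => RInt f (- INR n) (INR n) + RInt g (- INR n) (INR n))).
- intros n. symmetry. apply RInt_plusR; [apply hf|apply hg].
- apply is_lim_seq_plus'; apply line_lim; auto using is_lim_seq_opp_INR, is_lim_seq_INR.
Qed.

Lemma line_scal (c : R) (f : R -> R) : dom f -> line (fun x => c * f x) = c * line f.
Proof.
intros hf. apply line_unique; [now apply dom_scal|].
apply (is_lim_seq_ext (fun n => c * RInt f (- INR n) (INR n))).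
- intros n. symmetry. apply RInt_scalR, hf.
- apply (is_lim_seq_scal_l _ c (line f)).
  apply line_lim; auto using is_lim_seq_opp_INR, is_lim_seq_INR.
Qed.

Lemma line_minus (f g : R -> R) : dom f -> dom g ->
  line (fun x => f x - g x) = line f - line g.
Proof.
intros hf hg. rewrite (line_ext _ (fun x => f x + (-1) * g x)) by (intros; ring).
rewrite line_plus, line_scal; auto using dom_scal. ring.
Qed.

Lemma line_bound (f : R -> R) (C : R) : cont f ->
  (forall x, Rabs (f x) <= C / cosh (PI * x)) -> Rabs (line f) <= C.
Proof.
intros hf h. assert (hd : dom f) by (split; [exact hf|now exists C]).
assert (hC := dom_nonneg f C h).
assert (h1 := line_lim f _ _ hd is_lim_seq_opp_INR is_lim_seq_INR).
apply (is_lim_seq_abs _ (line f)) in h1.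
refine (is_lim_seq_le _ _ _ _ _ h1 (is_lim_seq_const C)).
intros n. assert (hn := pos_INR n).
eapply Rle_trans; [apply (RInt_dom f C _ _ hf h); lra|].
assert (b1 := gd_bound (INR n)). assert (b2 := gd_bound (- INR n)).
apply Rabs_def2 in b1, b2. nra.
Qed.

Lemma line_odd (f : R -> R) : dom f -> (forall x, f (- x) = - f x) -> line f = 0.
Proof.
intros h ho. apply line_unique; [exact h|].
apply (is_lim_seq_ext (fun _ => 0)); [|apply is_lim_seq_const].
intros n. symmetry. apply RInt_odd; [apply h|exact ho].
Qed.

Lemma is_lim_seq_sech : is_lim_seq (fun n => / cosh (PI * INR n)) 0.
Proof.
assert (hpi := PI2_1).
apply is_lim_seq_incr_1.
apply (is_lim_seq_le_le (fun _ => 0) _ (fun n => / INR (S n))).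
- intros n. split; [apply Rlt_le, sech_pos|].
  apply Rinv_le_contravar; [apply lt_0_INR, Nat.lt_0_succ|].
  assert (h1 := sinh_ge (PI * INR (S n))). assert (h2 := cosh_sinh_sqr (PI * INR (S n))).
  assert (h3 := cosh_pos (PI * INR (S n))). assert (h4 := pos_INR (S n)).
  specialize (h1 ltac:(apply Rmult_le_pos; lra)).
  assert (INR (S n) <= PI * INR (S n)) by (rewrite <- (Rmult_1_l (INR (S n))) at 1;
    apply Rmult_le_compat_r; lra).
  set (y := sinh _) in *. set (z := cosh _) in *. nra.
- apply is_lim_seq_const.
- apply (is_lim_seq_incr_1 (fun n => / INR n)).
  replace (Finite 0) with (Rbar_inv p_infty) by reflexivity.
  apply is_lim_seq_inv; [apply is_lim_seq_INR|discriminate].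
Qed.

Lemma dom_vanish (f : R -> R) : dom f ->
  is_lim_seq (fun n => f (INR n)) 0 /\ is_lim_seq (fun n => f (- INR n)) 0.
Proof.
intros [_ [C h]].
assert (hl : is_lim_seq (fun n => C / cosh (PI * INR n)) 0).
{ replace (Finite 0) with (Rbar_mult C 0) by (simpl; f_equal; ring).
  apply is_lim_seq_scal_l, is_lim_seq_sech. }
split; apply is_lim_seq_abs_0;
  apply (is_lim_seq_le_le (fun _ => 0) _ (fun n => C / cosh (PI * INR n)));
  try apply is_lim_seq_const; try exact hl; intros n; (split; [apply Rabs_pos|]).
- apply h.
- eapply Rle_trans; [apply h|]. rewrite <- Ropp_mult_distr_r, cosh_neg. apply Rle_refl.
Qed.

Lemma line_derive (F f : R -> R) : (forall x, is_derive F x (f x)) -> dom F -> dom f ->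
  line f = 0.
Proof.
intros h hF hf. apply line_unique; [exact hf|].
destruct (dom_vanish F hF) as [h1 h2].
apply (is_lim_seq_ext (fun n => F (INR n) - F (- INR n))).
- intros n. symmetry. apply RInt_FTC; [exact h|apply hf].
- replace (Finite 0) with (Finite (0 - 0)) by (f_equal; ring).
  now apply is_lim_seq_minus'.
Qed.

Lemma hol_cont (S s : R) (U V : R -> R -> R) : hol S U V -> Rabs s < S ->
  cont (fun x => U x s) /\ cont (fun x => V x s).
Proof.
intros [A [B h]] hs.
split; intros x; destruct (h x s hs) as (h1 & h2 & _ & _ & h5 & h6 & _);
  now apply continuity_2d_pt_continuous_1.
Qed.

(** In the rectangles over [-n, n] the vertical sides have the fixed length |s| and integrands of
    order 1 / cosh (pi n), so they disappear in the limit. *)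
Lemma hol_line (S s C : R) (U V : R -> R -> R) : hol S U V -> Rabs s < S ->
  (forall x t, Rmin 0 s <= t <= Rmax 0 s ->
    Rabs (U x t) <= C / cosh (PI * x) /\ Rabs (V x t) <= C / cosh (PI * x)) ->
  dom (fun x => U x s) /\ dom (fun x => V x s) /\
  line (fun x => U x s) = line (fun x => U x 0) /\ line (fun x => V x s) = line (fun x => V x 0).
Proof.
intros hh hs hb.
assert (bs' : Rmin 0 s <= s <= Rmax 0 s) by (split; [apply Rmin_r|apply Rmax_r]).
assert (b0 : Rmin 0 s <= 0 <= Rmax 0 s) by (split; [apply Rmin_l|apply Rmax_l]).
assert (h0 : Rabs 0 < S) by (rewrite Rabs_R0; eapply Rle_lt_trans; [apply Rabs_pos|exact hs]).
assert (d : forall t, Rmin 0 s <= t <= Rmax 0 s -> dom (fun x => U x t) /\ dom (fun x => V x t)).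
{ intros t ht. destruct (hol_cont S t U V hh (strip_between S s t hs ht)) as [c1 c2].
  split; (split; [assumption|exists C; intros x; apply (hb x t ht)]). }
assert (hC : 0 <= C) by (apply (dom_nonneg (fun x => U x 0) C); intros x; apply (hb x 0 b0)).
destruct (d s bs') as [d1 d2]. destruct (d 0 b0) as [d3 d4].
split; [exact d1|split; [exact d2|]].
destruct hh as [A [B h]].
assert (small : forall F : R -> R -> R, (forall x t, Rmin 0 s <= t <= Rmax 0 s ->
    Rabs (F x t) <= C / cosh (PI * x) /\ continuous (fun t => F x t) t) ->
  is_lim_seq (fun n => RInt (fun t => F (INR n) t - F (- INR n) t) 0 s) 0).
{ intros F hF. apply is_lim_seq_abs_0.
  apply (is_lim_seq_le_le (fun _ => 0) _ (fun n => Rabs s * (2 * C) * / cosh (PI * INR n))).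
  - intros n. split; [apply Rabs_pos|].
    assert (hx : forall t, Rmin 0 s <= t <= Rmax 0 s ->
      Rabs (F (INR n) t - F (- INR n) t) <= 2 * C / cosh (PI * INR n)).
    { intros t ht. destruct (hF (INR n) t ht) as [f1 _]. destruct (hF (- INR n) t ht) as [f2 _].
      rewrite <- Ropp_mult_distr_r, cosh_neg in f2.
      eapply Rle_trans; [apply Rabs_triang|]. rewrite Rabs_Ropp. unfold Rdiv in *. lra. }
    assert (hI : ex_RInt (fun t => F (INR n) t - F (- INR n) t) 0 s).
    { apply (ex_RInt_continuous (V := R_CompleteNormedModule)). intros t ht.
      apply (continuous_minus (fun t => F (INR n) t) (fun t => F (- INR n) t)); apply hF, ht. }
    destruct (Rle_or_lt 0 s) as [h1|h1].
    + rewrite (Rabs_pos_eq s) by exact h1.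
      eapply Rle_trans; [apply (abs_RInt_le_const _ 0 s (2 * C / cosh (PI * INR n)) h1 hI)|].
      * intros t ht. apply hx. rewrite Rmin_left, Rmax_right; lra.
      * right. unfold Rdiv. ring.
    + rewrite (Rabs_left s) by exact h1.
      assert (e : RInt (fun t => F (INR n) t - F (- INR n) t) 0 s =
        - RInt (fun t => F (INR n) t - F (- INR n) t) s 0).
      { symmetry. apply (opp_RInt_swap (V := R_CompleteNormedModule)). now apply ex_RInt_swap. }
      rewrite e, Rabs_Ropp.
      eapply Rle_trans; [apply (abs_RInt_le_const _ s 0 (2 * C / cosh (PI * INR n)))|].
      * lra.
      * now apply ex_RInt_swap.
      * intros t ht. apply hx. rewrite Rmin_right, Rmax_left; lra.
      * right. unfold Rdiv. ring.
  - apply is_lim_seq_const.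
  - replace (Finite 0) with (Rbar_mult (Rabs s * (2 * C)) 0) by (simpl; f_equal; ring).
    apply is_lim_seq_scal_l, is_lim_seq_sech. }
assert (hc : forall x t, Rmin 0 s <= t <= Rmax 0 s ->
  continuous (fun t => U x t) t /\ continuous (fun t => V x t) t).
{ intros x t ht. destruct (h x t (strip_between S s t hs ht)) as (_ & _ & _ & _ & h5 & h6 & _).
  split; now apply continuity_2d_pt_continuous_2. }
assert (hh : hol S U V) by (exists A, B; exact h).
assert (fin : forall (f g : R -> R) (r : nat -> R), dom f -> dom g ->
  (forall n, RInt f (- INR n) (INR n) - RInt g (- INR n) (INR n) = r n) ->
  is_lim_seq r 0 -> line f = line g).
{ intros f g r hf hg hr hl. apply line_unique; [exact hf|].
  apply (is_lim_seq_ext (fun n => r n + RInt g (- INR n) (INR n))).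
  - intros n. rewrite <- hr. ring.
  - replace (Finite (line g)) with (Finite (0 + line g)) by (f_equal; ring).
    apply is_lim_seq_plus'; [exact hl|].
    apply line_lim; auto using is_lim_seq_opp_INR, is_lim_seq_INR. }
split.
- eapply fin; [exact d1|exact d3| |].
  + intros n. apply (hol_rectangle S (- INR n) (INR n) s U V hh); [|exact hs].
    assert (hn := pos_INR n). lra.
  + apply (is_lim_seq_ext (fun n => RInt (fun t => - V (INR n) t - - V (- INR n) t) 0 s)).
    * intros n. apply RInt_extR. intros; ring.
    * apply (small (fun x t => - V x t)). intros x t ht. rewrite Rabs_Ropp. split; [apply (hb x t ht)|].
      apply (continuous_opp (fun t => V x t)), (hc x t ht).
- eapply fin; [exact d2|exact d4| |].
  + intros n. apply (hol_rectangle S (- INR n) (INR n) s U V hh); [|exact hs].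
    assert (hn := pos_INR n). lra.
  + apply (small U). intros x t ht. split; [apply (hb x t ht)|apply (hc x t ht)].
Qed.

(** * The Fourier transforms of sech and of its square *)

(** The squared modulus of cosh (pi (x + i s)). *)
Definition cosh_den (x s : R) : R :=
  (cosh (PI * x) * cos (PI * s)) ^ 2 + (sinh (PI * x) * sin (PI * s)) ^ 2.

(** Real and imaginary parts of [1 / cosh (pi (x + i s))]. *)
Definition sechU (x s : R) : R := cosh (PI * x) * cos (PI * s) / cosh_den x s.
Definition sechV (x s : R) : R := - (sinh (PI * x) * sin (PI * s)) / cosh_den x s.

Lemma cosh_den_eq (x s : R) : cosh_den x s = sinh (PI * x) ^ 2 + cos (PI * s) ^ 2.
Proof.
unfold cosh_den. rewrite !Rpow_mult_distr, cosh_sinh_sqr.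
assert (h := sin2_cos2 (PI * s)). unfold Rsqr in h.
replace (sin (PI * s) ^ 2) with (1 - cos (PI * s) ^ 2) by (simpl; lra). ring.
Qed.

Lemma cos_PI_pos (s : R) : Rabs s < / 2 -> 0 < cos (PI * s).
Proof.
intros hs. assert (hpi := PI_RGT_0). apply Rabs_def2 in hs. apply cos_gt_0; nra.
Qed.

Lemma cosh_den_ge (x s : R) : cos (PI * s) ^ 2 * cosh (PI * x) ^ 2 <= cosh_den x s.
Proof.
rewrite cosh_den_eq, cosh_sinh_sqr.
assert (h := sin2_cos2 (PI * s)). unfold Rsqr in h.
assert (h1 := pow2_ge_0 (sin (PI * s))). 
assert (cos (PI * s) ^ 2 <= 1) by (simpl in *; lra). nra.
Qed.

Lemma cosh_den_pos (x s : R) : Rabs s < / 2 -> 0 < cosh_den x s.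
Proof.
intros hs. eapply Rlt_le_trans; [|apply cosh_den_ge].
assert (h1 := cos_PI_pos s hs). assert (h2 := cosh_pos (PI * x)).
apply Rmult_lt_0_compat; apply pow_lt; assumption.
Qed.

Lemma hol_sech : hol (/ 2) sechU sechV.
Proof.
apply (hol_inv (/ 2) _ _ (hol_cosh (/ 2))).
intros x s hs. apply Rgt_not_eq, (cosh_den_pos x s hs).
Qed.

Lemma sechUV_sqr (x s : R) : Rabs s < / 2 ->
  sechU x s ^ 2 + sechV x s ^ 2 = / cosh_den x s.
Proof.
intros hs. assert (h := cosh_den_pos x s hs). unfold sechU, sechV.
replace (/ cosh_den x s) with (cosh_den x s / cosh_den x s ^ 2) by (field; lra).
unfold cosh_den at 3. field. lra.
Qed.

Lemma sech_bound (x s : R) : Rabs s < / 2 ->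
  Rabs (sechU x s) <= / cos (PI * s) / cosh (PI * x) /\
  Rabs (sechV x s) <= / cos (PI * s) / cosh (PI * x).
Proof.
intros hs. assert (h := sechUV_sqr x s hs). assert (hc := cos_PI_pos s hs).
assert (hd := cosh_den_ge x s). assert (hch := cosh_pos (PI * x)).
assert (k : forall z w, z ^ 2 + w ^ 2 = / cosh_den x s ->
  Rabs z <= / cos (PI * s) / cosh (PI * x)).
{ intros z w e. apply Rabs_le_between.
  assert (hz : z ^ 2 <= (/ cos (PI * s) / cosh (PI * x)) ^ 2).
  { replace ((/ cos (PI * s) / cosh (PI * x)) ^ 2)
      with (/ (cos (PI * s) ^ 2 * cosh (PI * x) ^ 2)) by (field; lra).
    apply Rle_trans with (/ cosh_den x s).
    - assert (0 <= w ^ 2) by apply pow2_ge_0. lra.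
    - apply Rinv_le_contravar; [apply Rmult_lt_0_compat; apply pow_lt; assumption|exact hd]. }
  assert (hq : 0 < / cos (PI * s) / cosh (PI * x)).
  { apply Rdiv_lt_0_compat; [now apply Rinv_0_lt_compat|exact hch]. }
  set (q := / cos (PI * s) / cosh (PI * x)) in *. nra. }
split; [apply (k _ (sechV x s) h)|].
apply (k _ (sechU x s)). lra.
Qed.

Lemma cos_PI_between (s t : R) : Rabs s < / 2 -> Rmin 0 s <= t <= Rmax 0 s ->
  0 < cos (PI * s) <= cos (PI * t).
Proof.
intros hs ht. split; [now apply cos_PI_pos|]. assert (hpi := PI_RGT_0).
apply Rabs_def2 in hs. unfold Rmin, Rmax in ht. destruct (Rle_dec 0 s) as [h|h].
- apply cos_decr_1; nra.
- rewrite <- (cos_neg (PI * s)), <- (cos_neg (PI * t)). apply cos_decr_1; nra.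
Qed.

Lemma exp_strip_bound (l t : R) : Rabs t <= / 2 ->
  exp (- (2 * PI * l * t)) <= exp (PI * Rabs l).
Proof.
intros ht. assert (hpi := PI_RGT_0).
assert (h : - (2 * PI * l * t) <= PI * Rabs l).
{ eapply Rle_trans; [apply Rle_abs|]. rewrite Rabs_Ropp, !Rabs_mult.
  rewrite (Rabs_pos_eq 2), (Rabs_pos_eq PI) by lra. assert (h1 := Rabs_pos l).
  assert (0 <= PI * Rabs l) by (apply Rmult_le_pos; lra). nra. }
destruct h as [h|h]; [left; now apply exp_increasing|rewrite h; lra].
Qed.

(** A holomorphic function that is [O(sech)] stays so after the factor [exp (2 pi i l z)],
    and its Fourier integral may be moved to the real line. *)
Lemma hol_line_exp (s l C : R) (U V : R -> R -> R) : hol (/ 2) U V -> Rabs s < / 2 ->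
  (forall x t, Rmin 0 s <= t <= Rmax 0 s ->
    Rabs (U x t) <= C / cosh (PI * x) /\ Rabs (V x t) <= C / cosh (PI * x)) ->
  let c := fun x => cos (2 * PI * l * x) in let w := fun x => sin (2 * PI * l * x) in
  let q := exp (- (2 * PI * l * s)) in
  dom (fun x => U x s * c x) /\ dom (fun x => V x s * c x) /\
  dom (fun x => U x s * w x) /\ dom (fun x => V x s * w x) /\
  q * (line (fun x => U x s * c x) - line (fun x => V x s * w x)) =
    line (fun x => U x 0 * c x - V x 0 * w x) /\
  q * (line (fun x => U x s * w x) + line (fun x => V x s * c x)) =
    line (fun x => U x 0 * w x + V x 0 * c x).
Proof.
intros hh hs hb c w q.
assert (bs' : Rmin 0 s <= s <= Rmax 0 s) by (split; [apply Rmin_r|apply Rmax_r]).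
assert (hc : cont c) by (unfold c; ct). assert (hw : cont w) by (unfold w; ct).
assert (bc : forall x, Rabs (c x) <= 1) by (intros; apply Rabs_le, COS_bound).
assert (bw : forall x, Rabs (w x) <= 1) by (intros; apply Rabs_le, SIN_bound).
destruct (hol_cont (/ 2) s U V hh hs) as [cU cV].
assert (dU : dom (fun x => U x s)) by (split; [exact cU|exists C; intros x; apply (hb x s bs')]).
assert (dV : dom (fun x => V x s)) by (split; [exact cV|exists C; intros x; apply (hb x s bs')]).
assert (d1 := dom_mult _ c 1 dU hc bc). assert (d2 := dom_mult _ c 1 dV hc bc).
assert (d3 := dom_mult _ w 1 dU hw bw). assert (d4 := dom_mult _ w 1 dV hw bw).
assert (he := hol_mult (/ 2) _ _ _ _ hh (hol_exp (/ 2) l)).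
set (D := 2 * C * exp (PI * Rabs l)).
destruct (hol_line (/ 2) s D _ _ he hs) as (_ & _ & e1 & e2).
{ intros x t ht. destruct (hb x t ht) as [b1 b2].
  assert (ht2 : Rabs t <= / 2) by (apply Rlt_le, (strip_between _ s t hs ht)).
  assert (hx := exp_strip_bound l t ht2). set (E := exp (- (2 * PI * l * t))) in *.
  assert (hE : 0 < E) by apply exp_pos.
  unfold Rdiv in *.
  assert (k : forall a b y z, Rabs a <= C * / cosh (PI * x) -> Rabs b <= C * / cosh (PI * x) ->
    Rabs y <= 1 -> Rabs z <= 1 -> Rabs (a * (y * E) + b * (z * E)) <= D * / cosh (PI * x)).
  { intros a b y z ha hb' hy hz. eapply Rle_trans; [apply Rabs_triang|].
    rewrite !Rabs_mult, (Rabs_pos_eq E) by lra.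
    set (r := C * / cosh (PI * x)) in *. set (X := exp (PI * Rabs l)) in *.
    assert (k1 : Rabs a * (Rabs y * E) <= r * (1 * X)).
    { assert (p1 := Rabs_pos a). assert (p2 := Rabs_pos y).
      apply Rmult_le_compat; [exact p1|apply Rmult_le_pos; lra|exact ha|].
      apply Rmult_le_compat; lra. }
    assert (k2 : Rabs b * (Rabs z * E) <= r * (1 * X)).
    { assert (p1 := Rabs_pos b). assert (p2 := Rabs_pos z).
      apply Rmult_le_compat; [exact p1|apply Rmult_le_pos; lra|exact hb'|].
      apply Rmult_le_compat; lra. }
    replace (D * / cosh (PI * x)) with (r * (1 * X) + r * (1 * X)) by (unfold D, r, X; ring). lra. }
  assert (b2' : Rabs (- V x t) <= C * / cosh (PI * x)) by now rewrite Rabs_Ropp.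
  split.
  - replace (U x t * (cos (2 * PI * l * x) * E) - V x t * (sin (2 * PI * l * x) * E)) with
      (U x t * (cos (2 * PI * l * x) * E) + - V x t * (sin (2 * PI * l * x) * E)) by ring.
    apply k; auto; [apply bc|apply bw].
  - apply k; auto; [apply bw|apply bc]. }
repeat match goal with |- _ /\ _ => split end; try assumption.
- rewrite <- line_minus by assumption.
  rewrite <- line_scal.
  + etransitivity; [|etransitivity; [exact e1|]].
    * apply line_ext. intros x. unfold c, w, q. ring.
    * apply line_ext. intros x. unfold c, w. rewrite Rmult_0_r, Ropp_0, exp_0. ring.
  + apply (dom_ext (fun x => U x s * c x + (-1) * (V x s * w x))); [intros; ring|].
    apply dom_plus; [assumption|now apply dom_scal].
- rewrite <- line_plus by assumption.
  rewrite <- line_scal by now apply dom_plus.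
  etransitivity; [|etransitivity; [exact e2|]].
  + apply line_ext. intros x. unfold c, w, q. ring.
  + apply line_ext. intros x. unfold c, w. rewrite Rmult_0_r, Ropp_0, exp_0. ring.
Qed.

Lemma sechU_0 (x : R) : sechU x 0 = / cosh (PI * x).
Proof.
assert (h := cosh_pos (PI * x)). unfold sechU, cosh_den.
rewrite Rmult_0_r, cos_0, sin_0. field. lra.
Qed.

Lemma sechV_0 (x : R) : sechV x 0 = 0.
Proof. unfold sechV. rewrite Rmult_0_r, sin_0. unfold Rdiv. ring. Qed.

(** [poisson s x] is the imaginary part of [tanh (pi (x + i s))]. *)
Definition poisson (s x : R) : R := sin (2 * PI * s) / (2 * cosh_den x s).

Lemma cont_cosh_den (s : R) : cont (fun x => cosh_den x s).
Proof. unfold cosh_den. ct. Qed.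

Lemma dom_poisson (s : R) : Rabs s < / 2 -> dom (poisson s).
Proof.
intros hs. split.
- unfold poisson. apply (cont_div (fun _ => sin (2 * PI * s)) (fun x => 2 * cosh_den x s)).
  + apply cont_const.
  + apply (cont_mult (fun _ => 2)); [apply cont_const|apply cont_cosh_den].
  + intros x. assert (h := cosh_den_pos x s hs). lra.
- exists (/ (2 * cos (PI * s) ^ 2)). intros x.
  assert (hc := cos_PI_pos s hs). assert (hd := cosh_den_ge x s).
  assert (h1 := cosh_ge_1 (PI * x)). assert (hp := cosh_den_pos x s hs).
  assert (hc2 : 0 < cos (PI * s) ^ 2) by now apply pow_lt.
  unfold poisson, Rdiv. rewrite Rabs_mult.
  assert (hs1 : Rabs (sin (2 * PI * s)) <= 1) by apply Rabs_le, SIN_bound.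
  rewrite (Rabs_pos_eq (/ _)) by (apply Rlt_le, Rinv_0_lt_compat; lra).
  apply Rle_trans with (1 * / (2 * cosh_den x s)).
  + apply Rmult_le_compat_r; [apply Rlt_le, Rinv_0_lt_compat; lra|exact hs1].
  + rewrite Rmult_1_l, <- Rinv_mult. apply Rinv_le_contravar.
    * apply Rmult_lt_0_compat; lra.
    * rewrite Rmult_assoc. apply Rmult_le_compat_l; [lra|].
      apply Rle_trans with (2 := hd). apply Rmult_le_compat_l; [lra|]. nra.
Qed.

(** The derivative of tanh (pi z) is pi sech^2 (pi z), and [2 * sechU x s * sechV x s] is the
    imaginary part of this square. *)
Lemma is_derive_poisson (s x : R) : Rabs s < / 2 ->
  is_derive (poisson s) x (PI * (2 * sechU x s * sechV x s)).
Proof.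
intros hs. assert (hp := cosh_den_pos x s hs).
assert (hd : is_derive (fun x => 2 * cosh_den x s) x (2 * (PI * 2 * sinh (PI * x) * cosh (PI * x)))).
{ apply (is_derive_ext (fun x => 2 * (sinh (PI * x) ^ 2 + cos (PI * s) ^ 2))).
  { intros t. now rewrite cosh_den_eq. }
  auto_derive; [easy|ring]. }
assert (h := is_derive_div (fun _ => sin (2 * PI * s)) (fun x => 2 * cosh_den x s) x _ _
  (is_derive_const (K := R_AbsRing) (V := R_NormedModule) (sin (2 * PI * s)) x) hd ltac:(lra)).
evar_last; [exact h|].
unfold sechU, sechV. replace (2 * PI * s) with (2 * (PI * s)) by ring. rewrite sin_2a.
change (@zero R_NormedModule) with 0. simpl. field. lra.
Qed.

(** A primitive is the argument of cosh (pi (x + i s)) divided by pi, which runs from -s to s. *)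
Lemma poisson_mass (s : R) : 0 < s < / 2 -> line (poisson s) = 2 * s.
Proof.
intros hs. assert (hs' : Rabs s < / 2) by (rewrite Rabs_pos_eq; lra).
assert (hpi := PI_RGT_0). assert (hc := cos_PI_pos s hs').
apply line_unique; [now apply dom_poisson|].
set (F := fun x => / PI * atan (tan (PI * s) * tanh (PI * x))).
assert (hF : forall x, is_derive F x (poisson s x)).
{ intros x. assert (hp := cosh_den_pos x s hs').
  assert (hch := cosh_pos (PI * x)).
  assert (h1 : is_derive tanh (PI * x) (/ cosh (PI * x) ^ 2)).
  { unfold tanh. evar_last.
    - apply (is_derive_div sinh cosh); [apply is_derive_sinh|apply is_derive_cosh|lra].
    - replace (cosh (PI * x) * cosh (PI * x) - sinh (PI * x) * sinh (PI * x)) with 1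
        by (assert (h := cosh_sinh_sqr (PI * x)); lra).
      field. lra. }
  assert (h2 : is_derive (fun x => tan (PI * s) * tanh (PI * x)) x
    (tan (PI * s) * (PI * / cosh (PI * x) ^ 2))).
  { apply (is_derive_scal (fun x => tanh (PI * x))).
    apply (is_derive_comp tanh (fun x => PI * x)); [exact h1|].
    auto_derive; [easy|ring]. }
  evar_last.
  - unfold F. apply (is_derive_scal (fun x => atan (tan (PI * s) * tanh (PI * x)))).
    apply (is_derive_comp atan (fun x => tan (PI * s) * tanh (PI * x))); [apply is_derive_atan|exact h2].
  - unfold scal; simpl; unfold mult; simpl. unfold poisson, Rsqr.
    unfold tan, tanh.
    replace (2 * PI * s) with (2 * (PI * s)) by ring. rewrite sin_2a.
    assert (e : 1 + sin (PI * s) / cos (PI * s) * (sinh (PI * x) / cosh (PI * x)) *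
      (sin (PI * s) / cos (PI * s) * (sinh (PI * x) / cosh (PI * x))) =
      cosh_den x s / (cos (PI * s) ^ 2 * cosh (PI * x) ^ 2)).
    { unfold cosh_den. field. split; lra. }
    rewrite e. field. repeat split; lra. }
apply (is_lim_seq_ext (fun n => F (INR n) - F (- INR n))).
{ intros n. symmetry. apply RInt_FTC; [exact hF|now apply dom_poisson]. }
assert (hl : is_lim_seq (fun n => tanh (PI * INR n)) 1).
{ apply (is_lim_seq_ext (fun n => 1 - exp (- (PI * INR n)) / cosh (PI * INR n))).
  - intros n. unfold tanh. assert (h := cosh_pos (PI * INR n)).
    apply (Rmult_eq_reg_r (cosh (PI * INR n))); [|lra].
    replace ((1 - exp (- (PI * INR n)) / cosh (PI * INR n)) * cosh (PI * INR n)) with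
      (cosh (PI * INR n) - exp (- (PI * INR n))) by (field; lra).
    replace (sinh (PI * INR n) / cosh (PI * INR n) * cosh (PI * INR n)) with (sinh (PI * INR n))
      by (field; lra).
    unfold cosh, sinh. field.
  - replace (Finite 1) with (Finite (1 - 0)) by (f_equal; ring).
    apply is_lim_seq_minus'; [apply is_lim_seq_const|].
    apply (is_lim_seq_le_le (fun _ => 0) _ (fun n => / cosh (PI * INR n))).
    + intros n. assert (h := sech_pos (PI * INR n)). assert (h' := exp_pos (- (PI * INR n))).
      assert (exp (- (PI * INR n)) <= 1).
      { rewrite <- exp_0. assert (hn := pos_INR n).
        assert (0 <= PI * INR n) by (apply Rmult_le_pos; lra).
        destruct (Req_dec (PI * INR n) 0) as [e|e].
        - rewrite e, Ropp_0. lra.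
        - left. apply exp_increasing. lra. }
      unfold Rdiv. split; [apply Rmult_le_pos; lra|]. nra.
    + apply is_lim_seq_const.
    + apply is_lim_seq_sech. }
assert (hlF : is_lim_seq (fun n => F (INR n)) s).
{ replace (Finite s) with (Finite (/ PI * atan (tan (PI * s) * 1))).
  2: { f_equal. rewrite Rmult_1_r, atan_tan by nra. field. lra. }
  unfold F. apply (is_lim_seq_scal_l _ (/ PI) (atan (tan (PI * s) * 1))).
  apply (is_lim_seq_continuous atan _ (tan (PI * s) * 1)).
  - apply continuity_pt_filterlim, (ex_derive_continuous atan). eexists; apply is_derive_atan.
  - apply (is_lim_seq_scal_l _ _ 1 hl). }
apply (is_lim_seq_ext (fun n => 2 * F (INR n))).
{ intros n. unfold F. rewrite <- (Ropp_mult_distr_r PI (INR n)).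
  replace (tanh (- (PI * INR n))) with (- tanh (PI * INR n)).
  - rewrite <- Ropp_mult_distr_r, atan_opp. ring.
  - unfold tanh. rewrite sinh_neg, cosh_neg. unfold Rdiv. ring. }
apply (is_lim_seq_scal_l _ 2 s hlF).
Qed.

(** The double zero of 1 - cos at 0 compensates the degeneration of [cosh_den x s] there as s tends
    to 1/2. What remains depends on s only through sin (2 pi s), which tends to 0: in the limit
    [poisson s] acts as a point mass at 0. *)
Lemma poisson_decay (s y x : R) : 0 < s < / 2 ->
  Rabs (poisson s x * (1 - cos (2 * PI * y * x))) <=
  sin (2 * PI * s) * (1 + y ^ 2) / cosh (PI * x).
Proof.
intros hs. assert (hs' : Rabs s < / 2) by (rewrite Rabs_pos_eq; lra).
assert (hpi := PI_RGT_0). assert (hp := cosh_den_pos x s hs').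
assert (hsin : 0 < sin (2 * PI * s)) by (apply sin_gt_0; nra).
rewrite one_minus_cos. replace (2 * PI * y * x / 2) with (PI * y * x) by field.
assert (h2 := pow2_ge_0 (sin (PI * y * x))). assert (hch := cosh_ge_1 (PI * x)).
unfold poisson. rewrite Rabs_pos_eq.
2: { apply Rmult_le_pos; [apply Rdiv_le_0_compat; lra|lra]. }
replace (sin (2 * PI * s) / (2 * cosh_den x s) * (2 * sin (PI * y * x) ^ 2)) with
  (sin (2 * PI * s) * (sin (PI * y * x) ^ 2 / cosh_den x s)) by (field; lra).
unfold Rdiv. rewrite (Rmult_assoc _ (1 + y ^ 2)). apply Rmult_le_compat_l; [lra|].
apply (Rmult_le_reg_r (cosh_den x s * cosh (PI * x))); [apply Rmult_lt_0_compat; lra|].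
replace (sin (PI * y * x) ^ 2 * / cosh_den x s * (cosh_den x s * cosh (PI * x))) with
  (sin (PI * y * x) ^ 2 * cosh (PI * x)) by (field; lra).
replace ((1 + y ^ 2) * / cosh (PI * x) * (cosh_den x s * cosh (PI * x))) with
  ((1 + y ^ 2) * cosh_den x s) by (field; lra).
assert (h3 := sin_sqr_le (PI * y * x)). assert (h4 := sinh_sqr_ge (PI * x)).
assert (h5 := cosh_sinh_sqr (PI * x)).
assert (h6 : sin (PI * y * x) ^ 2 <= 1).
{ assert (h := sin2_cos2 (PI * y * x)). unfold Rsqr in h.
  assert (h' := pow2_ge_0 (cos (PI * y * x))). simpl in *. lra. }
rewrite cosh_den_eq. assert (h8 := pow2_ge_0 y).
replace ((PI * y * x) ^ 2) with (y ^ 2 * (PI * x) ^ 2) in h3 by ring.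
set (S2 := sin (PI * y * x) ^ 2) in *. set (H := cosh (PI * x)) in *.
set (T := sinh (PI * x) ^ 2) in *. set (Y := y ^ 2) in *. set (X := (PI * x) ^ 2) in *.
assert (H <= 1 + T) by nra.
nra.
Qed.

Lemma cont_cos_freq (y : R) : cont (fun x => cos (2 * PI * y * x)).
Proof. ct. Qed.

Lemma cos_le_1 (x : R) : Rabs (cos x) <= 1.
Proof. apply Rabs_le, COS_bound. Qed.

Lemma sin_le_1 (x : R) : Rabs (sin x) <= 1.
Proof. apply Rabs_le, SIN_bound. Qed.

Lemma dom_sech2 (y : R) : dom (fun x => cos (2 * PI * y * x) / cosh (PI * x) ^ 2).
Proof.
apply (dom_ext (fun x => / cosh (PI * x) * (cos (2 * PI * y * x) * / cosh (PI * x)))).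
{ intros x. assert (h := cosh_pos (PI * x)). field. lra. }
apply (dom_mult _ _ 1 dom_sech).
- apply cont_mult; [apply cont_cos_freq|apply cont_sech].
- intros x. rewrite Rabs_mult, (Rabs_pos_eq (/ _)) by apply Rlt_le, sech_pos.
  assert (h := cos_le_1 (2 * PI * y * x)). 
  assert (h3 : / cosh (PI * x) <= 1).
  { rewrite <- Rinv_1. apply Rinv_le_contravar; [lra|apply cosh_ge_1]. }
  assert (h4 := Rabs_pos (cos (2 * PI * y * x))). nra.
Qed.

(** Moving sech^2 from height 0 to height s with the frequencies y and -y gives two linear equations
    for the transforms of its real and imaginary parts. Up to the factor [PI] the imaginary part is
    the derivative of [poisson s], and an integration by parts converts its sine transform. *)
Lemma poisson_transform (s y : R) : Rabs s < / 2 ->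
  2 * y * line (fun x => poisson s x * cos (2 * PI * y * x)) =
  sinh (2 * PI * y * s) * line (fun x => cos (2 * PI * y * x) / cosh (PI * x) ^ 2).
Proof.
intros hs.
set (U := fun x s => sechU x s * sechU x s - sechV x s * sechV x s).
set (V := fun x s => sechU x s * sechV x s + sechV x s * sechU x s).
assert (hh : hol (/ 2) U V) by exact (hol_mult _ _ _ _ _ hol_sech hol_sech).
set (C := 2 * (/ cos (PI * s)) ^ 2).
assert (hb : forall x t, Rmin 0 s <= t <= Rmax 0 s ->
  Rabs (U x t) <= C / cosh (PI * x) /\ Rabs (V x t) <= C / cosh (PI * x)).
{ intros x t ht. destruct (sech_bound x t (strip_between _ s t hs ht)) as [b1 b2].
  destruct (cos_PI_between s t hs ht) as [c1 c2].
  assert (hi : / cos (PI * t) <= / cos (PI * s)) by now apply Rinv_le_contravar.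
  assert (hi0 : 0 < / cos (PI * t)) by (apply Rinv_0_lt_compat; lra).
  assert (h1 := sech_pos (PI * x)).
  assert (h3 : / cosh (PI * x) <= 1).
  { rewrite <- Rinv_1. apply Rinv_le_contravar; [lra|apply cosh_ge_1]. }
  unfold C, Rdiv in *. set (r := / cos (PI * s)) in *. set (h := / cosh (PI * x)) in *.
  assert (k : forall a b, Rabs a <= / cos (PI * t) * h -> Rabs b <= / cos (PI * t) * h ->
    Rabs (a * b) <= r ^ 2 * h).
  { intros a b ha hb. rewrite Rabs_mult.
    assert (ha' : Rabs a <= r * h) by nra. assert (hb' : Rabs b <= r * h) by nra.
    assert (p1 := Rabs_pos a). assert (p2 := Rabs_pos b).
    apply Rle_trans with ((r * h) * (r * h)); [now apply Rmult_le_compat|].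
    replace (r * h * (r * h)) with (r ^ 2 * (h * h)) by ring.
    apply Rmult_le_compat_l; [apply pow2_ge_0|nra]. }
  unfold U, V.
  assert (k1 := k _ _ b1 b1). assert (k2 := k _ _ b2 b2). assert (k3 := k _ _ b1 b2).
  assert (k4 := k _ _ b2 b1).
  split; [eapply Rle_trans; [apply Rabs_triang|]; rewrite Rabs_Ropp; lra|].
  eapply Rle_trans; [apply Rabs_triang|]. lra. }
set (p := line (fun x => cos (2 * PI * y * x) / cosh (PI * x) ^ 2)).
destruct (hol_line_exp s y C U V hh hs hb) as (d1 & _ & _ & d4 & e1 & _).
destruct (hol_line_exp s (- y) C U V hh hs hb) as (_ & _ & _ & _ & e2 & _).
cbv beta zeta in *.
assert (hp : forall z, (z = y \/ z = - y) ->
  line (fun x => U x 0 * cos (2 * PI * z * x) - V x 0 * sin (2 * PI * z * x)) = p).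
{ intros z hz. apply line_ext. intros x. unfold U, V. rewrite sechU_0, sechV_0.
  assert (h := cosh_pos (PI * x)).
  destruct hz as [-> | ->].
  - field. lra.
  - replace (2 * PI * - y * x) with (- (2 * PI * y * x)) by ring. rewrite cos_neg. field. lra. }
rewrite hp in e1 by now left. rewrite hp in e2 by now right.
set (A := line (fun x => U x s * cos (2 * PI * y * x))) in *.
set (B := line (fun x => V x s * sin (2 * PI * y * x))) in *.
replace (line (fun x => U x s * cos (2 * PI * - y * x))) with A in e2.
2: { apply line_ext. intros x. replace (2 * PI * - y * x) with (- (2 * PI * y * x)) by ring.
     now rewrite cos_neg. }
replace (line (fun x => V x s * sin (2 * PI * - y * x))) with (- B) in e2.
2: { rewrite (line_ext _ (fun x => (-1) * (V x s * sin (2 * PI * y * x)))).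
     - rewrite line_scal by exact d4. unfold B. ring.
     - intros x. replace (2 * PI * - y * x) with (- (2 * PI * y * x)) by ring.
       rewrite sin_neg. ring. }
assert (eB : B = - (sinh (2 * PI * y * s) * p)).
{ unfold sinh. replace (- (2 * PI * - y * s)) with (2 * PI * y * s) in e2 by ring.
  assert (h : exp (2 * PI * y * s) * exp (- (2 * PI * y * s)) = 1)
    by (rewrite <- exp_plus, Rplus_opp_r; apply exp_0).
  set (q := exp (2 * PI * y * s)) in *. set (q' := exp (- (2 * PI * y * s))) in *.
  assert (f1 : A - B = q * p).
  { rewrite <- e1. replace (q * (q' * (A - B))) with (q * q' * (A - B)) by ring. rewrite h. ring. }
  assert (f2 : A - - B = q' * p).
  { rewrite <- e2. replace (q' * (q * (A - - B))) with (q * q' * (A - - B)) by ring. rewrite h. ring. }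
  lra. }
assert (hpi := PI_RGT_0).
assert (hz : line (fun x => PI * (V x s * sin (2 * PI * y * x)) +
  2 * PI * y * (poisson s x * cos (2 * PI * y * x))) = 0).
{ apply (line_derive (fun x => poisson s x * sin (2 * PI * y * x))).
  - intros x. eapply is_derive_Rmult; [now apply is_derive_poisson| |].
    + instantiate (1 := 2 * PI * y * cos (2 * PI * y * x)). auto_derive; [easy|ring].
    + unfold V. ring.
  - apply (dom_mult _ (fun x => sin (2 * PI * y * x)) 1 (dom_poisson s hs)); [ct|intros; apply sin_le_1].
  - apply dom_plus; apply dom_scal; [exact d4|].
    apply (dom_mult _ _ 1 (dom_poisson s hs)); [apply cont_cos_freq|intros; apply cos_le_1]. }
rewrite line_plus, !line_scal in hz; try assumption.
- fold B in hz. set (L := line (fun x => poisson s x * cos (2 * PI * y * x))) in *.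
  assert (B + 2 * y * L = 0) by (apply (Rmult_eq_reg_l PI); lra). lra.
- apply (dom_mult _ _ 1 (dom_poisson s hs)); [apply cont_cos_freq|intros; apply cos_le_1].
- now apply dom_scal.
- apply dom_scal. apply (dom_mult _ _ 1 (dom_poisson s hs)); [apply cont_cos_freq|intros; apply cos_le_1].
Qed.

(** As s tends to 1/2 the kernel [poisson s] becomes a unit mass at 0, and [poisson_transform] turns
    into this identity. *)
Lemma fourier_sech_sqr (y : R) :
  sinh (PI * y) * line (fun x => cos (2 * PI * y * x) / cosh (PI * x) ^ 2) = 2 * y.
Proof.
destruct (Req_dec y 0) as [-> | hy].
{ rewrite Rmult_0_r. unfold sinh. rewrite Ropp_0. field. }
set (p := line (fun x => cos (2 * PI * y * x) / cosh (PI * x) ^ 2)).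
assert (h : forall s, 0 < s < / 2 -> Rabs (2 * y * (2 * s) - sinh (2 * PI * y * s) * p) <=
  2 * Rabs y * (sin (2 * PI * s) * (1 + y ^ 2))).
{ intros s hs. assert (hs' : Rabs s < / 2) by (rewrite Rabs_pos_eq; lra).
  unfold p. rewrite <- poisson_transform by exact hs'. rewrite <- (poisson_mass s hs).
  assert (hd := dom_poisson s hs').
  assert (hd' : dom (fun x => poisson s x * cos (2 * PI * y * x)))
    by (apply (dom_mult _ _ 1 hd); [apply cont_cos_freq|intros; apply cos_le_1]).
  rewrite <- Rmult_minus_distr_l, <- line_minus by assumption.
  rewrite Rabs_mult, Rabs_mult, (Rabs_pos_eq 2) by lra.
  apply Rmult_le_compat_l; [assert (h1 := Rabs_pos y); lra|].
  apply line_bound.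
  - apply cont_minus; [apply hd|apply hd'].
  - intros x. rewrite <- (Rmult_1_r (poisson s x)) at 1. rewrite <- Rmult_minus_distr_l.
    now apply poisson_decay. }
assert (e := le_at_endpoint (fun s => 2 * y * (2 * s) - sinh (2 * PI * y * s) * p)
  (fun s => 2 * Rabs y * (sin (2 * PI * s) * (1 + y ^ 2))) 0 (/ 2) ltac:(lra)
  ltac:(ct) ltac:(ct) h).
cbv beta in e.
replace (2 * PI * / 2) with PI in e by field. rewrite sin_PI in e.
replace (2 * PI * y * / 2) with (PI * y) in e by field.
rewrite Rmult_0_l, Rmult_0_r in e. assert (h0 := Rabs_pos (2 * y * (2 * / 2) - sinh (PI * y) * p)).
assert (e0 : Rabs (2 * y * (2 * / 2) - sinh (PI * y) * p) = 0) by lra.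
apply Rabs_eq_0 in e0. lra.
Qed.

Lemma dom_sech_cos (y : R) : dom (fun x => / cosh (PI * x) * cos (2 * PI * y * x)).
Proof. apply (dom_mult _ _ 1 dom_sech); [apply cont_cos_freq|intros; apply cos_le_1]. Qed.

(** At s = 1/4 the kernel [poisson s] is 1 / cosh (2 pi x), so [poisson_transform] expresses the
    transform of sech by that of its square. At y = 0 that identity is void, and the explicit
    primitive takes over. *)
Lemma fourier_sech (y : R) : line (fun x => / cosh (PI * x) * cos (2 * PI * y * x)) = / cosh (PI * y).
Proof.
destruct (Req_dec y 0) as [-> | hy].
- rewrite (line_ext _ (fun x => / cosh (PI * x))).
  2: { intros x. replace (2 * PI * 0 * x) with 0 by ring. rewrite cos_0. ring. }
  rewrite Rmult_0_r. replace (cosh 0) with 1 by (unfold cosh; rewrite Ropp_0, exp_0; field).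
  rewrite Rinv_1. apply line_unique; [apply dom_sech|].
  apply is_lim_seq_spec. intros eps.
  destruct (gd_tail (eps / 2)) as [M [hM hg]]; [assert (h := cond_pos eps); lra|].
  destruct (INR_unbounded M) as [N hN]. exists N. intros n hn. apply le_INR in hn.
  destruct (hg (INR n)) as [h1 h2]; [lra|].
  rewrite RInt_sech. assert (b1 := gd_bound (INR n)). assert (b2 := gd_bound (- INR n)).
  apply Rabs_def2 in b1, b2. apply Rabs_def1; lra.
- assert (h4 : Rabs (/ 4) < / 2) by (rewrite Rabs_pos_eq; lra).
  assert (h := poisson_transform (/ 4) (2 * y) h4). assert (h' := fourier_sech_sqr (2 * y)).
  set (p := line _) in h'. fold p in h.
  replace (2 * PI * (2 * y) * / 4) with (PI * y) in h by field.
  replace (PI * (2 * y)) with (PI * y + PI * y) in h' by ring. rewrite sinh_plus in h'.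
  assert (hs : sinh (PI * y) <> 0).
  { intros e. rewrite e in h'. assert (y = 0) by lra. contradiction. }
  assert (hch := cosh_pos (PI * y)).
  assert (e1 : line (fun x => poisson (/ 4) x * cos (2 * PI * (2 * y) * x)) = / (2 * cosh (PI * y))).
  { apply (Rmult_eq_reg_l (2 * (2 * y))); [|lra]. rewrite h.
    apply (Rmult_eq_reg_l (2 * cosh (PI * y))); [|lra].
    replace (2 * cosh (PI * y) * (sinh (PI * y) * p)) with
      ((sinh (PI * y) * cosh (PI * y) + cosh (PI * y) * sinh (PI * y)) * p) by ring.
    rewrite h'. field. lra. }
  assert (hd : dom (fun x => poisson (/ 4) x * cos (2 * PI * (2 * y) * x)))
    by (apply (dom_mult _ _ 1 (dom_poisson _ h4)); [apply cont_cos_freq|intros; apply cos_le_1]).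
  assert (e2 : forall x, poisson (/ 4) x * cos (2 * PI * (2 * y) * x) =
    / cosh (PI * (2 * x)) * cos (2 * PI * y * (2 * x))).
  { intros x. unfold poisson. rewrite cosh_den_eq.
    replace (2 * PI * / 4) with (PI / 2) by field. rewrite sin_PI2.
    replace (PI * / 4) with (PI / 4) by reflexivity. rewrite cos_PI4.
    assert (h2 : sqrt 2 * sqrt 2 = 2) by (apply sqrt_sqrt; lra).
    assert (h3 : 0 < sqrt 2) by (apply sqrt_lt_R0; lra).
    replace ((1 / sqrt 2) ^ 2) with (/ (sqrt 2 * sqrt 2)) by (field; lra). rewrite h2.
    replace (2 * (sinh (PI * x) ^ 2 + / 2)) with (cosh (PI * (2 * x))).
    - replace (2 * PI * (2 * y) * x) with (2 * PI * y * (2 * x)) by ring. unfold Rdiv. ring.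
    - replace (PI * (2 * x)) with (PI * x + PI * x) by ring. rewrite cosh_plus.
      assert (h5 := cosh_sinh_sqr (PI * x)). simpl in *. lra. }
  apply line_unique; [apply dom_sech_cos|].
  assert (hl : is_lim_seq (fun n => 2 * RInt (fun x => poisson (/ 4) x * cos (2 * PI * (2 * y) * x))
    (- (INR n / 2)) (INR n / 2)) (2 * line (fun x => poisson (/ 4) x * cos (2 * PI * (2 * y) * x)))).
  { assert (hp2 : is_lim_seq (fun n => INR n / 2) p_infty).
    { apply (is_lim_seq_ext (fun n => / 2 * INR n)); [intros; field|].
      replace p_infty with (Rbar_mult (/ 2) p_infty).
      - apply is_lim_seq_scal_l, is_lim_seq_INR.
      - simpl. destruct (Rle_dec 0 (/ 2)) as [r|r]; [|lra].
        destruct (Rle_lt_or_eq_dec 0 (/ 2) r); [reflexivity|lra]. }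
    apply (is_lim_seq_scal_l _ 2 (Finite _)). apply line_lim; [exact hd| |exact hp2].
    apply (is_lim_seq_opp (fun n => INR n / 2) p_infty), hp2. }
  rewrite e1 in hl.
  replace (Finite (/ cosh (PI * y))) with (Finite (2 * / (2 * cosh (PI * y)))) by (f_equal; field; lra).
  refine (is_lim_seq_ext _ _ _ _ hl). intros n.
  rewrite (RInt_extR _ (fun x => (fun x => / cosh (PI * x) * cos (2 * PI * y * x)) (2 * x + 0)))
    by (intros x; rewrite e2, Rplus_0_r; reflexivity).
  rewrite (RInt_lin (fun x => / cosh (PI * x) * cos (2 * PI * y * x))) by apply dom_sech_cos.
  f_equal; field.
Qed.

(** * Real Jacobi functions *)

Lemma ellF_0 (k : R) : ellF 0 k = 0.
Proof. unfold ellF. apply (RInt_point (V := R_CompleteNormedModule)). Qed.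

Lemma ellF_inj (k a b : R) : 0 < k < 1 -> ellF a k = ellF b k -> a = b.
Proof. intros hk h. rewrite <- (am_ellF a k hk), <- (am_ellF b k hk). now rewrite h. Qed.

Lemma constant_of_derive_0 (f : R -> R) (a b : R) : (forall x, is_derive f x 0) -> f a = f b.
Proof.
intros h. assert (e := RInt_FTC f (fun _ => 0) a b h (cont_const 0)).
rewrite RInt_constR in e. lra.
Qed.

(** The hypothesis on [dth] says that [th] preserves the elliptic differential. Then
    [ellF (th x) k - ellF x k] is constant, and a translation of the argument acts on amplitudes as
    [th]. This serves in place of the addition theorems. *)
Lemma ellF_shift (k c : R) (th dth : R -> R) : 0 < k < 1 ->
  (forall x, is_derive th x (dth x)) ->
  (forall x, dth x / sqrt (1 - k ^ 2 * sin (th x) ^ 2) = / sqrt (1 - k ^ 2 * sin x ^ 2)) ->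
  ellF (th 0) k = c -> forall u, am (u + c) k = th (am u k).
Proof.
intros hk hth he h0 u.
apply (ellF_inj k _ _ hk). rewrite ellF_am by exact hk.
assert (h : forall x, is_derive (fun x => ellF (th x) k - ellF x k) x 0).
{ intros x. replace 0 with (dth x * / sqrt (1 - k ^ 2 * sin (th x) ^ 2) - / sqrt (1 - k ^ 2 * sin x ^ 2)).
  - apply (is_derive_minus (fun x => ellF (th x) k) (fun x => ellF x k)).
    + apply (is_derive_comp (fun p => ellF p k) th); [now apply is_derive_ellF|apply hth].
    + now apply is_derive_ellF.
  - specialize (he x). unfold Rdiv in he. rewrite he. ring. }
assert (e := constant_of_derive_0 _ (am u k) 0 h). cbv beta in e.
rewrite ellF_am, ellF_0, h0 in e by exact hk. lra.
Qed.

Lemma ellF_opp (k x : R) : 0 < k < 1 -> ellF (- x) k = - ellF x k.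
Proof.
intros hk.
assert (h : forall x, is_derive (fun x => ellF (- x) k + ellF x k) x 0).
{ intros z. replace 0 with (- 1 * / sqrt (1 - k ^ 2 * sin (- z) ^ 2) + / sqrt (1 - k ^ 2 * sin z ^ 2)).
  - apply (is_derive_plus (fun x => ellF (- x) k) (fun x => ellF x k)).
    + apply (is_derive_comp (fun p => ellF p k) (fun x => - x)); [now apply is_derive_ellF|].
      auto_derive; [easy|ring].
    + now apply is_derive_ellF.
  - rewrite sin_neg. replace ((- sin z) ^ 2) with (sin z ^ 2) by ring. ring. }
assert (e := constant_of_derive_0 _ x 0 h). cbv beta in e.
rewrite Ropp_0, ellF_0 in e. lra.
Qed.

Lemma am_opp (u k : R) : 0 < k < 1 -> am (- u) k = - am u k.
Proof.
intros hk. apply (ellF_inj k _ _ hk). now rewrite ellF_opp, !ellF_am.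
Qed.

Lemma snR_opp (u k : R) : 0 < k < 1 -> snR (- u) k = - snR u k.
Proof. intros hk. unfold snR. now rewrite am_opp, sin_neg. Qed.

Lemma cnR_opp (u k : R) : 0 < k < 1 -> cnR (- u) k = cnR u k.
Proof. intros hk. unfold cnR. now rewrite am_opp, cos_neg. Qed.

Lemma dnR_opp (u k : R) : 0 < k < 1 -> dnR (- u) k = dnR u k.
Proof. intros hk. unfold dnR. rewrite snR_opp by exact hk. f_equal. ring. Qed.

Lemma am_ellK (k : R) : 0 < k < 1 -> am (ellK k) k = PI / 2.
Proof. intros hk. apply (am_ellF (PI / 2) k hk). Qed.

Lemma am_increasing (u v k : R) : 0 < k < 1 -> u < v -> am u k < am v k.
Proof.
intros hk h. destruct (Rlt_or_le (am u k) (am v k)) as [h1|h1]; [exact h1|].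
assert (h2 := ellF_growth k _ _ hk h1). rewrite !ellF_am in h2 by exact hk. lra.
Qed.

Lemma ellK_pos (k : R) : 0 < k < 1 -> 0 < ellK k.
Proof.
intros hk. destruct (Rlt_or_le 0 (ellK k)) as [h|h]; [exact h|].
assert (h1 := ellF_growth k 0 (PI / 2) hk). rewrite ellF_0 in h1.
change (ellF (PI / 2) k) with (ellK k) in h1.
assert (hpi := PI_RGT_0). specialize (h1 ltac:(lra)). lra.
Qed.

Lemma jacR_ellK (k : R) : 0 < k < 1 ->
  snR (ellK k) k = 1 /\ cnR (ellK k) k = 0 /\ dnR (ellK k) k = comod k.
Proof.
intros hk. unfold dnR, snR, cnR. rewrite am_ellK, sin_PI2, cos_PI2 by exact hk.
repeat split. unfold comod. f_equal. ring.
Qed.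

Lemma am_bounds (u k : R) : 0 < k < 1 -> Rabs u < ellK k -> - (PI / 2) < am u k < PI / 2.
Proof.
intros hk h. apply Rabs_def2 in h. rewrite <- (am_ellK k hk). rewrite <- am_opp by exact hk.
split; apply am_increasing; lra.
Qed.

Lemma cnR_pos (u k : R) : 0 < k < 1 -> Rabs u < ellK k -> 0 < cnR u k.
Proof. intros hk h. apply cos_gt_0; now apply am_bounds. Qed.

Lemma cnR_nonneg (u k : R) : 0 < k < 1 -> Rabs u <= ellK k -> 0 <= cnR u k.
Proof.
intros hk [h|h]; [now apply Rlt_le, cnR_pos|].
destruct (jacR_ellK k hk) as (_ & h1 & _). unfold Rabs in h.
destruct (Rcase_abs u) as [h2|h2].
- replace u with (- ellK k) by lra. rewrite cnR_opp by exact hk. lra.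
- rewrite h. lra.
Qed.

Lemma snR_le_1 (u k : R) : Rabs (snR u k) <= 1.
Proof. apply sin_le_1. Qed.

Lemma cnR_le_1 (u k : R) : Rabs (cnR u k) <= 1.
Proof. apply cos_le_1. Qed.

Lemma snR_sqr_le (u k : R) : 0 <= snR u k ^ 2 <= 1.
Proof. assert (h := snR_cnR u k). assert (h1 := pow2_ge_0 (snR u k)). assert (h2 := pow2_ge_0 (cnR u k)). lra. Qed.

Lemma dnR_bounds (u k : R) : 0 < k < 1 -> comod k <= dnR u k <= 1.
Proof.
intros hk. assert (h := snR_sqr_le u k). assert (hp := dnR_pos u k hk).
assert (h1 := snR_dnR u k hk). assert (h2 := comod_sqr k hk). assert (h3 := comod_range k hk).
assert (0 < k ^ 2) by (apply pow_lt; lra).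
split; nra.
Qed.

Lemma dnR_le_1 (u k : R) : 0 < k < 1 -> Rabs (dnR u k) <= 1.
Proof. intros hk. assert (h := dnR_bounds u k hk). assert (h' := dnR_pos u k hk). apply Rabs_le. lra. Qed.

Lemma cont_snR (k : R) : 0 < k < 1 -> cont (fun u => snR u k).
Proof. intros hk. eapply cont_derive. intros; now apply is_derive_snR. Qed.

Lemma cont_cnR (k : R) : 0 < k < 1 -> cont (fun u => cnR u k).
Proof. intros hk. eapply cont_derive. intros; now apply is_derive_cnR. Qed.

Lemma cont_dnR (k : R) : 0 < k < 1 -> cont (fun u => dnR u k).
Proof. intros hk. eapply cont_derive. intros; now apply is_derive_dnR. Qed.

Lemma am_lower (u k : R) : 0 < k < 1 -> comod k * Rabs u <= Rabs (am u k).
Proof.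
intros hk. destruct (MVT_gen (fun v => am v k) 0 u (fun v => dnR v k)) as [c [_ h]].
- intros; now apply is_derive_am.
- intros; now apply am_continuous.
- rewrite am_0, !Rminus_0_r in h by exact hk. rewrite h, Rabs_mult.
  apply Rmult_le_compat_r; [apply Rabs_pos|].
  rewrite Rabs_pos_eq; [apply (dnR_bounds c k hk)|]. now apply Rlt_le, dnR_pos.
Qed.

(** am' = dn >= k' bounds the amplitude below linearly, and Jordan's inequality does the same for
    the sine. *)
Lemma snR_sqr_ge (u k : R) : 0 < k < 1 -> Rabs u <= ellK k ->
  comod k ^ 2 * u ^ 2 <= 4 * snR u k ^ 2.
Proof.
intros hk hu. unfold snR.
assert (h : Rabs (am u k) <= PI / 2).
{ destruct hu as [hu|hu].
  - assert (h := am_bounds u k hk hu). apply Rabs_le. lra.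
  - assert (hpi := PI_RGT_0). unfold Rabs in hu. destruct (Rcase_abs u).
    + replace u with (- ellK k) by lra. rewrite am_opp, am_ellK, Rabs_Ropp, Rabs_pos_eq by (auto; lra). lra.
    + rewrite hu, am_ellK, Rabs_pos_eq by (auto; lra). lra. }
eapply Rle_trans; [|apply (sin_sqr_ge _ h)].
rewrite <- Rpow_mult_distr, <- (pow2_abs (am u k)), <- (pow2_abs (comod k * u)).
apply pow_incr. split; [apply Rabs_pos|].
rewrite Rabs_mult, Rabs_pos_eq by (apply Rlt_le, comod_range, hk). now apply am_lower.
Qed.

Lemma am_2K (u k : R) : 0 < k < 1 -> am (u + 2 * ellK k) k = am u k + PI.
Proof.
intros hk. revert u.
assert (h : forall u, am (u + ellF PI k) k = am u k + PI).
{ apply (ellF_shift k (ellF PI k) (fun x => x + PI) (fun _ => 1) hk).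
  - intros x. auto_derive; [easy|ring].
  - intros x. rewrite neg_sin. replace ((- sin x) ^ 2) with (sin x ^ 2) by ring.
    unfold Rdiv. ring.
  - now rewrite Rplus_0_l. }
(* The shift of [- ellK k] by [ellF PI k] has amplitude [PI / 2], which is also that of [ellK k]. *)
assert (e : ellF PI k = 2 * ellK k).
{ assert (h1 := h (- ellK k)). rewrite am_opp, am_ellK in h1 by exact hk.
  assert (h2 : am (- ellK k + ellF PI k) k = am (ellK k) k) by (rewrite am_ellK by exact hk; lra).
  assert (h3 := ellF_am (- ellK k + ellF PI k) k hk). rewrite h2, ellF_am in h3 by exact hk. lra. }
rewrite <- e. exact h.
Qed.

Lemma snR_2K (u k : R) : 0 < k < 1 -> snR (u + 2 * ellK k) k = - snR u k.
Proof. intros hk. unfold snR. now rewrite am_2K, neg_sin. Qed.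

Lemma cnR_2K (u k : R) : 0 < k < 1 -> cnR (u + 2 * ellK k) k = - cnR u k.
Proof. intros hk. unfold cnR. now rewrite am_2K, neg_cos. Qed.

Lemma dnR_2K (u k : R) : 0 < k < 1 -> dnR (u + 2 * ellK k) k = dnR u k.
Proof. intros hk. unfold dnR. rewrite snR_2K by exact hk. f_equal. ring. Qed.

(** The amplitude [am (u + K)] is [phi + pi/2 + atan X] with [phi = am u]; the last term
    is smooth on the whole line, which avoids a choice of branch. *)
Lemma jacR_K (u k : R) : 0 < k < 1 ->
  snR (u + ellK k) k = cnR u k / dnR u k /\
  cnR (u + ellK k) k = - (comod k * snR u k / dnR u k) /\
  dnR (u + ellK k) k = comod k / dnR u k.
Proof.
intros hk. assert (hr := comod_range k hk). assert (hq := comod_sqr k hk).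
set (q := comod k) in *.
(* The shifted amplitude should satisfy tan (th - pi/2) = q tan x. By the subtraction formula [X] is
   tan (atan (q tan x) - x) cleared of its cosines, and its denominator [D] has no zero. *)
set (D := fun x => cos x ^ 2 + q * sin x ^ 2).
set (X := fun x => (q - 1) * sin x * cos x / D x).
set (th := fun x => x + PI / 2 + atan (X x)).
set (W := fun x => 1 - k ^ 2 * sin x ^ 2).
assert (hsc : forall x, cos x ^ 2 = 1 - sin x ^ 2).
{ intros x. assert (h := sin2_cos2 x). unfold Rsqr in h. simpl. lra. }
assert (hD : forall x, 0 < D x).
{ intros x. unfold D. rewrite hsc. assert (h := pow2_ge_0 (cos x)). rewrite hsc in h.
  nra. }
assert (hW : forall x, 0 < W x) by (intros x; apply ellF_radicand_pos, hk).
assert (hsW : forall x, 0 < sqrt (W x)) by (intros x; apply sqrt_lt_R0, hW).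
assert (hsW2 : forall x, sqrt (W x) ^ 2 = W x) by (intros x; apply pow2_sqrt, Rlt_le, hW).
assert (hk2 : k ^ 2 = 1 - q ^ 2) by lra.
assert (hX : forall x, 1 + X x ^ 2 = W x / D x ^ 2).
{ intros x. assert (hd := hD x). apply (Rmult_eq_reg_r (D x ^ 2)); [|apply Rgt_not_eq, pow_lt, hd].
  replace (W x / D x ^ 2 * D x ^ 2) with (W x) by (field; lra).
  unfold X. replace ((1 + ((q - 1) * sin x * cos x / D x) ^ 2) * D x ^ 2) with
    (D x ^ 2 + ((q - 1) * sin x) ^ 2 * cos x ^ 2) by (field; lra).
  unfold D, W. rewrite hk2, hsc. ring. }
assert (hsX : forall x, sqrt (1 + (X x)²) = sqrt (W x) / D x).
{ intros x. assert (hd := hD x). replace (1 + (X x)²) with (1 + X x ^ 2) by (unfold Rsqr; ring).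
  rewrite hX, sqrt_div_alt by (now apply pow_lt). f_equal. apply sqrt_pow2. lra. }
assert (hsin : forall x, sin (th x) = cos x / sqrt (W x)).
{ intros x. assert (hd := hD x). assert (hs := hsW x).
  unfold th. replace (x + PI / 2 + atan (X x)) with (PI / 2 + (x + atan (X x))) by ring.
  rewrite <- cos_sin, cos_plus, cos_atan, sin_atan, hsX.
  unfold X. apply (Rmult_eq_reg_r (sqrt (W x))); [|lra].
  replace (cos x / sqrt (W x) * sqrt (W x)) with (cos x) by (field; lra).
  replace ((cos x * (1 / (sqrt (W x) / D x)) -
    sin x * ((q - 1) * sin x * cos x / D x / (sqrt (W x) / D x))) * sqrt (W x)) with
    (cos x * (D x - (q - 1) * sin x ^ 2)) by (field; lra).
  unfold D. rewrite hsc. ring. }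
assert (hcos : forall x, cos (th x) = - (q * sin x / sqrt (W x))).
{ intros x. assert (hd := hD x). assert (hs := hsW x).
  unfold th. replace (x + PI / 2 + atan (X x)) with (PI / 2 + (x + atan (X x))) by ring.
  rewrite cos_plus, cos_PI2, sin_PI2, sin_plus, cos_atan, sin_atan, hsX.
  unfold X. apply (Rmult_eq_reg_r (sqrt (W x))); [|lra].
  replace (- (q * sin x / sqrt (W x)) * sqrt (W x)) with (- (q * sin x)) by (field; lra).
  replace ((0 * cos (x + atan ((q - 1) * sin x * cos x / D x)) - 1 *
    (sin x * (1 / (sqrt (W x) / D x)) +
    cos x * ((q - 1) * sin x * cos x / D x / (sqrt (W x) / D x)))) * sqrt (W x)) with
    (- (sin x * (D x + (q - 1) * cos x ^ 2))) by (field; lra).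
  unfold D. rewrite hsc. ring. }
assert (hWth : forall x, W (th x) = q ^ 2 / W x).
{ intros x. assert (hw := hW x). assert (hs := hsW x). unfold W at 1. rewrite hsin.
  apply (Rmult_eq_reg_r (W x)); [|lra].
  replace (q ^ 2 / W x * W x) with (q ^ 2) by (field; lra).
  rewrite <- (hsW2 x) at 2.
  replace ((1 - k ^ 2 * (cos x / sqrt (W x)) ^ 2) * sqrt (W x) ^ 2) with
    (sqrt (W x) ^ 2 - k ^ 2 * cos x ^ 2) by (field; lra).
  rewrite hsW2. unfold W. rewrite hsc, hk2. ring. }
assert (hsWth : forall x, sqrt (W (th x)) = q / sqrt (W x)).
{ intros x. rewrite hWth, sqrt_div_alt by apply hW. f_equal. apply sqrt_pow2. lra. }
assert (am_K : am (u + ellK k) k = th (am u k)).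
{ apply (ellF_shift k (ellK k) th (fun x => q / W x) hk).
  - intros x. assert (hd := hD x). assert (hw := hW x).
    assert (hXd : is_derive X x ((q - 1) * (cos x ^ 4 - q * sin x ^ 4 - (q - 1) * sin x ^ 2 * cos x ^ 2) / D x ^ 2)).
    { unfold X, D. auto_derive.
      - apply Rgt_not_eq. unfold D in hd. simpl in hd. exact hd.
      - unfold D in hd. field. simpl in hd. simpl. lra. }
    unfold th. evar_last.
    + apply (is_derive_plus (fun x => x + PI / 2) (fun x => atan (X x))).
      * instantiate (1 := 1). auto_derive; [easy|ring].
      * apply (is_derive_comp atan X); [apply is_derive_atan|exact hXd].
    + unfold plus, scal; simpl; unfold mult; simpl.
      replace (1 + (X x)²) with (1 + X x ^ 2) by (unfold Rsqr; ring). rewrite hX.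
      apply (Rmult_eq_reg_r (W x)); [|lra].
      replace (q / W x * W x) with q by (field; lra).
      match goal with |- ?l = _ => replace l with (W x + (q - 1) *
        ((cos x ^ 2) ^ 2 - q * sin x ^ 4 - (q - 1) * sin x ^ 2 * cos x ^ 2)) by (field; lra) end.
      unfold W. rewrite hsc, hk2. ring.
  - intros x. fold (W (th x)). fold (W x). rewrite hsWth.
    rewrite <- (hsW2 x) at 1. assert (h := hsW x). field. lra.
  - unfold th, X. rewrite sin_0.
    replace ((q - 1) * 0 * cos 0 / D 0) with 0 by (unfold Rdiv; ring).
    rewrite atan_0. unfold ellK, ellF. f_equal. ring. }
unfold dnR, snR, cnR. rewrite am_K. repeat split.
- apply hsin.
- apply hcos.
- fold (W (th (am u k))). rewrite hsWth. reflexivity.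
Qed.

Lemma jacR_sub_K (u k : R) : 0 < k < 1 ->
  snR (u - ellK k) k = - (cnR u k / dnR u k) /\
  cnR (u - ellK k) k = comod k * snR u k / dnR u k /\
  dnR (u - ellK k) k = comod k / dnR u k.
Proof.
intros hk. destruct (jacR_K (- u) k hk) as (h1 & h2 & h3).
replace (- u + ellK k) with (- (u - ellK k)) in * by ring.
rewrite snR_opp, cnR_opp, dnR_opp in h1 by exact hk.
rewrite snR_opp, cnR_opp, dnR_opp in h2 by exact hk.
rewrite !dnR_opp in h3 by exact hk.
split; [|split].
- lra.
- rewrite h2. unfold Rdiv. ring.
- exact h3.
Qed.

Lemma comod_comod (k : R) : 0 < k < 1 -> comod (comod k) = k.
Proof.
intros hk. unfold comod at 1. rewrite comod_sqr by exact hk.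
replace (1 - (1 - k ^ 2)) with (k ^ 2) by ring. apply sqrt_pow2. lra.
Qed.

(** dn is the derivative of the amplitude. This one integral normalizes the Fourier coefficients of
    all three functions. *)
Lemma RInt_dnR (k : R) : 0 < k < 1 -> RInt (fun u => dnR u k) (- ellK k) (ellK k) = PI :> R.
Proof.
intros hk. rewrite (RInt_FTC (fun u => am u k)).
- rewrite am_opp, am_ellK by exact hk. field.
- intros; now apply is_derive_am.
- now apply cont_dnR.
Qed.

(** Taking the amplitude as variable turns dn^2 du into the integrand of [ellE]. *)
Lemma RInt_dnR_sqr (k : R) : 0 < k < 1 ->
  RInt (fun u => dnR u k ^ 2) (- ellK k) (ellK k) = 2 * ellE k :> R.
Proof.
intros hk.
set (w := fun t => sqrt (1 - k ^ 2 * sin t ^ 2)).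
assert (hw : cont w).
{ intros t. apply (ex_derive_continuous w). unfold w.
  assert (h := ellF_radicand_pos k t hk). auto_derive. simpl in h. lra. }
set (G := fun p => RInt w 0 p).
assert (hG : forall p, is_derive G p (w p)).
{ intros p. apply (is_derive_RInt w G 0 p).
  - exists (mkposreal 1 Rlt_0_1). intros x _. now apply is_RInt_cont.
  - apply hw. }
rewrite (RInt_FTC (fun u => G (am u k))).
- rewrite am_opp, am_ellK by exact hk. unfold G.
  assert (e := RInt_reflect w 0 (PI / 2) hw).
  rewrite (RInt_extR _ w) in e.
  2: { intros x. unfold w. rewrite sin_neg. f_equal. ring. }
  rewrite Ropp_0 in e. rewrite (RInt_swap_bounds w (- (PI / 2)) 0 hw), <- e.
  change (RInt w 0 (PI / 2)) with (ellE k). ring.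
- intros u. evar_last.
  + apply (is_derive_comp G (fun u => am u k)); [apply hG|now apply is_derive_am].
  + unfold scal; simpl; unfold mult; simpl. unfold w. fold (snR u k). fold (dnR u k). ring.
- assert (h := cont_dnR k hk). ct.
Qed.

Ltac ctj := repeat first
  [ progress ct
  | match goal with
    | |- cont (fun x => snR (@?g x) ?k) =>
        apply (cont_comp (fun u => snR u k) g); [apply cont_snR; assumption|]
    | |- cont (fun x => cnR (@?g x) ?k) =>
        apply (cont_comp (fun u => cnR u k) g); [apply cont_cnR; assumption|]
    | |- cont (fun x => dnR (@?g x) ?k) =>
        apply (cont_comp (fun u => dnR u k) g); [apply cont_dnR; assumption|]
    end ].

(** * Fourier coefficients of sn, cn and dn *)

(** Bounded Lipschitz functions are stable under products, so the derivatives of sn, cn and dn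
    qualify without any computation of second derivatives. *)
Definition blip (f : R -> R) : Prop :=
  exists B L, (forall x, Rabs (f x) <= B) /\ forall x y, Rabs (f x - f y) <= L * Rabs (x - y).

Lemma blip_mult (f g : R -> R) : blip f -> blip g -> blip (fun x => f x * g x).
Proof.
intros (B & L & h1 & h2) (D & M & h3 & h4). exists (B * D), (B * M + D * L). split.
- intros x. rewrite Rabs_mult. apply Rmult_le_compat; auto using Rabs_pos.
- intros x y. replace (f x * g x - f y * g y) with (f x * (g x - g y) + g y * (f x - f y)) by ring.
  eapply Rle_trans; [apply Rabs_triang|]. rewrite !Rabs_mult.
  assert (Rabs (f x) * Rabs (g x - g y) <= B * (M * Rabs (x - y)))
    by (apply Rmult_le_compat; auto using Rabs_pos).
  assert (Rabs (g y) * Rabs (f x - f y) <= D * (L * Rabs (x - y)))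
    by (apply Rmult_le_compat; auto using Rabs_pos).
  lra.
Qed.

Lemma blip_scal (c : R) (f : R -> R) : blip f -> blip (fun x => c * f x).
Proof.
intros h. apply (blip_mult (fun _ => c)); [|exact h].
exists (Rabs c), 0. split; intros; [lra|]. rewrite Rminus_diag, Rabs_R0. lra.
Qed.

Lemma blip_derive (f df : R -> R) (B L : R) : (forall x, is_derive f x (df x)) ->
  (forall x, Rabs (f x) <= B) -> (forall x, Rabs (df x) <= L) -> blip f.
Proof.
intros hd hB hL. exists B, L. split; [exact hB|]. intros x y.
destruct (MVT_gen f y x df) as [c [_ h]].
- intros; apply hd.
- intros; apply cont_continuity_pt, (cont_derive f df hd).
- rewrite h, Rabs_mult. apply Rmult_le_compat_r; [apply Rabs_pos|apply hL].
Qed.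

Lemma Rabs_mult_le_1 (a b : R) : Rabs a <= 1 -> Rabs b <= 1 -> Rabs (a * b) <= 1.
Proof.
intros ha hb. rewrite Rabs_mult. assert (h2 := Rabs_pos b). nra.
Qed.

Lemma blip_snR (k : R) : 0 < k < 1 -> blip (fun u => snR u k).
Proof.
intros hk. apply (blip_derive _ (fun u => cnR u k * dnR u k) 1 1).
- intros; now apply is_derive_snR.
- intros; apply snR_le_1.
- intros; apply Rabs_mult_le_1; [apply cnR_le_1|now apply dnR_le_1].
Qed.

Lemma blip_cnR (k : R) : 0 < k < 1 -> blip (fun u => cnR u k).
Proof.
intros hk. apply (blip_derive _ (fun u => - (snR u k * dnR u k)) 1 1).
- intros; now apply is_derive_cnR.
- intros; apply cnR_le_1.
- intros; rewrite Rabs_Ropp; apply Rabs_mult_le_1; [apply snR_le_1|now apply dnR_le_1].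
Qed.

Lemma blip_dnR (k : R) : 0 < k < 1 -> blip (fun u => dnR u k).
Proof.
intros hk. apply (blip_derive _ (fun u => - (k ^ 2 * snR u k * cnR u k)) 1 1).
- intros; now apply is_derive_dnR.
- intros; now apply dnR_le_1.
- intros; rewrite Rabs_Ropp. apply Rabs_mult_le_1; [|apply cnR_le_1].
  apply Rabs_mult_le_1; [|apply snR_le_1]. rewrite Rabs_pos_eq; nra.
Qed.

(** This is the hypothesis of [fourier_pointwise] for the even part of the rescaled function about
    x. The scale [c] is quantified because the arguments will be [2 * K' * x] and [2 * K * x]. *)
Definition smooth2 (f : R -> R) : Prop :=
  forall c, exists C, forall x t, Rabs (/ 2 * (f (c * (x + t)) + f (c * (x - t))) - f (c * x)) <= C * t ^ 2.

Lemma smooth2_derive (f df : R -> R) : (forall x, is_derive f x (df x)) -> blip df -> smooth2 f.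
Proof.
intros hd (B & L & _ & hL) c. exists (Rabs L * c ^ 2). intros x t.
assert (hm : forall a b, exists z, f b - f a = df z * (b - a) /\ Rabs (z - a) <= Rabs (b - a)).
{ intros a b. destruct (MVT_gen f a b df) as [z [hz h]].
  - intros; apply hd.
  - intros; apply cont_continuity_pt, (cont_derive f df hd).
  - exists z. split; [exact h|].
    unfold Rmin, Rmax in hz. destruct (Rle_dec a b).
    + rewrite !Rabs_pos_eq; lra.
    + rewrite !Rabs_left1; lra. }
destruct (hm (c * x) (c * (x + t))) as (z1 & e1 & b1).
destruct (hm (c * x) (c * (x - t))) as (z2 & e2 & b2).
replace (c * (x + t) - c * x) with (c * t) in * by ring.
replace (c * (x - t) - c * x) with (- (c * t)) in * by ring. rewrite Rabs_Ropp in b2.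
replace (/ 2 * (f (c * (x + t)) + f (c * (x - t))) - f (c * x)) with
  (/ 2 * ((f (c * (x + t)) - f (c * x)) + (f (c * (x - t)) - f (c * x)))) by field.
rewrite e1, e2.
replace (/ 2 * (df z1 * (c * t) + df z2 * - (c * t))) with (/ 2 * ((df z1 - df z2) * (c * t))) by ring.
rewrite !Rabs_mult, (Rabs_pos_eq (/ 2)) by lra.
assert (h12 : Rabs (z1 - z2) <= 2 * Rabs (c * t)).
{ replace (z1 - z2) with ((z1 - c * x) - (z2 - c * x)) by ring.
  eapply Rle_trans; [apply Rabs_triang|]. rewrite Rabs_Ropp. lra. }
assert (h := hL z1 z2). assert (hl := Rle_abs L).
assert (h' : Rabs (df z1 - df z2) <= Rabs L * (2 * Rabs (c * t))).
{ eapply Rle_trans; [exact h|]. apply Rle_trans with (Rabs L * Rabs (z1 - z2)).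
  - apply Rmult_le_compat_r; [apply Rabs_pos|exact hl].
  - apply Rmult_le_compat_l; [apply Rabs_pos|exact h12]. }
assert (hct := Rabs_pos (c * t)).
replace (Rabs L * c ^ 2 * t ^ 2) with (Rabs L * (c * t) ^ 2) by ring.
rewrite <- (pow2_abs (c * t)), <- Rabs_mult. set (A := Rabs (c * t)) in *.
apply (Rmult_le_compat_r A) in h'; [|exact hct]. lra.
Qed.

Lemma smooth2_snR (k : R) : 0 < k < 1 -> smooth2 (fun u => snR u k).
Proof.
intros hk. apply (smooth2_derive _ (fun u => cnR u k * dnR u k)).
- intros; now apply is_derive_snR.
- apply blip_mult; [now apply blip_cnR|now apply blip_dnR].
Qed.

Lemma smooth2_cnR (k : R) : 0 < k < 1 -> smooth2 (fun u => cnR u k).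
Proof.
intros hk. apply (smooth2_derive _ (fun u => (-1) * (snR u k * dnR u k))).
- intros x. replace (-1 * (snR x k * dnR x k)) with (- (snR x k * dnR x k)) by ring.
  now apply is_derive_cnR.
- apply blip_scal, blip_mult; [now apply blip_snR|now apply blip_dnR].
Qed.

Lemma smooth2_dnR (k : R) : 0 < k < 1 -> smooth2 (fun u => dnR u k).
Proof.
intros hk. apply (smooth2_derive _ (fun u => (- k ^ 2) * (snR u k * cnR u k))).
- intros x. replace (- k ^ 2 * (snR x k * cnR x k)) with (- (k ^ 2 * snR x k * cnR x k)) by ring.
  now apply is_derive_dnR.
- apply blip_scal, blip_mult; [now apply blip_snR|now apply blip_cnR].
Qed.

Lemma smooth2_dnR_sqr (k : R) : 0 < k < 1 -> smooth2 (fun u => dnR u k ^ 2).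
Proof.
intros hk. apply (smooth2_derive _ (fun u => (- 2 * k ^ 2) * (snR u k * (cnR u k * dnR u k)))).
- intros x. apply (is_derive_ext (fun u => dnR u k * dnR u k)); [intros; simpl; ring|].
  eapply is_derive_Rmult; [now apply is_derive_dnR|now apply is_derive_dnR|]. ring.
- apply blip_scal, blip_mult; [now apply blip_snR|].
  apply blip_mult; [now apply blip_cnR|now apply blip_dnR].
Qed.

Lemma jac_den_pos (x y k : R) : 0 < k < 1 -> Rabs y < ellK (comod k) -> 0 < jac_den (x, y) k.
Proof.
intros hk hy. assert (h := cnR_pos y (comod k) (comod_range k hk) hy).
unfold jac_den. simpl Re. simpl Im.
assert (0 < cnR y (comod k) ^ 2) by now apply pow_lt.
assert (0 <= k ^ 2 * snR x k ^ 2 * snR y (comod k) ^ 2).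
{ apply Rmult_le_pos; [apply Rmult_le_pos|]; apply pow2_ge_0. }
lra.
Qed.

Lemma strip_scale (c s : R) : 0 < c -> Rabs s < / 2 -> Rabs (2 * c * s) < c.
Proof. intros hc hs. rewrite !Rabs_mult, (Rabs_pos_eq 2), (Rabs_pos_eq c) by lra. nra. Qed.

(** * Holomorphy of dn, cn and sn in the strip *)

Section Strip.

Variable k : R.
Hypothesis hk : 0 < k < 1.
Let k' := comod k.
Let K' := ellK k'.

Let hk' : 0 < k' < 1 := comod_range k hk.
Let hK' : 0 < K' := ellK_pos k' hk'.

Lemma hol_dn : hol (/ 2) (fun x s => Re (dn (2 * K' * x, 2 * K' * s) k))
  (fun x s => Im (dn (2 * K' * x, 2 * K' * s) k)).
Proof.
apply (hol_of_C (/ 2) (2 * K') (fun z => dn z k) (fun z => (- (k ^ 2 * (sn z k * cn z k)))%C)).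
2: { lra. }
intros [x y] hz. simpl in hz. replace (2 * K' * / 2) with K' in hz by field.
assert (hd : jac_den (x, y) k <> 0) by now apply Rgt_not_eq, jac_den_pos.
split; [now apply is_derive_dn|].
destruct (continuity_2d_pt_Cmult _ _ (x, y) _ _ (is_derive_sn (x, y) k hk hd)
  (is_derive_cn (x, y) k hk hd)) as [h1 h2].
split.
- apply (continuity_2d_pt_ext (fun x y => - k ^ 2 * Re (sn (x, y) k * cn (x, y) k)%C)).
  + intros u v. generalize (sn (u, v) k * cn (u, v) k)%C. intros w. unfold Re. simpl. ring.
  + apply continuity_2d_pt_mult; [apply continuity_2d_pt_const|exact h1].
- apply (continuity_2d_pt_ext (fun x y => - k ^ 2 * Im (sn (x, y) k * cn (x, y) k)%C)).
  + intros u v. generalize (sn (u, v) k * cn (u, v) k)%C. intros w. unfold Im. simpl. ring.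
  + apply continuity_2d_pt_mult; [apply continuity_2d_pt_const|exact h2].
Qed.

Lemma hol_cn : hol (/ 2) (fun x s => Re (cn (2 * K' * x, 2 * K' * s) k))
  (fun x s => Im (cn (2 * K' * x, 2 * K' * s) k)).
Proof.
apply (hol_of_C (/ 2) (2 * K') (fun z => cn z k) (fun z => (- (sn z k * dn z k))%C)).
2: { lra. }
intros [x y] hz. simpl in hz. replace (2 * K' * / 2) with K' in hz by field.
assert (hd : jac_den (x, y) k <> 0) by now apply Rgt_not_eq, jac_den_pos.
split; [now apply is_derive_cn|].
destruct (continuity_2d_pt_Cmult _ _ (x, y) _ _ (is_derive_sn (x, y) k hk hd)
  (is_derive_dn (x, y) k hk hd)) as [h1 h2].
split; now apply continuity_2d_pt_opp.
Qed.

Lemma hol_sn : hol (/ 2) (fun x s => Re (sn (2 * K' * x, 2 * K' * s) k))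
  (fun x s => Im (sn (2 * K' * x, 2 * K' * s) k)).
Proof.
apply (hol_of_C (/ 2) (2 * K') (fun z => sn z k) (fun z => (cn z k * dn z k)%C)).
2: { lra. }
intros [x y] hz. simpl in hz. replace (2 * K' * / 2) with K' in hz by field.
assert (hd : jac_den (x, y) k <> 0) by now apply Rgt_not_eq, jac_den_pos.
split; [now apply is_derive_sn|].
exact (continuity_2d_pt_Cmult _ _ (x, y) _ _ (is_derive_cn (x, y) k hk hd)
  (is_derive_dn (x, y) k hk hd)).
Qed.

End Strip.

(** Fourier coefficients on the lines [R + i s] in terms of those on the real line, for a
    function of period [a] up to the sign [e], real on the real line. *)
Lemma coeff_on_line (a e l s : R) (U V : R -> R -> R) : hol (/ 2) U V -> 0 < a -> Rabs s < / 2 ->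
  (forall x t, Rabs t < / 2 -> U (x + a) t = e * U x t /\ V (x + a) t = e * V x t) ->
  (forall x, V x 0 = 0) -> cos (2 * PI * l * a) = e -> sin (2 * PI * l * a) = 0 -> e ^ 2 = 1 ->
  let c := fun x => cos (2 * PI * l * x) in let w := fun x => sin (2 * PI * l * x) in
  RInt (fun x => U x s * c x) (- (a / 2)) (a / 2) =
    cosh (2 * PI * l * s) * RInt (fun x => U x 0 * c x) (- (a / 2)) (a / 2) /\
  RInt (fun x => V x s * c x) (- (a / 2)) (a / 2) =
    sinh (2 * PI * l * s) * RInt (fun x => U x 0 * w x) (- (a / 2)) (a / 2).
Proof.
intros hh ha hs hper hV0 hc1 hs1 he c w.
assert (h0 : Rabs 0 < / 2) by (rewrite Rabs_R0; lra).
destruct (hol_cont (/ 2) s U V hh hs) as [cU cV].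
destruct (hol_cont (/ 2) 0 U V hh h0) as [cU0 cV0].
(* The exponential of frequency [z] changes by the same sign [e] over a period, so the product is
   periodic and the vertical sides cancel. The frequencies [l] and [- l] give a linear system whose
   solution is expressed by cosh and sinh. *)
assert (key : forall z, (z = l \/ z = - l) ->
  exp (- (2 * PI * z * s)) * (RInt (fun x => U x s * cos (2 * PI * z * x)) (- (a / 2)) (a / 2) -
    RInt (fun x => V x s * sin (2 * PI * z * x)) (- (a / 2)) (a / 2)) =
    RInt (fun x => U x 0 * cos (2 * PI * z * x)) (- (a / 2)) (a / 2) /\
  exp (- (2 * PI * z * s)) * (RInt (fun x => U x s * sin (2 * PI * z * x)) (- (a / 2)) (a / 2) +
    RInt (fun x => V x s * cos (2 * PI * z * x)) (- (a / 2)) (a / 2)) =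
    RInt (fun x => U x 0 * sin (2 * PI * z * x)) (- (a / 2)) (a / 2)).
{ intros z hz.
  assert (hza : cos (2 * PI * z * a) = e /\ sin (2 * PI * z * a) = 0).
  { destruct hz as [-> | ->]; [now split|].
    replace (2 * PI * - l * a) with (- (2 * PI * l * a)) by ring.
    rewrite cos_neg, sin_neg. split; [exact hc1|lra]. }
  destruct hza as [za1 za2].
  assert (hcz : forall x, cos (2 * PI * z * (x + a)) = e * cos (2 * PI * z * x)).
  { intros x. rewrite Rmult_plus_distr_l, cos_plus, za1, za2. ring. }
  assert (hsz : forall x, sin (2 * PI * z * (x + a)) = e * sin (2 * PI * z * x)).
  { intros x. rewrite Rmult_plus_distr_l, sin_plus, za1, za2. ring. }
  assert (he2 : forall p q r, e * p * (e * q * r) = p * (q * r)).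
  { intros p q r. replace (e * p * (e * q * r)) with (e ^ 2 * (p * (q * r))) by ring. rewrite he. ring. }
  assert (ea : a / 2 = - (a / 2) + a) by field.
  destruct (hol_periodic (/ 2) (- (a / 2)) (a / 2) s _ _ (hol_mult _ _ _ _ _ hh (hol_exp (/ 2) z)))
    as [e1 e2].
  - lra.
  - exact hs.
  - intros t ht. rewrite ea at 1 2 3 4. destruct (hper (- (a / 2)) t ht) as [p1 p2].
    rewrite p1, p2, hcz, hsz, !he2. reflexivity.
  - intros t ht. rewrite ea at 1 2 3 4. destruct (hper (- (a / 2)) t ht) as [p1 p2].
    rewrite p1, p2, hcz, hsz, !he2. reflexivity.
  - split.
    + rewrite <- RInt_minusR by ctj. rewrite <- RInt_scalR by ctj.
      etransitivity; [|etransitivity; [exact e1|]].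
      * apply RInt_extR. intros x. ring.
      * apply RInt_extR. intros x. rewrite hV0, Rmult_0_r, Ropp_0, exp_0. ring.
    + rewrite <- RInt_plusR by ctj. rewrite <- RInt_scalR by ctj.
      etransitivity; [|etransitivity; [exact e2|]].
      * apply RInt_extR. intros x. ring.
      * apply RInt_extR. intros x. rewrite hV0, Rmult_0_r, Ropp_0, exp_0. ring. }
destruct (key l (or_introl eq_refl)) as [k1 k2].
destruct (key (- l) (or_intror eq_refl)) as [k3 k4].
assert (cl : forall F : R -> R, cont F -> RInt (fun x => F x * cos (2 * PI * - l * x)) (- (a / 2)) (a / 2) =
  RInt (fun x => F x * cos (2 * PI * l * x)) (- (a / 2)) (a / 2) :> R).
{ intros F hF. apply RInt_extR. intros x. replace (2 * PI * - l * x) with (- (2 * PI * l * x)) by ring.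
  now rewrite cos_neg. }
assert (sl : forall F : R -> R, cont F -> RInt (fun x => F x * sin (2 * PI * - l * x)) (- (a / 2)) (a / 2) =
  - RInt (fun x => F x * sin (2 * PI * l * x)) (- (a / 2)) (a / 2) :> R).
{ intros F hF. rewrite <- RInt_oppR by ctj. apply RInt_extR. intros x.
  replace (2 * PI * - l * x) with (- (2 * PI * l * x)) by ring. rewrite sin_neg. ring. }
rewrite !(cl (fun x => U x s)), (sl (fun x => V x s)), (cl (fun x => U x 0)) in k3 by assumption.
rewrite (sl (fun x => U x s)), (cl (fun x => V x s)), (sl (fun x => U x 0)) in k4 by assumption.
replace (- (2 * PI * - l * s)) with (2 * PI * l * s) in k3, k4 by ring.
assert (h : exp (2 * PI * l * s) * exp (- (2 * PI * l * s)) = 1)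
  by (rewrite <- exp_plus, Rplus_opp_r; apply exp_0).
unfold cosh, sinh, c, w.
set (q := exp (2 * PI * l * s)) in *. set (q' := exp (- (2 * PI * l * s))) in *.
set (A := RInt (fun x => U x s * cos (2 * PI * l * x)) _ _) in *.
set (B := RInt (fun x => V x s * sin (2 * PI * l * x)) _ _) in *.
set (A' := RInt (fun x => U x s * sin (2 * PI * l * x)) _ _) in *.
set (B' := RInt (fun x => V x s * cos (2 * PI * l * x)) _ _) in *.
set (al := RInt (fun x => U x 0 * cos (2 * PI * l * x)) _ _) in *.
set (al' := RInt (fun x => U x 0 * sin (2 * PI * l * x)) _ _) in *.
assert (inv : forall x y, q' * x = y -> x = q * y).
{ intros x y <-. replace (q * (q' * x)) with (q * q' * x) by ring. rewrite h. ring. }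
assert (inv' : forall x y, q * x = y -> x = q' * y).
{ intros x y <-. replace (q' * (q * x)) with (q * q' * x) by ring. rewrite h. ring. }
apply inv in k1, k2. apply inv' in k3, k4. split; lra.
Qed.

Section Coefficients.

Variable k : R.
Hypothesis hk : 0 < k < 1.
Let k' := comod k.
Let K := ellK k.
Let K' := ellK k'.
Let a := K / K'.

Let hk' : 0 < k' < 1 := comod_range k hk.
Let hK : 0 < K := ellK_pos k hk.
Let hK' : 0 < K' := ellK_pos k' hk'.

(** The factor common to Re dn, Re cn and Im sn at height s. It is positive for |s| < 1/2, and the
    other factors stay bounded as s tends to 1/2. *)
Let Q (s x : R) : R := cnR (2 * K' * s) k' / jac_den (2 * K' * x, 2 * K' * s) k.

Lemma aspect_pos : 0 < a.
Proof. apply Rdiv_lt_0_compat; [exact hK|exact hK']. Qed.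

Lemma aspect_scale (x : R) : 2 * K' * (x + a) = 2 * K' * x + 2 * ellK k.
Proof. unfold a, K. field. lra. Qed.

Lemma cont_Q (s : R) : Rabs s < / 2 -> cont (Q s).
Proof.
intros hs. unfold Q. apply (cont_div (fun _ => cnR (2 * K' * s) k')).
- apply cont_const.
- unfold jac_den. simpl Re. simpl Im. ctj.
- intros x. apply Rgt_not_eq, jac_den_pos; [exact hk|]. now apply strip_scale.
Qed.

Lemma Re_dn (s x : R) : Re (dn (2 * K' * x, 2 * K' * s) k) =
  dnR (2 * K' * s) k' * (dnR (2 * K' * x) k * Q s x).
Proof. unfold dn, Q. simpl. fold k'. unfold Rdiv. ring. Qed.

Lemma Re_cn (s x : R) : Re (cn (2 * K' * x, 2 * K' * s) k) = cnR (2 * K' * x) k * Q s x.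
Proof. unfold cn, Q. simpl. fold k'. unfold Rdiv. ring. Qed.

Lemma Im_sn (s x : R) : Im (sn (2 * K' * x, 2 * K' * s) k) =
  snR (2 * K' * s) k' * (cnR (2 * K' * x) k * dnR (2 * K' * x) k * Q s x).
Proof. unfold sn, Q. simpl. fold k'. unfold Rdiv. ring. Qed.

Lemma jac_period (x t : R) :
  dn (2 * K' * (x + a), t) k = dn (2 * K' * x, t) k /\
  cn (2 * K' * (x + a), t) k = Copp (cn (2 * K' * x, t) k) /\
  sn (2 * K' * (x + a), t) k = Copp (sn (2 * K' * x, t) k).
Proof.
assert (hd : jac_den (2 * K' * (x + a), t) k = jac_den (2 * K' * x, t) k).
{ unfold jac_den. simpl Re. simpl Im. rewrite aspect_scale, snR_2K by exact hk. ring. }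
unfold dn, cn, sn. rewrite hd. simpl Re. simpl Im.
rewrite aspect_scale, snR_2K, cnR_2K, dnR_2K by exact hk.
unfold Copp. simpl. repeat split; f_equal; unfold Rdiv; ring.
Qed.

Lemma jac_real (x : R) : dn (2 * K' * x, 2 * K' * 0) k = RtoC (dnR (2 * K' * x) k) /\
  cn (2 * K' * x, 2 * K' * 0) k = RtoC (cnR (2 * K' * x) k) /\
  sn (2 * K' * x, 2 * K' * 0) k = RtoC (snR (2 * K' * x) k).
Proof.
rewrite Rmult_0_r. change (2 * K' * x, 0) with (RtoC (2 * K' * x)).
now rewrite dn_RtoC, cn_RtoC, sn_RtoC.
Qed.

Lemma dn_coeff_on_line (l s : R) : Rabs s < / 2 -> cos (2 * PI * l * a) = 1 -> sin (2 * PI * l * a) = 0 ->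
  dnR (2 * K' * s) k' * RInt (fun x => dnR (2 * K' * x) k * cos (2 * PI * l * x) * Q s x) (- (a / 2)) (a / 2) =
  cosh (2 * PI * l * s) * RInt (fun x => dnR (2 * K' * x) k * cos (2 * PI * l * x)) (- (a / 2)) (a / 2).
Proof.
intros hs h1 h2. assert (cq := cont_Q s hs).
destruct (coeff_on_line a 1 l s _ _ (hol_dn k hk) aspect_pos hs) as [e _]; auto.
- intros x t ht. destruct (jac_period x (2 * K' * t)) as (p & _ & _).
  unfold K', k' in *. rewrite p. split; ring.
- intros x. destruct (jac_real x) as (p & _ & _). unfold K', k' in *. rewrite p. reflexivity.
- ring.
- rewrite <- RInt_scalR by ctj.
  etransitivity; [|etransitivity; [exact e|]].
  + apply RInt_extR. intros x. rewrite Re_dn. ring.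
  + f_equal. apply RInt_extR. intros x. fold k'. fold K'.
    destruct (jac_real x) as (p & _ & _). rewrite p. reflexivity.
Qed.

Lemma cn_coeff_on_line (l s : R) : Rabs s < / 2 -> cos (2 * PI * l * a) = -1 -> sin (2 * PI * l * a) = 0 ->
  RInt (fun x => cnR (2 * K' * x) k * cos (2 * PI * l * x) * Q s x) (- (a / 2)) (a / 2) =
  cosh (2 * PI * l * s) * RInt (fun x => cnR (2 * K' * x) k * cos (2 * PI * l * x)) (- (a / 2)) (a / 2).
Proof.
intros hs h1 h2. 
destruct (coeff_on_line a (-1) l s _ _ (hol_cn k hk) aspect_pos hs) as [e _]; auto.
- intros x t ht. destruct (jac_period x (2 * K' * t)) as (_ & p & _).
  unfold K', k' in *. rewrite p. unfold Re, Im. simpl. split; ring.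
- intros x. destruct (jac_real x) as (_ & p & _). unfold K', k' in *. rewrite p. reflexivity.
- ring.
- etransitivity; [|etransitivity; [exact e|]].
  + apply RInt_extR. intros x. rewrite Re_cn. ring.
  + f_equal. apply RInt_extR. intros x. fold k'. fold K'.
    destruct (jac_real x) as (_ & p & _). rewrite p. reflexivity.
Qed.

Lemma sn_coeff_on_line (l s : R) : Rabs s < / 2 -> cos (2 * PI * l * a) = -1 -> sin (2 * PI * l * a) = 0 ->
  snR (2 * K' * s) k' *
    RInt (fun x => cnR (2 * K' * x) k * dnR (2 * K' * x) k * cos (2 * PI * l * x) * Q s x) (- (a / 2)) (a / 2) =
  sinh (2 * PI * l * s) * RInt (fun x => snR (2 * K' * x) k * sin (2 * PI * l * x)) (- (a / 2)) (a / 2).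
Proof.
intros hs h1 h2. assert (cq := cont_Q s hs).
destruct (coeff_on_line a (-1) l s _ _ (hol_sn k hk) aspect_pos hs) as [_ e]; auto.
- intros x t ht. destruct (jac_period x (2 * K' * t)) as (_ & _ & p).
  unfold K', k' in *. rewrite p. unfold Re, Im. simpl. split; ring.
- intros x. destruct (jac_real x) as (_ & _ & p). unfold K', k' in *. rewrite p. reflexivity.
- ring.
- rewrite <- RInt_scalR by ctj.
  etransitivity; [|etransitivity; [exact e|]].
  + apply RInt_extR. intros x. fold k'. fold K'. rewrite Im_sn. ring.
  + f_equal. apply RInt_extR. intros x. fold k'. fold K'.
    destruct (jac_real x) as (_ & _ & p). rewrite p. reflexivity.
Qed.

Lemma dn_mass : RInt (fun x => dnR (2 * K' * x) k) (- (a / 2)) (a / 2) = PI / (2 * K') :> R.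
Proof.
assert (h := hK'). assert (e := RInt_lin (fun u => dnR u k) (2 * K') 0 (- (a / 2)) (a / 2) (cont_dnR k hk)).
replace (2 * K' * - (a / 2) + 0) with (- ellK k) in e by (unfold a; fold K; field; lra).
replace (2 * K' * (a / 2) + 0) with (ellK k) in e by (unfold a; fold K; field; lra).
rewrite RInt_dnR in e by exact hk.
rewrite (RInt_extR _ (fun x => dnR (2 * K' * x) k)) in e by (intros; f_equal; ring).
apply (Rmult_eq_reg_l (2 * K')); [|lra]. rewrite e. field. lra.
Qed.

(** As [s -> 1/2] the kernel [Q s] concentrates at [0]: away from [0] it is at most
    [cn (2 K' s, k') / (k sn (2 K' s, k') sn (2 K' x, k))^2], and its mass is read off from [dn]. *)
Lemma Q_limit (phi F G : R -> R) (C : R) : cont phi -> cont F -> cont G ->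
  (forall x, Rabs x <= a / 2 -> Rabs (phi x - dnR (2 * K' * x) k) <= C * snR (2 * K' * x) k ^ 2) ->
  (forall s, 0 < s < / 2 -> F s = G s * RInt (fun x => phi x * Q s x) (- (a / 2)) (a / 2)) ->
  F (/ 2) = G (/ 2) * (PI / (2 * K') / k).
Proof.
intros hphi hF hG hC hs. assert (ha := aspect_pos). assert (hKp := hK').
set (m := PI / (2 * K')).
assert (C0 : 0 <= C).
{ assert (h := hC (a / 2) ltac:(rewrite Rabs_pos_eq; lra)).
  replace (2 * K' * (a / 2)) with K in h by (unfold a; field; lra).
  destruct (jacR_ellK k hk) as (e & _ & _). fold K in e. rewrite e in h.
  assert (h0 := Rabs_pos (phi (a / 2) - dnR K k)). lra. }
(* Multiplying by sn^2 cancels the sn^2 in the denominator of the bound on [Q s]; both sides then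
   stay continuous at s = 0, and the factor is 1 at s = 1/2. *)
assert (hb : forall s, 0 < s < / 2 ->
  Rabs (snR (2 * K' * s) k' ^ 2 * (F s - G s * (m / dnR (2 * K' * s) k'))) <=
  Rabs (G s) * (a * (C / k ^ 2 * cnR (2 * K' * s) k'))).
{ intros s hs0. assert (hs' : Rabs s < / 2) by (rewrite Rabs_pos_eq; lra).
  assert (cq := cont_Q s hs'). assert (hy := strip_scale K' s hKp hs').
  assert (hcn := cnR_pos _ k' hk' hy). fold K' in hcn.
  assert (hdn := dnR_pos (2 * K' * s) k' hk').
  (* The coefficient of order 0 of dn is the same on all lines and equals [m] by [dn_mass]. *)
  assert (e : dnR (2 * K' * s) k' * RInt (fun x => dnR (2 * K' * x) k * Q s x) (- (a / 2)) (a / 2) = m).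
  { assert (e := dn_coeff_on_line 0 s hs').
    replace (2 * PI * 0 * a) with 0 in e by ring. specialize (e cos_0 sin_0).
    replace (2 * PI * 0 * s) with 0 in e by ring.
    replace (cosh 0) with 1 in e by (unfold cosh; rewrite Ropp_0, exp_0; field).
    rewrite (RInt_extR (fun x => dnR (2 * K' * x) k * cos (2 * PI * 0 * x) * Q s x)
      (fun x => dnR (2 * K' * x) k * Q s x)) in e
      by (intros x; replace (2 * PI * 0 * x) with 0 by ring; rewrite cos_0; ring).
    rewrite (RInt_extR (fun x => dnR (2 * K' * x) k * cos (2 * PI * 0 * x))
      (fun x => dnR (2 * K' * x) k)) in e
      by (intros x; replace (2 * PI * 0 * x) with 0 by ring; rewrite cos_0; ring).
    rewrite dn_mass in e. rewrite e. unfold m. ring. }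
  assert (e' : m / dnR (2 * K' * s) k' = RInt (fun x => dnR (2 * K' * x) k * Q s x) (- (a / 2)) (a / 2)).
  { rewrite <- e. field. lra. }
  rewrite e', hs, <- Rmult_minus_distr_l by exact hs0.
  rewrite <- RInt_minusR by ctj.
  replace (snR (2 * K' * s) k' ^ 2 * (G s * RInt (fun x => phi x * Q s x - dnR (2 * K' * x) k * Q s x) (- (a / 2)) (a / 2)))
    with (G s * (snR (2 * K' * s) k' ^ 2 * RInt (fun x => phi x * Q s x - dnR (2 * K' * x) k * Q s x) (- (a / 2)) (a / 2)))
    by ring.
  rewrite Rabs_mult. apply Rmult_le_compat_l; [apply Rabs_pos|].
  rewrite <- RInt_scalR by ctj.
  replace a with (a / 2 - - (a / 2)) at 3 by field.
  apply RInt_bound_const; [lra|ctj|].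
  intros x hx. specialize (hC x ltac:(apply Rabs_le; lra)).
  assert (hd := jac_den_pos (2 * K' * x) (2 * K' * s) k hk hy). unfold Q.
  set (D := jac_den (2 * K' * x, 2 * K' * s) k) in *.
  assert (hD : k ^ 2 * snR (2 * K' * x) k ^ 2 * snR (2 * K' * s) k' ^ 2 <= D).
  { unfold D, jac_den. simpl Re. simpl Im. fold k'. assert (h := pow2_ge_0 (cnR (2 * K' * s) k')). lra. }
  assert (hk2 : 0 < k ^ 2) by (apply pow_lt; lra).
  replace (snR (2 * K' * s) k' ^ 2 * (phi x * (cnR (2 * K' * s) k' / D) - dnR (2 * K' * x) k * (cnR (2 * K' * s) k' / D)))
    with ((phi x - dnR (2 * K' * x) k) * (snR (2 * K' * s) k' ^ 2 * cnR (2 * K' * s) k' / D)) by (field; lra).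
  assert (hw : 0 <= snR (2 * K' * s) k' ^ 2 * cnR (2 * K' * s) k' / D).
  { apply Rdiv_le_0_compat; [|exact hd]. apply Rmult_le_pos; [apply pow2_ge_0|lra]. }
  rewrite Rabs_mult, (Rabs_pos_eq _ hw).
  apply Rle_trans with (C * snR (2 * K' * x) k ^ 2 * (snR (2 * K' * s) k' ^ 2 * cnR (2 * K' * s) k' / D)).
  { apply Rmult_le_compat_r; [exact hw|exact hC]. }
  replace (C * snR (2 * K' * x) k ^ 2 * (snR (2 * K' * s) k' ^ 2 * cnR (2 * K' * s) k' / D)) with
    (C / k ^ 2 * cnR (2 * K' * s) k' * (k ^ 2 * snR (2 * K' * x) k ^ 2 * snR (2 * K' * s) k' ^ 2 / D))
    by (field; lra).
  rewrite <- (Rmult_1_r (C / k ^ 2 * cnR (2 * K' * s) k')) at 2.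
  apply Rmult_le_compat_l.
  - apply Rmult_le_pos; [apply Rdiv_le_0_compat; lra|lra].
  - apply (Rmult_le_reg_r D); [exact hd|]. unfold Rdiv. rewrite Rmult_assoc, Rinv_l, Rmult_1_r by lra. lra. }
assert (cs' := cont_snR k' hk'). assert (cc' := cont_cnR k' hk').
assert (h := le_at_endpoint
  (fun s => snR (2 * K' * s) k' ^ 2 * (F s - G s * (m / dnR (2 * K' * s) k')))
  (fun s => Rabs (G s) * (a * (C / k ^ 2 * cnR (2 * K' * s) k'))) 0 (/ 2) ltac:(lra)).
cbv beta in h.
assert (c1 : cont (fun s => snR (2 * K' * s) k' ^ 2 * (F s - G s * (m / dnR (2 * K' * s) k')))).
{ ctj. intros s. apply Rgt_not_eq, dnR_pos, hk'. }
assert (c2 : cont (fun s => Rabs (G s) * (a * (C / k ^ 2 * cnR (2 * K' * s) k')))) by ctj.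
specialize (h c1 c2 hb).
replace (2 * K' * / 2) with K' in h by field.
(* At s = 1/2 the argument is K', where sn = 1, where cn = 0 kills the bound, and where dn is the
   complement of k', that is k. *)
destruct (jacR_ellK k' hk') as (j1 & j2 & j3). fold K' in j1, j2, j3.
unfold k' in j3 at 2. rewrite comod_comod in j3 by exact hk.
rewrite j1, j2, j3 in h.
replace (Rabs (G (/ 2)) * (a * (C / k ^ 2 * 0))) with 0 in h by ring.
assert (h0 := Rabs_pos (1 ^ 2 * (F (/ 2) - G (/ 2) * (m / k)))).
assert (h1 : Rabs (1 ^ 2 * (F (/ 2) - G (/ 2) * (m / k))) = 0) by lra.
apply Rabs_eq_0 in h1. fold m. lra.
Qed.

(** Makes the factor cos (2 pi l x) admissible in [Q_limit]: its quadratic deviation from 1 is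
    measured by sn^2 through [snR_sqr_ge]. *)
Lemma phi_cos (l x : R) : Rabs x <= a / 2 ->
  Rabs (1 - cos (2 * PI * l * x)) <= 2 * (2 * PI * l) ^ 2 / (k' ^ 2 * (2 * K') ^ 2) * snR (2 * K' * x) k ^ 2.
Proof.
intros hx. assert (hKp := hK'). assert (hkp := hk').
eapply Rle_trans; [apply one_minus_cos_bound|].
assert (h := snR_sqr_ge (2 * K' * x) k hk). fold k' in h.
assert (hb : Rabs (2 * K' * x) <= ellK k).
{ rewrite !Rabs_mult, (Rabs_pos_eq 2), (Rabs_pos_eq K') by lra.
  replace (ellK k) with (2 * K' * (a / 2)) by (unfold a; fold K; field; lra).
  apply Rmult_le_compat_l; lra. }
specialize (h hb).
set (S2 := snR (2 * K' * x) k ^ 2) in *.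
replace ((2 * PI * l * x) ^ 2 / 2) with
  ((2 * PI * l) ^ 2 / (2 * (k' ^ 2 * (2 * K') ^ 2)) * (k' ^ 2 * (2 * K' * x) ^ 2)) by (field; lra).
replace (2 * (2 * PI * l) ^ 2 / (k' ^ 2 * (2 * K') ^ 2) * S2) with
  ((2 * PI * l) ^ 2 / (2 * (k' ^ 2 * (2 * K') ^ 2)) * (4 * S2)) by (field; lra).
apply Rmult_le_compat_l; [|exact h].
apply Rdiv_le_0_compat; [apply pow2_ge_0|].
assert (0 < k' ^ 2 * (2 * K') ^ 2) by (apply Rmult_lt_0_compat; apply pow_lt; lra). lra.
Qed.

(** [Q_limit] with [G] equal to dn (2 K' s, k'), whose boundary value k cancels the 1/k in the mass
    of the kernel. *)
Lemma dn_coeff (l : R) : cos (2 * PI * l * a) = 1 -> sin (2 * PI * l * a) = 0 ->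
  RInt (fun x => dnR (2 * K' * x) k * cos (2 * PI * l * x)) (- (a / 2)) (a / 2) =
  PI / (2 * K') / cosh (PI * l).
Proof.
intros h1 h2.
set (be := RInt _ _ _).
set (C := 2 * (2 * PI * l) ^ 2 / (k' ^ 2 * (2 * K') ^ 2)).
assert (e := Q_limit (fun x => dnR (2 * K' * x) k * cos (2 * PI * l * x))
  (fun s => cosh (2 * PI * l * s) * be) (fun s => dnR (2 * K' * s) k') C
  ltac:(ctj) ltac:(ctj) ltac:(ctj)).
cbv beta in e.
replace (2 * PI * l * / 2) with (PI * l) in e by field.
replace (2 * K' * / 2) with K' in e by field.
destruct (jacR_ellK k' hk') as (j1 & j2 & j3). fold K' in j1, j2, j3.
unfold k' in j3 at 2. rewrite comod_comod in j3 by exact hk. rewrite j3 in e.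
assert (hch := cosh_pos (PI * l)). assert (hKp := hK').
apply (Rmult_eq_reg_l (cosh (PI * l))); [|lra]. rewrite e.
- field. lra.
- intros x hx. replace (dnR (2 * K' * x) k * cos (2 * PI * l * x) - dnR (2 * K' * x) k) with
    (- (dnR (2 * K' * x) k * (1 - cos (2 * PI * l * x)))) by ring.
  rewrite Rabs_Ropp, Rabs_mult. assert (h := phi_cos l x hx). fold C in h.
  assert (hd := dnR_le_1 (2 * K' * x) k hk). assert (p1 := Rabs_pos (1 - cos (2 * PI * l * x))).
  assert (p2 := Rabs_pos (dnR (2 * K' * x) k)). nra.
- intros s hs. symmetry. apply dn_coeff_on_line; auto. rewrite Rabs_pos_eq; lra.
Qed.

(** dn^2 - cn^2 = k'^2 sn^2, and dn + cn >= k' on this interval because cn >= 0 there. *)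
Lemma cn_dn_close (x : R) : Rabs x <= a / 2 ->
  Rabs (cnR (2 * K' * x) k - dnR (2 * K' * x) k) <= / k' * snR (2 * K' * x) k ^ 2.
Proof.
intros hx. assert (hKp := hK'). assert (hkp := hk').
assert (hb : Rabs (2 * K' * x) <= ellK k).
{ rewrite !Rabs_mult, (Rabs_pos_eq 2), (Rabs_pos_eq K') by lra.
  replace (ellK k) with (2 * K' * (a / 2)) by (unfold a; fold K; field; lra).
  apply Rmult_le_compat_l; lra. }
assert (h1 := cnR_nonneg _ k hk hb). assert (h2 := dnR_bounds (2 * K' * x) k hk). fold k' in h2.
assert (h3 := snR_cnR (2 * K' * x) k). assert (h4 := snR_dnR (2 * K' * x) k hk).
assert (h5 := snR_sqr_le (2 * K' * x) k).
set (s := snR (2 * K' * x) k) in *. set (c := cnR (2 * K' * x) k) in *. set (d := dnR (2 * K' * x) k) in *.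
apply (Rmult_le_reg_l k'); [lra|].
replace (k' * (/ k' * s ^ 2)) with (s ^ 2) by (field; lra).
assert (hk2 : 0 < k ^ 2 < 1) by nra.
assert (e : (d - c) * (d + c) = (1 - k ^ 2) * s ^ 2) by nra.
assert (hdc : 0 <= d - c) by nra.
rewrite Rabs_minus_sym, Rabs_pos_eq by exact hdc.
apply Rle_trans with ((d - c) * (d + c)).
- rewrite (Rmult_comm k'). apply Rmult_le_compat_l; lra.
- rewrite e. nra.
Qed.

(** Re cn carries no factor that depends on s alone besides [Q s], so [G] is 1 and the 1/k of the
    kernel mass survives. *)
Lemma cn_coeff (l : R) : cos (2 * PI * l * a) = -1 -> sin (2 * PI * l * a) = 0 ->
  RInt (fun x => cnR (2 * K' * x) k * cos (2 * PI * l * x)) (- (a / 2)) (a / 2) =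
  PI / (2 * K') / k / cosh (PI * l).
Proof.
intros h1 h2. set (be := RInt _ _ _).
set (C := 2 * (2 * PI * l) ^ 2 / (k' ^ 2 * (2 * K') ^ 2)).
assert (e := Q_limit (fun x => cnR (2 * K' * x) k * cos (2 * PI * l * x))
  (fun s => cosh (2 * PI * l * s) * be) (fun s => 1) (C + / k')
  ltac:(ctj) ltac:(ctj) ltac:(ctj)).
cbv beta in e.
replace (2 * PI * l * / 2) with (PI * l) in e by field.
assert (hch := cosh_pos (PI * l)). assert (hKp := hK').
apply (Rmult_eq_reg_l (cosh (PI * l))); [|lra]. rewrite e.
- field. lra.
- intros x hx. replace (cnR (2 * K' * x) k * cos (2 * PI * l * x) - dnR (2 * K' * x) k) with
    (- (cnR (2 * K' * x) k * (1 - cos (2 * PI * l * x))) + (cnR (2 * K' * x) k - dnR (2 * K' * x) k)) by ring.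
  eapply Rle_trans; [apply Rabs_triang|].
  rewrite Rabs_Ropp, Rabs_mult. assert (h := phi_cos l x hx). fold C in h.
  assert (hd := cnR_le_1 (2 * K' * x) k). assert (p1 := Rabs_pos (1 - cos (2 * PI * l * x))).
  assert (p2 := Rabs_pos (cnR (2 * K' * x) k)). assert (h' := cn_dn_close x hx). nra.
- intros s hs. symmetry. rewrite Rmult_1_l. apply cn_coeff_on_line; auto. rewrite Rabs_pos_eq; lra.
Qed.

(** For sn it is the imaginary part that carries the positive kernel, against cn dn cos, which
    agrees with dn to second order at 0. Sine coefficients on the real line thus come with sinh, and
    [G] = sn (2 K' s, k') is 1 at the boundary. *)
Lemma sn_coeff (l : R) : cos (2 * PI * l * a) = -1 -> sin (2 * PI * l * a) = 0 ->
  sinh (PI * l) * RInt (fun x => snR (2 * K' * x) k * sin (2 * PI * l * x)) (- (a / 2)) (a / 2) =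
  PI / (2 * K') / k.
Proof.
intros h1 h2.
set (be := RInt _ _ _).
set (C := 2 * (2 * PI * l) ^ 2 / (k' ^ 2 * (2 * K') ^ 2)).
assert (e := Q_limit (fun x => cnR (2 * K' * x) k * dnR (2 * K' * x) k * cos (2 * PI * l * x))
  (fun s => sinh (2 * PI * l * s) * be) (fun s => snR (2 * K' * s) k') (C + 1)
  ltac:(ctj) ltac:(ctj) ltac:(ctj)).
cbv beta in e.
replace (2 * PI * l * / 2) with (PI * l) in e by field.
replace (2 * K' * / 2) with K' in e by field.
destruct (jacR_ellK k' hk') as (j1 & j2 & j3). fold K' in j1, j2, j3. rewrite j1 in e.
rewrite e; [ring| |].
- intros x hx.
  assert (hKp := hK').
  assert (hb : Rabs (2 * K' * x) <= ellK k).
  { rewrite !Rabs_mult, (Rabs_pos_eq 2), (Rabs_pos_eq K') by lra.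
    replace (ellK k) with (2 * K' * (a / 2)) by (unfold a; fold K; field; lra).
    apply Rmult_le_compat_l; lra. }
  assert (h0 := cnR_nonneg _ k hk hb). assert (h3 := snR_cnR (2 * K' * x) k).
  replace (cnR (2 * K' * x) k * dnR (2 * K' * x) k * cos (2 * PI * l * x) - dnR (2 * K' * x) k) with
    (- (cnR (2 * K' * x) k * dnR (2 * K' * x) k * (1 - cos (2 * PI * l * x))) +
     - (dnR (2 * K' * x) k * (1 - cnR (2 * K' * x) k))) by ring.
  eapply Rle_trans; [apply Rabs_triang|].
  rewrite !Rabs_Ropp, !(Rabs_mult _ (1 - _)). assert (h := phi_cos l x hx). fold C in h.
  assert (hd := Rabs_mult_le_1 _ _ (cnR_le_1 (2 * K' * x) k) (dnR_le_1 (2 * K' * x) k hk)).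
  assert (p1 := Rabs_pos (1 - cos (2 * PI * l * x))).
  assert (p2 := Rabs_pos (cnR (2 * K' * x) k * dnR (2 * K' * x) k)).
  assert (hd2 := dnR_le_1 (2 * K' * x) k hk). assert (p3 := Rabs_pos (dnR (2 * K' * x) k)).
  assert (hc1 : Rabs (1 - cnR (2 * K' * x) k) <= snR (2 * K' * x) k ^ 2).
  { assert (hc := cnR_le_1 (2 * K' * x) k). rewrite Rabs_pos_eq in hc by exact h0.
    rewrite Rabs_pos_eq by lra. nra. }
  assert (p4 := Rabs_pos (1 - cnR (2 * K' * x) k)). nra.
- intros s hs. symmetry. apply sn_coeff_on_line; auto. rewrite Rabs_pos_eq; lra.
Qed.

End Coefficients.

(** * Fourier series of sn, cn and dn *)

(** [phase e n]: the exponential [exp (2 pi i n x / a)] has period [a] up to the factor [e]. *)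
Definition phase (e n : R) : Prop := cos (2 * PI * n) = e /\ sin (2 * PI * n) = 0.

Lemma phase_plus (e e' m n : R) : phase e m -> phase e' n -> phase (e * e') (m + n).
Proof.
intros [h1 h2] [h3 h4]. unfold phase. rewrite Rmult_plus_distr_l, cos_plus, sin_plus, h1, h2, h3, h4.
split; ring.
Qed.

Lemma phase_opp (e n : R) : phase e n -> phase e (- n).
Proof.
intros [h1 h2]. unfold phase. rewrite <- Ropp_mult_distr_r, cos_neg, sin_neg, h2. split; [exact h1|ring].
Qed.

Lemma phase_INR (j : nat) : phase 1 (INR j).
Proof.
unfold phase. replace (2 * PI * INR j) with (0 + 2 * INR j * PI) by ring.
now rewrite cos_period, sin_period, cos_0, sin_0.
Qed.

Lemma phase_half : phase (-1) (/ 2).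
Proof.
unfold phase. replace (2 * PI * / 2) with PI by field. rewrite cos_PI, sin_PI. now split.
Qed.

Lemma phase_index (s e : R) : phase e s -> forall j, phase e (INR j + s) /\ phase e (s - 1 - INR j).
Proof.
intros h j. split.
- rewrite <- (Rmult_1_l e). apply phase_plus; [apply phase_INR|exact h].
- replace (s - 1 - INR j) with (- INR (S j) + s) by (rewrite S_INR; ring).
  rewrite <- (Rmult_1_l e). apply phase_plus; [apply phase_opp, phase_INR|exact h].
Qed.

Lemma phase_0 : phase 1 0.
Proof. apply (phase_INR 0). Qed.

(** The cosine coefficients of the even part of [f] about [x] are the terms of the Fourier series of
    [f] at [x], which reduces convergence at every point to convergence at 0. *)
Lemma coeff_translate (f : R -> R) (a e l x : R) : 0 < a -> cont f -> (forall x, f (x + a) = e * f x) ->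
  e ^ 2 = 1 -> phase e (l * a) ->
  RInt (fun t => / 2 * (f (x + t) + f (x - t)) * cos (2 * PI * l * t)) (- (a / 2)) (a / 2) =
  RInt (fun t => f t * cos (2 * PI * l * t)) (- (a / 2)) (a / 2) * cos (2 * PI * l * x) +
  RInt (fun t => f t * sin (2 * PI * l * t)) (- (a / 2)) (a / 2) * sin (2 * PI * l * x).
Proof.
intros ha hf hper he [h1 h2].
replace (2 * PI * (l * a)) with (2 * PI * l * a) in * by ring.
assert (e1 : RInt (fun t => f (x + t) * cos (2 * PI * l * t)) (- (a / 2)) (a / 2) =
  RInt (fun t => f t * cos (2 * PI * l * (t - x))) (- (a / 2)) (a / 2)).
{ rewrite <- (RInt_period (fun t => f t * cos (2 * PI * l * (t - x))) a x).
  - replace (x - a / 2) with (- (a / 2) + x) by ring. replace (x + a / 2) with (a / 2 + x) by ring.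
    rewrite <- (RInt_shift (fun t => f t * cos (2 * PI * l * (t - x)))) by ct.
    apply RInt_extR. intros t. rewrite (Rplus_comm t x). do 2 f_equal. ring.
  - ct.
  - intros t. rewrite hper. replace (2 * PI * l * (t + a - x)) with (2 * PI * l * (t - x) + 2 * PI * l * a) by ring.
    rewrite cos_plus, h1, h2.
    replace (e * f t * (cos (2 * PI * l * (t - x)) * e - sin (2 * PI * l * (t - x)) * 0)) with
      (e ^ 2 * (f t * cos (2 * PI * l * (t - x)))) by ring. rewrite he. ring. }
assert (e2 : RInt (fun t => f (x - t) * cos (2 * PI * l * t)) (- (a / 2)) (a / 2) =
  RInt (fun t => f (x + t) * cos (2 * PI * l * t)) (- (a / 2)) (a / 2)).
{ assert (r := RInt_reflect (fun t => f (x + t) * cos (2 * PI * l * t)) (- (a / 2)) (a / 2) ltac:(ct)).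
  rewrite Ropp_involutive in r. rewrite <- r. apply RInt_extR. intros t.
  replace (2 * PI * l * - t) with (- (2 * PI * l * t)) by ring. rewrite cos_neg. reflexivity. }
rewrite (RInt_extR _ (fun t => / 2 * (f (x + t) * cos (2 * PI * l * t) + f (x - t) * cos (2 * PI * l * t))))
  by (intros; ring).
rewrite RInt_scalR, RInt_plusR, e2, e1 by ct.
rewrite (RInt_extR _ (fun t => cos (2 * PI * l * x) * (f t * cos (2 * PI * l * t)) +
  sin (2 * PI * l * x) * (f t * sin (2 * PI * l * t)))).
- rewrite RInt_plusR, !RInt_scalR by ct.
  set (A := RInt (fun t => f t * cos (2 * PI * l * t)) _ _).
  set (B := RInt (fun t => f t * sin (2 * PI * l * t)) _ _). change (@eq R (/ 2 * (cos (2 * PI * l * x) * A + sin (2 * PI * l * x) * B + (cos (2 * PI * l * x) * A + sin (2 * PI * l * x) * B))) (A * cos (2 * PI * l * x) + B * sin (2 * PI * l * x))). field.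
- intros t. rewrite Rmult_minus_distr_l, cos_minus. ring.
Qed.

Lemma fourier_sum (f : R -> R) (a e s x C l : R) : 0 < a -> cont f ->
  (forall x, f (x + a) = e * f x) -> e ^ 2 = 1 -> phase e s -> s = 0 \/ s = / 2 ->
  (forall t, Rabs t <= a / 2 -> Rabs (/ 2 * (f (x + t) + f (x - t)) - f x) <= C * t ^ 2) ->
  is_lim_seq (bs (fun n => / a *
    (RInt (fun t => f t * cos (2 * PI * (n / a) * t)) (- (a / 2)) (a / 2) * cos (2 * PI * (n / a) * x) +
     RInt (fun t => f t * sin (2 * PI * (n / a) * t)) (- (a / 2)) (a / 2) * sin (2 * PI * (n / a) * x))) s) l ->
  l = f x.
Proof.
intros ha hf hper he hph hs hC hl.
set (G := fun t => / 2 * (f (x + t) + f (x - t))).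
replace (f x) with (G 0) by (unfold G; rewrite Rplus_0_r, Rminus_0_r; field).
apply (fourier_pointwise a s ha hs G C).
- unfold G. ct.
- intros t ht. replace (G 0) with (f x) by (unfold G; rewrite Rplus_0_r, Rminus_0_r; field). now apply hC.
- refine (is_lim_seq_ext _ _ _ _ hl). intros N.
  apply bs_ext; intros j; f_equal;
  (rewrite <- (coeff_translate f a e); [| | | | |];
  [apply RInt_extR; intros t; unfold G; f_equal; f_equal; field; lra|exact ha|exact hf|exact hper|exact he|]).
  + replace ((INR j + s) / a * a) with (INR j + s) by (field; lra). now apply phase_index.
  + replace ((s - 1 - INR j) / a * a) with (s - 1 - INR j) by (field; lra). now apply phase_index.
Qed.

(** * Geometric decay of the coefficients *)

Lemma exp_pow (x : R) (j : nat) : exp x ^ j = exp (x * INR j).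
Proof.
induction j as [|j IH]; [simpl; rewrite Rmult_0_r, exp_0; reflexivity|].
rewrite S_INR. simpl. rewrite IH, <- exp_plus. f_equal. ring.
Qed.

Lemma sech_le_exp (z : R) : / cosh z <= 2 * exp (- Rabs z).
Proof.
assert (h : exp (Rabs z) <= 2 * cosh z).
{ unfold cosh. assert (h1 := exp_pos z). assert (h2 := exp_pos (- z)).
  unfold Rabs. destruct (Rcase_abs z); lra. }
assert (hp := exp_pos (Rabs z)).
rewrite exp_Ropp. replace (2 * / exp (Rabs z)) with (/ (exp (Rabs z) / 2)) by (field; lra).
apply Rinv_le_contravar; lra.
Qed.

Lemma sech_geom (b n : R) (j : nat) : 0 < b -> INR j <= Rabs n ->
  / cosh (PI * (n * b)) <= 2 * exp (- (PI * b)) ^ j.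
Proof.
intros hb hn. eapply Rle_trans; [apply sech_le_exp|].
apply Rmult_le_compat_l; [lra|]. rewrite exp_pow.
assert (hpi := PI_RGT_0).
rewrite !Rabs_mult, (Rabs_pos_eq PI), (Rabs_pos_eq b) by lra.
assert (h : - (PI * (Rabs n * b)) <= - (PI * b) * INR j).
{ replace (PI * (Rabs n * b)) with (PI * b * Rabs n) by ring.
  assert (0 < PI * b) by (apply Rmult_lt_0_compat; lra). nra. }
destruct h as [h|h]; [left; now apply exp_increasing|rewrite h; lra].
Qed.

Lemma csch_geom (b n : R) (j : nat) : 0 < b -> INR j <= Rabs n -> / 2 <= Rabs n ->
  Rabs (/ sinh (PI * (n * b))) <= 4 / (PI * b) * exp (- (PI * (b / 2))) ^ j.
Proof.
intros hb hn hn2. assert (hpi := PI_RGT_0). assert (hpb : 0 < PI * b) by (apply Rmult_lt_0_compat; lra).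
set (z := PI * (n * b)).
assert (hz : Rabs z = PI * b * Rabs n).
{ unfold z. rewrite !Rabs_mult, (Rabs_pos_eq PI), (Rabs_pos_eq b) by lra. ring. }
assert (hs : Rabs (sinh z) = sinh (Rabs z)).
{ unfold Rabs at 2. destruct (Rcase_abs z) as [h|h].
  - rewrite sinh_neg, Rabs_left1; [reflexivity|]. assert (h1 := sinh_ge (- z) ltac:(lra)).
    rewrite sinh_neg in h1. lra.
  - apply Rabs_pos_eq. assert (h1 := sinh_ge z ltac:(lra)). lra. }
assert (hz0 : PI * b / 2 <= Rabs z) by (rewrite hz; nra).
(* In sinh z = 2 sinh (z/2) cosh (z/2) the factor sinh (z/2) is at least z/2 >= pi b / 4. The
   remaining cosh (z/2) is the reason for the rate with [b / 2]. *)
assert (hlow : PI * b / 2 * cosh (Rabs z / 2) <= sinh (Rabs z)).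
{ replace (Rabs z) with (Rabs z / 2 + Rabs z / 2) at 2 by field. rewrite sinh_plus.
  assert (h1 := sinh_ge (Rabs z / 2) ltac:(lra)). assert (h2 := cosh_pos (Rabs z / 2)). nra. }
rewrite Rabs_inv, hs. assert (hc := cosh_pos (Rabs z / 2)).
apply Rle_trans with (/ (PI * b / 2 * cosh (Rabs z / 2))).
{ apply Rinv_le_contravar; [apply Rmult_lt_0_compat; lra|exact hlow]. }
replace (Rabs z / 2) with (PI * (Rabs n * (b / 2))) in * by (rewrite hz; field).
assert (h := sech_geom (b / 2) (Rabs n) j ltac:(lra) ltac:(rewrite Rabs_Rabsolu; exact hn)).
replace (/ (PI * b / 2 * cosh (PI * (Rabs n * (b / 2))))) with
  (2 / (PI * b) * / cosh (PI * (Rabs n * (b / 2)))) by (field; lra).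
replace (4 / (PI * b) * exp (- (PI * (b / 2))) ^ j) with
  (2 / (PI * b) * (2 * exp (- (PI * (b / 2))) ^ j)) by (field; lra).
apply Rmult_le_compat_l; [|exact h]. apply Rlt_le, Rdiv_lt_0_compat; lra.
Qed.

Lemma exp_ratio (b : R) : 0 < b -> 0 < exp (- (PI * b)) < 1.
Proof.
intros hb. split; [apply exp_pos|]. rewrite <- exp_0. apply exp_increasing.
assert (hpi := PI_RGT_0). assert (0 < PI * b) by (apply Rmult_lt_0_compat; lra). lra.
Qed.

Lemma index_abs (s : R) (j : nat) : s = 0 \/ s = / 2 ->
  INR j <= Rabs (INR j + s) /\ INR j <= Rabs (s - 1 - INR j).
Proof.
intros hs. assert (h := pos_INR j). split.
- rewrite Rabs_pos_eq; destruct hs; lra.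
- rewrite Rabs_left1; destruct hs; lra.
Qed.

Lemma index_half (j : nat) : / 2 <= Rabs (INR j + / 2) /\ / 2 <= Rabs (/ 2 - 1 - INR j).
Proof.
assert (h := pos_INR j). split; [rewrite Rabs_pos_eq|rewrite Rabs_left1]; lra.
Qed.

(** [fser h s f]: the bilateral series of the functions [h n] converges to [f] uniformly
    at a geometric rate. *)
Definition fser (h : R -> R -> R) (s : R) (f : R -> R) : Prop :=
  exists B r, 0 < r < 1 /\ forall N x, Rabs (bs (fun n => h n x) s N - f x) <= B * r ^ N.

(** The geometric bounds already give convergence at a rate uniform in x; the last hypothesis,
    supplied by Fejer's theorem, only names the limit. *)
Lemma fser_intro (h : R -> R -> R) (s B r : R) (f : R -> R) : 0 < r < 1 ->
  (forall j x, Rabs (h (INR j + s) x) <= B * r ^ j /\ Rabs (h (s - 1 - INR j) x) <= B * r ^ j) ->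
  (forall x (l : R), is_lim_seq (bs (fun n => h n x) s) l -> l = f x) -> fser h s f.
Proof.
intros hr hb hl. exists (2 * B / (1 - r)), r. split; [exact hr|]. intros N x.
assert (hb' : forall j, Rabs (h (INR j + s) x) + Rabs (h (s - 1 - INR j) x) <= 2 * B * r ^ j).
{ intros j. destruct (hb j x). lra. }
destruct (bs_cauchy (fun n => h n x) s (2 * B) r hr hb') as [l hlim].
rewrite <- (hl x l hlim).
apply (bs_tail_lim (fun n => h n x) s (2 * B) r l N hr hb' hlim).
Qed.

Section Series.

Variable k : R.
Hypothesis hk : 0 < k < 1.
Let k' := comod k.
Let K := ellK k.
Let K' := ellK k'.
Let b := K' / K.

Let hk' : 0 < k' < 1 := comod_range k hk.
Let hK : 0 < K := ellK_pos k hk.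
Let hK' : 0 < K' := ellK_pos k' hk'.

Lemma freq_eq (n : R) : n / (K / K') = n * b.
Proof. assert (h := hK). assert (h' := hK'). unfold b. field. lra. Qed.

Lemma freq_phase (e n : R) : phase e n ->
  cos (2 * PI * (n * b) * (K / K')) = e /\ sin (2 * PI * (n * b) * (K / K')) = 0.
Proof.
intros h. replace (2 * PI * (n * b) * (K / K')) with (2 * PI * n); [exact h|].
assert (h1 := hK). assert (h' := hK'). unfold b. field. lra.
Qed.

Lemma b_pos : 0 < b.
Proof. apply Rdiv_lt_0_compat; [exact hK'|exact hK]. Qed.

Lemma RInt_even_sin (f : R -> R) (l c : R) : cont f -> (forall x, f (- x) = f x) ->
  RInt (fun t => f t * sin (2 * PI * l * t)) (- c) c = 0 :> R.
Proof.
intros hf he. apply RInt_odd; [ct|]. intros x. rewrite he.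
replace (2 * PI * l * - x) with (- (2 * PI * l * x)) by ring. rewrite sin_neg. ring.
Qed.

Lemma RInt_odd_cos (f : R -> R) (l c : R) : cont f -> (forall x, f (- x) = - f x) ->
  RInt (fun t => f t * cos (2 * PI * l * t)) (- c) c = 0 :> R.
Proof.
intros hf he. apply RInt_odd; [ct|]. intros x. rewrite he.
replace (2 * PI * l * - x) with (- (2 * PI * l * x)) by ring. rewrite cos_neg. ring.
Qed.

Lemma dn_scaled : cont (fun x => dnR (2 * K' * x) k) /\
  (forall x, dnR (2 * K' * - x) k = dnR (2 * K' * x) k) /\
  (forall x, dnR (2 * K' * (x + K / K')) k = 1 * dnR (2 * K' * x) k).
Proof.
split; [ctj|split]; intros x.
- replace (2 * K' * - x) with (- (2 * K' * x)) by ring. now apply dnR_opp.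
- assert (e := aspect_scale k hk x). cbv zeta in e. fold k' K K' in e. rewrite e. unfold K.
  rewrite dnR_2K by exact hk. ring.
Qed.

Lemma cn_scaled : cont (fun x => cnR (2 * K' * x) k) /\
  (forall x, cnR (2 * K' * - x) k = cnR (2 * K' * x) k) /\
  (forall x, cnR (2 * K' * (x + K / K')) k = -1 * cnR (2 * K' * x) k).
Proof.
split; [ctj|split]; intros x.
- replace (2 * K' * - x) with (- (2 * K' * x)) by ring. now apply cnR_opp.
- assert (e := aspect_scale k hk x). cbv zeta in e. fold k' K K' in e. rewrite e. unfold K.
  rewrite cnR_2K by exact hk. ring.
Qed.

Lemma sn_scaled : cont (fun x => snR (2 * K' * x) k) /\
  (forall x, snR (2 * K' * - x) k = - snR (2 * K' * x) k) /\
  (forall x, snR (2 * K' * (x + K / K')) k = -1 * snR (2 * K' * x) k).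
Proof.
split; [ctj|split]; intros x.
- replace (2 * K' * - x) with (- (2 * K' * x)) by ring. now apply snR_opp.
- assert (e := aspect_scale k hk x). cbv zeta in e. fold k' K K' in e. rewrite e. unfold K.
  rewrite snR_2K by exact hk. ring.
Qed.

Theorem dn_series : fser (fun n x => PI / (2 * K) * (/ cosh (PI * (n * b)) * cos (2 * PI * (n * b) * x))) 0
  (fun x => dnR (2 * K' * x) k).
Proof.
assert (hKp := hK). assert (hKp' := hK'). assert (hpi := PI_RGT_0).
assert (ha : 0 < K / K') by now apply Rdiv_lt_0_compat.
destruct dn_scaled as (hc & he & hp).
assert (hC0 : 0 < PI / (2 * K)) by (apply Rdiv_lt_0_compat; lra).
apply (fser_intro _ _ (PI / (2 * K) * 2) (exp (- (PI * b))) _ (exp_ratio b b_pos)).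
- assert (hm : forall n j x, INR j <= Rabs n ->
    Rabs (PI / (2 * K) * (/ cosh (PI * (n * b)) * cos (2 * PI * (n * b) * x))) <=
    PI / (2 * K) * 2 * exp (- (PI * b)) ^ j).
  { intros n j x hn. rewrite Rabs_mult, (Rabs_mult (/ _)).
    rewrite (Rabs_pos_eq (PI / (2 * K))) by lra.
    rewrite (Rabs_pos_eq (/ cosh _)) by apply Rlt_le, sech_pos.
    rewrite (Rmult_assoc _ 2). apply Rmult_le_compat_l; [lra|].
    assert (h := sech_geom b n j b_pos hn). assert (h1 := cos_le_1 (2 * PI * (n * b) * x)).
    assert (h2 := sech_pos (PI * (n * b))). assert (h3 := Rabs_pos (cos (2 * PI * (n * b) * x))). nra. }
  intros j x. destruct (index_abs 0 j (or_introl eq_refl)). split; now apply hm.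
- intros x l hl.
  destruct (smooth2_dnR k hk (2 * K')) as [C hC].
  apply (fourier_sum (fun x => dnR (2 * K' * x) k) (K / K') 1 0 x C l); auto.
  + ring.
  + apply phase_0.
  + refine (is_lim_seq_ext _ _ _ _ hl). intros N.
    assert (t : forall n, phase 1 n -> PI / (2 * K) * (/ cosh (PI * (n * b)) * cos (2 * PI * (n * b) * x)) =
      / (K / K') * (RInt (fun t => dnR (2 * K' * t) k * cos (2 * PI * (n / (K / K')) * t)) (- (K / K' / 2)) (K / K' / 2) * cos (2 * PI * (n / (K / K')) * x) +
        RInt (fun t => dnR (2 * K' * t) k * sin (2 * PI * (n / (K / K')) * t)) (- (K / K' / 2)) (K / K' / 2) * sin (2 * PI * (n / (K / K')) * x))).
    { intros n hn. rewrite freq_eq.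
      rewrite (RInt_even_sin (fun t => dnR (2 * K' * t) k)) by assumption.
      destruct (freq_phase 1 n hn) as [p1 p2].
      assert (e := dn_coeff k hk (n * b) p1 p2). cbv zeta in e. fold k' K K' in e. rewrite e.
      field. assert (h := cosh_pos (PI * (n * b))). lra. }
    apply bs_ext; intros j; apply t; apply (phase_index 0 1 phase_0).
Qed.

Theorem cn_series : fser (fun n x => PI / (2 * K) / k * (/ cosh (PI * (n * b)) * cos (2 * PI * (n * b) * x))) (/ 2)
  (fun x => cnR (2 * K' * x) k).
Proof.
assert (hKp := hK). assert (hKp' := hK'). assert (hpi := PI_RGT_0).
assert (ha : 0 < K / K') by now apply Rdiv_lt_0_compat.
assert (hC0 : 0 < PI / (2 * K) / k) by (apply Rdiv_lt_0_compat; [apply Rdiv_lt_0_compat; lra|lra]).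
destruct cn_scaled as (hc & he & hp).
apply (fser_intro _ _ (PI / (2 * K) / k * 2) (exp (- (PI * b))) _ (exp_ratio b b_pos)).
- assert (hm : forall n j x, INR j <= Rabs n ->
    Rabs (PI / (2 * K) / k * (/ cosh (PI * (n * b)) * cos (2 * PI * (n * b) * x))) <=
    PI / (2 * K) / k * 2 * exp (- (PI * b)) ^ j).
  { intros n j x hn. rewrite Rabs_mult, (Rabs_mult (/ _)).
    rewrite (Rabs_pos_eq (PI / (2 * K) / k)) by lra.
    rewrite (Rabs_pos_eq (/ cosh _)) by apply Rlt_le, sech_pos.
    rewrite (Rmult_assoc _ 2). apply Rmult_le_compat_l; [lra|].
    assert (h := sech_geom b n j b_pos hn). assert (h1 := cos_le_1 (2 * PI * (n * b) * x)).
    assert (h2 := sech_pos (PI * (n * b))). assert (h3 := Rabs_pos (cos (2 * PI * (n * b) * x))). nra. }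
  intros j x. destruct (index_abs (/ 2) j (or_intror eq_refl)). split; now apply hm.
- intros x l hl.
  destruct (smooth2_cnR k hk (2 * K')) as [C hC].
  apply (fourier_sum (fun x => cnR (2 * K' * x) k) (K / K') (-1) (/ 2) x C l); auto.
  + ring.
  + apply phase_half.
  + refine (is_lim_seq_ext _ _ _ _ hl). intros N.
    assert (t : forall n, phase (-1) n -> PI / (2 * K) / k * (/ cosh (PI * (n * b)) * cos (2 * PI * (n * b) * x)) =
      / (K / K') * (RInt (fun t => cnR (2 * K' * t) k * cos (2 * PI * (n / (K / K')) * t)) (- (K / K' / 2)) (K / K' / 2) * cos (2 * PI * (n / (K / K')) * x) +
        RInt (fun t => cnR (2 * K' * t) k * sin (2 * PI * (n / (K / K')) * t)) (- (K / K' / 2)) (K / K' / 2) * sin (2 * PI * (n / (K / K')) * x))).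
    { intros n hn. rewrite freq_eq.
      rewrite (RInt_even_sin (fun t => cnR (2 * K' * t) k)) by assumption.
      destruct (freq_phase (-1) n hn) as [p1 p2].
      assert (e := cn_coeff k hk (n * b) p1 p2). cbv zeta in e. fold k' K K' in e. rewrite e.
      field. assert (h := cosh_pos (PI * (n * b))). lra. }
    apply bs_ext; intros j; apply t; apply (phase_index (/ 2) (-1) phase_half).
Qed.

Theorem sn_series : fser (fun n x => PI / (2 * K) / k * (/ sinh (PI * (n * b)) * sin (2 * PI * (n * b) * x))) (/ 2)
  (fun x => snR (2 * K' * x) k).
Proof.
assert (hKp := hK). assert (hKp' := hK'). assert (hpi := PI_RGT_0).
assert (ha : 0 < K / K') by now apply Rdiv_lt_0_compat. assert (hbp := b_pos).
assert (hC0 : 0 < PI / (2 * K) / k) by (apply Rdiv_lt_0_compat; [apply Rdiv_lt_0_compat; lra|lra]).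
destruct sn_scaled as (hc & he & hp).
apply (fser_intro _ _ (PI / (2 * K) / k * (4 / (PI * b))) (exp (- (PI * (b / 2)))) _ (exp_ratio (b / 2) ltac:(lra))).
- assert (hm : forall n j x, INR j <= Rabs n -> / 2 <= Rabs n ->
    Rabs (PI / (2 * K) / k * (/ sinh (PI * (n * b)) * sin (2 * PI * (n * b) * x))) <=
    PI / (2 * K) / k * (4 / (PI * b)) * exp (- (PI * (b / 2))) ^ j).
  { intros n j x hn hn2. rewrite Rabs_mult, (Rabs_mult (/ _)).
    rewrite (Rabs_pos_eq (PI / (2 * K) / k)) by lra.
    rewrite (Rmult_assoc _ (4 / (PI * b))). apply Rmult_le_compat_l; [lra|].
    assert (h := csch_geom b n j hbp hn hn2). assert (h1 := sin_le_1 (2 * PI * (n * b) * x)).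
    assert (h2 := Rabs_pos (/ sinh (PI * (n * b)))). assert (h3 := Rabs_pos (sin (2 * PI * (n * b) * x))). nra. }
  intros j x. destruct (index_abs (/ 2) j (or_intror eq_refl)). destruct (index_half j). split; now apply hm.
- intros x l hl.
  destruct (smooth2_snR k hk (2 * K')) as [C hC].
  apply (fourier_sum (fun x => snR (2 * K' * x) k) (K / K') (-1) (/ 2) x C l); auto.
  + ring.
  + apply phase_half.
  + refine (is_lim_seq_ext _ _ _ _ hl). intros N.
    assert (t : forall n, phase (-1) n -> / 2 <= Rabs n -> PI / (2 * K) / k * (/ sinh (PI * (n * b)) * sin (2 * PI * (n * b) * x)) =
      / (K / K') * (RInt (fun t => snR (2 * K' * t) k * cos (2 * PI * (n / (K / K')) * t)) (- (K / K' / 2)) (K / K' / 2) * cos (2 * PI * (n / (K / K')) * x) +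
        RInt (fun t => snR (2 * K' * t) k * sin (2 * PI * (n / (K / K')) * t)) (- (K / K' / 2)) (K / K' / 2) * sin (2 * PI * (n / (K / K')) * x))).
    { intros n hn hn2. rewrite freq_eq.
      rewrite (RInt_odd_cos (fun t => snR (2 * K' * t) k)) by assumption.
      destruct (freq_phase (-1) n hn) as [p1 p2].
      assert (e := sn_coeff k hk (n * b) p1 p2). cbv zeta in e. fold k' K K' in e.
      set (be := RInt _ _ _) in *.
      assert (hs : sinh (PI * (n * b)) <> 0).
      { intros e0. rewrite e0, Rmult_0_l in e.
        assert (0 < PI / (2 * K') / k) by (apply Rdiv_lt_0_compat; [apply Rdiv_lt_0_compat; lra|lra]). lra. }
      apply (Rmult_eq_reg_l (sinh (PI * (n * b)))); [|exact hs].
      replace (sinh (PI * (n * b)) * (/ (K / K') * (0 * cos (2 * PI * (n * b) * x) + be * sin (2 * PI * (n * b) * x)))) with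
        (sinh (PI * (n * b)) * be * (/ (K / K') * sin (2 * PI * (n * b) * x))) by ring.
      rewrite e. field. lra. }
    apply bs_ext; intros j; apply t; first [apply (phase_index (/ 2) (-1) phase_half)|apply index_half].
Qed.

End Series.

(** * The square of dn and the periodization of the square of sech *)

Lemma is_lim_seq_scaled_geom (B r : R) : 0 < r < 1 -> is_lim_seq (fun N => B * r ^ N) 0.
Proof.
intros hr. apply (is_lim_seq_geom (Rabs B) r); [exact hr|]. intros N.
rewrite Rminus_0_r, Rabs_mult, (Rabs_pos_eq (r ^ N)); [lra|]. apply pow_le; lra.
Qed.

(** Termwise integration of a series against a bounded weight. *)
Lemma fser_RInt (h : R -> R -> R) (s : R) (f g : R -> R) (a b : R) : a <= b -> fser h s f ->
  (forall n, cont (h n)) -> cont f -> cont g -> (forall x, Rabs (g x) <= 1) ->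
  is_lim_seq (bs (fun n => RInt (fun x => h n x * g x) a b) s) (RInt (fun x => f x * g x) a b).
Proof.
intros hab (B & r & hr & hb) hh hf hg hg1.
apply (is_lim_seq_ext (fun N => RInt (fun x => bs (fun n => h n x) s N * g x) a b)).
- intros N. rewrite <- (RInt_bs (fun n x => h n x * g x)).
  2: { intros n. now apply cont_mult. }
  apply RInt_extR. intros x.
  rewrite (bs_ext (fun n => h n x * g x) (fun n => g x * h n x)) by (intros; ring).
  rewrite bs_scal. ring.
- apply (RInt_uniform_limit _ _ a b (fun N => B * r ^ N)); [exact hab|now apply cont_mult| | |].
  + intros N. apply cont_mult; [now apply cont_bs|exact hg].
  + intros N x _. rewrite <- Rmult_minus_distr_r, Rabs_mult.
    assert (h1 := hb N x). assert (h2 := hg1 x). assert (h3 := Rabs_pos (bs (fun n => h n x) s N - f x)).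
    nra.
  + now apply is_lim_seq_scaled_geom.
Qed.

Lemma tanh_eq (x : R) : tanh x = 1 - 2 / (exp (2 * x) + 1).
Proof.
unfold tanh, sinh, cosh. replace (2 * x) with (x + x) by ring. rewrite exp_plus, exp_Ropp.
assert (h := exp_pos x). field. split; nra.
Qed.

Lemma tanh_neg (x : R) : tanh (- x) = - tanh x.
Proof. unfold tanh. rewrite sinh_neg, cosh_neg. unfold Rdiv. ring. Qed.

Lemma tanh_lim (z : nat -> R) : is_lim_seq z p_infty -> is_lim_seq (fun N => tanh (z N)) 1.
Proof.
intros hz.
apply (is_lim_seq_ext (fun N => 1 - 2 * / (exp (2 * z N) + 1))).
{ intros N. rewrite tanh_eq. reflexivity. }
replace (Finite 1) with (Finite (1 - 2 * 0)) by (f_equal; ring).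
apply is_lim_seq_minus'; [apply is_lim_seq_const|].
apply (is_lim_seq_scal_l _ 2 0).
replace (Finite 0) with (Rbar_inv p_infty) by reflexivity.
apply is_lim_seq_inv; [|discriminate].
apply (is_lim_seq_le_p_loc z); [|exact hz].
exists 0%nat. intros N _. assert (h := exp_ineq1_le (2 * z N)). assert (h' := exp_pos (2 * z N)).
destruct (Rle_or_lt 0 (z N)); lra.
Qed.

Lemma is_lim_seq_affine (c d : R) : 0 < d -> is_lim_seq (fun N => (INR N + c) * d) p_infty.
Proof.
intros hd. apply (is_lim_seq_ext (fun N => d * INR N + c * d)); [intros; ring|].
apply (is_lim_seq_plus _ _ p_infty (c * d)); [|apply is_lim_seq_const|reflexivity].
replace p_infty with (Rbar_mult d p_infty).
- apply is_lim_seq_scal_l, is_lim_seq_INR.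
- simpl. destruct (Rle_dec 0 d) as [r|r]; [|lra].
  destruct (Rle_lt_or_eq_dec 0 d r); [reflexivity|lra].
Qed.

(** The sum telescopes to the total variation of tanh, whatever the offset [c]. *)
Lemma bs_tanh_step (b c s : R) : 0 < b ->
  is_lim_seq (bs (fun n => tanh (PI * ((n + c + 1) * b)) - tanh (PI * ((n + c) * b))) s) 2.
Proof.
intros hb. assert (hpi := PI_RGT_0). assert (hpb : 0 < PI * b) by (apply Rmult_lt_0_compat; lra).
set (h := fun n => tanh (PI * ((n + c) * b))).
apply (is_lim_seq_ext (fun N => h (INR N + 1 + s) - h (s - 1 - INR N))).
- intros N. rewrite <- bs_step, <- bs_minus. apply bs_ext; intros j; unfold h; do 4 f_equal; ring.
- replace (Finite 2) with (Finite (1 - - (1))) by (f_equal; ring).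
  apply is_lim_seq_minus'.
  + unfold h. apply tanh_lim.
    apply (is_lim_seq_ext (fun N => (INR N + (1 + s + c)) * (PI * b))); [intros; ring|].
    now apply is_lim_seq_affine.
  + apply (is_lim_seq_ext (fun N => - tanh ((INR N + (1 - s - c)) * (PI * b)))).
    * intros N. rewrite <- tanh_neg. unfold h. f_equal. ring.
    * apply (is_lim_seq_opp _ 1). apply tanh_lim. now apply is_lim_seq_affine.
Qed.

(** The shift from -M to M consists of 2M unit steps, each worth 2. *)
Lemma bs_tanh (b s : R) (M : nat) : 0 < b ->
  is_lim_seq (bs (fun n => tanh (PI * ((n + INR M) * b)) - tanh (PI * ((n - INR M) * b))) s) (4 * INR M).
Proof.
intros hb. induction M as [|M IH].
- apply (is_lim_seq_ext (fun _ => 0)).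
  + intros N. rewrite (bs_ext _ (fun n => 0 * 0)); [rewrite bs_scal; ring| |];
    intros j; simpl INR; rewrite Rplus_0_r, Rminus_0_r; ring.
  + simpl INR. rewrite Rmult_0_r. apply is_lim_seq_const.
- assert (h1 := bs_tanh_step b (INR M) s hb). assert (h2 := bs_tanh_step b (- INR M - 1) s hb).
  rewrite S_INR.
  replace (Finite (4 * (INR M + 1))) with (Finite (4 * INR M + 2 + 2)) by (f_equal; ring).
  refine (is_lim_seq_ext _ _ _ _ (is_lim_seq_plus' _ _ _ _ (is_lim_seq_plus' _ _ _ _ IH h1) h2)).
  intros N. rewrite <- !bs_plus. apply bs_ext; intros j; rewrite ?S_INR.
  + replace (INR j + s + (- INR M - 1) + 1) with (INR j + s - INR M) by ring.
    replace (INR j + s + (- INR M - 1)) with (INR j + s - (INR M + 1)) by ring.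
    replace (INR j + s + (INR M + 1)) with (INR j + s + INR M + 1) by ring. ring.
  + replace (s - 1 - INR j + (- INR M - 1) + 1) with (s - 1 - INR j - INR M) by ring.
    replace (s - 1 - INR j + (- INR M - 1)) with (s - 1 - INR j - (INR M + 1)) by ring.
    replace (s - 1 - INR j + (INR M + 1)) with (s - 1 - INR j + INR M + 1) by ring. ring.
Qed.

Lemma tanh_diff (x y : R) : tanh (x + y) - tanh x = sinh y * (/ cosh x * / cosh (x + y)).
Proof.
assert (h1 := cosh_pos x). assert (h2 := cosh_pos (x + y)).
unfold tanh. apply (Rmult_eq_reg_r (cosh x * cosh (x + y))); [|apply Rgt_not_eq; now apply Rmult_lt_0_compat].
replace (sinh y * (/ cosh x * / cosh (x + y)) * (cosh x * cosh (x + y))) with (sinh y) by (field; lra).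
replace ((sinh (x + y) / cosh (x + y) - sinh x / cosh x) * (cosh x * cosh (x + y))) with
  (sinh (x + y) * cosh x - sinh x * cosh (x + y)) by (field; lra).
rewrite sinh_plus, cosh_plus. assert (h3 := cosh_sinh_sqr x).
replace ((sinh x * cosh y + cosh x * sinh y) * cosh x - sinh x * (cosh x * cosh y + sinh x * sinh y))
  with (sinh y * (cosh x ^ 2 - sinh x ^ 2)) by ring.
rewrite h3. ring.
Qed.

Section Square.

Variable k : R.
Hypothesis hk : 0 < k < 1.
Let k' := comod k.
Let K := ellK k.
Let K' := ellK k'.
Let a := K / K'.
Let b := K' / K.

Let hk' : 0 < k' < 1 := comod_range k hk.
Let hK : 0 < K := ellK_pos k hk.
Let hK' : 0 < K' := ellK_pos k' hk'.

(** One factor dn is expanded in its series; integrated against the other, each term is again a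
    Fourier coefficient of dn. The case [m = 0] is Parseval's identity. *)
Lemma dn_sqr_coeff_series (m : R) : phase 1 m ->
  is_lim_seq (bs (fun n => PI / (2 * K) * (PI / (2 * K')) *
    (/ 2 * (/ cosh (PI * (n * b)) * / cosh (PI * ((n + m) * b)) +
            / cosh (PI * (n * b)) * / cosh (PI * ((n - m) * b))))) 0)
    (RInt (fun x => dnR (2 * K' * x) k ^ 2 * cos (2 * PI * (m * b) * x)) (- (a / 2)) (a / 2)).
Proof.
intros hm. assert (hKp := hK). assert (hKp' := hK').
assert (ha : 0 < a) by now apply Rdiv_lt_0_compat.
assert (h := fser_RInt _ _ _ (fun x => dnR (2 * K' * x) k * cos (2 * PI * (m * b) * x)) (- (a / 2)) (a / 2)
  ltac:(lra) (dn_series k hk)).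
cbv zeta in h. fold k' K K' b in h.
rewrite (RInt_extR _ (fun x => dnR (2 * K' * x) k * (dnR (2 * K' * x) k * cos (2 * PI * (m * b) * x))))
  by (intros; ring).
refine (is_lim_seq_ext _ _ _ _ (h _ _ _ _)).
- intros N.
  assert (t : forall n, phase 1 n -> RInt (fun x => PI / (2 * K) * (/ cosh (PI * (n * b)) * cos (2 * PI * (n * b) * x)) *
      (dnR (2 * K' * x) k * cos (2 * PI * (m * b) * x))) (- (a / 2)) (a / 2) =
    PI / (2 * K) * (PI / (2 * K')) * (/ 2 * (/ cosh (PI * (n * b)) * / cosh (PI * ((n + m) * b)) +
            / cosh (PI * (n * b)) * / cosh (PI * ((n - m) * b)))) :> R).
  { intros n hn.
    rewrite (RInt_extR _ (fun x => PI / (2 * K) * / cosh (PI * (n * b)) * / 2 *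
      (dnR (2 * K' * x) k * cos (2 * PI * ((n + m) * b) * x) +
       dnR (2 * K' * x) k * cos (2 * PI * ((n - m) * b) * x)))).
    - rewrite RInt_scalR, RInt_plusR by ctj.
      assert (p1 : phase 1 (n + m)) by (rewrite <- (Rmult_1_l 1); now apply phase_plus).
      assert (p2 : phase 1 (n - m)) by (rewrite <- (Rmult_1_l 1); apply phase_plus, phase_opp; assumption).
      destruct (freq_phase k hk 1 _ p1) as [q1 q2]. destruct (freq_phase k hk 1 _ p2) as [q3 q4].
      assert (e1 := dn_coeff k hk ((n + m) * b) q1 q2). assert (e2 := dn_coeff k hk ((n - m) * b) q3 q4).
      cbv zeta in e1, e2. fold k' K K' a in e1, e2. rewrite e1, e2.
      assert (c1 := cosh_pos (PI * (n * b))). assert (c2 := cosh_pos (PI * ((n + m) * b))).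
      assert (c3 := cosh_pos (PI * ((n - m) * b))). field. lra.
    - intros x.
      replace (2 * PI * ((n + m) * b) * x) with (2 * PI * (n * b) * x + 2 * PI * (m * b) * x) by ring.
      replace (2 * PI * ((n - m) * b) * x) with (2 * PI * (n * b) * x - 2 * PI * (m * b) * x) by ring.
      rewrite cos_plus, cos_minus. assert (c1 := cosh_pos (PI * (n * b))). field. lra. }
  apply bs_ext; intros j; apply t; apply (phase_index 0 1 phase_0).
- intros n. ctj.
- ctj.
- ctj.
- intros x. apply Rabs_mult_le_1; [now apply dnR_le_1|apply cos_le_1].
Qed.

(** After multiplication by sinh (pi M b), [tanh_diff] writes every product of two sech as a
    difference of tanh, and the series telescopes. *)
Lemma dn_sqr_coeff (M : nat) :
  sinh (PI * (INR M * b)) *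
    RInt (fun x => dnR (2 * K' * x) k ^ 2 * cos (2 * PI * (INR M * b) * x)) (- (a / 2)) (a / 2) =
  PI / (2 * K) * (PI / (2 * K')) * (2 * INR M).
Proof.
assert (hKp := hK). assert (hKp' := hK'). assert (hb : 0 < b) by now apply Rdiv_lt_0_compat.
assert (h := dn_sqr_coeff_series (INR M) (phase_INR M)).
apply (is_lim_seq_scal_l _ (sinh (PI * (INR M * b)))) in h.
assert (h' := is_lim_seq_scal_l _ (PI / (2 * K) * (PI / (2 * K')) * / 2) _ (bs_tanh b 0 M hb)).
assert (e : forall N, sinh (PI * (INR M * b)) * bs (fun n => PI / (2 * K) * (PI / (2 * K')) *
    (/ 2 * (/ cosh (PI * (n * b)) * / cosh (PI * ((n + INR M) * b)) +
            / cosh (PI * (n * b)) * / cosh (PI * ((n - INR M) * b))))) 0 N =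
  PI / (2 * K) * (PI / (2 * K')) * / 2 *
    bs (fun n => tanh (PI * ((n + INR M) * b)) - tanh (PI * ((n - INR M) * b))) 0 N).
{ intros N. rewrite <- !bs_scal.
  assert (t : forall n, sinh (PI * (INR M * b)) * (PI / (2 * K) * (PI / (2 * K')) *
    (/ 2 * (/ cosh (PI * (n * b)) * / cosh (PI * ((n + INR M) * b)) +
            / cosh (PI * (n * b)) * / cosh (PI * ((n - INR M) * b))))) =
    PI / (2 * K) * (PI / (2 * K')) * / 2 * (tanh (PI * ((n + INR M) * b)) - tanh (PI * ((n - INR M) * b)))).
  { intros n.
    assert (t1 := tanh_diff (PI * (n * b)) (PI * (INR M * b))).
    assert (t2 := tanh_diff (PI * (n * b)) (- (PI * (INR M * b)))).
    replace (PI * (n * b) + PI * (INR M * b)) with (PI * ((n + INR M) * b)) in t1 by ring.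
    replace (PI * (n * b) + - (PI * (INR M * b))) with (PI * ((n - INR M) * b)) in t2 by ring.
    rewrite sinh_neg in t2.
    replace (tanh (PI * ((n + INR M) * b)) - tanh (PI * ((n - INR M) * b))) with
      ((tanh (PI * ((n + INR M) * b)) - tanh (PI * (n * b))) - (tanh (PI * ((n - INR M) * b)) - tanh (PI * (n * b)))) by ring.
    rewrite t1, t2. ring. }
  apply bs_ext; intros; apply t. }
apply (is_lim_seq_ext _ _ _ e) in h.
rewrite (is_lim_seq_inj _ _ _ h h'). field. lra.
Qed.

(** For [m = 0] the series cannot be telescoped, but the integral of dn^2 over a period is known.
    This is how [ellE] enters the formulas. *)
Lemma dn_sqr_mean : is_lim_seq (bs (fun n => / cosh (PI * (n * b)) ^ 2) 0) (4 * K * ellE k / PI ^ 2).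
Proof.
assert (hKp := hK). assert (hKp' := hK'). assert (hpi := PI_RGT_0).
assert (h := dn_sqr_coeff_series 0 phase_0).
rewrite (RInt_extR _ (fun x => dnR (2 * K' * x) k ^ 2)) in h.
2: { intros x. replace (2 * PI * (0 * b) * x) with 0 by ring. rewrite cos_0. ring. }
assert (e := RInt_lin (fun u => dnR u k ^ 2) (2 * K') 0 (- (a / 2)) (a / 2) ltac:(ctj)).
replace (2 * K' * - (a / 2) + 0) with (- ellK k) in e by (unfold a; fold K; field; lra).
replace (2 * K' * (a / 2) + 0) with (ellK k) in e by (unfold a; fold K; field; lra).
rewrite RInt_dnR_sqr in e by exact hk.
rewrite (RInt_extR _ (fun x => dnR (2 * K' * x) k ^ 2)) in e by (intros; do 2 f_equal; ring).
set (I := RInt (fun x => dnR (2 * K' * x) k ^ 2) (- (a / 2)) (a / 2)) in *.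
apply (is_lim_seq_scal_l _ (4 * K * K' / PI ^ 2)) in h.
replace (Finite (4 * K * ellE k / PI ^ 2)) with (Rbar_mult (4 * K * K' / PI ^ 2) I).
- refine (is_lim_seq_ext _ _ _ _ h). intros N. rewrite <- bs_scal.
  apply bs_ext; intros j; rewrite Rplus_0_r, Rminus_0_r.
  + assert (c := cosh_pos (PI * ((INR j + 0) * b))). rewrite ?Rplus_0_r in *. field. lra.
  + assert (c := cosh_pos (PI * ((0 - 1 - INR j) * b))). field. lra.
- simpl. f_equal. replace (4 * K * K' / (PI * (PI * 1)) * I) with (2 * K / PI ^ 2 * (2 * K' * I)) by (field; lra).
  rewrite e. field. lra.
Qed.

End Square.

(** * Periodization of the square of sech *)

Definition sech_sqr_sum (b y : R) : R := real (Lim_seq (bs (fun n => / cosh (PI * (y + n * b)) ^ 2) 0)).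

Lemma sech_sqr_le (y b n : R) (j : nat) : 0 < b -> INR j <= Rabs n ->
  / cosh (PI * (y + n * b)) <= 2 * exp (PI * Rabs y) * exp (- (PI * b)) ^ j.
Proof.
intros hb hn. assert (hpi := PI_RGT_0).
eapply Rle_trans; [apply sech_le_exp|].
rewrite Rmult_assoc. apply Rmult_le_compat_l; [lra|].
rewrite exp_pow, <- exp_plus.
assert (h : - Rabs (PI * (y + n * b)) <= PI * Rabs y + - (PI * b) * INR j).
{ rewrite Rabs_mult, (Rabs_pos_eq PI) by lra.
  assert (h1 := Rabs_triang (y + n * b) (- y)). replace (y + n * b + - y) with (n * b) in h1 by ring.
  rewrite Rabs_Ropp, Rabs_mult, (Rabs_pos_eq b) in h1 by lra.
  assert (INR j * b <= Rabs n * b) by (apply Rmult_le_compat_r; lra).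
  assert (PI * (INR j * b) <= PI * (Rabs (y + n * b) + Rabs y)) by (apply Rmult_le_compat_l; lra).
  lra. }
destruct h as [h|h]; [left; now apply exp_increasing|rewrite h; lra].
Qed.

Lemma sech_sqr_le_sech (z : R) : 0 <= / cosh z ^ 2 <= / cosh z.
Proof.
assert (h := cosh_ge_1 z). split; [apply Rlt_le, Rinv_0_lt_compat, pow_lt; lra|].
apply Rinv_le_contravar; [lra|]. simpl. nra.
Qed.

Section Sum.

Variable b : R.
Hypothesis hb : 0 < b.

Let r := exp (- (PI * b)).

Lemma sech_sqr_terms (y : R) (j : nat) :
  Rabs (/ cosh (PI * (y + (INR j + 0) * b)) ^ 2) + Rabs (/ cosh (PI * (y + (0 - 1 - INR j) * b)) ^ 2) <=
  4 * exp (PI * Rabs y) * r ^ j.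
Proof.
destruct (index_abs 0 j (or_introl eq_refl)) as [i1 i2].
assert (h1 := sech_sqr_le_sech (PI * (y + (INR j + 0) * b))).
assert (h2 := sech_sqr_le_sech (PI * (y + (0 - 1 - INR j) * b))).
assert (h3 := sech_sqr_le y b _ j hb i1). assert (h4 := sech_sqr_le y b _ j hb i2).
rewrite !Rabs_pos_eq by lra. unfold r. lra.
Qed.

Lemma sech_sqr_sum_lim (y : R) :
  is_lim_seq (bs (fun n => / cosh (PI * (y + n * b)) ^ 2) 0) (sech_sqr_sum b y).
Proof.
destruct (bs_cauchy (fun n => / cosh (PI * (y + n * b)) ^ 2) 0 _ r (exp_ratio b hb) (sech_sqr_terms y)) as [l hl].
unfold sech_sqr_sum. rewrite (is_lim_seq_unique _ _ hl). exact hl.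
Qed.

Lemma sech_sqr_sum_rate (y Y : R) (N : nat) : Rabs y <= Y ->
  Rabs (bs (fun n => / cosh (PI * (y + n * b)) ^ 2) 0 N - sech_sqr_sum b y) <=
  4 * exp (PI * Y) / (1 - r) * r ^ N.
Proof.
intros hy. assert (hr := exp_ratio b hb). fold r in hr.
apply (bs_tail_lim (fun n => / cosh (PI * (y + n * b)) ^ 2) 0 (4 * exp (PI * Y)) r _ N hr).
- intros j. eapply Rle_trans; [apply sech_sqr_terms|].
  apply Rmult_le_compat_r; [apply pow_le; lra|]. apply Rmult_le_compat_l; [lra|].
  assert (hpi := PI_RGT_0). assert (h : PI * Rabs y <= PI * Y) by (apply Rmult_le_compat_l; lra).
  destruct h as [h|h]; [left; now apply exp_increasing|rewrite h; lra].
- apply sech_sqr_sum_lim.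
Qed.

Lemma cont_sech_sqr (c : R) : cont (fun y => / cosh (PI * (y + c)) ^ 2).
Proof. ct. intros y. apply Rgt_not_eq, pow_lt, cosh_pos. Qed.

Lemma cont_sech_sqr_sum : cont (sech_sqr_sum b).
Proof.
assert (hr := exp_ratio b hb). fold r in hr.
apply (cont_uniform_limit (fun N y => bs (fun n => / cosh (PI * (y + n * b)) ^ 2) 0 N)).
- intros N. apply (cont_bs (fun n y => / cosh (PI * (y + n * b)) ^ 2)). intros n. apply cont_sech_sqr.
- intros Y eps he. destruct (geom_small (4 * exp (PI * Y) / (1 - r)) r eps hr he) as [N hN].
  exists N. intros y hy. eapply Rle_lt_trans; [apply (sech_sqr_sum_rate y Y N hy)|]. now apply hN.
Qed.

Lemma sech_sqr_vanish (c d : R) : 0 < d -> is_lim_seq (fun N => / cosh (PI * ((INR N + c) * d)) ^ 2) 0.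
Proof.
intros hd. assert (hpi := PI_RGT_0).
apply (is_lim_seq_le_le (fun _ => 0) _ (fun N => / cosh (PI * ((INR N + c) * d)))).
- intros N. apply sech_sqr_le_sech.
- apply is_lim_seq_const.
- apply (is_lim_seq_geom (2 * exp (PI * Rabs (c * d))) (exp (- (PI * d)))); [now apply exp_ratio|].
  intros N. rewrite Rminus_0_r, Rabs_pos_eq by apply Rlt_le, sech_pos.
  replace ((INR N + c) * d) with (c * d + INR N * d) by ring.
  apply sech_sqr_le; [exact hd|]. rewrite Rabs_pos_eq; [lra|apply pos_INR].
Qed.

(** Shifting the index trades one end term for another, and both tend to 0. Periodicity and evenness
    of the periodization both rest on this. *)
Lemma bs_sech_sqr_step (y : R) :
  is_lim_seq (bs (fun n => / cosh (PI * (y + (n + 1) * b)) ^ 2) 0) (sech_sqr_sum b y).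
Proof.
replace (Finite (sech_sqr_sum b y)) with (Finite (sech_sqr_sum b y + (0 - 0))) by (f_equal; ring).
set (h := fun n => / cosh (PI * (y + n * b)) ^ 2).
apply (is_lim_seq_ext (fun N => bs h 0 N + (h (INR N + 1 + 0) - h (0 - 1 - INR N)))).
{ intros N. rewrite <- bs_step. unfold h. ring. }
apply is_lim_seq_plus'; [apply sech_sqr_sum_lim|].
apply is_lim_seq_minus'.
- apply (is_lim_seq_ext (fun N => / cosh (PI * ((INR N + (1 + y / b)) * b)) ^ 2)); [|now apply sech_sqr_vanish].
  intros N. unfold h. do 4 f_equal. field. lra.
- apply (is_lim_seq_ext (fun N => / cosh (PI * ((INR N + (1 - y / b)) * b)) ^ 2)); [|now apply sech_sqr_vanish].
  intros N. unfold h. rewrite <- (cosh_neg (PI * (y + _))). do 3 f_equal. field. lra.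
Qed.

Lemma sech_sqr_sum_periodic (y : R) : sech_sqr_sum b (y + b) = 1 * sech_sqr_sum b y.
Proof.
assert (h1 := sech_sqr_sum_lim (y + b)). assert (h2 := bs_sech_sqr_step y).
assert (e : forall N, bs (fun n => / cosh (PI * (y + (n + 1) * b)) ^ 2) 0 N =
  bs (fun n => / cosh (PI * (y + b + n * b)) ^ 2) 0 N)
  by (intros N; apply bs_ext; intros; do 4 f_equal; ring).
apply (is_lim_seq_ext _ _ _ e) in h2.
rewrite (is_lim_seq_inj _ _ _ h1 h2). ring.
Qed.

Lemma sech_sqr_sum_even (y : R) : sech_sqr_sum b (- y) = sech_sqr_sum b y.
Proof.
assert (h1 := sech_sqr_sum_lim (- y)). assert (h2 := bs_sech_sqr_step y).
assert (e : forall N, bs (fun n => / cosh (PI * (y + (n + 1) * b)) ^ 2) 0 N =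
  bs (fun n => / cosh (PI * (- y + n * b)) ^ 2) 0 N).
(* Negating the argument in the shifted sum exchanges the members [j] and [- 1 - j] of each pair, so
   the two sums agree term by term. *)
{ intros N. apply sum_eq. intros j _. rewrite Rplus_comm. f_equal.
  - rewrite <- cosh_neg. do 3 f_equal. ring.
  - rewrite <- cosh_neg. do 3 f_equal. ring. }
apply (is_lim_seq_ext _ _ _ e) in h2.
apply (is_lim_seq_inj _ _ _ h1 h2).
Qed.

Lemma is_derive_sech_sqr (z : R) :
  is_derive (fun z => / cosh (PI * z) ^ 2) z (- 2 * PI * sinh (PI * z) / cosh (PI * z) ^ 3) /\
  is_derive (fun z => - 2 * PI * sinh (PI * z) / cosh (PI * z) ^ 3) z
    (PI ^ 2 * (4 / cosh (PI * z) ^ 2 - 6 / cosh (PI * z) ^ 4)).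
Proof.
assert (h := cosh_pos (PI * z)). assert (hc := cosh_sinh_sqr (PI * z)).
split.
- auto_derive; [apply (pow_nonzero (cosh (PI * z)) 2); lra|]. field. lra.
- auto_derive; [apply (pow_nonzero (cosh (PI * z)) 3); lra|].
  apply (Rmult_eq_reg_r (cosh (PI * z) ^ 4)); [|apply Rgt_not_eq, pow_lt, h].
  match goal with |- ?l = ?q => replace q with (PI ^ 2 * (4 * cosh (PI * z) ^ 2 - 6)) by (field; lra);
    replace l with (PI ^ 2 * (6 * sinh (PI * z) ^ 2 - 2 * cosh (PI * z) ^ 2)) by (field; lra) end.
  rewrite hc. ring.
Qed.

(** The second derivative at w is at most 10 pi^2 sech (pi w) <= 20 pi^2 exp (- pi |w|), and
    [exp (PI * b)] pays for replacing w by the centre z. The decay in z makes the estimate summable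
    over the periodization. *)
Lemma sech_sqr_second_difference (z t : R) : Rabs t <= b / 2 ->
  Rabs (/ 2 * (/ cosh (PI * (z + t)) ^ 2 + / cosh (PI * (z - t)) ^ 2) - / cosh (PI * z) ^ 2) <=
  20 * PI ^ 2 * exp (PI * b) * exp (- (PI * Rabs z)) * t ^ 2.
Proof.
intros ht. assert (hpi := PI_RGT_0).
set (f := fun z => / cosh (PI * z) ^ 2).
set (df := fun z => - 2 * PI * sinh (PI * z) / cosh (PI * z) ^ 3).
set (ddf := fun z => PI ^ 2 * (4 / cosh (PI * z) ^ 2 - 6 / cosh (PI * z) ^ 4)).
set (L := 20 * PI ^ 2 * exp (PI * b) * exp (- (PI * Rabs z))).
assert (hdd : forall w, Rabs (w - z) <= b / 2 -> Rabs (ddf w) <= L).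
{ intros w hw. unfold ddf. rewrite Rabs_mult, Rabs_pos_eq by apply pow2_ge_0.
  assert (hs := sech_sqr_le_sech (PI * w)). assert (hc := cosh_ge_1 (PI * w)).
  assert (h1 : Rabs (4 / cosh (PI * w) ^ 2 - 6 / cosh (PI * w) ^ 4) <= 10 * / cosh (PI * w)).
  { assert (h4 : 0 <= / cosh (PI * w) ^ 4 <= / cosh (PI * w) ^ 2).
    { split; [apply Rlt_le, Rinv_0_lt_compat, pow_lt; lra|].
      apply Rinv_le_contravar; [apply pow_lt; lra|]. apply Rle_pow; [exact hc|lia]. }
    unfold Rdiv. apply Rabs_le. lra. }
  assert (h2 : / cosh (PI * w) <= 2 * (exp (PI * b) * exp (- (PI * Rabs z)))).
  { eapply Rle_trans; [apply sech_le_exp|]. apply Rmult_le_compat_l; [lra|].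
    rewrite <- exp_plus.
    assert (h : - Rabs (PI * w) <= PI * b + - (PI * Rabs z)).
    { rewrite Rabs_mult, (Rabs_pos_eq PI) by lra.
      assert (h3 := Rabs_triang w (z - w)). replace (w + (z - w)) with z in h3 by ring.
      rewrite Rabs_minus_sym in hw. assert (hb0 := hb). nra. }
    destruct h as [h|h]; [left; now apply exp_increasing|rewrite h; lra]. }
  apply Rle_trans with (PI ^ 2 * (10 * (2 * (exp (PI * b) * exp (- (PI * Rabs z)))))).
  - apply Rmult_le_compat_l; [apply pow2_ge_0|]. lra.
  - right. unfold L. ring. }
assert (mvt : forall g dg u v, (forall x, is_derive g x (dg x)) ->
  exists w, g v - g u = dg w * (v - u) /\ Rmin u v <= w <= Rmax u v).
{ intros g dg u v hg. destruct (MVT_gen g u v dg) as [w [hw h]].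
  - intros; apply hg.
  - intros; apply cont_continuity_pt, (cont_derive g dg hg).
  - now exists w. }
destruct (mvt f df z (z + t) (fun x => proj1 (is_derive_sech_sqr x))) as (w1 & e1 & b1).
destruct (mvt f df z (z - t) (fun x => proj1 (is_derive_sech_sqr x))) as (w2 & e2 & b2).
destruct (mvt df ddf w2 w1 (fun x => proj2 (is_derive_sech_sqr x))) as (w3 & e3 & b3).
assert (hw : Rabs (w3 - z) <= b / 2 /\ Rabs (w1 - w2) <= 2 * Rabs t).
{ assert (q1 : Rabs (w1 - z) <= Rabs t /\ Rabs (w2 - z) <= Rabs t /\ Rabs (w3 - z) <= Rabs t /\ Rabs (w1 - w2) <= 2 * Rabs t).
  { unfold Rmin, Rmax in b1, b2, b3. unfold Rabs.
    destruct (Rle_dec z (z + t)), (Rle_dec z (z - t)), (Rle_dec w2 w1);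
    repeat split; repeat destruct (Rcase_abs _); lra. }
  lra. }
destruct hw as [hw1 hw2].
change (Rabs (/ 2 * (f (z + t) + f (z - t)) - f z) <= L * t ^ 2).
replace (/ 2 * (f (z + t) + f (z - t)) - f z) with (/ 2 * ((f (z + t) - f z) + (f (z - t) - f z))) by field.
rewrite e1, e2. replace (/ 2 * (df w1 * (z + t - z) + df w2 * (z - t - z))) with (/ 2 * ((df w1 - df w2) * t)) by ring.
rewrite e3, !Rabs_mult, (Rabs_pos_eq (/ 2)) by lra.
assert (h3 := hdd w3 hw1). rewrite <- (pow2_abs t).
assert (p1 := Rabs_pos (ddf w3)). assert (p2 := Rabs_pos (w1 - w2)). assert (p3 := Rabs_pos t).
assert (Rabs (ddf w3) * Rabs (w1 - w2) <= L * (2 * Rabs t)) by (apply Rmult_le_compat; assumption).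
assert (Rabs (ddf w3) * Rabs (w1 - w2) * Rabs t <= L * (2 * Rabs t) * Rabs t) by (apply Rmult_le_compat_r; assumption).
simpl. lra.
Qed.

Lemma sech_sqr_sum_smooth (y : R) : exists C, forall t, Rabs t <= b / 2 ->
  Rabs (/ 2 * (sech_sqr_sum b (y + t) + sech_sqr_sum b (y - t)) - sech_sqr_sum b y) <= C * t ^ 2.
Proof.
assert (hr := exp_ratio b hb). fold r in hr. assert (hpi := PI_RGT_0).
set (A := 20 * PI ^ 2 * exp (PI * b) * exp (PI * Rabs y)).
assert (hA : 0 < A).
{ unfold A. assert (h1 := exp_pos (PI * b)). assert (h2 := exp_pos (PI * Rabs y)).
  assert (0 < PI ^ 2) by (apply pow_lt; lra).
  apply Rmult_lt_0_compat; [apply Rmult_lt_0_compat; [lra|exact h1]|exact h2]. }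
(* The partial sum with N = 0, plus the bound of [bs_tail_lim] for the rest. *)
exists (2 * A + 2 * A / (1 - r)). intros t ht.
set (g := fun n => / 2 * (/ cosh (PI * (y + t + n * b)) ^ 2 + / cosh (PI * (y - t + n * b)) ^ 2) -
  / cosh (PI * (y + n * b)) ^ 2).
assert (hl : is_lim_seq (bs g 0)
  (/ 2 * (sech_sqr_sum b (y + t) + sech_sqr_sum b (y - t)) - sech_sqr_sum b y)).
{ apply (is_lim_seq_ext (fun N => / 2 * (bs (fun n => / cosh (PI * (y + t + n * b)) ^ 2) 0 N +
    bs (fun n => / cosh (PI * (y - t + n * b)) ^ 2) 0 N) - bs (fun n => / cosh (PI * (y + n * b)) ^ 2) 0 N)).
  - intros N. rewrite <- bs_plus, <- bs_scal, <- bs_minus. reflexivity.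
  - apply is_lim_seq_minus'; [|apply sech_sqr_sum_lim].
    apply (is_lim_seq_scal_l _ (/ 2) (Finite _)). apply is_lim_seq_plus'; apply sech_sqr_sum_lim. }
assert (hg : forall n j, INR j <= Rabs n -> Rabs (g n) <= A * t ^ 2 * r ^ j).
{ intros n j hn. unfold g.
  replace (y + t + n * b) with (y + n * b + t) by ring.
  replace (y - t + n * b) with (y + n * b - t) by ring.
  eapply Rle_trans; [apply (sech_sqr_second_difference (y + n * b) t ht)|].
  replace (A * t ^ 2 * r ^ j) with (20 * PI ^ 2 * exp (PI * b) * (exp (PI * Rabs y) * r ^ j) * t ^ 2)
    by (unfold A; ring).
  apply Rmult_le_compat_r; [apply pow2_ge_0|].
  apply Rmult_le_compat_l.
  { assert (h1 := exp_pos (PI * b)). assert (h2 := pow2_ge_0 PI). apply Rmult_le_pos; lra. }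
  unfold r. rewrite exp_pow, <- exp_plus.
  assert (h : - (PI * Rabs (y + n * b)) <= PI * Rabs y + - (PI * b) * INR j).
  { assert (h1 := Rabs_triang (y + n * b) (- y)). replace (y + n * b + - y) with (n * b) in h1 by ring.
    rewrite Rabs_Ropp, Rabs_mult, (Rabs_pos_eq b) in h1 by lra.
    assert (INR j * b <= Rabs n * b) by (apply Rmult_le_compat_r; lra).
    assert (PI * (INR j * b) <= PI * (Rabs (y + n * b) + Rabs y)) by (apply Rmult_le_compat_l; lra).
    lra. }
  destruct h as [h|h]; [left; now apply exp_increasing|rewrite h; lra]. }
assert (hg2 : forall j, Rabs (g (INR j + 0)) + Rabs (g (0 - 1 - INR j)) <= 2 * A * t ^ 2 * r ^ j).
{ intros j. destruct (index_abs 0 j (or_introl eq_refl)) as [i1 i2].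
  assert (h1 := hg _ j i1). assert (h2 := hg _ j i2). lra. }
assert (h0 := bs_tail_lim g 0 (2 * A * t ^ 2) r _ 0 hr hg2 hl).
assert (h1 := hg2 0%nat). rewrite pow_O in h0, h1.
set (S := / 2 * (sech_sqr_sum b (y + t) + sech_sqr_sum b (y - t)) - sech_sqr_sum b y) in *.
assert (e : bs g 0 0 = g (INR 0 + 0) + g (0 - 1 - INR 0)) by reflexivity.
replace S with (bs g 0 0 - (bs g 0 0 - S)) by ring.
eapply Rle_trans; [apply Rabs_triang|]. rewrite Rabs_Ropp.
assert (h2 : Rabs (bs g 0 0) <= 2 * A * t ^ 2).
{ rewrite e. eapply Rle_trans; [apply Rabs_triang|]. lra. }
replace ((2 * A + 2 * A / (1 - r)) * t ^ 2) with (2 * A * t ^ 2 + 2 * A * t ^ 2 / (1 - r) * 1) by (field; lra).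
lra.
Qed.

Lemma phase_mult_INR (M : nat) (n : R) : phase 1 n -> phase 1 (INR M * n).
Proof.
intros h. induction M as [|M IH].
- simpl INR. rewrite Rmult_0_l. apply phase_0.
- rewrite S_INR. replace ((INR M + 1) * n) with (INR M * n + n) by ring.
  rewrite <- (Rmult_1_l 1) at 1. now apply phase_plus.
Qed.

(** Unfolding: the integral over a period of the periodization is the integral over the line. *)
Lemma sech_sqr_sum_coeff (M : nat) :
  sinh (PI * (INR M / b)) *
    RInt (fun t => sech_sqr_sum b t * cos (2 * PI * (INR M / b) * t)) (- (b / 2)) (b / 2) = 2 * (INR M / b).
Proof.
rewrite <- (fourier_sech_sqr (INR M / b)). f_equal.
set (l := INR M / b). set (g := fun x => cos (2 * PI * l * x) / cosh (PI * x) ^ 2).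
assert (hg : cont g) by apply (dom_sech2 l).
assert (hr := exp_ratio b hb). fold r in hr.
assert (h1 : is_lim_seq (fun N => RInt (fun t => bs (fun n => / cosh (PI * (t + n * b)) ^ 2) 0 N * cos (2 * PI * l * t)) (- (b / 2)) (b / 2))
  (RInt (fun t => sech_sqr_sum b t * cos (2 * PI * l * t)) (- (b / 2)) (b / 2))).
{ apply (RInt_uniform_limit _ _ _ _ (fun N => 4 * exp (PI * (b / 2)) / (1 - r) * r ^ N)).
  - lra.
  - apply cont_mult; [apply cont_sech_sqr_sum|ct].
  - intros N. apply cont_mult; [|ct].
    apply (cont_bs (fun n y => / cosh (PI * (y + n * b)) ^ 2)). intros n. apply cont_sech_sqr.
  - intros N x hx. rewrite <- Rmult_minus_distr_r, Rabs_mult.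
    assert (h := sech_sqr_sum_rate x (b / 2) N ltac:(apply Rabs_le; lra)).
    assert (hc := cos_le_1 (2 * PI * l * x)).
    assert (p1 := Rabs_pos (bs (fun n => / cosh (PI * (x + n * b)) ^ 2) 0 N - sech_sqr_sum b x)).
    assert (p2 := Rabs_pos (cos (2 * PI * l * x))). nra.
  - now apply is_lim_seq_scaled_geom. }
assert (t : forall n, phase 1 n -> RInt (fun t => / cosh (PI * (t + n * b)) ^ 2 * cos (2 * PI * l * t)) (- (b / 2)) (b / 2) =
  RInt g (- (b / 2) + n * b) (b / 2 + n * b)).
{ intros n hn. rewrite <- RInt_shift by exact hg. apply RInt_extR. intros x. unfold g.
  destruct (phase_mult_INR M n hn) as [p1 p2].
  replace (2 * PI * l * (x + n * b)) with (2 * PI * l * x + 2 * PI * (INR M * n)) by (unfold l; field; lra).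
  rewrite cos_plus, p1, p2. unfold Rdiv. ring. }
(* The translates with indices from -N - 1 to N tile an interval that reaches one period further on
   the left than on the right. *)
assert (u : forall N, RInt (fun t => bs (fun n => / cosh (PI * (t + n * b)) ^ 2) 0 N * cos (2 * PI * l * t)) (- (b / 2)) (b / 2) =
  RInt g (- (INR N + (1 + / 2)) * b) ((INR N + / 2) * b)).
{ intros N.
  rewrite (RInt_extR _ (fun t => bs (fun n => / cosh (PI * (t + n * b)) ^ 2 * cos (2 * PI * l * t)) 0 N)).
  2: { intros x. rewrite (bs_ext (fun n => / cosh (PI * (x + n * b)) ^ 2 * cos (2 * PI * l * x))
         (fun n => cos (2 * PI * l * x) * / cosh (PI * (x + n * b)) ^ 2)) by (intros; ring).
       rewrite bs_scal. ring. }
  rewrite (RInt_bs (fun n t => / cosh (PI * (t + n * b)) ^ 2 * cos (2 * PI * l * t))).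
  2: { intros n. apply cont_mult; [apply cont_sech_sqr|ct]. }
  rewrite (bs_ext _ (fun n => RInt g (- (b / 2) + n * b) (b / 2 + n * b)))
    by (intros j; apply t; apply (phase_index 0 1 phase_0)).
  induction N as [|N IH].
  - unfold bs. simpl sum_f_R0. simpl INR. rewrite Rplus_comm.
    replace (- (b / 2) + (0 + 0) * b) with (b / 2 + (0 - 1 - 0) * b) by field.
    rewrite RInt_ChaslesR by exact hg. f_equal; field.
  - unfold bs in *. rewrite tech5, IH, S_INR.
    match goal with |- ?X + (?Y + ?Z) = _ => replace (X + (Y + Z)) with (Z + (X + Y)) by ring end.
    replace (- (b / 2) + (INR N + 1 + 0) * b) with ((INR N + / 2) * b) by field.
    rewrite RInt_ChaslesR by exact hg.
    replace (b / 2 + (0 - 1 - (INR N + 1)) * b) with (- (INR N + (1 + / 2)) * b) by field.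
    rewrite RInt_ChaslesR by exact hg. f_equal; field. }
apply (is_lim_seq_ext _ _ _ u) in h1.
assert (h2 := line_lim g (fun N => - (INR N + (1 + / 2)) * b) (fun N => (INR N + / 2) * b) (dom_sech2 l)).
assert (h3 : is_lim_seq (fun N => - (INR N + (1 + / 2)) * b) m_infty).
{ apply (is_lim_seq_ext (fun N => - ((INR N + (1 + / 2)) * b))); [intros; ring|].
  apply (is_lim_seq_opp _ p_infty). now apply is_lim_seq_affine. }
specialize (h2 h3 (is_lim_seq_affine (/ 2) b hb)).
exact (is_lim_seq_inj _ _ _ h1 h2).
Qed.

End Sum.

(** * The right-hand sides and the transforms on the real line *)

Lemma dom_bs (h : R -> R -> R) (s : R) (N : nat) : (forall n, dom (h n)) ->
  dom (fun x => bs (fun n => h n x) s N).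
Proof.
intros hd. unfold bs. induction N as [|N IH]; simpl; [apply dom_plus; apply hd|].
apply dom_plus; [exact IH|apply dom_plus; apply hd].
Qed.

Lemma line_bs (h : R -> R -> R) (s : R) (N : nat) : (forall n, dom (h n)) ->
  line (fun x => bs (fun n => h n x) s N) = bs (fun n => line (h n)) s N.
Proof.
intros hd. induction N as [|N IH].
- unfold bs. simpl. apply line_plus; apply hd.
- unfold bs in *. rewrite tech5, <- IH, <- line_plus by apply hd.
  rewrite <- line_plus; [reflexivity|exact (dom_bs h s N hd)|apply dom_plus; apply hd].
Qed.

(** The weight is dominated by sech, of mass 1, so the uniform rate of the series passes unchanged
    to the integrals. *)
Lemma fser_line (h : R -> R -> R) (s : R) (f g : R -> R) : fser h s f ->
  (forall n, dom (fun x => h n x * g x)) -> (forall n, cont (h n)) -> cont f ->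
  dom (fun x => f x * g x) -> cont g -> (forall x, Rabs (g x) <= / cosh (PI * x)) ->
  is_lim_seq (bs (fun n => line (fun x => h n x * g x)) s) (line (fun x => f x * g x)).
Proof.
intros (B & r & hr & hb) hd hh hf hfg hg hg1.
apply (is_lim_seq_geom B r); [exact hr|]. intros N.
rewrite <- (line_bs (fun n x => h n x * g x)) by exact hd.
rewrite <- line_minus; [|exact (dom_bs _ s N hd)|exact hfg].
assert (e : forall x, bs (fun n => h n x * g x) s N - f x * g x = (bs (fun n => h n x) s N - f x) * g x).
{ intros x. rewrite (bs_ext (fun n => h n x * g x) (fun n => g x * h n x)) by (intros; ring).
  rewrite bs_scal. ring. }
apply line_bound.
- apply cont_minus; [apply (cont_bs (fun n x => h n x * g x)); intros n; apply cont_mult; auto|].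
  now apply cont_mult.
- intros x. rewrite e, Rabs_mult. unfold Rdiv. apply Rmult_le_compat; try apply Rabs_pos; auto.
Qed.

Lemma is_derive_tanh_shift (c y : R) :
  is_derive (fun y => / PI * tanh (PI * (y + c))) y (/ cosh (PI * (y + c)) ^ 2).
Proof.
assert (hpi := PI_RGT_0). assert (hc := cosh_pos (PI * (y + c))).
assert (hs := cosh_sinh_sqr (PI * (y + c))).
unfold tanh. auto_derive; [lra|].
apply (Rmult_eq_reg_r (cosh (PI * (y + c)) ^ 2)); [|apply Rgt_not_eq, pow_lt, hc].
match goal with |- ?l = ?q => replace q with 1 by (field; lra);
  replace l with (cosh (PI * (y + c)) ^ 2 - sinh (PI * (y + c)) ^ 2) by (field; lra) end.
lra.
Qed.

Section Identity.

Variable k : R.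
Hypothesis hk : 0 < k < 1.
Let k' := comod k.
Let K := ellK k.
Let K' := ellK k'.
Let E := ellE k.
Let b := K' / K.

Let hk' : 0 < k' < 1 := comod_range k hk.
Let hK : 0 < K := ellK_pos k hk.
Let hK' : 0 < K' := ellK_pos k' hk'.

(** The two sides have the same Fourier coefficients of order [n <> 0]; Parseval's
    identity for [dn (., k)] gives equality at [y = 0]. *)
Theorem zeta_density (y : R) :
  2 * K * dnR (2 * K * y) k' ^ 2 + 2 * (E - K) = PI ^ 2 / (2 * K) * sech_sqr_sum b y.
Proof.
assert (hKp := hK). assert (hKp' := hK'). assert (hb : 0 < b) by now apply Rdiv_lt_0_compat.
assert (hpi := PI_RGT_0).
set (h := fun y => 2 * K * dnR (2 * K * y) k' ^ 2 - PI ^ 2 / (2 * K) * sech_sqr_sum b y).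
assert (hc : cont h).
{ assert (c1 := cont_sech_sqr_sum b hb). unfold h. ctj. }
assert (hev : forall y, h (- y) = h y).
{ intros x. unfold h. rewrite sech_sqr_sum_even by exact hb.
  replace (2 * K * - x) with (- (2 * K * x)) by ring. now rewrite dnR_opp. }
assert (hper : forall y, h (y + b) = 1 * h y).
{ intros x. unfold h. rewrite sech_sqr_sum_periodic by exact hb.
  replace (2 * K * (x + b)) with (2 * K * x + 2 * ellK k') by (unfold b, K'; field; lra).
  rewrite dnR_2K by exact hk'. ring. }
assert (coef : forall M, (0 < M)%nat -> forall n, n = INR M \/ n = - INR M ->
  RInt (fun t => h t * cos (2 * PI * (n / b) * t)) (- (b / 2)) (b / 2) = 0 :> R).
{ intros M hM n hn. assert (hMp := lt_0_INR M hM).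
  (* Taking the modulus k' exchanges [K] and [K'] and replaces [b] by its inverse, which is the
     frequency of the periodization. *)
  assert (e1 := dn_sqr_coeff k' hk' M). assert (e2 := sech_sqr_sum_coeff b hb M).
  cbv zeta in e1. rewrite (comod_comod k hk : comod k' = k) in e1. fold K in e1. fold K' in e1. fold b in e1.
  replace (INR M * (K / K')) with (INR M / b) in e1 by (unfold b; field; lra).
  rewrite (RInt_extR _ (fun t => 2 * K * (dnR (2 * K * t) k' ^ 2 * cos (2 * PI * (INR M / b) * t)) -
    PI ^ 2 / (2 * K) * (sech_sqr_sum b t * cos (2 * PI * (INR M / b) * t)))).
  2: { intros t. unfold h. destruct hn as [-> | ->]; [ring|].
       replace (2 * PI * (- INR M / b) * t) with (- (2 * PI * (INR M / b) * t)) by (field; lra).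
       rewrite cos_neg. ring. }
  assert (c1 := cont_sech_sqr_sum b hb).
  rewrite RInt_minusR by ctj. rewrite RInt_scalR by ctj. rewrite RInt_scalR by ctj.
  set (I1 := RInt (fun t => dnR (2 * K * t) k' ^ 2 * cos (2 * PI * (INR M / b) * t)) _ _) in *.
  set (I2 := RInt (fun t => sech_sqr_sum b t * cos (2 * PI * (INR M / b) * t)) _ _) in *.
  assert (hs : 0 < sinh (PI * (INR M / b))).
  { assert (h1 : 0 < PI * (INR M / b)) by (apply Rmult_lt_0_compat; [lra|now apply Rdiv_lt_0_compat]).
    assert (h2 := sinh_ge _ (Rlt_le _ _ h1)). lra. }
  apply (Rmult_eq_reg_l (sinh (PI * (INR M / b)))); [|lra].
  replace (sinh (PI * (INR M / b)) * (2 * K * I1 - PI ^ 2 / (2 * K) * I2)) with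
    (2 * K * (sinh (PI * (INR M / b)) * I1) - PI ^ 2 / (2 * K) * (sinh (PI * (INR M / b)) * I2)) by ring.
  rewrite e1, e2. unfold b. field. lra. }
set (c0 := RInt h (- (b / 2)) (b / 2)).
(* Every partial sum of the Fourier series of [h] is its mean, so Fejer's theorem makes [h]
   constant. *)
assert (hconst : forall x, c0 / b = h x).
{ intros x.
  destruct (smooth2_dnR_sqr k' hk' (2 * K)) as [C1 hC1].
  destruct (sech_sqr_sum_smooth b hb x) as [C2 hC2].
  apply (fourier_sum h b 1 0 x (2 * K * C1 + PI ^ 2 / (2 * K) * C2)); auto.
  - ring.
  - apply phase_0.
  - intros t ht. specialize (hC1 x t). specialize (hC2 t ht). unfold h.
    replace (/ 2 * (2 * K * dnR (2 * K * (x + t)) k' ^ 2 - PI ^ 2 / (2 * K) * sech_sqr_sum b (x + t) +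
      (2 * K * dnR (2 * K * (x - t)) k' ^ 2 - PI ^ 2 / (2 * K) * sech_sqr_sum b (x - t))) -
      (2 * K * dnR (2 * K * x) k' ^ 2 - PI ^ 2 / (2 * K) * sech_sqr_sum b x)) with
      (2 * K * (/ 2 * (dnR (2 * K * (x + t)) k' ^ 2 + dnR (2 * K * (x - t)) k' ^ 2) - dnR (2 * K * x) k' ^ 2) +
       - (PI ^ 2 / (2 * K) * (/ 2 * (sech_sqr_sum b (x + t) + sech_sqr_sum b (x - t)) - sech_sqr_sum b x))) by ring.
    eapply Rle_trans; [apply Rabs_triang|]. rewrite Rabs_Ropp, Rabs_mult, (Rabs_mult (PI ^ 2 / (2 * K))).
    assert (hq : 0 < PI ^ 2 / (2 * K)) by (apply Rdiv_lt_0_compat; [apply pow_lt; lra|lra]).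
    rewrite (Rabs_pos_eq (2 * K)), (Rabs_pos_eq (PI ^ 2 / (2 * K))) by lra.
    apply (Rmult_le_compat_l (2 * K)) in hC1; [|lra].
    apply (Rmult_le_compat_l (PI ^ 2 / (2 * K))) in hC2; [|lra]. lra.
  - apply (is_lim_seq_ext (fun _ => c0 / b)); [|apply is_lim_seq_const].
    intros N. symmetry. unfold bs. rewrite sum_f_R0_first.
    + rewrite !(RInt_even_sin h) by assumption.
      rewrite (coef 1%nat Nat.lt_0_1 (0 - 1 - INR 0)) by (simpl; lra).
      rewrite (RInt_extR (fun t => h t * cos (2 * PI * ((INR 0 + 0) / b) * t)) h).
      * fold c0. simpl INR. replace (2 * PI * ((0 + 0) / b) * x) with 0 by (field; lra).
        rewrite cos_0. field. lra.
      * intros t. simpl INR. replace (2 * PI * ((0 + 0) / b) * t) with 0 by (field; lra).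
        rewrite cos_0. ring.
    + intros j hj. rewrite !(RInt_even_sin h) by assumption.
      rewrite (coef j hj (INR j + 0)) by lra.
      rewrite (coef (S j) (Nat.lt_0_succ j) (0 - 1 - INR j)) by (rewrite S_INR; lra). ring. }
(* dn is 1 at 0, and [dn_sqr_mean], this time for the modulus k, evaluates the periodization at
   0. *)
assert (h0 : h 0 = 2 * K - 2 * E).
{ unfold h. rewrite Rmult_0_r. destruct (jacR_0 k' hk') as (_ & _ & e). rewrite e.
  assert (e1 := dn_sqr_mean k hk). cbv zeta in e1. fold k' in e1. fold K in e1. fold K' in e1. fold b in e1.
  assert (e2 := sech_sqr_sum_lim b hb 0).
  assert (e3 : forall N, bs (fun n => / cosh (PI * (0 + n * b)) ^ 2) 0 N = bs (fun n => / cosh (PI * (n * b)) ^ 2) 0 N)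
    by (intros N; apply bs_ext; intros; do 4 f_equal; ring).
  apply (is_lim_seq_ext _ _ _ e3) in e2.
  rewrite (is_lim_seq_inj _ _ _ e2 e1). fold E. field. lra. }
assert (e := hconst y). rewrite (hconst 0), h0 in e. unfold h in e. lra.
Qed.

(** What the transform formulas need to know about the right-hand sides. *)
Definition zeta_like (s : R) (Z : R -> R) : Prop :=
  (forall y, is_lim_seq (bs (fun n => PI / (2 * K) * (tanh (PI * (y + n * b)) - tanh (PI * (n * b)))) s) (Z y)) /\
  (forall y, Z (- y) = - Z y) /\
  exists t : R, is_lim_seq (bs (fun n => / cosh (PI * (n * b)) ^ 2) s) t /\ is_derive Z 0 (PI ^ 2 / (2 * K) * t).

(** By Legendre's relation this is the Jacobi zeta function of 2 K y for the modulus k', plus pi y /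
    K'. *)
Definition zetaD (y : R) : R := RInt (fun u => dnR u k' ^ 2) 0 (2 * K * y) + 2 * (E - K) * y.
Definition zetaN (y : R) : R := k ^ 2 * RInt (fun u => ndR u k' ^ 2) 0 (2 * K * y) + 2 * (E - K) * y.

Lemma zetaD_eq (y : R) : zetaD y = RInt (fun t => PI ^ 2 / (2 * K) * sech_sqr_sum b t) 0 y.
Proof.
unfold zetaD.
rewrite (RInt_extR (fun t => PI ^ 2 / (2 * K) * sech_sqr_sum b t)
  (fun t => 2 * K * dnR (2 * K * t + 0) k' ^ 2 + 2 * (E - K))).
2: { intros t. rewrite <- zeta_density, Rplus_0_r. reflexivity. }
rewrite RInt_plusR by ctj. rewrite RInt_scalR by ctj.
rewrite (RInt_lin (fun u => dnR u k' ^ 2)) by ctj.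
rewrite RInt_constR. replace (2 * K * 0 + 0) with 0 by ring. rewrite Rplus_0_r. ring.
Qed.

Lemma is_derive_zetaD (y : R) : is_derive zetaD y (PI ^ 2 / (2 * K) * sech_sqr_sum b y).
Proof.
assert (hb : 0 < b) by (apply Rdiv_lt_0_compat; [exact hK'|exact hK]).
assert (c1 := cont_sech_sqr_sum b hb).
apply (is_derive_ext (fun y => RInt (fun t => PI ^ 2 / (2 * K) * sech_sqr_sum b t) 0 y));
  [intros; symmetry; apply zetaD_eq|].
assert (c2 : cont (fun t => PI ^ 2 / (2 * K) * sech_sqr_sum b t)) by (apply (cont_mult (fun _ => _)); ct).
apply (is_derive_RInt (fun t => PI ^ 2 / (2 * K) * sech_sqr_sum b t) _ 0 y).
- exists (mkposreal 1 Rlt_0_1). intros x _. now apply is_RInt_cont.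
- apply c2.
Qed.

(** Termwise integration of the periodization, whose terms have multiples of tanh as primitives; the
    convergence is uniform between 0 and y. *)
Lemma zetaD_lim (y : R) :
  is_lim_seq (bs (fun n => PI / (2 * K) * (tanh (PI * (y + n * b)) - tanh (PI * (n * b)))) 0) (zetaD y).
Proof.
assert (hKp := hK). assert (hb : 0 < b) by (apply Rdiv_lt_0_compat; [exact hK'|exact hK]).
assert (hpi := PI_RGT_0). assert (hr := exp_ratio b hb).
assert (c1 := cont_sech_sqr_sum b hb).
assert (cu : forall N, cont (fun t => bs (fun n => / cosh (PI * (t + n * b)) ^ 2) 0 N)).
{ intros N. apply (cont_bs (fun n t => / cosh (PI * (t + n * b)) ^ 2)). intros n. apply cont_sech_sqr. }
assert (hl : is_lim_seq (fun N => RInt (fun t => bs (fun n => / cosh (PI * (t + n * b)) ^ 2) 0 N) 0 y)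
  (RInt (sech_sqr_sum b) 0 y)).
{ assert (hl : forall u v, u <= v -> (Rabs u <= Rabs y /\ Rabs v <= Rabs y) ->
    is_lim_seq (fun N => RInt (fun t => bs (fun n => / cosh (PI * (t + n * b)) ^ 2) 0 N) u v)
      (RInt (sech_sqr_sum b) u v)).
  { intros u v huv [hu hv].
    apply (RInt_uniform_limit _ _ u v (fun N => 4 * exp (PI * Rabs y) / (1 - exp (- (PI * b))) * exp (- (PI * b)) ^ N));
      auto; [|now apply is_lim_seq_scaled_geom].
    intros N x hx. apply (sech_sqr_sum_rate b hb x (Rabs y) N).
    apply Rabs_le_between in hu, hv. apply Rabs_le. lra. }
  assert (hy := Rabs_pos y).
  destruct (Rle_or_lt 0 y) as [h|h].
  - apply hl; [exact h|]. rewrite Rabs_R0. split; lra.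
  - rewrite RInt_swap_bounds by exact c1.
    apply (is_lim_seq_ext (fun N => - RInt (fun t => bs (fun n => / cosh (PI * (t + n * b)) ^ 2) 0 N) y 0)).
    + intros N. now rewrite (RInt_swap_bounds _ y 0).
    + apply (is_lim_seq_opp _ (Finite (RInt (sech_sqr_sum b) y 0))). apply hl; [lra|]. rewrite Rabs_R0. split; lra. }
apply (is_lim_seq_scal_l _ (PI ^ 2 / (2 * K))) in hl.
rewrite zetaD_eq, RInt_scalR by exact c1.
refine (is_lim_seq_ext _ _ _ _ hl). intros N.
rewrite (RInt_bs (fun n t => / cosh (PI * (t + n * b)) ^ 2)) by (intros n; apply cont_sech_sqr).
rewrite <- bs_scal.
assert (t : forall n, PI ^ 2 / (2 * K) * RInt (fun t => / cosh (PI * (t + n * b)) ^ 2) 0 y =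
  PI / (2 * K) * (tanh (PI * (y + n * b)) - tanh (PI * (n * b)))).
{ intros n. rewrite (RInt_FTC _ _ 0 y (is_derive_tanh_shift (n * b)) (cont_sech_sqr (n * b))).
  rewrite Rplus_0_l. field. lra. }
apply bs_ext; intros; apply t.
Qed.

Lemma zetaD_odd (y : R) : zetaD (- y) = - zetaD y.
Proof.
unfold zetaD. assert (h := RInt_reflect (fun u => dnR u k' ^ 2) 0 (2 * K * y) ltac:(ctj)).
rewrite (RInt_extR _ (fun u => dnR u k' ^ 2)) in h by (intros x; now rewrite dnR_opp).
rewrite Ropp_0 in h. replace (2 * K * - y) with (- (2 * K * y)) by ring.
rewrite (RInt_swap_bounds (fun u => dnR u k' ^ 2) (- (2 * K * y)) 0) by ctj.
lra.
Qed.

Lemma zetaD_like : zeta_like 0 zetaD.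
Proof.
assert (hb : 0 < b) by (apply Rdiv_lt_0_compat; [exact hK'|exact hK]).
split; [exact zetaD_lim|split; [exact zetaD_odd|]].
exists (sech_sqr_sum b 0). split; [|apply is_derive_zetaD].
refine (is_lim_seq_ext _ _ _ _ (sech_sqr_sum_lim b hb 0)).
intros N. apply bs_ext; intros; do 4 f_equal; ring.
Qed.

(** dn (u + K', k') = k nd (u, k'), so k^2 nd^2 is dn^2 moved by half its period. On indices this is
    a shift by 1/2, which pairs [zetaN] with the half-integral series of cn and sn. *)
Lemma zetaN_eq (y : R) : zetaN y = zetaD (y + b / 2) - zetaD (b / 2).
Proof.
assert (hKp := hK). unfold zetaN, zetaD.
assert (e1 : k ^ 2 * RInt (fun u => ndR u k' ^ 2) 0 (2 * K * y) =
  RInt (fun u => dnR (u + K') k' ^ 2) 0 (2 * K * y)).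
{ rewrite <- RInt_scalR.
  2: { unfold ndR. ctj. intros x. apply Rgt_not_eq, dnR_pos, hk'. }
  apply RInt_extR. intros u. destruct (jacR_K u k' hk') as (_ & _ & e).
  fold K' in e. rewrite e, (comod_comod k hk : comod k' = k). unfold ndR.
  unfold Rdiv. ring. }
rewrite e1, (RInt_shift (fun u => dnR u k' ^ 2)) by ctj.
replace (2 * K * (b / 2)) with (0 + K') by (unfold b; field; lra).
replace (2 * K * (y + b / 2)) with (2 * K * y + K') by (unfold b; field; lra).
assert (h := RInt_ChaslesR (fun u => dnR u k' ^ 2) 0 (0 + K') (2 * K * y + K') ltac:(ctj)).
rewrite <- h. ring.
Qed.

Lemma zetaN_like : zeta_like (/ 2) zetaN.
Proof.
assert (hb : 0 < b) by (apply Rdiv_lt_0_compat; [exact hK'|exact hK]).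
split; [|split].
- intros y. rewrite zetaN_eq.
  refine (is_lim_seq_ext _ _ _ _ (is_lim_seq_minus' _ _ _ _ (zetaD_lim (y + b / 2)) (zetaD_lim (b / 2)))).
  intros N. rewrite <- bs_minus. apply sum_eq. intros j _.
  replace (y + b / 2 + (INR j + 0) * b) with (y + (INR j + / 2) * b) by field.
  replace (b / 2 + (INR j + 0) * b) with ((INR j + / 2) * b) by field.
  replace (y + b / 2 + (0 - 1 - INR j) * b) with (y + (/ 2 - 1 - INR j) * b) by field.
  replace (b / 2 + (0 - 1 - INR j) * b) with ((/ 2 - 1 - INR j) * b) by field. ring.
- intros y. unfold zetaN.
  assert (cn' : cont (fun u => ndR u k' ^ 2)).
  { unfold ndR. ctj. intros x. apply Rgt_not_eq, dnR_pos, hk'. }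
  assert (h := RInt_reflect (fun u => ndR u k' ^ 2) 0 (2 * K * y) cn').
  rewrite (RInt_extR _ (fun u => ndR u k' ^ 2)) in h by (intros x; unfold ndR; now rewrite dnR_opp).
  rewrite Ropp_0 in h.
  replace (2 * K * - y) with (- (2 * K * y)) by ring.
  rewrite (RInt_swap_bounds (fun u => ndR u k' ^ 2) (- (2 * K * y)) 0) by exact cn'.
  rewrite <- h. ring.
- exists (sech_sqr_sum b (b / 2)). split.
  + refine (is_lim_seq_ext _ _ _ _ (sech_sqr_sum_lim b hb (b / 2))).
    intros N. apply sum_eq. intros j _.
    replace (b / 2 + (INR j + 0) * b) with ((INR j + / 2) * b) by field.
    replace (b / 2 + (0 - 1 - INR j) * b) with ((/ 2 - 1 - INR j) * b) by field. reflexivity.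
  + apply (is_derive_ext (fun y => zetaD (y + b / 2) - zetaD (b / 2))); [intros; symmetry; apply zetaN_eq|].
    evar_last.
    * apply (is_derive_minus (fun y => zetaD (y + b / 2)) (fun _ => zetaD (b / 2))).
      -- apply (is_derive_comp zetaD (fun y => y + b / 2) 0 (PI ^ 2 / (2 * K) * sech_sqr_sum b (0 + b / 2)) 1);
           [apply is_derive_zetaD|].
         auto_derive; [easy|ring].
      -- apply (is_derive_const (K := R_AbsRing) (V := R_NormedModule)).
    * unfold minus, opp, plus, scal, zero; simpl; unfold mult; simpl. rewrite Rplus_0_l. ring.
Qed.

(** Oddness of [Z] allows symmetrization in y; the product formulas for cosines and sines produce
    exactly the two arguments with plus and minus. *)
Lemma zeta_half_difference (s : R) (Z : R -> R) (y : R) : zeta_like s Z ->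
  is_lim_seq (bs (fun n => PI / (2 * K) * (/ 2 * (tanh (PI * (n * b) + PI * y) - tanh (PI * (n * b) - PI * y)))) s) (Z y).
Proof.
intros (hl & ho & _).
replace (Finite (Z y)) with (Finite (/ 2 * (Z y - Z (- y)))) by (f_equal; rewrite ho; field).
refine (is_lim_seq_ext _ _ _ _ (is_lim_seq_scal_l _ (/ 2) (Finite _)
  (is_lim_seq_minus' _ _ _ _ (hl y) (hl (- y))))).
intros N. rewrite <- bs_minus, <- bs_scal.
assert (t : forall n, / 2 * (PI / (2 * K) * (tanh (PI * (y + n * b)) - tanh (PI * (n * b))) -
    PI / (2 * K) * (tanh (PI * (- y + n * b)) - tanh (PI * (n * b)))) =
  PI / (2 * K) * (/ 2 * (tanh (PI * (n * b) + PI * y) - tanh (PI * (n * b) - PI * y)))).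
{ intros n. replace (PI * (y + n * b)) with (PI * (n * b) + PI * y) by ring.
  replace (PI * (- y + n * b)) with (PI * (n * b) - PI * y) by ring. ring. }
apply bs_ext; intros; apply t.
Qed.

(** * Transforms of the three series on the real line *)

Definition line_cos (f : R -> R) (y : R) : R := line (fun x => f x * (/ cosh (PI * x) * cos (2 * PI * y * x))).
Definition line_sin (f : R -> R) (y : R) : R := line (fun x => f x * (/ cosh (PI * x) * sin (2 * PI * y * x))).

Lemma dom_sech_sin (y : R) : dom (fun x => / cosh (PI * x) * sin (2 * PI * y * x)).
Proof. apply (dom_mult _ (fun x => sin (2 * PI * y * x)) 1 dom_sech); [ct|intros; apply sin_le_1]. Qed.

Lemma dom_weight (f g : R -> R) : cont f -> (forall x, Rabs (f x) <= 1) -> dom g -> dom (fun x => f x * g x).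
Proof.
intros hf h1 hg. apply (dom_ext (fun x => g x * f x)); [intros; ring|]. now apply (dom_mult _ _ 1).
Qed.

Lemma line_sech_cos_cos (l y : R) :
  line (fun x => cos (2 * PI * l * x) * (/ cosh (PI * x) * cos (2 * PI * y * x))) =
  / 2 * (/ cosh (PI * l + PI * y) + / cosh (PI * l - PI * y)).
Proof.
rewrite (line_ext _ (fun x => / 2 * (/ cosh (PI * x) * cos (2 * PI * (l + y) * x) + / cosh (PI * x) * cos (2 * PI * (l - y) * x)))).
- rewrite line_scal, line_plus, !fourier_sech; try apply dom_sech_cos.
  + do 3 f_equal; f_equal; ring.
  + apply dom_plus; apply dom_sech_cos.
- intros x. replace (2 * PI * (l + y) * x) with (2 * PI * l * x + 2 * PI * y * x) by ring.
  replace (2 * PI * (l - y) * x) with (2 * PI * l * x - 2 * PI * y * x) by ring.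
  rewrite cos_plus, cos_minus. field. apply Rgt_not_eq, cosh_pos.
Qed.

Lemma line_sech_sin_sin (l y : R) :
  line (fun x => sin (2 * PI * l * x) * (/ cosh (PI * x) * sin (2 * PI * y * x))) =
  / 2 * (/ cosh (PI * l - PI * y) - / cosh (PI * l + PI * y)).
Proof.
rewrite (line_ext _ (fun x => / 2 * (/ cosh (PI * x) * cos (2 * PI * (l - y) * x) - / cosh (PI * x) * cos (2 * PI * (l + y) * x)))).
- rewrite line_scal, line_minus, !fourier_sech; try apply dom_sech_cos.
  + f_equal. f_equal; do 2 f_equal; ring.
  + apply (dom_ext (fun x => / cosh (PI * x) * cos (2 * PI * (l - y) * x) + (-1) * (/ cosh (PI * x) * cos (2 * PI * (l + y) * x))));
      [intros; ring|].
    apply dom_plus; [apply dom_sech_cos|apply dom_scal, dom_sech_cos].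
- intros x. replace (2 * PI * (l + y) * x) with (2 * PI * l * x + 2 * PI * y * x) by ring.
  replace (2 * PI * (l - y) * x) with (2 * PI * l * x - 2 * PI * y * x) by ring.
  rewrite cos_plus, cos_minus. field. apply Rgt_not_eq, cosh_pos.
Qed.

Lemma sech_cos_le (y x : R) : Rabs (/ cosh (PI * x) * cos (2 * PI * y * x)) <= / cosh (PI * x).
Proof.
rewrite Rabs_mult, Rabs_pos_eq by apply Rlt_le, sech_pos.
assert (h := sech_pos (PI * x)). assert (h' := cos_le_1 (2 * PI * y * x)). nra.
Qed.

Lemma sech_sin_le (y x : R) : Rabs (/ cosh (PI * x) * sin (2 * PI * y * x)) <= / cosh (PI * x).
Proof.
rewrite Rabs_mult, Rabs_pos_eq by apply Rlt_le, sech_pos.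
assert (h := sech_pos (PI * x)). assert (h' := sin_le_1 (2 * PI * y * x)). nra.
Qed.

(** By [tanh_diff] the factor sinh (pi y) turns each term into a difference of tanh. At y = 0 the
    resulting identity is void, so the value there is read off as a series of sech^2, which
    [zeta_like] relates to the derivative of [Z]. *)
Lemma cosine_series_transform (s C : R) (f Z : R -> R) :
  fser (fun n x => C * (/ cosh (PI * (n * b)) * cos (2 * PI * (n * b) * x))) s f ->
  cont f -> (forall x, Rabs (f x) <= 1) -> zeta_like s Z ->
  (forall y, sinh (PI * y) * line_cos f y = C * (2 * K / PI) * Z y) /\
  exists d, is_derive Z 0 d /\ line_cos f 0 = C * (2 * K / PI) * (d / PI).
Proof.
intros hs hf hf1 hZ. assert (hKp := hK). assert (hpi := PI_RGT_0).
assert (hl : forall y, is_lim_seq (bs (fun n => C * (/ cosh (PI * (n * b)) *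
    (/ 2 * (/ cosh (PI * (n * b) + PI * y) + / cosh (PI * (n * b) - PI * y))))) s) (line_cos f y)).
{ intros y.
  assert (dn : forall n, dom (fun x => cos (2 * PI * (n * b) * x) * (/ cosh (PI * x) * cos (2 * PI * y * x))))
    by (intros n; apply dom_weight; [ct|intros; apply cos_le_1|apply dom_sech_cos]).
  refine (is_lim_seq_ext _ _ _ _ (fser_line _ s f (fun x => / cosh (PI * x) * cos (2 * PI * y * x)) hs _ _ hf _ _ _)).
  - intros N.
    assert (t : forall n, line (fun x => C * (/ cosh (PI * (n * b)) * cos (2 * PI * (n * b) * x)) *
        (/ cosh (PI * x) * cos (2 * PI * y * x))) =
      C * (/ cosh (PI * (n * b)) * (/ 2 * (/ cosh (PI * (n * b) + PI * y) + / cosh (PI * (n * b) - PI * y))))).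
    { intros n. rewrite <- line_sech_cos_cos, <- !line_scal by (try apply dom_scal; apply dn).
      apply line_ext. intros x. ring. }
    apply bs_ext; intros; apply t.
  - intros n. apply (dom_ext (fun x => (C * / cosh (PI * (n * b))) * (cos (2 * PI * (n * b) * x) * (/ cosh (PI * x) * cos (2 * PI * y * x)))));
      [intros; ring|]. apply dom_scal, dn.
  - intros n. ct.
  - apply dom_weight; [exact hf|exact hf1|apply dom_sech_cos].
  - apply dom_sech_cos.
  - apply sech_cos_le. }
split.
- intros y. assert (h1 := is_lim_seq_scal_l _ (sinh (PI * y)) _ (hl y)).
  assert (h2 := is_lim_seq_scal_l _ (C * (2 * K / PI)) _ (zeta_half_difference s Z y hZ)).
  refine (is_lim_seq_inj _ _ _ h1 (is_lim_seq_ext _ _ _ _ h2)).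
  intros N. rewrite <- !bs_scal.
  assert (t : forall n, C * (2 * K / PI) * (PI / (2 * K) * (/ 2 * (tanh (PI * (n * b) + PI * y) - tanh (PI * (n * b) - PI * y)))) =
    sinh (PI * y) * (C * (/ cosh (PI * (n * b)) * (/ 2 * (/ cosh (PI * (n * b) + PI * y) + / cosh (PI * (n * b) - PI * y)))))).
  { intros n. assert (t1 := tanh_diff (PI * (n * b)) (PI * y)). assert (t2 := tanh_diff (PI * (n * b)) (- (PI * y))).
    rewrite sinh_neg in t2. replace (PI * (n * b) + - (PI * y)) with (PI * (n * b) - PI * y) in t2 by ring.
    replace (tanh (PI * (n * b) + PI * y) - tanh (PI * (n * b) - PI * y)) with
      ((tanh (PI * (n * b) + PI * y) - tanh (PI * (n * b))) - (tanh (PI * (n * b) - PI * y) - tanh (PI * (n * b)))) by ring.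
    rewrite t1, t2.
    set (p := / cosh (PI * (n * b))). set (q := / cosh (PI * (n * b) + PI * y)). set (w := / cosh (PI * (n * b) - PI * y)).
    field. lra. }
  apply bs_ext; intros; apply t.
- destruct hZ as (_ & _ & t & ht & hd). exists (PI ^ 2 / (2 * K) * t). split; [exact hd|].
  replace (C * (2 * K / PI) * (PI ^ 2 / (2 * K) * t / PI)) with (C * t) by (field; lra).
  refine (is_lim_seq_inj _ _ _ (hl 0) (is_lim_seq_ext _ _ _ _ (is_lim_seq_scal_l _ C (Finite _) ht))).
  intros N. rewrite <- bs_scal.
  assert (u : forall n, C * / cosh (PI * (n * b)) ^ 2 =
    C * (/ cosh (PI * (n * b)) * (/ 2 * (/ cosh (PI * (n * b) + PI * 0) + / cosh (PI * (n * b) - PI * 0))))).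
  { intros n. rewrite Rmult_0_r, Rplus_0_r, Rminus_0_r. field. apply Rgt_not_eq, cosh_pos. }
  apply bs_ext; intros; apply u.
Qed.

(** With 1 / sinh for 1 / cosh the factor that produces tanh is cosh (pi y), and the coth terms
    cancel between the two halves. This factor has no zero, hence no separate clause for y = 0;
    half-integral indices stay away from the zero of sinh. *)
Lemma sine_series_transform (C : R) (f Z : R -> R) :
  fser (fun n x => C * (/ sinh (PI * (n * b)) * sin (2 * PI * (n * b) * x))) (/ 2) f ->
  cont f -> (forall x, Rabs (f x) <= 1) -> zeta_like (/ 2) Z ->
  forall y, cosh (PI * y) * line_sin f y = C * (2 * K / PI) * Z y.
Proof.
intros hs hf hf1 hZ y. assert (hKp := hK). assert (hpi := PI_RGT_0).
assert (hb : 0 < b) by (apply Rdiv_lt_0_compat; [exact hK'|exact hK]).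
assert (hl : is_lim_seq (bs (fun n => C * (/ sinh (PI * (n * b)) *
    (/ 2 * (/ cosh (PI * (n * b) - PI * y) - / cosh (PI * (n * b) + PI * y))))) (/ 2)) (line_sin f y)).
{ assert (dn : forall n, dom (fun x => sin (2 * PI * (n * b) * x) * (/ cosh (PI * x) * sin (2 * PI * y * x))))
    by (intros n; apply dom_weight; [ct|intros; apply sin_le_1|apply dom_sech_sin]).
  refine (is_lim_seq_ext _ _ _ _ (fser_line _ (/ 2) f (fun x => / cosh (PI * x) * sin (2 * PI * y * x)) hs _ _ hf _ _ _)).
  - intros N.
    assert (t : forall n, line (fun x => C * (/ sinh (PI * (n * b)) * sin (2 * PI * (n * b) * x)) *
        (/ cosh (PI * x) * sin (2 * PI * y * x))) =
      C * (/ sinh (PI * (n * b)) * (/ 2 * (/ cosh (PI * (n * b) - PI * y) - / cosh (PI * (n * b) + PI * y))))).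
    { intros n. rewrite <- line_sech_sin_sin, <- !line_scal by (try apply dom_scal; apply dn).
      apply line_ext. intros x. ring. }
    apply bs_ext; intros; apply t.
  - intros n. apply (dom_ext (fun x => (C * / sinh (PI * (n * b))) * (sin (2 * PI * (n * b) * x) * (/ cosh (PI * x) * sin (2 * PI * y * x)))));
      [intros; ring|]. apply dom_scal, dn.
  - intros n. ct.
  - apply dom_weight; [exact hf|exact hf1|apply dom_sech_sin].
  - apply dom_sech_sin.
  - apply sech_sin_le. }
assert (h1 := is_lim_seq_scal_l _ (cosh (PI * y)) _ hl).
assert (h2 := is_lim_seq_scal_l _ (C * (2 * K / PI)) _ (zeta_half_difference (/ 2) Z y hZ)).
refine (is_lim_seq_inj _ _ _ h1 (is_lim_seq_ext _ _ _ _ h2)).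
intros N. rewrite <- !bs_scal.
assert (t : forall n, / 2 <= Rabs n ->
  C * (2 * K / PI) * (PI / (2 * K) * (/ 2 * (tanh (PI * (n * b) + PI * y) - tanh (PI * (n * b) - PI * y)))) =
  cosh (PI * y) * (C * (/ sinh (PI * (n * b)) * (/ 2 * (/ cosh (PI * (n * b) - PI * y) - / cosh (PI * (n * b) + PI * y)))))).
{ intros n hn. set (x := PI * (n * b)). set (z := PI * y).
  assert (hx : sinh x <> 0).
  { assert (h := sinh_sqr_ge x). intros e. rewrite e in h.
    assert (hx : x <> 0).
    { unfold x. intros e0. apply Rmult_integral in e0. destruct e0 as [e0|e0]; [lra|].
      apply Rmult_integral in e0. destruct e0 as [e0|e0]; [rewrite e0, Rabs_R0 in hn; lra|lra]. }
    assert (0 < x ^ 2) by (apply pow2_gt_0; exact hx). simpl in h. lra. }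
  assert (c1 := cosh_pos (x + z)). assert (c2 := cosh_pos (x - z)).
  (* [cosh z / (sinh x cosh (x + z)) = coth x - tanh (x + z)], and the same with [- z] *)
  assert (t1 : cosh z * (/ sinh x * / cosh (x + z)) = cosh x / sinh x - tanh (x + z)).
  { unfold tanh. apply (Rmult_eq_reg_r (sinh x * cosh (x + z))).
    2: { apply Rmult_integral_contrapositive. split; lra. }
    replace (cosh z * (/ sinh x * / cosh (x + z)) * (sinh x * cosh (x + z))) with (cosh z) by (field; lra).
    replace ((cosh x / sinh x - sinh (x + z) / cosh (x + z)) * (sinh x * cosh (x + z))) with
      (cosh x * cosh (x + z) - sinh (x + z) * sinh x) by (field; lra).
    rewrite cosh_plus, sinh_plus. assert (h := cosh_sinh_sqr x).
    replace (cosh x * (cosh x * cosh z + sinh x * sinh z) - (sinh x * cosh z + cosh x * sinh z) * sinh x) with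
      (cosh z * (cosh x ^ 2 - sinh x ^ 2)) by ring. rewrite h. ring. }
  assert (t2 : cosh z * (/ sinh x * / cosh (x - z)) = cosh x / sinh x - tanh (x - z)).
  { unfold tanh. apply (Rmult_eq_reg_r (sinh x * cosh (x - z))).
    2: { apply Rmult_integral_contrapositive. split; lra. }
    replace (cosh z * (/ sinh x * / cosh (x - z)) * (sinh x * cosh (x - z))) with (cosh z) by (field; lra).
    replace ((cosh x / sinh x - sinh (x - z) / cosh (x - z)) * (sinh x * cosh (x - z))) with
      (cosh x * cosh (x - z) - sinh (x - z) * sinh x) by (field; lra).
    unfold Rminus at 2 3. rewrite cosh_plus, sinh_plus, cosh_neg, sinh_neg. assert (h := cosh_sinh_sqr x).
    replace (cosh x * (cosh x * cosh z + sinh x * - sinh z) - (sinh x * cosh z + cosh x * - sinh z) * sinh x) with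
      (cosh z * (cosh x ^ 2 - sinh x ^ 2)) by ring. rewrite h. ring. }
  replace (cosh z * (C * (/ sinh x * (/ 2 * (/ cosh (x - z) - / cosh (x + z)))))) with
    (C * / 2 * (cosh z * (/ sinh x * / cosh (x - z)) - cosh z * (/ sinh x * / cosh (x + z)))) by ring.
  rewrite t1, t2. field. lra. }
apply bs_ext; intros; apply t; apply index_half.
Qed.

End Identity.

(** * The transforms on horizontal lines *)

(** The filter of neighbourhoods on [C] is that of the product, so convergence is componentwise; for
    the absolute integral, [Cmod] is at most [sqrt 2] times the larger component. *)
Lemma line_complex (f g : R -> R) : dom f -> dom g ->
  ex_RInt_gen (fun t => Cmod (f t, g t)) (Rbar_locally m_infty) (Rbar_locally p_infty) /\
  is_RInt_gen (V := prod_NormedModule R_AbsRing R_NormedModule R_NormedModule)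
    (fun t => (f t, g t)) (Rbar_locally m_infty) (Rbar_locally p_infty) (line f, line g).
Proof.
intros hf hg. split.
- exists (line (fun t => Cmod (f t, g t))). apply line_correct.
  destruct hf as [cf [A hA]], hg as [cg [B hB]]. split.
  + unfold Cmod. simpl fst. simpl snd.
    apply (cont_comp sqrt); [|ct].
    intros x. apply continuous_sqrt.
  + exists (sqrt 2 * (Rmax A B)). intros x. rewrite Rabs_pos_eq by apply Cmod_ge_0.
    eapply Rle_trans; [apply Cmod_2Rmax|]. unfold Rdiv. rewrite Rmult_assoc.
    apply Rmult_le_compat_l; [apply sqrt_pos|]. simpl.
    assert (h := sech_pos (PI * x)). specialize (hA x). specialize (hB x). unfold Rdiv in *.
    apply Rmax_lub.
    * eapply Rle_trans; [exact hA|]. apply Rmult_le_compat_r; [lra|apply Rmax_l].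
    * eapply Rle_trans; [exact hB|]. apply Rmult_le_compat_r; [lra|apply Rmax_r].
- intros P [eps hP].
  assert (h1 := line_filterlim f hf _ (locally_ball (line f) eps)).
  assert (h2 := line_filterlim g hg _ (locally_ball (line g) eps)).
  unfold filtermap in h1, h2.
  assert (h := filter_and (F := filter_prod (Rbar_locally m_infty) (Rbar_locally p_infty)) _ _ h1 h2).
  unfold filtermapi.
  refine (filter_imp _ _ _ h).
  intros [a b] [b1 b2]. simpl in *.
  exists (RInt f a b, RInt g a b). split.
  + apply (is_RInt_fct_extend_pair (U := R_NormedModule) (V := R_NormedModule) (fun t => (f t, g t)));
      apply is_RInt_cont; [apply hf|apply hg].
  + apply hP. now split.
Qed.

Lemma Cexp_eq (t s y : R) : Cexp (2 * PI * Ci * (t, s) * y)%C =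
  (cos (2 * PI * y * t) * exp (- (2 * PI * y * s)), sin (2 * PI * y * t) * exp (- (2 * PI * y * s))).
Proof.
unfold Cexp.
assert (e1 : Re (2 * PI * Ci * (t, s) * y)%C = - (2 * PI * y * s)) by (unfold Re; simpl; ring).
assert (e2 : Im (2 * PI * Ci * (t, s) * y)%C = 2 * PI * y * t) by (unfold Im; simpl; ring).
rewrite e1, e2. f_equal; ring.
Qed.

Lemma Ccosh_eq (t s : R) : Ccosh (PI * (t, s))%C = (cosh (PI * t) * cos (PI * s), sinh (PI * t) * sin (PI * s)).
Proof.
unfold Ccosh, Cexp.
assert (e1 : Re (PI * (t, s))%C = PI * t) by (unfold Re; simpl; ring).
assert (e2 : Im (PI * (t, s))%C = PI * s) by (unfold Im; simpl; ring).
assert (e3 : Re (- (PI * (t, s)))%C = - (PI * t)) by (unfold Re; simpl; ring).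
assert (e4 : Im (- (PI * (t, s)))%C = - (PI * s)) by (unfold Im; simpl; ring).
rewrite e1, e2, e3, e4, cos_neg, sin_neg. unfold cosh, sinh.
apply injective_projections; simpl; field.
Qed.

Lemma Csinh_eq (t s : R) : Csinh (PI * (t, s))%C = (sinh (PI * t) * cos (PI * s), cosh (PI * t) * sin (PI * s)).
Proof.
unfold Csinh, Cexp.
assert (e1 : Re (PI * (t, s))%C = PI * t) by (unfold Re; simpl; ring).
assert (e2 : Im (PI * (t, s))%C = PI * s) by (unfold Im; simpl; ring).
assert (e3 : Re (- (PI * (t, s)))%C = - (PI * t)) by (unfold Re; simpl; ring).
assert (e4 : Im (- (PI * (t, s)))%C = - (PI * s)) by (unfold Im; simpl; ring).
rewrite e1, e2, e3, e4, cos_neg, sin_neg. unfold cosh, sinh.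
apply injective_projections; simpl; field.
Qed.

Lemma sech_C (t s : R) : (/ Ccosh (PI * (t, s)))%C = (sechU t s, sechV t s).
Proof. rewrite Ccosh_eq. reflexivity. Qed.

Lemma Csinh_shift (t s : R) : Csinh (PI * (t, s))%C = (Ci * Ccosh (PI * (t, (s - / 2)%R)))%C.
Proof.
rewrite Csinh_eq, Ccosh_eq.
replace (PI * (s - / 2)) with (- (PI / 2 - PI * s)) by field.
rewrite cos_neg, sin_neg, cos_shift, sin_shift. apply injective_projections; simpl; ring.
Qed.

Section Transforms.

Variable k : R.
Hypothesis hk : 0 < k < 1.
Let k' := comod k.
Let K := ellK k.
Let K' := ellK k'.

Let hk' : 0 < k' < 1 := comod_range k hk.
Let hK : 0 < K := ellK_pos k hk.
Let hK' : 0 < K' := ellK_pos k' hk'.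

(** cn decreases on [0, K'], so its value at height s bounds the denominators from below on all
    lines between 0 and s at once. *)
Lemma cnR_between (s t : R) : Rabs s < / 2 -> Rmin 0 s <= t <= Rmax 0 s ->
  0 < cnR (2 * K' * s) k' <= cnR (2 * K' * t) k'.
Proof.
intros hs ht. assert (hKp := hK'). split.
{ apply cnR_pos; [exact hk'|]. now apply strip_scale. }
assert (pos : forall u v, 0 <= u <= v -> v < / 2 -> cnR (2 * K' * v) k' <= cnR (2 * K' * u) k').
{ intros u v huv hv.
  assert (mono : forall x y, x <= y -> am x k' <= am y k').
  { intros x y [h|h]; [left; now apply am_increasing|rewrite h; lra]. }
  assert (h0 := mono 0 (2 * K' * u) ltac:(nra)). rewrite am_0 in h0 by exact hk'.
  assert (h1 := mono (2 * K' * u) (2 * K' * v) ltac:(nra)).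
  assert (h2 := mono (2 * K' * v) K' ltac:(nra)). unfold K' in h2 at 2. rewrite am_ellK in h2 by exact hk'.
  assert (hpi := PI_RGT_0). unfold cnR. apply cos_decr_1; lra. }
unfold Rmin, Rmax in ht. apply Rabs_def2 in hs. destruct (Rle_dec 0 s) as [h|h].
- apply pos; lra.
- rewrite <- (cnR_opp (2 * K' * s)), <- (cnR_opp (2 * K' * t)) by exact hk'.
  replace (- (2 * K' * s)) with (2 * K' * - s) by ring. replace (- (2 * K' * t)) with (2 * K' * - t) by ring.
  apply pos; lra.
Qed.

Lemma quotient_bound (p x s t : R) : Rabs s < / 2 -> Rmin 0 s <= t <= Rmax 0 s -> Rabs p <= 1 ->
  Rabs (p / jac_den (2 * K' * x, 2 * K' * t) k) <= / cnR (2 * K' * s) k' ^ 2.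
Proof.
intros hs ht hp. destruct (cnR_between s t hs ht) as [h1 h2].
assert (hd : cnR (2 * K' * t) k' ^ 2 <= jac_den (2 * K' * x, 2 * K' * t) k).
{ unfold jac_den. simpl Re. simpl Im. fold k'.
  assert (0 <= k ^ 2 * snR (2 * K' * x) k ^ 2 * snR (2 * K' * t) k' ^ 2)
    by (apply Rmult_le_pos; [apply Rmult_le_pos|]; apply pow2_ge_0). lra. }
assert (hc : cnR (2 * K' * s) k' ^ 2 <= cnR (2 * K' * t) k' ^ 2) by (apply pow_incr; lra).
assert (h0 : 0 < cnR (2 * K' * s) k' ^ 2) by now apply pow_lt.
unfold Rdiv. rewrite Rabs_mult, Rabs_inv, (Rabs_pos_eq (jac_den _ _)) by lra.
apply Rle_trans with (1 * / jac_den (2 * K' * x, 2 * K' * t) k).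
- apply Rmult_le_compat_r; [apply Rlt_le, Rinv_0_lt_compat; lra|exact hp].
- rewrite Rmult_1_l. apply Rinv_le_contravar; lra.
Qed.

Definition integrand (f : C -> C) (y s t : R) : C :=
  (f (2 * K' * t, 2 * K' * s)%R / Ccosh (PI * (t, s)) * Cexp (2 * PI * Ci * (t, s) * y))%C.

(** Heights of both signs occur: quotients by cosh use s = eps > 0, quotients by sinh use s = eps -
    1/2 < 0. The dominated components [u] and [v] are kept explicit so that linear combinations can
    be formed. *)
Definition line_transform (f : C -> C) (y : R) (l : R * R) : Prop := forall s, Rabs s < / 2 ->
  exists u v : R -> R, dom u /\ dom v /\ (forall t, integrand f y s t = (u t, v t)) /\ l = (line u, line v).

(** Cauchy's theorem moves the line to the real axis, where the Jacobi function and sech are real;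
    the exponential then splits the integral into its cosine and sine parts. *)
Lemma line_transform_intro (f : C -> C) (fr : R -> R) (y : R) :
  hol (/ 2) (fun x s => Re (f (2 * K' * x, 2 * K' * s))) (fun x s => Im (f (2 * K' * x, 2 * K' * s))) ->
  (forall s, Rabs s < / 2 -> exists B, forall x t, Rmin 0 s <= t <= Rmax 0 s ->
    Rabs (Re (f (2 * K' * x, 2 * K' * t))) <= B /\ Rabs (Im (f (2 * K' * x, 2 * K' * t))) <= B) ->
  (forall x, f (2 * K' * x, 2 * K' * 0) = RtoC (fr x)) ->
  line_transform f y (line_cos fr y, line_sin fr y).
Proof.
intros hf hB hr s hs.
set (U := fun x s => Re (f (2 * K' * x, 2 * K' * s))).
set (V := fun x s => Im (f (2 * K' * x, 2 * K' * s))).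
set (U1 := fun x s => U x s * sechU x s - V x s * sechV x s).
set (V1 := fun x s => U x s * sechV x s + V x s * sechU x s).
assert (hh : hol (/ 2) U1 V1) by (exact (hol_mult _ _ _ _ _ hf hol_sech)).
destruct (hB s hs) as [B hBs].
assert (hB0 : 0 <= B).
{ destruct (hBs 0 s) as [h _]; [split; [apply Rmin_r|apply Rmax_r]|].
  eapply Rle_trans; [apply Rabs_pos|exact h]. }
set (C := 2 * B * / cos (PI * s)).
assert (hb : forall x t, Rmin 0 s <= t <= Rmax 0 s ->
  Rabs (U1 x t) <= C / cosh (PI * x) /\ Rabs (V1 x t) <= C / cosh (PI * x)).
{ intros x t ht. destruct (hBs x t ht) as [a1 a2]. fold (U x t) in a1. fold (V x t) in a2.
  destruct (sech_bound x t (strip_between _ s t hs ht)) as [b1 b2].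
  destruct (cos_PI_between s t hs ht) as [c1 c2].
  assert (hi : / cos (PI * t) <= / cos (PI * s)) by now apply Rinv_le_contravar.
  assert (h1 := sech_pos (PI * x)). unfold Rdiv in *.
  set (r := / cos (PI * s)) in *. set (h := / cosh (PI * x)) in *.
  assert (k1 : forall a c, Rabs a <= B -> Rabs c <= / cos (PI * t) * h -> Rabs (a * c) <= B * (r * h)).
  { intros a c ha hc. rewrite Rabs_mult. apply Rmult_le_compat; try apply Rabs_pos; [exact ha|].
    eapply Rle_trans; [exact hc|]. apply Rmult_le_compat_r; lra. }
  assert (k2 := k1 _ _ a1 b1). assert (k3 := k1 _ _ a2 b2). assert (k4 := k1 _ _ a1 b2).
  assert (k5 := k1 _ _ a2 b1). unfold U1, V1, C.
  split; (eapply Rle_trans; [apply Rabs_triang|]); rewrite ?Rabs_Ropp; lra. }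
destruct (hol_line_exp s y C U1 V1 hh hs hb) as (d1 & d2 & d3 & d4 & e1 & e2).
cbv zeta beta in *. set (q := exp (- (2 * PI * y * s))) in *.
set (c := fun x => cos (2 * PI * y * x)) in *. set (w := fun x => sin (2 * PI * y * x)) in *.
exists (fun t => q * (U1 t s * c t + -1 * (V1 t s * w t))), (fun t => q * (U1 t s * w t + V1 t s * c t)).
split; [apply dom_scal, dom_plus; [exact d1|apply dom_scal; exact d4]|].
split; [apply dom_scal, dom_plus; [exact d3|exact d2]|].
split.
- intros t. unfold integrand. unfold Cdiv. rewrite sech_C, Cexp_eq. fold q. fold (c t). fold (w t).
  unfold U1, V1, U, V. generalize (f (2 * K' * t, 2 * K' * s)). intros z.
  apply injective_projections; unfold Re, Im; simpl; ring.
- symmetry. f_equal.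
  + rewrite line_scal by (apply dom_plus; [exact d1|apply dom_scal; exact d4]).
    rewrite line_plus; [|exact d1|apply dom_scal; exact d4]. rewrite line_scal by exact d4.
    transitivity (q * (line (fun x => U1 x s * c x) - line (fun x => V1 x s * w x))); [ring|].
    etransitivity; [exact e1|]. apply line_ext. intros x. unfold U1, V1, U, V.
    rewrite sechU_0, sechV_0, hr. simpl. fold (c x). ring.
  + rewrite line_scal by (apply dom_plus; [exact d3|exact d2]).
    rewrite line_plus; [|exact d3|exact d2].
    etransitivity; [exact e2|]. apply line_ext. intros x. unfold U1, V1, U, V.
    rewrite sechU_0, sechV_0, hr. simpl. fold (w x). ring.
Qed.

Lemma dn_line_transform (y : R) : line_transform (fun z => dn z k) y
  (line_cos (fun x => dnR (2 * K' * x) k) y, 0).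
Proof.
replace 0 with (line_sin (fun x => dnR (2 * K' * x) k) y).
- apply line_transform_intro.
  + exact (hol_dn k hk).
  + intros s hs. exists (/ cnR (2 * K' * s) k' ^ 2). intros x t ht. split.
    * apply quotient_bound; [exact hs|exact ht|].
      repeat apply Rabs_mult_le_1; try apply cnR_le_1; now apply dnR_le_1.
    * apply quotient_bound; [exact hs|exact ht|]. rewrite Rabs_Ropp.
      repeat apply Rabs_mult_le_1; try apply cnR_le_1; try apply snR_le_1; rewrite Rabs_pos_eq; nra.
  + intros x. destruct (jac_real k hk x) as (p & _ & _). exact p.
- destruct (dn_scaled k hk) as (hc & he & _). apply line_odd.
  + apply dom_weight; [exact hc|intros; now apply dnR_le_1|apply dom_sech_sin].
  + intros x. cbv zeta in he. fold k' K' in he. rewrite he.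
    replace (PI * - x) with (- (PI * x)) by ring. replace (2 * PI * y * - x) with (- (2 * PI * y * x)) by ring.
    rewrite cosh_neg, sin_neg. ring.
Qed.

Lemma cn_line_transform (y : R) : line_transform (fun z => cn z k) y
  (line_cos (fun x => cnR (2 * K' * x) k) y, 0).
Proof.
replace 0 with (line_sin (fun x => cnR (2 * K' * x) k) y).
- apply line_transform_intro.
  + exact (hol_cn k hk).
  + intros s hs. exists (/ cnR (2 * K' * s) k' ^ 2). intros x t ht. split.
    * apply quotient_bound; [exact hs|exact ht|]. apply Rabs_mult_le_1; apply cnR_le_1.
    * apply quotient_bound; [exact hs|exact ht|]. rewrite Rabs_Ropp.
      repeat apply Rabs_mult_le_1; try apply snR_le_1; now apply dnR_le_1.
  + intros x. destruct (jac_real k hk x) as (_ & p & _). exact p.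
- destruct (cn_scaled k hk) as (hc & he & _). apply line_odd.
  + apply dom_weight; [exact hc|intros; apply cnR_le_1|apply dom_sech_sin].
  + intros x. cbv zeta in he. fold k' K' in he. rewrite he.
    replace (PI * - x) with (- (PI * x)) by ring. replace (2 * PI * y * - x) with (- (2 * PI * y * x)) by ring.
    rewrite cosh_neg, sin_neg. ring.
Qed.

Lemma sn_line_transform (y : R) : line_transform (fun z => sn z k) y
  (0, line_sin (fun x => snR (2 * K' * x) k) y).
Proof.
replace 0 with (line_cos (fun x => snR (2 * K' * x) k) y).
- apply line_transform_intro.
  + exact (hol_sn k hk).
  + intros s hs. exists (/ cnR (2 * K' * s) k' ^ 2). intros x t ht. split.
    * apply quotient_bound; [exact hs|exact ht|]. apply Rabs_mult_le_1; [apply snR_le_1|now apply dnR_le_1].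
    * apply quotient_bound; [exact hs|exact ht|].
      repeat apply Rabs_mult_le_1; try apply snR_le_1; try apply cnR_le_1; now apply dnR_le_1.
  + intros x. destruct (jac_real k hk x) as (_ & _ & p). exact p.
- destruct (sn_scaled k hk) as (hc & he & _). apply line_odd.
  + apply dom_weight; [exact hc|intros; apply snR_le_1|apply dom_sech_cos].
  + intros x. cbv zeta in he. fold k' K' in he. rewrite he.
    replace (PI * - x) with (- (PI * x)) by ring. replace (2 * PI * y * - x) with (- (2 * PI * y * x)) by ring.
    rewrite cosh_neg, cos_neg. ring.
Qed.

Lemma scale_C (t s : R) : (2 * K' * (t, s))%C = (2 * K' * t, 2 * K' * s).
Proof. apply injective_projections; simpl; ring. Qed.

Lemma is_fourier_cosh (f : C -> C) (y : R) (l : R * R) : line_transform f y l ->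
  is_fourier (fun x => (f (2 * K' * x) / Ccosh (PI * x))%C) y l.
Proof.
intros h eps heps.
destruct (h eps ltac:(rewrite Rabs_pos_eq; lra)) as (u & v & du & dv & e & ->).
replace (fourier_integrand (fun x => (f (2 * K' * x) / Ccosh (PI * x))%C) eps y) with (fun t => (u t, v t)).
- now apply line_complex.
- apply functional_extensionality. intros t. rewrite <- e. unfold fourier_integrand, integrand.
  rewrite scale_C. reflexivity.
Qed.

(** Lowering the line by [1/2]: [x = z + i / 2] gives [exp (2 pi i x y) = exp (- pi y) exp (2 pi i z y)]. *)
Lemma is_fourier_sinh (f g : C -> C) (p q y : R) (l : R * R) : line_transform f y l ->
  (forall u v, 0 < v < K' -> g (u, v) = (Ci * (p, q) * f (u, (v - K')%R))%C) ->
  is_fourier (fun x => (g (2 * K' * x) / Csinh (PI * x))%C) y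
    ((p, q) * exp (- (PI * y))%R * l)%C.
Proof.
intros h hg eps heps. assert (hKp := hK').
assert (hs : Rabs (eps - / 2) < / 2) by (rewrite Rabs_left; lra).
destruct (h (eps - / 2) hs) as (u & v & du & dv & e & ->).
set (c := exp (- (PI * y))).
assert (d1 : dom (fun t => p * c * u t + (- (q * c)) * v t))
  by (apply dom_plus; now apply dom_scal).
assert (d2 : dom (fun t => p * c * v t + (q * c) * u t))
  by (apply dom_plus; now apply dom_scal).
replace (fourier_integrand (fun x => (g (2 * K' * x) / Csinh (PI * x))%C) eps y) with
  (fun t => (p * c * u t + (- (q * c)) * v t, p * c * v t + (q * c) * u t)).
- replace ((p, q) * c * (line u, line v))%C with
    (line (fun t => p * c * u t + (- (q * c)) * v t), line (fun t => p * c * v t + (q * c) * u t)).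
  + now apply line_complex.
  + rewrite !line_plus, !line_scal by (try apply dom_scal; assumption).
    apply injective_projections; simpl; ring.
- apply functional_extensionality. intros t.
  assert (e' : (p * c * u t + - (q * c) * v t, p * c * v t + q * c * u t) = ((p, q) * c * integrand f y (eps - / 2) t)%C).
  { rewrite e. apply injective_projections; simpl; ring. }
  rewrite e'. unfold fourier_integrand, integrand.
  rewrite scale_C, hg, Csinh_shift.
  2: { split; [apply Rmult_lt_0_compat; lra|nra]. }
  replace (2 * K' * (eps - / 2)) with (2 * K' * eps - K') by field.
  assert (ex : Cexp (2 * PI * Ci * (t, eps) * y)%C = (c * Cexp (2 * PI * Ci * (t, (eps - / 2)%R) * y))%C).
  { rewrite !Cexp_eq. replace (- (2 * PI * y * eps)) with (- (PI * y) + - (2 * PI * y * (eps - / 2))) by field.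
    rewrite exp_plus. fold c. apply injective_projections; simpl; ring. }
  rewrite ex.
  assert (hc0 : Ccosh (PI * (t, (eps - / 2)%R))%C <> 0%C).
  { rewrite Ccosh_eq. intros e0. assert (hd := cosh_den_pos t (eps - / 2) hs). unfold cosh_den in hd.
    injection e0 as e1 e2. rewrite e1, e2 in hd. simpl in hd. lra. }
  assert (hCi : Ci <> 0%C) by (intros e0; injection e0; lra).
  match goal with |- @eq _ ?u ?v => change (@eq C u v) end. field. now split.
Qed.

(** The shift by i K' acts in these coordinates as the shift of the imaginary coordinate by K' in
    the functions of modulus k', which [jacR_sub_K] provides. The rest is algebra in the Pythagorean
    relations. *)
Lemma jac_shift (u v : R) : 0 < v < K' ->
  cs (u, v) k = (Ci * ((-1)%R, 0%R) * dn (u, (v - K')%R) k)%C /\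
  ds (u, v) k = (Ci * ((- k)%R, 0%R) * cn (u, (v - K')%R) k)%C /\
  ns (u, v) k = (Ci * (0%R, (- k)%R) * sn (u, (v - K')%R) k)%C.
Proof.
intros hv.
destruct (jacR_sub_K v k' hk') as (q1 & q2 & q3). fold K' in q1, q2, q3.
rewrite (comod_comod k hk : comod k' = k) in q2, q3.
assert (hs1 : 0 < snR v k').
{ unfold snR. assert (h1 := am_increasing 0 v k' hk' ltac:(lra)). rewrite am_0 in h1 by exact hk'.
  assert (h2 := am_increasing v K' k' hk' ltac:(lra)). unfold K' in h2. rewrite am_ellK in h2 by exact hk'.
  apply sin_gt_0; lra. }
assert (hd1 := dnR_pos v k' hk'). 
assert (hD : 0 < jac_den (u, v) k) by (apply jac_den_pos; [exact hk|rewrite Rabs_pos_eq; fold k' K'; lra]).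
assert (eD : jac_den (u, v) k = cnR v k' ^ 2 + k ^ 2 * snR u k ^ 2 * snR v k' ^ 2) by reflexivity.
assert (eD' : jac_den (u, v - K') k = k ^ 2 * (snR v k' ^ 2 + snR u k ^ 2 * cnR v k' ^ 2) / dnR v k' ^ 2).
{ unfold jac_den. simpl Re. simpl Im. fold k'. rewrite q1, q2. field. lra. }
assert (r1 := snR_cnR u k). assert (r2 := snR_dnR u k hk). assert (r3 := snR_cnR v k').
assert (r4 := snR_dnR v k' hk'). assert (r5 := comod_sqr k hk). fold k' in r5. rewrite r5 in r4.
unfold cs, ds, ns, sn, cn, dn. rewrite eD'. simpl Re. simpl Im. fold k'. rewrite q1, q2, q3.
set (s := snR u k) in *. set (c := cnR u k) in *. set (d := dnR u k) in *.
set (s1 := snR v k') in *. set (c1 := cnR v k') in *. set (d1 := dnR v k') in *.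
set (D := jac_den (u, v) k) in *.
assert (e1 : c ^ 2 = 1 - s ^ 2) by lra. assert (e2 : d ^ 2 = 1 - k ^ 2 * s ^ 2) by lra.
assert (e3 : c1 ^ 2 = 1 - s1 ^ 2) by lra. assert (e4 : d1 ^ 2 = 1 - (1 - k ^ 2) * s1 ^ 2) by lra.
set (P := s1 ^ 2 + s ^ 2 * c1 ^ 2) in *.
assert (hP : 0 < P).
{ unfold P. assert (0 < s1 ^ 2) by now apply pow_lt.
  assert (0 <= s ^ 2 * c1 ^ 2) by (apply Rmult_le_pos; apply pow2_ge_0). lra. }
(* The squared modulus of the numerator of sn is the product of the denominator at height v and, up
   to the factor k^2 / dn^2, of the one at height v - K'; this is what lets the quotients
   simplify. *)
assert (eP : (s * d1) ^ 2 + (c * d * s1 * c1) ^ 2 = D * P).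
{ rewrite eD. unfold P. ring [e1 e2 e3 e4]. }
(* [1 / sn = D (s d1 - i c d s1 c1) / (D P)] *)
assert (inv : Cinv (s * d1 / D, c * d * s1 * c1 / D)%R = (s * d1 / P, - (c * d * s1 * c1) / P)).
{ assert (hn : (s * d1 / D) ^ 2 + (c * d * s1 * c1 / D) ^ 2 = P / D).
  { replace ((s * d1 / D) ^ 2 + (c * d * s1 * c1 / D) ^ 2) with
      (((s * d1) ^ 2 + (c * d * s1 * c1) ^ 2) / D ^ 2) by (field; lra).
    rewrite eP. field. lra. }
  unfold Cinv. simpl fst. simpl snd. rewrite hn. apply injective_projections; simpl; field; lra. }
unfold Cdiv. rewrite inv. clearbody P s c d s1 c1 d1 D.
split; [|split]; apply injective_projections; simpl;
  (field_simplify_eq; [ring [e1 e2 e3 e4 eD]|repeat split; lra]).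
Qed.

End Transforms.

(** * Values at zero and the six formulas *)

Lemma is_lim_difference_quotient (f : R -> R) (d : R) : is_derive f 0 d -> f 0 = 0 ->
  is_lim (fun y => f y / y) 0 d.
Proof.
intros h h0. apply is_derive_Reals in h. apply is_lim_spec. intros eps.
destruct (h eps (cond_pos eps)) as [del hd]. exists del. intros y hy hy0.
change (Rabs (y - 0) < del) in hy. rewrite Rminus_0_r in hy.
specialize (hd y hy0 hy). rewrite Rplus_0_l, h0, Rminus_0_r in hd. exact hd.
Qed.

Lemma sinh_0 : sinh 0 = 0.
Proof. unfold sinh. rewrite Ropp_0. field. Qed.

Lemma sinh_neq_0 (x : R) : x <> 0 -> sinh x <> 0.
Proof.
intros hx e. assert (h := sinh_sqr_ge x). rewrite e in h.
assert (h' := pow2_gt_0 x hx). simpl in h. lra.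
Qed.

Lemma is_lim_sinh_quotient (Z : R -> R) (d : R) : is_derive Z 0 d -> Z 0 = 0 ->
  is_lim (fun y => Z y / sinh (PI * y)) 0 (d / PI).
Proof.
intros hd h0. assert (hpi := PI_RGT_0).
assert (hs : is_derive (fun y => sinh (PI * y)) 0 PI).
{ auto_derive; [easy|]. rewrite Rmult_0_r. unfold cosh. rewrite Ropp_0, exp_0. field. }
assert (l1 := is_lim_difference_quotient Z d hd h0).
assert (l2 := is_lim_difference_quotient _ PI hs ltac:(cbv beta; rewrite Rmult_0_r; apply sinh_0)).
assert (l := is_lim_div _ _ _ _ _ l1 l2 ltac:(intros e; injection e; lra) ltac:(exact I)).
refine (is_lim_ext_loc _ _ _ _ _ l).
exists (mkposreal 1 Rlt_0_1). intros y _ hy. field. split; [|exact hy].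
apply sinh_neq_0. apply Rmult_integral_contrapositive. split; [lra|exact hy].
Qed.

(** Away from 0 the product identity determines [F]; at 0 the derivatives of [Z] and of sinh (pi y)
    give the limit of the quotient. The continuous factor [c] accommodates the constants and the
    factor - exp (- pi y) of the sinh formulas. *)
Lemma value_or_limit_intro (g c F Z : R -> R) (y d : R) : cont c ->
  (forall y, y <> 0 -> g y = c y * (Z y / sinh (PI * y))) ->
  (forall y, sinh (PI * y) * F y = Z y) -> is_derive Z 0 d -> F 0 = d / PI ->
  value_or_limit g y (c y * F y).
Proof.
intros hc hg hF hd h0. assert (hpi := PI_RGT_0). split.
- intros hy. rewrite hg, <- hF by exact hy. field.
  apply sinh_neq_0. apply Rmult_integral_contrapositive. split; [lra|exact hy].
- intros ->. rewrite h0.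
  assert (hZ : Z 0 = 0) by (rewrite <- hF, Rmult_0_r, sinh_0; ring).
  assert (l1 := is_lim_sinh_quotient Z d hd hZ).
  assert (l2 : is_lim c 0 (c 0)).
  { apply is_lim_continuity. now apply cont_continuity_pt. }
  refine (is_lim_ext_loc _ _ _ _ _ (is_lim_mult _ _ _ _ _ l2 l1 I)).
  exists (mkposreal 1 Rlt_0_1). intros z _ hz. symmetry. now apply hg.
Qed.

Theorem mainTheorem2 (k : R) (hk : 0 < k < 1) :
  let k' := comod k in
  let K := ellK k in
  let E := ellE k in
  let K' := ellK k' in
  let N := fun y : R =>
    k ^ 2 * RInt (fun u => ndR u k' ^ 2) 0 (2 * K * y) + 2 * (E - K) * y in
  let D := fun y : R =>
    RInt (fun u => dnR u k' ^ 2) 0 (2 * K * y) + 2 * (E - K) * y in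
  (forall y : R, exists l : R,
     value_or_limit (fun y => 1 / k * (1 / sinh (PI * y)) * N y) y l /\
     is_fourier (fun x => (cn (2 * K' * x) k / Ccosh (PI * x))%C) y l) /\
  (forall y : R, exists l : R,
     value_or_limit (fun y => 1 / sinh (PI * y) * D y) y l /\
     is_fourier (fun x => (dn (2 * K' * x) k / Ccosh (PI * x))%C) y l) /\
  (forall y : R,
     is_fourier (fun x => (sn (2 * K' * x) k / Ccosh (PI * x))%C) y
       (Ci / k * (1 / cosh (PI * y))%R * N y)%C) /\
  (forall y : R, exists l : R,
     value_or_limit (fun y => 2 / (1 - exp (2 * PI * y)) * D y) y l /\
     is_fourier (fun x => (cs (2 * K' * x) k / Csinh (PI * x))%C) y l) /\
  (forall y : R, exists l : R,
     value_or_limit (fun y => 2 / (1 - exp (2 * PI * y)) * N y) y l /\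
     is_fourier (fun x => (ds (2 * K' * x) k / Csinh (PI * x))%C) y l) /\
  (forall y : R,
     is_fourier (fun x => (ns (2 * K' * x) k / Csinh (PI * x))%C) y
       (2 / (1 + exp (2 * PI * y)) * N y)%R).
Proof.
intros k' K E K' N D.
assert (hk' := comod_range k hk). assert (hK := ellK_pos k hk). assert (hK' := ellK_pos k' hk').
fold K in hK. fold K' in hK'. assert (hpi := PI_RGT_0).
assert (zD := zetaD_like k hk : zeta_like k 0 D).
assert (zN := zetaN_like k hk : zeta_like k (/ 2) N).
set (fc := fun x => cnR (2 * K' * x) k). set (fd := fun x => dnR (2 * K' * x) k).
set (fs := fun x => snR (2 * K' * x) k).
destruct (cosine_series_transform k hk 0 (PI / (2 * K)) fd D) as [Fd [d1 [hd1 Fd0]]].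
{ exact (dn_series k hk). }
{ exact (proj1 (dn_scaled k hk)). }
{ intros x. now apply dnR_le_1. }
{ exact zD. }
destruct (cosine_series_transform k hk (/ 2) (PI / (2 * K) / k) fc N) as [Fc [d2 [hd2 Fc0]]].
{ exact (cn_series k hk). }
{ exact (proj1 (cn_scaled k hk)). }
{ intros x. apply cnR_le_1. }
{ exact zN. }
assert (Fs := sine_series_transform k hk (PI / (2 * K) / k) fs N).
specialize (Fs (sn_series k hk) (proj1 (sn_scaled k hk)) (fun x => snR_le_1 _ k) zN).
fold K in Fd, Fd0, Fc, Fc0, Fs.
assert (Fd' : forall y, sinh (PI * y) * line_cos fd y = D y).
{ intros y. rewrite Fd. field. lra. }
assert (Fd0' : line_cos fd 0 = d1 / PI) by (rewrite Fd0; field; lra).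
assert (Fc' : forall y, sinh (PI * y) * (k * line_cos fc y) = N y).
{ intros y. replace (sinh (PI * y) * (k * line_cos fc y)) with (k * (sinh (PI * y) * line_cos fc y)) by ring.
  rewrite Fc. field. lra. }
assert (Fc0' : k * line_cos fc 0 = d2 / PI) by (rewrite Fc0; field; lra).
assert (Fs' : forall y, line_sin fs y = / k * / cosh (PI * y) * N y).
{ intros y. assert (hc := cosh_pos (PI * y)).
  apply (Rmult_eq_reg_l (cosh (PI * y))); [|lra]. rewrite Fs. field. lra. }
(* [2 / (1 - exp (2 pi y)) = - exp (- pi y) / sinh (pi y)] *)
assert (hexp : forall y Z, y <> 0 -> 2 / (1 - exp (2 * PI * y)) * Z = - exp (- (PI * y)) * (Z / sinh (PI * y))).
{ intros y Z hy. assert (hs : sinh (PI * y) <> 0).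
  { apply sinh_neq_0. apply Rmult_integral_contrapositive. split; [lra|exact hy]. }
  assert (e : 1 - exp (2 * PI * y) = - 2 * exp (PI * y) * sinh (PI * y)).
  { unfold sinh. replace (2 * PI * y) with (PI * y + PI * y) by ring. rewrite exp_plus, exp_Ropp.
    assert (h := exp_pos (PI * y)). field. lra. }
  rewrite e, exp_Ropp. assert (h := exp_pos (PI * y)). field. split; [exact hs|lra]. }
assert (cexp : cont (fun y => - exp (- (PI * y)))) by ct.
assert (js := jac_shift k hk). fold k' K' in js.
split; [|split; [|split; [|split; [|split]]]].
(* It is [k * line_cos fc y], not [line_cos fc y], that satisfies the product identity with [N]. *)
- intros y. exists (/ k * (k * line_cos fc y)). split.
  + apply (value_or_limit_intro _ (fun _ => / k) (fun y => k * line_cos fc y) N y d2); auto using cont_const.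
    intros z _. unfold Rdiv. ring.
  + replace (/ k * (k * line_cos fc y)) with (line_cos fc y) by (field; lra).
    exact (is_fourier_cosh k (fun z => cn z k) y _ (cn_line_transform k hk y)).
- intros y. exists (1 * line_cos fd y). split.
  + apply (value_or_limit_intro _ (fun _ => 1) (line_cos fd) D y d1); auto using cont_const.
    intros z _. unfold Rdiv. ring.
  + rewrite Rmult_1_l.
    exact (is_fourier_cosh k (fun z => dn z k) y _ (dn_line_transform k hk y)).
- intros y. assert (hc := cosh_pos (PI * y)).
  replace (Ci / k * (1 / cosh (PI * y))%R * N y)%C with (0, line_sin fs y).
  + exact (is_fourier_cosh k (fun z => sn z k) y _ (sn_line_transform k hk y)).
  + rewrite Fs'. apply injective_projections; simpl; field; lra.
- intros y. exists (- exp (- (PI * y)) * line_cos fd y). split.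
  + apply (value_or_limit_intro _ (fun y => - exp (- (PI * y))) (line_cos fd) D y d1); auto.
  + replace (RtoC (- exp (- (PI * y)) * line_cos fd y)) with
      (((-1)%R, 0%R) * exp (- (PI * y))%R * (line_cos fd y, 0%R))%C
      by (apply injective_projections; simpl; ring).
    apply (is_fourier_sinh k hk (fun z => dn z k) (fun z => cs z k) (-1) 0 y _ (dn_line_transform k hk y)).
    intros u v hv. apply (js u v hv).
- intros y. exists (- exp (- (PI * y)) * (k * line_cos fc y)). split.
  + apply (value_or_limit_intro _ (fun y => - exp (- (PI * y))) (fun y => k * line_cos fc y) N y d2); auto.
  + replace (RtoC (- exp (- (PI * y)) * (k * line_cos fc y))) with
      (((- k)%R, 0%R) * exp (- (PI * y))%R * (line_cos fc y, 0%R))%C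
      by (apply injective_projections; simpl; ring).
    apply (is_fourier_sinh k hk (fun z => cn z k) (fun z => ds z k) (- k) 0 y _ (cn_line_transform k hk y)).
    intros u v hv. apply (js u v hv).
- intros y. assert (hc := cosh_pos (PI * y)).
  replace (RtoC (2 / (1 + exp (2 * PI * y)) * N y)) with
    ((0%R, (- k)%R) * exp (- (PI * y))%R * (0%R, line_sin fs y))%C.
  + apply (is_fourier_sinh k hk (fun z => sn z k) (fun z => ns z k) 0 (- k) y _ (sn_line_transform k hk y)).
    intros u v hv. apply (js u v hv).
  + assert (e : 1 + exp (2 * PI * y) = 2 * exp (PI * y) * cosh (PI * y)).
    { unfold cosh. replace (2 * PI * y) with (PI * y + PI * y) by ring. rewrite exp_plus, exp_Ropp.
      assert (h := exp_pos (PI * y)). field. lra. }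
    rewrite e, Fs', exp_Ropp. assert (h := exp_pos (PI * y)).
    apply injective_projections; simpl; field; lra.
Qed.
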